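(* Let $h$ be a singular hermitian metric on a holomorphic vector bundle $E$ over a complex manifold $X$, and assume that $h$ is negatively curved in the sense of Griffiths. (i) If $E$ is a trivial vector bundle over a polydisc, there exists a sequence of smooth hermitian metrics $\{h_\nu\}$ with negative Griffiths curvature, decreasing to $h$ pointwise on any smaller polydisc. (ii) $\log\det h$ is a plurisubharmonic function. In particular, if $\det h\not\equiv 0$, then $\log\det h\in L^1_{loc}(X)$.
   Context: A singular hermitian metric $h$ on a holomorphic vector bundle $E\to X$ over a complex manifold $X$ is a measurable map from the base space $X$ to the space of non-negative hermitian forms on the fibers. Such an $h$ is called negatively curved in the sense of Griffiths if $\|u\|_h^2$ is plurisubharmonic for any holomorphic section $u$ of $E$ (over any open subset of $X$). In a local holomorphic frame, $h$ is regarded as a matrix-valued function (also denoted $h$), sections are regarded as column vectors of functions, $(s,t)_h=t^*hs$ and $\|s\|_h^2=(s,s)_h$; $\det h$ is the determinant of this matrix. A smooth hermitian metric $h_\nu$ has negative Griffiths curvature if its Chern curvature $\Theta^{h_\nu}=\bar\partial(h_\nu^{-1}\partial h_\nu)=\sum_{j,k}\Theta^{h_\nu}_{jk}\,dz_j\wedge d\bar z_k$ satisfies $\sum_{j,k}(\Theta^{h_\nu}_{jk}s,s)_{h_\nu}\xi_j\bar\xi_k\le 0$ for every section $s$ and every vector $\xi\in\mathbb{C}^n$, where $n=\dim X$; equivalently, $\|u\|_{h_\nu}^2$ is plurisubharmonic for every holomorphic section $u$. The sequence $\{h_\nu\}$ is decreasing if $\|s\|_{h_\nu}^2$ is decreasing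 in $\nu$ for every constant section $s$ of the trivial bundle.
   Formalization: In the final claim (log det h in L^1_loc when det h is not identically 0), X is assumed connected; otherwise it fails, e.g. for two disjoint discs with h = 0 on one and h = 1 on the other. *)

(* Defs.v *)
Set Warnings "-notation-overridden,-notation-incompatible-prefix,-ambiguous-paths,-redundant-canonical-projection".
From HB Require Import structures.
From mathcomp Require Import all_boot all_order all_algebra complex.
From mathcomp Require Import all_classical all_reals all_analysis.
Set Implicit Arguments.
Unset Strict Implicit.
Unset Printing Implicit Defensive.
Import Order.TTheory GRing.Theory Num.Theory.
Import numFieldNormedType.Exports.
Local Open Scope classical_set_scope.
Local Open Scope ring_scope.

(* R[i] with the topology of its modulus, as a normed module over itself; the
   row spaces 'rV[R[i]]_n then carry the sup norm over R[i], and
   [differentiable] on them is complex differentiability. *)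
HB.instance Definition _ (R : realType) := PseudoPointedMetric.copy R[i] R[i]^o.
HB.instance Definition _ (R : realType) := NormedModule.copy R[i] R[i]^o.

Section several_complex_variables.
Context {R : realType} {n : nat}.
Local Notation C := R[i].
Local Notation Cn := 'rV[R[i]]_n.

Definition polydisc (a : Cn) (rho : 'I_n -> R) : set Cn :=
  [set z | forall j, `|z 0 j - a 0 j| < (rho j)%:C%C].

Definition holomorphic {W : normedModType C} (D : set Cn) (f : Cn -> W) : Prop :=
  forall z, D z -> differentiable f z.

Section real_derivatives.
Context {W : normedModType C}.
Implicit Type f : Cn -> W.

(* The increment is a real multiple of v, unlike in ['D_v f], whose increments
   over 'rV[R[i]]_n are complex multiples. *)
Definition rquotient (v : Cn) f (z : Cn) (t : R) : W :=
  (t%:C%C)^-1 *: (f (z + t%:C%C *: v) - f z).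

Definition rderivable (v : Cn) f (z : Cn) : Prop :=
  cvg (rquotient v f z t @[t --> (0 : R)^']).

Definition rderive (v : Cn) f (z : Cn) : W :=
  lim (rquotient v f z t @[t --> (0 : R)^']).

Fixpoint Ck (k : nat) (D : set Cn) f : Prop :=
  (forall z, D z -> {for z, continuous f}) /\
  (if k is k'.+1 then
     forall v, (forall z, D z -> rderivable v f z) /\ Ck k' D (rderive v f)
   else True).

Definition smooth (D : set Cn) f : Prop := forall k, Ck k D f.

(* d/dz_j = (d/dx_j - i d/dy_j)/2 and d/dzbar_j = (d/dx_j + i d/dy_j)/2. *)
Definition ddz (j : 'I_n) f (z : Cn) : W :=
  2^-1 *: (rderive (delta_mx 0 j) f z
           - 'i%C *: rderive ('i%C *: delta_mx 0 j) f z).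

Definition ddzbar (j : 'I_n) f (z : Cn) : W :=
  2^-1 *: (rderive (delta_mx 0 j) f z
           + 'i%C *: rderive ('i%C *: delta_mx 0 j) f z).

End real_derivatives.

(* Values in [-oo, +oo); the function identically -oo is allowed. The last
   clause is the sub-mean value inequality over every closed complex disc
   { a + l b : |l| <= 1 } contained in D. *)
Definition psh (D : set Cn) (u : Cn -> \bar R) : Prop :=
  [/\ forall z, D z -> (u z < +oo)%E,
      forall z (c : R), D z -> (u z < c%:E)%E ->
        \forall w \near z, (u w < c%:E)%E
    & forall a b : Cn, (forall l : C, `|l| <= 1 -> D (a + l *: b)) ->
        (u a <= ((2 * pi)^-1)%R%:E *
           \int[@lebesgue_measure R]_(t in `[0%R, (2 * pi)%R])
             u (a + (cos t +i* sin t)%C *: b)%R)%E].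

End several_complex_variables.

(* Lebesgue measure on C^n, as the 2n-fold product of the Lebesgue measure of R;
   [leb_coord] identifies the iterated product of copies of R with C^n. *)
Record lebesgue_space (R : realType) (n : nat) := LebesgueSpace {
  leb_display : measure_display;
  leb_type : measurableType leb_display;
  leb_measure : {measure set leb_type -> \bar R};
  leb_coord : leb_type -> 'rV[R[i]]_n }.

Section lebesgue_Cn.
Context (R : realType).

Definition lebesgue_point : lebesgue_space R 0 :=
  @LebesgueSpace R 0 _ unit (@dirac _ unit tt R) (fun=> 0).

Definition lebesgue_add_coord (n : nat) (L : lebesgue_space R n) :
    lebesgue_space R n.+1 :=
  @LebesgueSpace R n.+1 _ (leb_type L * measurableTypeR R * measurableTypeR R)%type
    ((leb_measure L \x @lebesgue_measure R) \x @lebesgue_measure R)%E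
    (fun p => row_mx ((p.1.2 +i* p.2)%C%:M : 'rV[R[i]]_1) (leb_coord p.1.1)).

Fixpoint lebesgue_Cn (n : nat) : lebesgue_space R n :=
  if n is m.+1 then lebesgue_add_coord (lebesgue_Cn m) else lebesgue_point.

Definition locally_L1 (n : nat) (D : set 'rV[R[i]]_n)
    (u : 'rV[R[i]]_n -> \bar R) : Prop :=
  forall K, compact K -> K `<=` D ->
    (leb_measure (lebesgue_Cn n)).-integrable
      (@leb_coord _ _ (lebesgue_Cn n) @^-1` K)
      (u \o @leb_coord _ _ (lebesgue_Cn n)).

End lebesgue_Cn.

Record complex_manifold (R : realType) (n : nat) := ComplexManifold {
  mfd_space :> topologicalType;
  mfd_hausdorff : hausdorff_space mfd_space;
  mfd_second_countable : @second_countable mfd_space;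
  mfd_index : Type;
  mfd_dom : mfd_index -> set mfd_space;
  mfd_chart : mfd_index -> mfd_space -> 'rV[R[i]]_n;
  mfd_inv : mfd_index -> 'rV[R[i]]_n -> mfd_space;
  mfd_dom_open : forall i, open (mfd_dom i);
  mfd_img_open : forall i, open (mfd_chart i @` mfd_dom i);
  mfd_cover : forall x, exists i, mfd_dom i x;
  mfd_chartK : forall i x, mfd_dom i x -> mfd_inv i (mfd_chart i x) = x;
  mfd_chart_continuous : forall i x, mfd_dom i x ->
    {for x, continuous (mfd_chart i)};
  mfd_inv_continuous : forall i z, (mfd_chart i @` mfd_dom i) z ->
    {for z, continuous (mfd_inv i)};
  mfd_transition : forall i j,
    holomorphic (mfd_chart i @` (mfd_dom i `&` mfd_dom j))
                (mfd_chart j \o mfd_inv i) }.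

Section functions_on_manifolds.
Context {R : realType} {n : nat} {X : complex_manifold R n}.

Definition mfd_holomorphic {W : normedModType R[i]} (U : set X) (f : X -> W) :
    Prop :=
  forall i : mfd_index X,
    holomorphic (mfd_chart i @` (U `&` mfd_dom i)) (f \o mfd_inv i).

Definition mfd_psh (U : set X) (u : X -> \bar R) : Prop :=
  forall i : mfd_index X,
    psh (mfd_chart i @` (U `&` mfd_dom i)) (u \o mfd_inv i).

Definition mfd_locally_L1 (U : set X) (u : X -> \bar R) : Prop :=
  forall i : mfd_index X,
    locally_L1 (mfd_chart i @` (U `&` mfd_dom i)) (u \o mfd_inv i).

Definition borel_measurable (U : set X) (f : X -> R) : Prop :=
  forall B : set R, measurable B -> <<s @open X >> (U `&` f @^-1` B).

(* phi is a biholomorphism of X onto the open set D of C^n, with inverse psi. *)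
Definition biholomorphism_onto (D : set 'rV[R[i]]_n)
    (phi : X -> 'rV[R[i]]_n) (psi : 'rV[R[i]]_n -> X) : Prop :=
  [/\ (forall x, D (phi x)) /\ mfd_holomorphic [set: X] phi,
      cancel phi psi,
      forall z, D z -> phi (psi z) = z,
      forall z, D z -> {for z, continuous psi}
    & forall i : mfd_index X,
        holomorphic (D `&` psi @^-1` mfd_dom i) (mfd_chart i \o psi)].

End functions_on_manifolds.

(* A holomorphic vector bundle is given by its fibers, its local
   trivializations and the holomorphy of the transition matrices; these
   determine the complex structure of the total space. *)
Record vector_bundle (R : realType) (n : nat) (X : complex_manifold R n)
    (r : nat) := VectorBundle {
  vb_fiber :> X -> lmodType R[i];
  vb_index : Type;
  vb_dom : vb_index -> set X;
  vb_triv : vb_index -> forall x, {linear vb_fiber x -> 'cV[R[i]]_r};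
  vb_dom_open : forall i, open (vb_dom i);
  vb_cover : forall x, exists i, vb_dom i x;
  vb_triv_bij : forall i x, vb_dom i x -> bijective (vb_triv i x);
  vb_transition : forall i j, exists g : X -> 'M[R[i]]_r,
    mfd_holomorphic (vb_dom i `&` vb_dom j) g /\
    forall x, (vb_dom i `&` vb_dom j) x ->
      forall v, vb_triv j x v = g x *m vb_triv i x v }.

Section hermitian_metrics.
Context {R : realType} {n r : nat} {X : complex_manifold R n}.
Variable E : vector_bundle X r.

Definition holomorphic_section (U : set X) (u : forall x, E x) : Prop :=
  forall i : vb_index E,
    mfd_holomorphic (U `&` vb_dom i) (fun x => vb_triv i x (u x)).

Definition holomorphic_frame (U : set X) (e : 'I_r -> forall x, E x) : Prop :=
  [/\ open U,
      forall j, holomorphic_section U (e j)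
    & forall x, U x -> forall v : E x,
        exists! c : 'cV[R[i]]_r, v = \sum_j c j 0 *: e j x].

Definition nonneg_hermitian_form (V : lmodType R[i]) (f : V -> V -> R[i]) :
    Prop :=
  [/\ forall a u v w, f (a *: u + v) w = a * f u w + f v w,
      forall u v, f v u = (f u v)^*
    & forall u, 0 <= f u u].

Definition form_family := forall x, E x -> E x -> R[i].

(* The matrix of h in the frame e, with (s, t)_h = t^* h s. *)
Definition frame_matrix (h : form_family) (e : 'I_r -> forall x, E x) (x : X) :
    'M[R[i]]_r :=
  \matrix_(i, j) h x (e j x) (e i x).

Definition singular_hermitian_metric (h : form_family) : Prop :=
  (forall x, nonneg_hermitian_form (h x)) /\
  (forall U e, holomorphic_frame U e -> forall i j,
     borel_measurable U (fun x => complex.Re (frame_matrix h e x i j)) /\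
     borel_measurable U (fun x => complex.Im (frame_matrix h e x i j))).

Definition norm_sq (h : form_family) (u : forall x, E x) (x : X) : R :=
  complex.Re (h x (u x) (u x)).

Definition griffiths_negative (h : form_family) : Prop :=
  forall (U : set X) (u : forall x, E x),
    open U -> holomorphic_section U u ->
    mfd_psh U (fun x => (norm_sq h u x)%:E).

(* [lne] sends 0 to -oo. *)
Definition log_det (h : form_family) (e : 'I_r -> forall x, E x) (x : X) :
    \bar R :=
  lne (complex.Re (\det (frame_matrix h e x)))%:E.

Definition det_not_identically_zero (h : form_family) : Prop :=
  exists U e x, [/\ holomorphic_frame U e, U x & \det (frame_matrix h e x) != 0].

End hermitian_metrics.

Section smooth_metrics.
Context {R : realType} {n r : nat}.
Local Notation Cn := 'rV[R[i]]_n.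
Implicit Types (H : Cn -> 'M[R[i]]_r) (D : set Cn).

Definition hdot (M : 'M[R[i]]_r) (s t : 'cV[R[i]]_r) : R[i] :=
  ((map_mx Num.conj t)^T *m M *m s) 0 0.

Definition smooth_hermitian_metric D H : Prop :=
  smooth D H /\
  forall z, D z -> H z \is hermsymmx /\
    forall s : 'cV[R[i]]_r, s != 0 -> 0 < hdot (H z) s s.

(* Theta_jk, the coefficient of dz_j /\ dzbar_k in
   dbar(H^-1 dH) = sum_jk d/dzbar_k (H^-1 dH/dz_j) dzbar_k /\ dz_j. *)
Definition chern_curvature H (j k : 'I_n) (z : Cn) : 'M[R[i]]_r :=
  - ddzbar k (fun w => invmx (H w) *m ddz j H w) z.

Definition negative_griffiths_curvature D H : Prop :=
  forall z, D z -> forall (s : 'cV[R[i]]_r) (xi : Cn),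
    \sum_j \sum_k
      hdot (H z) (chern_curvature H j k z *m s) s * xi 0 j * (xi 0 k)^* <= 0.

End smooth_metrics.

(* Main.v *)
(* Extend [h] by zero outside a relatively compact open set and convolve it with
   a rotation-invariant bump kernel of radius e_nu -> 0, adding e_nu I.  Convolution
   replaces a holomorphic field u by its translates, so testing negativity on the
   affine fields u(z) = P z + c gives, by Fubini and the submean inequality on
   circles, smooth metrics h_nu >= h that decrease with the radius and still
   satisfy the submean inequality for affine fields.  Expanding
   |s - lambda h^-1 A s|^2_{h_nu} to second order, with A chosen to cancel the
   first-order terms, turns this inequality into the sign of the Chern curvature.
   That |u|^2_{h_nu} is plurisubharmonic for an arbitrary holomorphic u, along an
   arbitrary holomorphic disc Phi, follows since a smooth function f with
   nonnegative Levi form is, up to O(|d|^3), at least f(p) plus the real part of a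
   holomorphic quadratic polynomial in d; the cubic error is absorbed by e |Phi|^2.

   For the determinant, choose at a point z a frame of affine fields u_i along a
   line, orthonormal at z for h_nu and adapted to the first-order part of h_nu.
   Then log det h_nu (z + lambda b) is at least sum_i (|u_i|^2 - 1) plus a harmonic
   function, up to O(|lambda|^3), so log det h_nu is submean up to o(s^2) on circles
   of radius s, hence submean; monotone convergence passes this to log det h.  The
   interior of the set where an upper semicontinuous submean function is -oo is
   clopen in a connected manifold, and near any other point the submean inequality
   over rotated circles bounds the integral over polydiscs from below. *)
From HB Require Import structures.
Require Import Defs.
From mathcomp Require Import all_boot all_order all_algebra complex.
From mathcomp Require Import all_classical all_reals all_analysis.
From mathcomp Require Import spectral measurable_realfun ring lra.
Set Implicit Arguments.
Unset Strict Implicit.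
Unset Printing Implicit Defensive.
Import Order.TTheory GRing.Theory Num.Theory.
Import numFieldNormedType.Exports.
Local Open Scope classical_set_scope.
Local Open Scope ring_scope.
Local Open Scope complex_scope.

(** Negativity is given on straight discs of the charts of X, whereas the coordinates of the
    polydisc in (i) come from a biholomorphism that need not be a chart. A straight disc of the
    polydisc is then a curved disc in a chart. Hence plurisubharmonicity along arbitrary holomorphic
    discs has to be proved before the metric can be smoothed on the polydisc. It is obtained from
    the same smoothing, applied in rank one with constant fields, and from the mean value property
    of functions that are only known to be complex differentiable at each point. The submean
    inequalities produced by second-order expansions hold only on small circles and only up to
    o(s^2). [radial_mean_le], a perturbed maximum principle, turns them into exact inequalities
    between circles of arbitrary radii. It serves the monotonicity of the convolutions, the
    holomorphic discs and the determinant. The metric is cut off to sets [QQ nu] that grow with nu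
    and on which its entries are bounded, so that a single sequence serves all smaller polydiscs,
    each from some rank on. *)

Notation Re := complex.Re.
Notation Im := complex.Im.
Notation cj := (@Num.conj _).

(** * Circle means and the mean value property *)

Section complex_numbers.
Context {R : realType}.
Implicit Types z w : R[i].

Definition cabs z : R := Num.sqrt (Re z ^+ 2 + Im z ^+ 2).
Definition cis (t : R) : R[i] := cos t +i* sin t.

Lemma normcabs z : `|z| = (cabs z)%:C.
Proof. by rewrite normc_def. Qed.

Lemma cabs_ge0 z : 0 <= cabs z. Proof. exact: sqrtr_ge0. Qed.

Lemma cabsM z w : cabs (z * w) = cabs z * cabs w.
Proof. by apply: complexI; rewrite -normcabs normrM !normcabs rmorphM. Qed.

Lemma cabsD z w : cabs (z + w) <= cabs z + cabs w.
Proof. by rewrite -lecR -normcabs rmorphD /= -!normcabs ler_normD. Qed.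

Lemma cabsN z : cabs (- z) = cabs z.
Proof. by apply: complexI; rewrite -!normcabs normrN. Qed.

Lemma cabsB z w : cabs (z - w) = cabs (w - z).
Proof. by rewrite -cabsN opprB. Qed.

Lemma cabs0 : cabs 0 = 0.
Proof. by apply: complexI; rewrite -normcabs normr0. Qed.

Lemma cabs1 : cabs 1 = 1.
Proof. by apply: complexI; rewrite -normcabs normr1. Qed.

Lemma cabs_real (x : R) : cabs x%:C = `|x|.
Proof. by rewrite /cabs /= expr0n /= addr0 sqrtr_sqr. Qed.

Lemma cabs_eq0 z : (cabs z == 0) = (z == 0).
Proof. by rewrite -(inj_eq (@complexI R)) -normcabs normr_eq0. Qed.

Lemma cabs_conj z : cabs (cj z) = cabs z.
Proof. by case: z => a b; rewrite /cabs /= sqrrN. Qed.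

Lemma cabs_sqr z : cabs z ^+ 2 = Re z ^+ 2 + Im z ^+ 2.
Proof. by rewrite sqr_sqrtr // addr_ge0 // sqr_ge0. Qed.

Lemma mulcJ z : z * cj z = (cabs z ^+ 2)%:C.
Proof. by rewrite cabs_sqr; case: z => a b; simpc => /=; congr (_ +i* _); ring. Qed.

Lemma Re_le_cabs z : `|Re z| <= cabs z.
Proof. by rewrite -sqrtr_sqr ler_wsqrtr // lerDl sqr_ge0. Qed.

Lemma Im_le_cabs z : `|Im z| <= cabs z.
Proof. by rewrite -sqrtr_sqr ler_wsqrtr // lerDr sqr_ge0. Qed.

Lemma cabs_le_ReIm z : cabs z <= `|Re z| + `|Im z|.
Proof.
rewrite -(@ler_pXn2r _ 2) ?nnegrE ?cabs_ge0 ?addr_ge0 // cabs_sqr.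
rewrite -(real_normK (num_real (Re z))) -(real_normK (num_real (Im z))).
have := mulr_ge0 (normr_ge0 (Re z)) (normr_ge0 (Im z)); nra.
Qed.

Lemma cabs_cis t : cabs (cis t) = 1.
Proof. by rewrite /cabs /= cos2Dsin2 sqrtr1. Qed.

Lemma cisD s t : cis (s + t) = cis s * cis t.
Proof. by rewrite /cis; simpc; rewrite cosD sinD; congr (_ +i* _); ring. Qed.

Lemma cis0 : cis 0 = 1.
Proof. by rewrite /cis cos0 sin0. Qed.

Lemma ReD z w : Re (z + w) = Re z + Re w. Proof. by case: z; case: w. Qed.
Lemma ImD z w : Im (z + w) = Im z + Im w. Proof. by case: z; case: w. Qed.
Lemma ReN z : Re (- z) = - Re z. Proof. by case: z. Qed.
Lemma ImN z : Im (- z) = - Im z. Proof. by case: z. Qed.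
Lemma ReM z w : Re (z * w) = Re z * Re w - Im z * Im w.
Proof. by case: z; case: w. Qed.
Lemma ImM z w : Im (z * w) = Re z * Im w + Im z * Re w.
Proof. by case: z; case: w. Qed.
Lemma ReZ (a : R) z : Re (a%:C * z) = a * Re z.
Proof. by rewrite ReM /= mul0r subr0. Qed.
Lemma ImZ (a : R) z : Im (a%:C * z) = a * Im z.
Proof. by rewrite ImM /= mul0r addr0. Qed.
Lemma ReJ z : Re (cj z) = Re z. Proof. by case: z. Qed.
Lemma ImJ z : Im (cj z) = - Im z. Proof. by case: z. Qed.

Lemma cjD z w : cj (z + w) = cj z + cj w. Proof. exact: (rmorphD (@conjc R)). Qed.
Lemma cjN z : cj (- z) = - cj z. Proof. exact: (rmorphN (@conjc R)). Qed.
Lemma cjM z w : cj (z * w) = cj z * cj w. Proof. exact: (rmorphM (@conjc R)). Qed.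
Lemma cjZ (a : R) z : cj (a%:C * z) = a%:C * cj z.
Proof. by rewrite cjM; congr (_ * _); exact: conjc_real. Qed.
Lemma cj_sum (I : Type) (r : seq I) (P : pred I) (F : I -> R[i]) :
  cj (\sum_(i <- r | P i) F i) = \sum_(i <- r | P i) cj (F i).
Proof. exact: (rmorph_sum (@conjc R)). Qed.

Lemma Re_sum (I : Type) (r : seq I) (P : pred I) (F : I -> R[i]) :
  Re (\sum_(i <- r | P i) F i) = \sum_(i <- r | P i) Re (F i).
Proof. by elim/big_rec2: _ => //= i x y _ <-; rewrite ReD. Qed.

Lemma cabs_sum (I : Type) (r : seq I) (P : pred I) (F : I -> R[i]) :
  cabs (\sum_(i <- r | P i) F i) <= \sum_(i <- r | P i) cabs (F i).
Proof.
elim/big_rec2: _ => [|i x y _ h]; first by rewrite cabs0.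
by apply: le_trans (cabsD _ _) _; rewrite lerD2l.
Qed.

(** The range of the angle matters: its sign is what [cmean_rot] asks for, and its bound exhibits
    the closed disc as a compact image in [disc_compact]. *)
Lemma polar z : exists t, 0 <= t <= 2 * pi /\ z = (cabs z)%:C * cis t.
Proof.
have pi0 := pi_gt0 R.
have [->|z0] := eqVneq z 0.
  by exists 0; rewrite lexx mulr_ge0 ?ltW //; split=> //; rewrite cabs0 mul0r.
have c0 : 0 < cabs z by rewrite lt0r cabs_ge0 cabs_eq0 z0.
set x := Re z / cabs z; set y := Im z / cabs z.
have xy : x ^+ 2 + y ^+ 2 = 1.
  by rewrite !expr_div_n -mulrDl -cabs_sqr divff // expf_neq0 // lt0r_neq0.
have x1 : -1 <= x <= 1.
  by have := sqr_ge0 y => ?; apply/andP; split; nra.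
have x1' : x \in `[-1, 1] by rewrite in_itv.
have Y : Num.sqrt (1 - x ^+ 2) = `|y|.
  by rewrite -xy addrC addKr sqrtr_sqr.
have zE : z = (cabs z)%:C * (x +i* y).
  apply/eqP; rewrite eq_complex; simpc; rewrite /x /y /=.
  by rewrite !(mulrC (cabs z)) !divfK ?lt0r_neq0 // !eqxx.
have a0 := acos_ge0 x1; have a1 := acos_lepi x1.
have [y0|y0] := leP 0 y.
  exists (acos x); rewrite a0 /=; split; first lra.
  by rewrite {1}zE /cis acosK // sin_acos // Y ger0_norm.
(* In the lower half plane the angle is reflected across the real axis and brought back to
   [0, 2 pi]. *)
exists (2 * pi - acos x); split; first by apply/andP; split; lra.
have -> : 2 * pi - acos x = - acos x + pi *+ 2 by ring.
rewrite {1}zE /cis cosD2pi sinD2pi cosN sinN acosK // sin_acos // Y ltr0_norm //.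
by rewrite opprK.
Qed.

Lemma cvg_complex T (F : set_system T) {FF : Filter F} (f : T -> R[i]) (l : R[i]) :
  (Re (f x) @[x --> F] --> Re l) -> (Im (f x) @[x --> F] --> Im l) ->
  f x @[x --> F] --> l.
Proof.
move=> fr fi; apply/cvgrPdist_lt => e e0.
(* A positive element of R[i] is real, so the tolerance can be replaced by its real part. *)
move: (e0); rewrite ltcE /= => /andP[/eqP e2 e1].
have h0 : 0 < Re e / 2 by rewrite divr_gt0.
move/cvgrPdist_lt : fr => /(_ _ h0); move/cvgrPdist_lt : fi => /(_ _ h0).
apply: filterS2 => x hi hr.
rewrite normcabs ltcE /= -e2 eqxx /=.
apply: le_lt_trans (cabs_le_ReIm _) _.
rewrite ReD ImD ReN ImN (splitr (Re e)); exact: ltrD.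
Qed.

Lemma cvg_cabs T (F : set_system T) {FF : Filter F} (f : T -> R[i]) (l : R[i]) :
  f x @[x --> F] --> l <->
  (forall e : R, 0 < e -> \forall x \near F, cabs (f x - l) < e).
Proof.
split=> [/cvgrPdist_lt h e e0|h].
  have : 0 < e%:C by rewrite ltcR.
  move=> /h; apply: filterS => x; rewrite normcabs ltcR; by rewrite cabsB.
apply/cvgrPdist_lt => e e0; have := e0.
rewrite ltcE /= => /andP[/eqP e2 /h]; apply: filterS => x hx.
by rewrite normcabs ltcE /= -e2 eqxx /= cabsB.
Qed.

Lemma cvg_Re T (F : set_system T) {FF : Filter F} (f : T -> R[i]) (l : R[i]) :
  f x @[x --> F] --> l -> Re (f x) @[x --> F] --> Re l.
Proof.
move/cvg_cabs => h; apply/cvgrPdist_lt => e /h; apply: filterS => x.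
by apply: le_lt_trans; rewrite cabsB -ReN -ReD Re_le_cabs.
Qed.

Lemma cvg_Im T (F : set_system T) {FF : Filter F} (f : T -> R[i]) (l : R[i]) :
  f x @[x --> F] --> l -> Im (f x) @[x --> F] --> Im l.
Proof.
move/cvg_cabs => h; apply/cvgrPdist_lt => e /h; apply: filterS => x.
by apply: le_lt_trans; rewrite cabsB -ImN -ImD Im_le_cabs.
Qed.

Lemma cvg_cabs_norm T (F : set_system T) {FF : Filter F} (f : T -> R[i]) (l : R[i]) :
  f x @[x --> F] --> l -> cabs (f x) @[x --> F] --> cabs l.
Proof.
move/cvg_cabs => h; apply/cvgrPdist_lt => e /h; apply: filterS => x.
apply: le_lt_trans; rewrite ler_norml; apply/andP; split.
  have := cabsD l (f x - l); rewrite addrC subrK; lra.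
have := cabsD (f x) (l - f x); rewrite addrC subrK -(cabsB (f x)); lra.
Qed.

Lemma continuous_cis : continuous cis.
Proof.
move=> t; apply: cvg_complex; [exact: continuous_cos|exact: continuous_sin].
Qed.

Lemma continuous_real_complex : continuous (fun x : R => x%:C).
Proof. by move=> t; apply: cvg_complex; [exact: cvg_id|exact: cvg_cst]. Qed.

Lemma cvg_real_complex T (F : set_system T) {FF : Filter F} (f : T -> R) (l : R) :
  f x @[x --> F] --> l -> (f x)%:C @[x --> F] --> l%:C.
Proof. by move=> h; apply: cvg_complex => //; exact: cvg_cst. Qed.

Lemma cvg_conjc T (F : set_system T) {FF : Filter F} (f : T -> R[i]) (l : R[i]) :
  f x @[x --> F] --> l -> cj (f x) @[x --> F] --> cj l.
Proof.
move=> h; apply: cvg_complex.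
  by under eq_fun do rewrite ReJ; rewrite ReJ; exact: cvg_Re.
by under eq_fun do rewrite ImJ; rewrite ImJ; apply: cvgN; exact: cvg_Im.
Qed.

End complex_numbers.

(** * Integrals of continuous functions over segments, and circle means *)

Section segment_integrals.
Context {R : realType}.
Local Notation mu := (@lebesgue_measure R).
Implicit Types (f g : R -> R) (a b : R).

Definition segint a b f : R := \int[mu]_(t in `[a, b]) f t.

Lemma cont_within f (A : set R) : continuous f -> {within A, continuous f}.
Proof. by move=> cf; apply: continuous_subspaceT. Qed.

Lemma seg_integrable a b f : continuous f -> mu.-integrable `[a, b] (EFin \o f).
Proof.
move=> cf; apply: continuous_compact_integrable; first exact: segment_compact.
exact: cont_within.
Qed.

Lemma segintD a b f g : continuous f -> continuous g ->
  segint a b (fun t => f t + g t) = segint a b f + segint a b g.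
Proof. by move=> cf cg; apply: RintegralD => //; exact: seg_integrable. Qed.

Lemma segintB a b f g : continuous f -> continuous g ->
  segint a b (fun t => f t - g t) = segint a b f - segint a b g.
Proof. by move=> cf cg; apply: RintegralB => //; exact: seg_integrable. Qed.

Lemma segintZ a b k f : continuous f ->
  segint a b (fun t => k * f t) = k * segint a b f.
Proof. by move=> cf; apply: RintegralZl => //; exact: seg_integrable. Qed.

Lemma segint_cst a b k : a <= b -> segint a b (fun=> k) = k * (b - a).
Proof.
move=> ab; rewrite /segint Rintegral_cst //= lebesgue_measure_itv /= lte_fin.
by move: ab; rewrite le_eqVlt => /predU1P[->|->] //=; rewrite ltxx subrr mulr0.
Qed.

Lemma segint_le a b f g : continuous f -> continuous g ->
  (forall t, a <= t <= b -> f t <= g t) -> segint a b f <= segint a b g.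
Proof.
move=> cf cg h; apply: le_Rintegral => //; try exact: seg_integrable.
Qed.

Lemma segint_eq a b f g :
  (forall t, a <= t <= b -> f t = g t) -> segint a b f = segint a b g.
Proof.
by move=> h; apply: eq_Rintegral => x; rewrite inE /= in_itv /= => /h.
Qed.

Lemma segint_abs a b f M : a <= b -> continuous f ->
  (forall t, a <= t <= b -> `|f t| <= M) -> `|segint a b f| <= M * (b - a).
Proof.
move=> ab cf h.
have h1 (t : R) : a <= t <= b -> - M <= f t <= M by move/h; rewrite ler_norml.
rewrite ler_norml; apply/andP; split.
  rewrite -mulNr -(segint_cst (- M) ab); apply: segint_le => //.
    by move=> x; exact: cvg_cst.
  by move=> t /h1/andP[].
rewrite -(segint_cst M ab); apply: segint_le => //.
  by move=> x; exact: cvg_cst.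
by move=> t /h1/andP[].
Qed.

Lemma segintE a b f : continuous f ->
  (segint a b f)%:E = (\int[mu]_(t in `[a, b]) (f t)%:E)%E.
Proof.
by move=> cf; rewrite /segint fineK //; apply: integrable_fin_num => //;
  exact: seg_integrable.
Qed.

Lemma segint_cat a b c f : a <= b -> b <= c -> continuous f ->
  segint a c f = segint a b f + segint b c f.
Proof.
move=> ab bc cf.
have := @Rintegral_itvB R f (BLeft a) (BRight c) b (seg_integrable _ _ cf).
rewrite !bnd_simp => /(_ ab bc) h.
by rewrite addrC; apply/eqP; rewrite -subr_eq; apply/eqP; rewrite /segint h
  Rintegral_itv_obnd_cbnd //; apply: integrableS (seg_integrable b c cf) => //;
  apply: subset_itvr; rewrite bnd_simp.
Qed.

Lemma segint_FTC a b f (F : R -> R) : a <= b -> continuous f ->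
  (forall x : R, a <= x <= b -> is_derive x (1:R) F (f x)) ->
  segint a b f = F b - F a.
Proof.
move=> ab cf h; move: ab; rewrite le_eqVlt => /predU1P[ab|ab].
  by rewrite -ab subrr /segint set_itv1 Rintegral_set1.
have cF (x : R) : a <= x <= b -> {for x, continuous F}.
  move=> /h hx; apply: differentiable_continuous; apply/derivable1_diffP.
  exact: ex_derive.
apply: EFin_inj; rewrite segintE // (continuous_FTC2 (F := F)) //.
- exact: cont_within.
- split.
  + move=> x; rewrite in_itv /= => /andP[ax xb].
    have hx : a <= x <= b by rewrite !ltW.
    by have := h _ hx => ?; exact: ex_derive.
  + by apply: cvg_at_right_filter; apply: cF; rewrite lexx ltW.
  + by apply: cvg_at_left_filter; apply: cF; rewrite lexx ltW.
- move=> x; rewrite in_itv /= => /andP[ax xb].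
  have hx : a <= x <= b by rewrite !ltW.
  by have := h _ hx => ?; rewrite derive1E derive_val.
Qed.

Lemma primitive f M : continuous f -> 0 < M ->
  exists P : R -> R, forall x : R, - M <= x <= M -> is_derive x (1:R) P (f x).
Proof.
move=> cf M0; exists (fun x => segint (- M - 1) x f) => x /andP[x1 x2].
(* The end points are moved one unit outwards so that all of [-M, M] is interior. *)
have [] := @continuous_FTC1_closed R f (- M - 1) x (M + 1).
- lra.
- exact: seg_integrable.
- lra.
- exact: cf.
by move=> d1 d2; apply: DeriveDef => //; rewrite -derive1E.
Qed.

Lemma derive_cst_seg (F : R -> R) a b : a <= b ->
  (forall x : R, a <= x <= b -> is_derive x (1:R) F 0) -> F a = F b.
Proof.
move=> ab h; have := @segint_FTC a b (fun=> 0) F ab.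
rewrite segint_cst // mul0r => H; apply/esym/eqP; rewrite -subr_eq0.
by rewrite -H // => x; exact: cvg_cst.
Qed.

Lemma is_derive_shift (F : R -> R) (x c l : R) :
  is_derive (x + c) (1:R) F l -> is_derive x (1:R) (fun y => F (y + c)) l.
Proof.
move=> h.
have h1 : is_derive x (1:R) (fun y : R => y + c) 1.
  by apply: is_derive_eq; rewrite addr0.
have := @is_derive1_comp R F (fun y => y + c) x l 1 h h1.
by rewrite mulr1.
Qed.

(** For a primitive P of f, the difference P(x + p) - P(x) has derivative f(x + p) - f(x) = 0;
    equating its values at 0 and al gives the two integrals. *)
Lemma segint_shift f p al : continuous f -> 0 <= p -> 0 <= al ->
  (forall t, f (t + p) = f t) ->
  segint 0 p (fun t => f (t + al)) = segint 0 p f.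
Proof.
move=> cf p0 al0 pf.
have M0 : 0 < p + al + 1 by lra.
have [P hP] := primitive cf M0.
have cfs : continuous (fun t => f (t + al)).
  by move=> x; apply: continuous_comp; [apply: cvgD; [exact: cvg_id|exact: cvg_cst]
   |exact: cf].
have h1 (x : R) : 0 <= x <= p -> is_derive x (1:R) (fun t => P (t + al)) (f (x + al)).
  by move=> hx; apply: is_derive_shift; apply: hP; lra.
have h2 (x : R) : 0 <= x <= p -> is_derive x (1:R) P (f x).
  by move=> hx; apply: hP; lra.
have h3 (x : R) : 0 <= x <= al -> is_derive x (1:R) (fun x => P (x + p) - P x) 0.
  move=> hx.
  have h3 : is_derive x 1 (fun y => P (y + p)) (f x).
    by rewrite -pf; apply: is_derive_shift; apply: hP; lra.
  have h4 : is_derive x 1 P (f x) by apply: hP; lra.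
  by apply: is_derive_eq; rewrite subrr.
have := derive_cst_seg al0 h3.
rewrite (segint_FTC p0 cfs h1) (segint_FTC p0 cf h2) !add0r => ->.
by rewrite (addrC p).
Qed.

End segment_integrals.

Section circle_means.
Context {R : realType}.
Implicit Types (f g : R -> R) (a b : R).

Definition cmean f : R := (2 * pi)^-1 * segint 0 (2 * pi) f.

Lemma pi20 : 0 < 2 * pi :> R.
Proof. by rewrite mulr_gt0 // pi_gt0. Qed.
Hint Resolve pi20 : core.

Lemma cmeanD f g : continuous f -> continuous g ->
  cmean (fun t => f t + g t) = cmean f + cmean g.
Proof. by move=> cf cg; rewrite /cmean segintD // mulrDr. Qed.

Lemma cmeanB f g : continuous f -> continuous g ->
  cmean (fun t => f t - g t) = cmean f - cmean g.
Proof. by move=> cf cg; rewrite /cmean segintB // mulrBr. Qed.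

Lemma cmeanZ k f : continuous f -> cmean (fun t => k * f t) = k * cmean f.
Proof. by move=> cf; rewrite /cmean segintZ // mulrCA. Qed.

Lemma cmean_cst k : cmean (fun=> k) = k.
Proof. by rewrite /cmean segint_cst ?ltW // subr0 mulrC mulfK ?lt0r_neq0. Qed.

Lemma cmean_le f g : continuous f -> continuous g ->
  (forall t, 0 <= t <= 2 * pi -> f t <= g t) -> cmean f <= cmean g.
Proof.
move=> cf cg h; rewrite ler_pM2l ?invr_gt0 //; exact: segint_le.
Qed.

Lemma cmean_abs f (M : R) : continuous f ->
  (forall t, 0 <= t <= 2 * pi -> `|f t| <= M) -> `|cmean f| <= M.
Proof.
move=> cf h; rewrite normrM ger0_norm; last by rewrite invr_ge0 ltW.
rewrite mulrC.
rewrite ler_pdivrMr //; have := segint_abs (ltW pi20) cf h.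
by rewrite subr0.
Qed.

Lemma cmean_sum (I : Type) (r : seq I) (F : I -> R -> R) :
  (forall i, continuous (F i)) ->
  cmean (fun t => \sum_(i <- r) F i t) = \sum_(i <- r) cmean (F i).
Proof.
move=> cF; elim: r => [|i r IH].
  by under [in LHS]eq_fun do rewrite big_nil; rewrite cmean_cst big_nil.
under eq_fun do rewrite big_cons.
rewrite cmeanD // ?IH ?big_cons // => x.
apply: cvg_big => [|j _]; [exact: add_continuous|exact: cF].
Qed.

Lemma cmeanE f : continuous f ->
  (cmean f)%:E = (((2 * pi)^-1)%R%:E *
     \int[@lebesgue_measure R]_(t in `[0%R, (2 * pi)%R]) (f t)%:E)%E.
Proof. by move=> cf; rewrite -segintE. Qed.

Lemma cis2pi (t : R) : cis (t + 2 * pi) = cis t.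
Proof.
rewrite /cis (_ : t + 2 * pi = t + pi *+ 2); last by ring.
by rewrite cosD2pi sinD2pi.
Qed.

Lemma cmean_rot (g : R[i] -> R) (al : R) :
  continuous (fun t => g (cis t)) -> 0 <= al ->
  cmean (fun t => g (cis t * cis al)) = cmean (fun t => g (cis t)).
Proof.
move=> cg al0; rewrite /cmean; congr (_ * _).
rewrite -[RHS](segint_shift cg (ltW pi20) al0).
  by under [in RHS]eq_fun do rewrite cisD.
by move=> t; rewrite cis2pi.
Qed.

(** Rotating by pi changes the sign of the integrand, so the mean is its own opposite. *)
Lemma cmean_cos : cmean cos = 0.
Proof.
have cc : continuous (cos : R -> R) by move=> t; exact: continuous_cos.
have /esym := cmean_rot (g := @complex.Re R) cc (pi_ge0 R).
under [in RHS]eq_fun do rewrite -cisD /= cosDpi -mulN1r.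
rewrite cmeanZ //= => h.
have {}h : cmean cos = -1 * cmean cos := h.
lra.
Qed.

Lemma cmean_sin : cmean sin = 0.
Proof.
have cc : continuous (sin : R -> R) by move=> t; exact: continuous_sin.
have /esym := cmean_rot (g := @complex.Im R) cc (pi_ge0 R).
under [in RHS]eq_fun do rewrite -cisD /= sinDpi -mulN1r.
rewrite cmeanZ //= => h.
have {}h : cmean sin = -1 * cmean sin := h.
lra.
Qed.

End circle_means.
#[global] Hint Resolve pi20 : core.

(** * Polydiscs as neighbourhoods, and Borel measurability on C^n *)

Section polydiscs.
Context {R : realType} {n : nat}.
Local Notation Cn := 'rV[R[i]]_n.
Implicit Types (z w : Cn) (s : R).

(** The polydiscs with equal radii are the sup-norm balls of C^n; indexing them by a real radius
    avoids the R[i]-valued radii of the norm. *)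
Definition pd z s : set Cn := polydisc z (fun=> s).

Lemma pdE z s w : pd z s w <-> forall j, cabs (w 0 j - z 0 j) < s.
Proof.
by split=> h j; have := h j; rewrite normcabs ltcR.
Qed.

Lemma pd_center z s : 0 < s -> pd z s z.
Proof. by move=> s0; apply/pdE => j; rewrite subrr cabs0. Qed.

Lemma pd_sub z s s' : s <= s' -> pd z s `<=` pd z s'.
Proof. by move=> ss w /pdE h; apply/pdE => j; apply: lt_le_trans (h j) _. Qed.

Lemma pd_triangle z w y s s' : pd z s w -> pd w s' y -> pd z (s + s') y.
Proof.
move=> /pdE h /pdE h'; apply/pdE => j.
rewrite (_ : y 0 j - z 0 j = (w 0 j - z 0 j) + (y 0 j - w 0 j)); last by ring.
by apply: le_lt_trans (cabsD _ _) _; apply: ltrD.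
Qed.

Lemma pd_sym z w s : pd z s w -> pd w s z.
Proof. by move=> /pdE h; apply/pdE => j; rewrite cabsB. Qed.

Lemma nbhs_pd z (A : set Cn) : nbhs z A <-> exists2 s : R, 0 < s & pd z s `<=` A.
Proof.
split=> [/nbhs_ballP[e /= e0 h]|[s s0 h]].
  move: (e0); rewrite ltcE /= => /andP[/eqP e2 e1].
  exists (Re e) => // w hw; apply: h; split=> // i j.
  have /pdE/(_ j) := hw; rewrite (ord1 i) => hj.
  by rewrite -ball_normE /ball_ /= normcabs cabsB ltcE /= -e2 eqxx.
apply/nbhs_ballP; exists s%:C; first by rewrite /= ltcR.
move=> w [_ hw]; apply: h; apply/pdE => j.
by have := hw 0 j; rewrite -ball_normE /ball_ /= normcabs ltcR cabsB.
Qed.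

Lemma pd_open z s : open (pd z s).
Proof.
rewrite openE => w hw; apply/nbhs_pd.
have [e e0 he] : exists2 e : R, 0 < e & forall j, cabs (w 0 j - z 0 j) + e <= s.
  (* For n = 0 membership does not give 0 < s, which the maximum, starting from 0, needs; any
     positive radius then works. *)
  have [n0|n0] := posnP n.
    by exists 1 => // j; exfalso; move: (j); rewrite n0 => -[].
  pose m := \big[Order.max/0]_j cabs (w 0 j - z 0 j).
  have ms : m < s.
    have /pdE h := hw; apply/bigmax_ltP; split=> [|j _]; last exact: h.
    by apply: le_lt_trans (h (Ordinal n0)); exact: cabs_ge0.
  exists (s - m); first by rewrite subr_gt0.
  by move=> j; have := le_bigmax 0 (fun j => cabs (w 0 j - z 0 j)) j; rewrite -/m; lra.
exists e => // y /pdE hy; apply/pdE => j.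
rewrite (_ : y 0 j - z 0 j = (w 0 j - z 0 j) + (y 0 j - w 0 j)); last by ring.
by apply: le_lt_trans (cabsD _ _) _; have := hy j; have := he j; lra.
Qed.

Lemma open_pd (D : set Cn) : open D <->
  forall z, D z -> exists2 s : R, 0 < s & pd z s `<=` D.
Proof.
rewrite openE; split=> h z Dz; first by apply/nbhs_pd; exact: h.
by apply/nbhs_pd; exact: h.
Qed.

Lemma cvg_rV T (F : set_system T) {FF : Filter F} (f : T -> Cn) (l : Cn) :
  (forall j, f x 0 j @[x --> F] --> l 0 j) -> f x @[x --> F] --> l.
Proof.
move=> h A /nbhs_pd[s s0 hs].
have : \forall x \near F, forall j : 'I_n, cabs (f x 0 j - l 0 j) < s.
  by apply: filter_forall => j; apply: (cvg_cabs _ _).1 => //; exact: h.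
by apply: filterS => x hx; apply: hs; apply/pdE.
Qed.

Lemma cvg_coord (l : Cn) (j : 'I_n) : (fun w : Cn => w 0 j) @ l --> l 0 j.
Proof.
apply: (@cvg_cabs R _ (nbhs l) _ _ _).2 => e e0.
by apply/nbhs_pd; exists e => // w /pdE.
Qed.

End polydiscs.

Notation BCn R n := (g_sigma_algebraType (@open 'rV[R[i]]_n)).

Section borel_measurability.
Context {R : realType}.
Local Notation Cn n := 'rV[R[i]]_n.

(** An open set is the countable union of the rational boxes that it contains, and the preimage of a
    box is cut out by finitely many conditions on real coordinates. *)
Lemma rV_open_measurable d (S : measurableType d) n (F : S -> Cn n) :
  (forall j, measurable_fun setT (fun x => Re (F x 0 j))) ->
  (forall j, measurable_fun setT (fun x => Im (F x 0 j))) ->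
  forall O, open O -> measurable (F @^-1` O).
Proof.
move=> mr mi O Oo.
pose box (c : {ffun 'I_n -> rat * rat} * nat) : set (Cn n) :=
  [set w | forall j, `|Re (w 0 j) - ratr (c.1 j).1| < c.2.+1%:R^-1 /\
                     `|Im (w 0 j) - ratr (c.1 j).2| < c.2.+1%:R^-1].
have -> : F @^-1` O =
    \bigcup_c (if `[< box c `<=` O >] then F @^-1` box c else set0).
  apply/seteqP; split=> [x Ox|x [c _]]; last by case: asboolP => // h /h.
  have [s s0 hs] := (open_pd O).1 Oo _ Ox.
  (* Two points of such a box differ by less than 2 / (k + 1) in each real and each imaginary part,
     hence by less than s in each coordinate. *)
  have [k hk] : exists k : nat, k.+1%:R^-1 < s / 4%:R.
    have := near_infty_natSinv_lt (PosNum (divr_gt0 s0 (ltr0n R 4))).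
    by move=> [k _ /(_ k (leqnn k))]; exists k.
  have /choice[q hq] : forall j, exists q : rat * rat,
      `|Re (F x 0 j) - ratr q.1| < k.+1%:R^-1 /\
      `|Im (F x 0 j) - ratr q.2| < k.+1%:R^-1.
    move=> j; have k0 : (0 : R) < k.+1%:R^-1 by rewrite invr_gt0.
    have {k0}h (y : R) : exists q : rat, `|y - ratr q| < k.+1%:R^-1.
      move: (k.+1%:R^-1) k0 => e k0.
      have [q] := @rat_in_itvoo R (y - e) (y + e) ltac:(lra).
      rewrite in_itv /= => /andP[h1 h2]; exists q.
      by rewrite ltr_norml; apply/andP; split; lra.
    have [q1 h1] := h (Re (F x 0 j)); have [q2 h2] := h (Im (F x 0 j)).
    by exists (q1, q2).
  exists (finfun q, k) => //.
  case: asboolP => [_|]; first by move=> j /=; rewrite ffunE; exact: hq.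
  move=> nb; exfalso; apply: nb => w hw; apply: hs; apply/pdE => j.
  have [w1 w2] := hw j; have [x1 x2] := hq j.
  move: w1 w2; rewrite /= ffunE => w1 w2.
  apply: le_lt_trans (cabs_le_ReIm _) _; rewrite ReD ImD ReN ImN.
  have t1 := ler_distD (ratr (q j).1) (Re (w 0 j)) (Re (F x 0 j)).
  have t2 := ler_distD (ratr (q j).2) (Im (w 0 j)) (Im (F x 0 j)).
  rewrite (distrC (ratr _)) in t1; rewrite (distrC (ratr _)) in t2.
  by move: x1 x2 w1 w2 t1 t2 hk; move: (k.+1%:R^-1 : R) => e; lra.
apply: countable_bigcupT_measurable => [|c].
  exact: countableP.
case: asboolP => // _.
rewrite (_ : F @^-1` box c = \bigcap_(j in [set: 'I_n])
   ((fun x => Re (F x 0 j)) @^-1` [set y | `|y - ratr (c.1 j).1| < c.2.+1%:R^-1]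
   `&` (fun x => Im (F x 0 j)) @^-1` [set y | `|y - ratr (c.1 j).2| < c.2.+1%:R^-1])).
  apply: fin_bigcap_measurable => // j _.
  have mb (q : R) : measurable [set y : R | `|y - q| < c.2.+1%:R^-1 :> R].
    apply: open_measurable; have -> : [set y : R | `|y - q| < c.2.+1%:R^-1] =
        ball q (c.2.+1%:R^-1).
      by apply/seteqP; split=> y; rewrite -ball_normE /ball_ /= distrC.
    exact: ball_open.
  apply: measurableI; rewrite -[X in measurable X]setTI.
    exact: mr.
  exact: mi.
by apply/seteqP; split=> [x h j _|x h j]; [exact: h|exact: h].
Qed.

Lemma measurable_to_BCn d (S : measurableType d) n (F : S -> Cn n) :
  (forall j, measurable_fun setT (fun x => Re (F x 0 j))) ->
  (forall j, measurable_fun setT (fun x => Im (F x 0 j))) ->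
  measurable_fun setT (F : S -> BCn R n).
Proof.
move=> mr mi; apply: (@measurability _ _ S (BCn R n) setT F open) => //.
by move=> _ [ U Uo <-]; rewrite setTI; exact: rV_open_measurable.
Qed.

Lemma open_BCn n (O : set (Cn n)) : open O -> measurable (O : set (BCn R n)).
Proof. by move=> Oo; apply: sub_sigma_algebra. Qed.

Lemma continuous_BCn n (f : Cn n -> R) :
  continuous f -> measurable_fun setT (f : BCn R n -> R).
Proof.
move=> /continuousP cf; apply: (measurability _ (RGenOpens.measurableE R)) => //.
move=> _ [_ [a [b ->] <-]]; rewrite setTI; apply: open_BCn; apply: cf.
exact: interval_open.
Qed.

Lemma measurable_ReBCn n (j : 'I_n) :
  measurable_fun setT (fun z : BCn R n => Re ((z : Cn n) 0 j)).
Proof.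
apply: (@continuous_BCn n (fun z : Cn n => Re (z 0 j))) => z.
exact: cvg_Re (@cvg_coord _ _ _ _).
Qed.

Lemma measurable_ImBCn n (j : 'I_n) :
  measurable_fun setT (fun z : BCn R n => Im ((z : Cn n) 0 j)).
Proof.
apply: (@continuous_BCn n (fun z : Cn n => Im (z 0 j))) => z.
exact: cvg_Im (@cvg_coord _ _ _ _).
Qed.

(** Identifying R x R with C^1 reduces the product sigma-algebra to the rational boxes above. *)
Lemma continuous2_measurable (g : R * R -> R) :
  continuous g -> measurable_fun setT (g : measurableTypeR R * measurableTypeR R -> R).
Proof.
move=> cg.
pose G (z : Cn 1) := g (Re (z 0 0), Im (z 0 0)).
have cG : continuous G.
  move=> z; apply: (@continuous_comp _ _ _ (fun z : Cn 1 => (Re (z 0 0), Im (z 0 0))) g);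
    last exact: cg.
  exact: (cvg_pair (cvg_Re (@cvg_coord R 1 z 0)) (cvg_Im (@cvg_coord R 1 z 0))).
pose F (p : measurableTypeR R * measurableTypeR R) : BCn R 1 :=
  (\row_(j < 1) (p.1 +i* p.2) : Cn 1).
have mF : measurable_fun setT F.
  apply: measurable_to_BCn => j /=.
    by under eq_fun do rewrite mxE; exact: measurable_fst.
  by under eq_fun do rewrite mxE; exact: measurable_snd.
have -> : g = (G : BCn R 1 -> R) \o F.
  by apply/funext => -[a b]; rewrite /G /F /= !mxE.
by apply: measurableT_comp => //; exact: continuous_BCn.
Qed.

End borel_measurability.

Section iterated_integrals.
Context {R : realType}.
Local Open Scope ereal_scope.

(** Extension by zero outside A x B reduces the statement to Tonelli's theorem on the whole
    product. *)
Lemma tonelli_set d1 d2 (T1 : measurableType d1) (T2 : measurableType d2)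
  (m1 : {sigma_finite_measure set T1 -> \bar R})
  (m2 : {sigma_finite_measure set T2 -> \bar R})
  (A : set T1) (B : set T2) (f : T1 * T2 -> \bar R) :
  measurable A -> measurable B -> measurable_fun setT f -> (forall p, 0 <= f p) ->
  \int[m1]_(x in A) \int[m2]_(y in B) f (x, y) =
  \int[m2]_(y in B) \int[m1]_(x in A) f (x, y).
Proof.
move=> mA mB mf f0.
pose g := f \_ (A `*` B).
have mg : measurable_fun setT g.
  by apply/(measurable_restrictT f (measurableX mA mB)); exact: measurable_funS mf.
have g0 p : 0 <= g p by rewrite /g patchE; case: ifP.
have H1 x : ((fun x => \int[m2]_(y in B) f (x, y)) \_ A) x = \int[m2]_y g (x, y).
  rewrite patchE; case: ifPn => [/set_mem Ax|/negP xA].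
    rewrite integral_mkcond; apply: eq_integral => y _; rewrite /g !patchE.
    by rewrite in_setX (mem_set Ax).
  apply/esym/integral0_eq => y _.
  by rewrite /g patchE in_setX (negbTE (introN idP xA)).
have H2 y : ((fun y => \int[m1]_(x in A) f (x, y)) \_ B) y = \int[m1]_x g (x, y).
  rewrite patchE; case: ifPn => [/set_mem By|/negP yB].
    rewrite integral_mkcond; apply: eq_integral => x _; rewrite /g !patchE.
    by rewrite in_setX (mem_set By) andbT.
  apply/esym/integral0_eq => x _.
  by rewrite /g patchE in_setX (negbTE (introN idP yB)) andbF.
rewrite integral_mkcond [RHS]integral_mkcond.
under eq_integral do rewrite H1.
under [RHS]eq_integral do rewrite H2.
exact: fubini_tonelli.
Qed.

End iterated_integrals.

Section continuous_parameters.
Context {R : realType}.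
Local Notation mu := (@lebesgue_measure R).

Lemma continuous_pairing (T U V : topologicalType) (f : T -> U) (g : T -> V) :
  continuous f -> continuous g -> continuous (fun x => (f x, g x)).
Proof. by move=> cf cg x; exact: (cvg_pair (cf x) (cg x)). Qed.

Lemma rect_bound (g : R * R -> R) (a b c d : R) : continuous g ->
  exists2 M : R, 0 <= M & forall x t, a <= x <= b -> c <= t <= d -> `|g (x, t)| <= M.
Proof.
move=> cg.
have K : compact (`[a, b]%classic `*` `[c, d]%classic : set (R * R)).
  by apply: compact_setX; exact: segment_compact.
have := continuous_compact (continuous_subspaceT cg) K.
move/compact_bounded => [M [_ hM]].
exists (`|M| + 1)%R => [|x t xab tcd]; first by rewrite addr_ge0.
apply: (hM (`|M| + 1)%R).
  by rewrite (le_lt_trans (ler_norm M)) // ltrDl.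
by exists (x, t) => //=; rewrite !in_itv /=.
Qed.

Lemma continuous_pair1 (g : R * R -> R) (x : R) : continuous g ->
  continuous (fun t => g (x, t)).
Proof.
move=> cg t; apply: (@continuous_comp _ _ _ (fun t : R => (x, t)) g); last exact: cg.
by apply: continuous_pairing; [move=> ?; exact: cvg_cst|move=> ?; exact: cvg_id].
Qed.

Lemma continuous_pair2 (g : R * R -> R) (t : R) : continuous g ->
  continuous (fun x => g (x, t)).
Proof.
move=> cg x; apply: (@continuous_comp _ _ _ (fun x : R => (x, t)) g); last exact: cg.
by apply: continuous_pairing; [move=> ?; exact: cvg_id|move=> ?; exact: cvg_cst].
Qed.

Lemma segint_continuous (g : R * R -> R) (a b : R) : continuous g ->
  continuous (fun x => segint a b (fun t => g (x, t))).
Proof.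
move=> cg x.
have [M M0 hM] := rect_bound (x - 1) (x + 1) a b cg.
have := @continuity_under_integral R _ _ mu (fun x t => g (x, t)) `[a, b]%classic
  (measurable_itv _) (x - 1) (x + 1) _ _ (fun=> M) _ _ x.
apply.
- by move=> y _; apply: seg_integrable; exact: continuous_pair1.
- by apply: aeW => t _ y _; exact: continuous_pair2.
- by apply: (@seg_integrable _ _ _ (fun=> M)) => t; exact: cvg_cst.
- move=> y /=; rewrite in_itv /= => /andP[y1 y2]; apply: aeW => t /=.
  by rewrite in_itv /= => tab; apply: hM => //; rewrite !ltW.
- by rewrite inE /= in_itv /=; lra.
Qed.

Lemma segint_swap (g : R * R -> R) (a b c d : R) : a <= b -> c <= d -> continuous g ->
  segint a b (fun x => segint c d (fun t => g (x, t))) =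
  segint c d (fun t => segint a b (fun x => g (x, t))).
Proof.
move=> ab cd cg.
have [M M0 hM] := rect_bound a b c d cg.
(* Tonelli asks for a nonnegative integrand: g + M is nonnegative on the rectangle, and the absolute
   value makes it so everywhere without changing it there. *)
pose h p : R := `|g p + M|.
have ch : continuous h.
  by move=> p; apply: cvg_norm; apply: cvgD; [exact: cg|exact: cvg_cst].
have hE x t : a <= x <= b -> c <= t <= d -> g (x, t) = h (x, t) - M.
  move=> xab tcd; have := hM x t xab tcd; rewrite ler_norml => /andP[h1 _].
  by rewrite /h ger0_norm; lra.
have c1 x : continuous (fun t => h (x, t)) by exact: continuous_pair1.
have c2 t : continuous (fun x => h (x, t)) by exact: continuous_pair2.
have ch' : continuous (fun p : R * R => h (p.2, p.1)).
  move=> p; apply: (@continuous_comp _ _ _ (fun p : R * R => (p.2, p.1)) h); last exact: ch.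
  by apply: continuous_pairing; [move=> ?; exact: cvg_snd|move=> ?; exact: cvg_fst].
have cM : continuous ((fun=> M) : R -> R) by move=> ?; exact: cvg_cst.
have cMM k : continuous ((fun=> k) : R -> R) by move=> ?; exact: cvg_cst.
transitivity (segint a b (fun x => segint c d (fun t => h (x, t)) - M * (d - c))).
  apply: segint_eq => x xab; rewrite -segint_cst // -segintB //.
  by apply: segint_eq => t tcd; exact: hE.
transitivity (segint c d (fun t => segint a b (fun x => h (x, t)) - M * (b - a)));
  last first.
  apply: segint_eq => t tcd; rewrite -segint_cst // -segintB //.
  by apply: segint_eq => x xab; rewrite hE.
rewrite !segintB //; first last.
- exact: segint_continuous.
- exact: (@segint_continuous (fun p => h (p.2, p.1))).
rewrite !segint_cst // -!mulrA (mulrC (d - c)); congr (_ - _).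
apply: EFin_inj; rewrite !segintE; first last.
- exact: segint_continuous.
- exact: (@segint_continuous (fun p => h (p.2, p.1))).
under eq_integral do rewrite segintE //.
under [RHS]eq_integral do rewrite segintE //.
apply: (@tonelli_set R _ _ _ _ mu mu `[a, b]%classic `[c, d]%classic (EFin \o h)) => //.
- by apply/measurable_EFinP; exact: continuous2_measurable.
- by move=> p; rewrite /= lee_fin /h.
Qed.

Lemma cmean_swap (g : R * R -> R) : continuous g ->
  cmean (fun x => cmean (fun t => g (x, t))) =
  cmean (fun t => cmean (fun x => g (x, t))).
Proof.
move=> cg.
have cg' : continuous (fun p : R * R => g (p.2, p.1)).
  move=> p; apply: (@continuous_comp _ _ _ (fun p : R * R => (p.2, p.1)) g); last exact: cg.
  by apply: continuous_pairing; [move=> ?; exact: cvg_snd|move=> ?; exact: cvg_fst].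
rewrite /cmean segintZ; last exact: segint_continuous.
rewrite segintZ; last exact: (@segint_continuous (fun p => g (p.2, p.1))).
by rewrite segint_swap // ltW.
Qed.

Lemma cmean_continuous (g : R * R -> R) : continuous g ->
  continuous (fun x => cmean (fun t => g (x, t))).
Proof.
by move=> cg x; apply: cvgMr; exact: segint_continuous.
Qed.

End continuous_parameters.

(** * Monotonicity of circle means in the radius *)

Section radial_monotonicity.
Context {R : realType}.
Variables (f : R[i] -> R) (r : R).
Hypothesis r0 : 0 < r.
Hypothesis cf : forall z, cabs z <= r -> {for z, continuous f}.
Hypothesis sub : forall e, 0 < e -> exists2 d, 0 < d &
  forall z s, cabs z < r -> 0 < s < d -> cabs z + s <= r ->
    f z <= cmean (fun t => f (z + s%:C * cis t)) + e * s ^+ 2.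

(** Averaging over rotations makes f radial while keeping the submean inequality, so that only a
    function of one real variable remains. *)
Let F z := cmean (fun t => f (z * cis t)).

(** This is min(|s|, r). It makes the radial profile [phi] continuous on all of R, as the integral
    lemmas require. *)
Let clamp (s : R) : R := (`|s| + r - `| `|s| - r|) / 2.

Let clampP s : 0 <= clamp s <= r.
Proof.
rewrite /clamp; have := normr_ge0 s; move: (`|s|) => x x0.
by case: (ger0P (x - r)) => h; apply/andP; split; move: h r0; lra.
Qed.

Let clamp_id s : 0 <= s <= r -> clamp s = s.
Proof.
move=> /andP[s0 sr]; rewrite /clamp (ger0_norm s0).
by case: (ger0P (s - r)) => h; move: h r0; lra.
Qed.

Let comp_cont (g : R * R -> R[i]) : continuous g -> (forall p, cabs (g p) <= r) ->
  continuous (fun p => f (g p)).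
Proof.
by move=> cg gr p; apply: (@continuous_comp _ _ _ g f); [exact: cg|exact: cf].
Qed.

Let phi s := cmean (fun t => f ((clamp s)%:C * cis t)).

Let cont_cis1 (w : R[i]) : continuous (fun t : R => w * cis t).
Proof. by move=> t; apply: cvgM; [exact: cvg_cst|exact: continuous_cis]. Qed.

Let cont_f1 (w w' : R[i]) : cabs w + cabs w' <= r ->
  continuous (fun t : R => f (w + w' * cis t)).
Proof.
move=> h t; apply: (@continuous_comp _ _ _ (fun t => w + w' * cis t) f).
  by apply: cvgD; [exact: cvg_cst|exact: cont_cis1].
by apply: cf; apply: le_trans (cabsD _ _) _; rewrite cabsM cabs_cis mulr1.
Qed.

Let cont_f0 (w : R[i]) : cabs w <= r -> continuous (fun t : R => f (w * cis t)).
Proof.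
move=> h; have := @cont_f1 0 w; rewrite cabs0 add0r => /(_ h).
by under eq_fun do rewrite add0r.
Qed.

Let clamp_cont : continuous clamp.
Proof.
move=> s; apply: cvgMl; apply: cvgB.
  by apply: cvgD; [apply: cvg_norm; exact: cvg_id|exact: cvg_cst].
apply: cvg_norm; apply: cvgB; last exact: cvg_cst.
by apply: cvg_norm; exact: cvg_id.
Qed.

Let phi_cont : continuous phi.
Proof.
apply: (@cmean_continuous R (fun p => f ((clamp p.1)%:C * cis p.2))).
apply: comp_cont => [p|p].
  apply: cvgM.
    apply: cvg_real_complex; apply: (@continuous_comp _ _ _ fst clamp).
      exact: cvg_fst.
    exact: clamp_cont.
  by apply: (@continuous_comp _ _ _ snd cis); [exact: cvg_snd|exact: continuous_cis].
rewrite cabsM cabs_cis mulr1 cabs_real ger0_norm; by case/andP: (clampP p.1).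
Qed.

Let F_phi z : cabs z <= r -> F z = phi (cabs z).
Proof.
move=> zr; have [al [/andP[al0 _] zE]] := polar z.
have cz : 0 <= cabs z <= r by rewrite cabs_ge0.
rewrite /phi clamp_id // /F {1}zE.
under eq_fun do rewrite -mulrA (mulrC (cis al)).
apply: (@cmean_rot R (fun w => f ((cabs z)%:C * w))) => //.
by apply: cont_f0; rewrite cabs_real ger0_norm // cabs_ge0.
Qed.

Let mean_sqr (s d : R) : cmean (fun t => cabs (s%:C + d%:C * cis t) ^+ 2) = s ^+ 2 + d ^+ 2.
Proof.
have -> : (fun t => cabs (s%:C + d%:C * cis t) ^+ 2) =
    (fun t => (s ^+ 2 + d ^+ 2) + (2 * s * d) * cos t).
  apply/funext => t; rewrite cabs_sqr ReD ImD ReZ ImZ /=.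
  have E : d ^+ 2 = d ^+ 2 * (cos t ^+ 2 + sin t ^+ 2) by rewrite cos2Dsin2 mulr1.
  by rewrite [X in _ = _ + X + _]E; ring.
have cc : continuous (cos : R -> R) by move=> t; exact: continuous_cos.
rewrite cmeanD; [|by move=> t; exact: cvg_cst|by move=> t; apply: cvgMr; exact: cc].
by rewrite cmean_cst cmeanZ // cmean_cos mulr0 addr0.
Qed.

(** Perturbed maximum principle for psi(x) = phi(x) + e x^2 on [0, r], where phi is the radial
    profile. If its maximum were at c < r, a small circle of radius x about c would give a
    contradiction: the mean of |.|^2 over it is c^2 + x^2, a gain of e x^2 against a submean error
    of only (e / 2) x^2. So the maximum is at r, and e tends to 0. *)
Lemma radial_mean_le (s : R) : 0 <= s <= r ->
  cmean (fun t => f (s%:C * cis t)) <= cmean (fun t => f (r%:C * cis t)).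
Proof.
move=> sr.
have rr : 0 <= r <= r by rewrite lexx ltW.
suff H : phi s <= phi r by move: H; rewrite /phi !clamp_id.
suff H e : 0 < e -> phi s <= phi r + e * r ^+ 2.
  apply/ler_addgt0Pr => e e0; have := H (e / r ^+ 2).
  by rewrite divfK ?expf_neq0 ?lt0r_neq0 // divr_gt0 // ?exprn_gt0 // => ->.
move=> e0.
pose psi x := phi x + e * x ^+ 2.
have psi_cont : {within `[0, r], continuous psi}.
  apply: cont_within => x; apply: cvgD; first exact: phi_cont.
  by apply: cvgMr; exact: exprn_continuous.
have [c /andP[]] := EVT_max (ltW r0) psi_cont.
rewrite /= !bnd_simp => c0 cr cmax.
have hmax x : 0 <= x <= r -> psi x <= psi c by move=> hx; apply: cmax; rewrite in_itv.
suff cE : c = r.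
  have := hmax s sr; rewrite cE /psi; have := mulr_ge0 (ltW e0) (sqr_ge0 s); lra.
apply: contrapT => /eqP cne.
have {}cr : c < r by rewrite lt_neqAle cne.
(* Half of e: the error allowed in the submean inequality must stay below the gain of the quadratic
   term. *)
have e20 : 0 < e / 2 by rewrite divr_gt0.
have [d d0 hd] := sub e20.
pose x := Num.min d (r - c) / 2.
have x0 : 0 < x by rewrite divr_gt0 // lt_min d0 subr_gt0.
have xd : x < d by rewrite ltr_pdivrMr // gt_min; apply/orP; left; lra.
have xr : c + x <= r.
  have : x <= (r - c) / 2 by rewrite ler_pM2r // ge_min lexx orbT.
  lra.
have cc : cabs c%:C = c by rewrite cabs_real ger0_norm.
have cx : cabs x%:C = x by rewrite cabs_real ger0_norm ?ltW.
have cont2 : continuous (fun p : R * R => f ((c%:C + x%:C * cis p.2) * cis p.1)).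
  apply: comp_cont => p.
    apply: cvgM.
      apply: cvgD; first exact: cvg_cst.
      apply: cvgM; first exact: cvg_cst.
      by apply: (@continuous_comp _ _ _ snd cis); [exact: cvg_snd|exact: continuous_cis].
    by apply: (@continuous_comp _ _ _ fst cis); [exact: cvg_fst|exact: continuous_cis].
  rewrite cabsM cabs_cis mulr1; apply: le_trans (cabsD _ _) _.
  by rewrite cabsM cabs_cis mulr1 cc cx.
(* The submean inequality at every point of the circle of radius c, averaged over that circle. *)
have step1 : phi c <= cmean (fun t => cmean (fun y =>
    f ((c%:C + x%:C * cis y) * cis t))) + e / 2 * x ^+ 2.
  rewrite -[X in _ <= _ + X]cmean_cst -cmeanD; first last.
  - by move=> t; exact: cvg_cst.
  - exact: cmean_continuous cont2.
  have hc : 0 <= c <= r by rewrite c0 ltW.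
  rewrite /phi clamp_id //; apply: cmean_le.
  - by apply: cont_f0; rewrite cc ltW.
  - move=> t; apply: cvgD; last exact: cvg_cst.
    exact: (cmean_continuous cont2).
  move=> t /andP[t0 _].
  have -> : cmean (fun y => f ((c%:C + x%:C * cis y) * cis t)) =
     cmean (fun y => f (c%:C * cis t + x%:C * cis y)).
    rewrite -(@cmean_rot R (fun w => f (c%:C * cis t + x%:C * w)) t) //.
      by under eq_fun do rewrite mulrDl -mulrA.
    by apply: cont_f1; rewrite cabsM cabs_cis mulr1 cc cx.
  by apply: hd; rewrite ?cabsM ?cabs_cis ?mulr1 ?cc // x0.
(* After exchanging the two means, the inner one is the radial average F at a point of the small
   circle, which the maximality of c bounds. *)
have step2 : cmean (fun t => cmean (fun y => f ((c%:C + x%:C * cis y) * cis t))) <=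
   psi c - e * (c ^+ 2 + x ^+ 2).
  have sqc : continuous (fun t : R => cabs (c%:C + x%:C * cis t) ^+ 2).
    move=> t; have h := cvg_cabs_norm (cvgD (cvg_cst c%:C) (@cont_cis1 x%:C t)).
    apply: (@continuous_comp _ _ _ (fun t => cabs (c%:C + x%:C * cis t))
      (fun y : R => y ^+ 2)); [exact: h|exact: exprn_continuous].
  rewrite (cmean_swap cont2) -mean_sqr -cmeanZ //.
  rewrite -[psi c]cmean_cst -cmeanB; first last.
  - by move=> t; apply: cvgMr; exact: sqc.
  - by move=> t; exact: cvg_cst.
  apply: cmean_le.
  - apply: (@cmean_continuous R (fun p => f ((c%:C + x%:C * cis p.1) * cis p.2))).
    move=> p; apply: (@continuous_comp _ _ _ (fun p : R * R => (p.2, p.1))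
       (fun p : R * R => f ((c%:C + x%:C * cis p.2) * cis p.1))); last exact: cont2.
    by apply: continuous_pairing; [move=> ?; exact: cvg_snd|move=> ?; exact: cvg_fst].
  - move=> t; apply: cvgB; first exact: cvg_cst.
    by apply: cvgMr; exact: sqc.
  move=> y _.
  have wr : cabs (c%:C + x%:C * cis y) <= r.
    apply: le_trans (cabsD _ _) _.
    by rewrite cabsM cabs_cis mulr1 cc cx.
  change (F (c%:C + x%:C * cis y) <= psi c - e * cabs (c%:C + x%:C * cis y) ^+ 2).
  rewrite F_phi // lerBrDr; apply: hmax; by rewrite cabs_ge0.
have := le_trans step1 (lerD step2 (lexx _)).
rewrite /psi; have := mulr_gt0 e0 (exprn_gt0 2 x0); lra.
Qed.

End radial_monotonicity.

(** * Goursat's argument for divergence-free fields *)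

Section divergence_free.
Context {R : realType}.
Variables (U V : R * R -> R) (s0 t0 l m : R).
Hypotheses (l0 : 0 <= l) (m0 : 0 <= m) (cU : continuous U) (cV : continuous V).
Let Q (p : R * R) := s0 <= p.1 <= s0 + l /\ t0 <= p.2 <= t0 + m.
(* As in Goursat's lemma, no regularity of the partial derivatives is assumed;
   the common coefficient [a] expresses that [U_s = V_t]. *)
Hypothesis CR : forall p, Q p -> exists a b c : R, forall e, 0 < e ->
  exists2 d, 0 < d & forall x y, Q (p.1 + x, p.2 + y) -> `|x| <= d -> `|y| <= d ->
    `|U (p.1 + x, p.2 + y) - U p - (a * x + b * y)| <= e * (`|x| + `|y|) /\
    `|V (p.1 + x, p.2 + y) - V p - (c * x + a * y)| <= e * (`|x| + `|y|).

(** The outward flux of the field (U, -V) through the boundary of the rectangle with corner (s, t)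
    and sides k, h. *)
Let J (s t k h : R) : R :=
  segint t (t + h) (fun y => U (s + k, y) - U (s, y)) -
  segint s (s + k) (fun x => V (x, t + h) - V (x, t)).

Let cU1 s : continuous (fun y => U (s, y)). Proof. exact: continuous_pair1. Qed.
Let cV2 t : continuous (fun x => V (x, t)). Proof. exact: continuous_pair2. Qed.
Let cB (f g : R -> R) : continuous f -> continuous g -> continuous (fun x => f x - g x).
Proof. by move=> cf cg x; apply: cvgB; [exact: cf|exact: cg]. Qed.

Let J_split s t k h : 0 <= k -> 0 <= h ->
  J s t (k + k) (h + h) = J s t k h + J (s + k) t k h + J s (t + h) k h + J (s + k) (t + h) k h.
Proof.
move=> k0 h0; rewrite /J.
have cat1 (f : R -> R) a c : 0 <= c -> continuous f ->
    segint a (a + (c + c)) f = segint a (a + c) f + segint (a + c) (a + c + c) f.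
  by move=> c0 cf; rewrite addrA; apply: segint_cat => //; lra.
rewrite !cat1 //; try exact: cB.
have B (f g : R -> R) a b := @segintB R a b f g.
rewrite !segintB // !addrA.
set a1 := segint t _ _; ring.
Qed.

(** The linear parts of the expansions at p contribute a k h to each of the two integrals and cancel
    in the flux. The remainders contribute at most 2 e (k + h) times k + h. *)
Let J_small s t k h p e : 0 <= k -> 0 <= h -> 0 < e -> Q p ->
  Q (s, t) -> Q (s + k, t + h) -> s <= p.1 <= s + k -> t <= p.2 <= t + h ->
  (exists a b c : R, forall x y, Q (p.1 + x, p.2 + y) -> `|x| <= k -> `|y| <= h ->
    `|U (p.1 + x, p.2 + y) - U p - (a * x + b * y)| <= e * (`|x| + `|y|) /\
    `|V (p.1 + x, p.2 + y) - V p - (c * x + a * y)| <= e * (`|x| + `|y|)) ->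
  `|J s t k h| <= 2 * e * (k + h) ^+ 2.
Proof.
move=> k0 h0 e0 Qp Q1 Q2 /andP[ps1 ps2] /andP[pt1 pt2] [a [b [c H]]].
case: Q1 => /= /andP[a1 a2] /andP[a3 a4]; case: Q2 => /= /andP[b1 b2] /andP[b3 b4].
have HH x y : s <= x <= s + k -> t <= y <= t + h ->
    `|U (x, y) - U p - (a * (x - p.1) + b * (y - p.2))| <= e * (k + h) /\
    `|V (x, y) - V p - (c * (x - p.1) + a * (y - p.2))| <= e * (k + h).
  move=> /andP[x1 x2] /andP[y1 y2].
  have hx : `|x - p.1| <= k by rewrite ler_norml; apply/andP; split; lra.
  have hy : `|y - p.2| <= h by rewrite ler_norml; apply/andP; split; lra.
  have := H (x - p.1) (y - p.2); rewrite !subrKC.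
  have Qxy : Q (x, y) by split; apply/andP; split => /=; lra.
  move=> /(_ Qxy hx hy) [h1 h2]; have le : e * (`|x - p.1| + `|y - p.2|) <= e * (k + h).
    by rewrite ler_pM2l // lerD.
  by split; [exact: le_trans h1 le|exact: le_trans h2 le].
have I1 : `|segint t (t + h) (fun y => U (s + k, y) - U (s, y) - a * k)| <=
    2 * e * (k + h) * h.
  rewrite -[X in _ <= _ * X](_ : t + h - t = h); last by ring.
  apply: segint_abs; [lra| |].
    by apply: cB; [exact: cB|move=> ?; exact: cvg_cst].
  move=> y hy; have [|//|u1 _] := @HH (s + k) y; first by apply/andP; split; lra.
  have [|//|u2 _] := @HH s y; first by apply/andP; split; lra.
  move: u1 u2; rewrite !ler_norml => /andP[u1 u2] /andP[u3 u4].
  by apply/andP; split; lra.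
have I2 : `|segint s (s + k) (fun x => V (x, t + h) - V (x, t) - a * h)| <=
    2 * e * (k + h) * k.
  rewrite -[X in _ <= _ * X](_ : s + k - s = k); last by ring.
  apply: segint_abs; [lra| |].
    by apply: cB; [exact: cB|move=> ?; exact: cvg_cst].
  move=> x hx; have [//||_ u1] := @HH x (t + h); first by apply/andP; split; lra.
  have [//||_ u2] := @HH x t; first by apply/andP; split; lra.
  move: u1 u2; rewrite !ler_norml => /andP[u1 u2] /andP[u3 u4].
  by apply/andP; split; lra.
have cst (f : R -> R) x y z : continuous f -> x <= y ->
    segint x y (fun z' => f z' - z) = segint x y f - z * (y - x).
  move=> cf xy; rewrite segintB //; last by move=> ?; exact: cvg_cst.
  by rewrite segint_cst.
have th : t <= t + h by lra.
have sk : s <= s + k by lra.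
move: I1 I2; rewrite !cst //; try exact: cB.
rewrite /J; move: (segint t _ _) (segint s _ _) => A B.
rewrite !ler_norml => /andP[u1 u2] /andP[u3 u4].
by apply/andP; split; nra.
Qed.

(** Passes to a quarter of the rectangle that carries at least a fourth of the flux; if the first
    three quarters fail, the last one succeeds by the triangle inequality. *)
Let step (k : nat) (p : R * R) : R * R :=
  let a := l / 2 ^+ k.+1 in let b := m / 2 ^+ k.+1 in
  let big q := `|J p.1 p.2 (a + a) (b + b)| <= 4 * `|J q.1 q.2 a b| in
  if big (p.1, p.2) then (p.1, p.2) else
  if big (p.1 + a, p.2) then (p.1 + a, p.2) else
  if big (p.1, p.2 + b) then (p.1, p.2 + b) else (p.1 + a, p.2 + b).

Let corner := fix F k := if k is k'.+1 then step k' (F k') else (s0, t0).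

Let half (x : R) k : x / 2 ^+ k.+1 + x / 2 ^+ k.+1 = x / 2 ^+ k.
Proof. by rewrite exprS invfM; field; rewrite expf_neq0. Qed.

Let corner_step k :
  [/\ (corner k).1 <= (corner k.+1).1 <= (corner k).1 + l / 2 ^+ k.+1,
      (corner k).2 <= (corner k.+1).2 <= (corner k).2 + m / 2 ^+ k.+1
    & `|J (corner k).1 (corner k).2 (l / 2 ^+ k) (m / 2 ^+ k)| <=
      4 * `|J (corner k.+1).1 (corner k.+1).2 (l / 2 ^+ k.+1) (m / 2 ^+ k.+1)|].
Proof.
have a0 : 0 <= l / 2 ^+ k.+1 by rewrite divr_ge0 // exprn_ge0.
have b0 : 0 <= m / 2 ^+ k.+1 by rewrite divr_ge0 // exprn_ge0.
rewrite -(half l k) -(half m k) /= -/corner /step; move: (corner k) => [s t] /=.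
move: (l / 2 ^+ k.+1) (m / 2 ^+ k.+1) a0 b0 => a b a0 b0.
have T1 := lexx s; have T2 := lexx t.
case: ifPn => [h|h1] /=; first by split=> //; apply/andP; split; lra.
case: ifPn => [h|h2] /=; first by split=> //; apply/andP; split; lra.
case: ifPn => [h|h3] /=; first by split=> //; apply/andP; split; lra.
split; [by apply/andP; split; lra|by apply/andP; split; lra|].
rewrite leNgt; apply/negP => h4.
move: h1 h2 h3 h4; rewrite -!ltNge J_split //.
move: (J s t a b) (J (s + a) t a b) (J s (t + b) a b) (J (s + a) (t + b) a b) => A B C D.
have := ler_normD (A + B + C) D; have := ler_normD (A + B) C; have := ler_normD A B.
lra.
Qed.

Let nested (a : nat -> R) (c : R) : 0 <= c ->
  (forall k, a k <= a k.+1 <= a k + c / 2 ^+ k.+1) ->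
  exists x, forall k, a k <= x <= a k + c / 2 ^+ k.
Proof.
move=> c0 h.
have nd i j : (i <= j)%N -> a i <= a j /\ a j + c / 2 ^+ j <= a i + c / 2 ^+ i.
  elim: j => [|j IH]; first by rewrite leqn0 => /eqP->.
  rewrite leq_eqVlt ltnS => /predU1P[->//|/IH[h1 h2]].
  have := h j; rewrite -(half c j) in h2 => /andP[h3 h4]; split; lra.
have p0 k : 0 <= c / 2 ^+ k by rewrite divr_ge0 // exprn_ge0.
have ub i j : a i <= a j + c / 2 ^+ j.
  have [ij|ji] := leqP i j.
    by have [h1 _] := nd _ _ ij; have := p0 j; lra.
  by have [_ h1] := nd _ _ (ltnW ji); have := p0 i; lra.
exists (sup (range a)) => k; apply/andP; split.
  apply: ub_le_sup; last by exists k.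
  by exists (a 0%N + c / 2 ^+ 0) => _ [i _ <-].
apply: ge_sup; first by exists (a 0%N), 0%N.
by move=> _ [i _ <-].
Qed.

(** The flux through the rectangle of rank k is at least 4^-k times the original one, while the
    expansion at the limit point of the corners bounds it by 2 e' (l + m)^2 4^-k, with e'
    arbitrary. *)
Lemma divergence_free :
  segint t0 (t0 + m) (fun y => U (s0 + l, y) - U (s0, y)) =
  segint s0 (s0 + l) (fun x => V (x, t0 + m) - V (x, t0)).
Proof.
apply/eqP; rewrite -subr_eq0 -/(J s0 t0 l m) -normr_le0.
have [p1 hp1] : exists x, forall k, (corner k).1 <= x <= (corner k).1 + l / 2 ^+ k.
  by apply: nested => // k; have [] := corner_step k.
have [p2 hp2] : exists x, forall k, (corner k).2 <= x <= (corner k).2 + m / 2 ^+ k.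
  by apply: nested => // k; have [] := corner_step k.
have hJ k : `|J s0 t0 l m| <=
    4 ^+ k * `|J (corner k).1 (corner k).2 (l / 2 ^+ k) (m / 2 ^+ k)|.
  elim: k => [|k IH]; first by rewrite /= !expr0 !divr1 mul1r.
  apply: le_trans IH _; rewrite exprSr -mulrA ler_pM2l ?exprn_gt0 //.
  by have [_ _] := corner_step k.
have Qp : Q (p1, p2).
  by have := hp1 0%N; have := hp2 0%N; rewrite /= !expr0 !divr1.
have [a [b [c H]]] := CR Qp.
apply/ler_addgt0Pr => e e0; rewrite add0r.
(* Chosen so that 2 e' (l + m)^2 <= e; the added 1 covers a degenerate rectangle. *)
pose e' := e / (2 * ((l + m) ^+ 2 + 1)).
have D0 : 0 < 2 * ((l + m) ^+ 2 + 1) by have := sqr_ge0 (l + m); lra.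
have e'0 : 0 < e' by rewrite divr_gt0.
have [d d0 hd] := H e' e'0.
have [k [lk mk]] : exists k : nat, l / 2 ^+ k <= d /\ m / 2 ^+ k <= d.
  have [k hk] : exists k : nat, (l + m) / d < k%:R.
    exists (Num.truncn ((l + m) / d)).+1; exact: truncnS_gt.
  have k2 : (k%:R : R) <= 2 ^+ k.
    by rewrite -natrX ler_nat; exact/ltnW/ltn_expl.
  have P : 0 < (2 : R) ^+ k by rewrite exprn_gt0.
  have H2 : l + m <= d * 2 ^+ k.
    by rewrite mulrC -ler_pdivrMr //; apply: le_trans (ltW hk) k2.
  exists k; rewrite !ler_pdivrMr //; split; apply: le_trans H2.
    by rewrite lerDl.
  by rewrite lerDr.
have P : 0 < (2 : R) ^+ k by rewrite exprn_gt0.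
have lk0 : 0 <= l / 2 ^+ k by rewrite divr_ge0 // ltW.
have mk0 : 0 <= m / 2 ^+ k by rewrite divr_ge0 // ltW.
have low j : s0 <= (corner j).1 /\ (corner j).1 + l / 2 ^+ j <= s0 + l.
  elim: j => [|j [i1 i2]]; first by rewrite /= expr0 divr1.
  have [/andP[h1 h2] _ _] := corner_step j; rewrite -(half l j) in i2; split; lra.
have low2 j : t0 <= (corner j).2 /\ (corner j).2 + m / 2 ^+ j <= t0 + m.
  elim: j => [|j [i1 i2]]; first by rewrite /= expr0 divr1.
  have [_ /andP[h1 h2] _] := corner_step j; rewrite -(half m j) in i2; split; lra.
have [i1 i2] := low k; have [i3 i4] := low2 k.
have hh : `|J (corner k).1 (corner k).2 (l / 2 ^+ k) (m / 2 ^+ k)| <=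
    2 * e' * (l / 2 ^+ k + m / 2 ^+ k) ^+ 2.
  apply: (J_small lk0 mk0 e'0 Qp) => //.
  - by split; apply/andP; split => /=; lra.
  - by split; apply/andP; split => /=; lra.
  - exists a, b, c => x y Qxy xk yk; apply: hd => //.
      exact: le_trans xk lk.
    exact: le_trans yk mk.
apply: le_trans (hJ k) _.
have -> : (4 : R) ^+ k = 2 ^+ k * 2 ^+ k by rewrite -exprMn; congr (_ ^+ _); ring.
have : 2 ^+ k * 2 ^+ k * `|J (corner k).1 (corner k).2 (l / 2 ^+ k) (m / 2 ^+ k)| <=
   2 * e' * (l + m) ^+ 2.
  apply: le_trans (ler_wpM2l _ hh) _; first by rewrite mulr_ge0 // ltW.
  rewrite le_eqVlt; apply/orP; left; apply/eqP; field; exact: lt0r_neq0.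
move/le_trans; apply; rewrite /e'.
rewrite (_ : 2 * (e / _) * _ = e * (2 * (l + m) ^+ 2 / (2 * ((l + m) ^+ 2 + 1)))); last by ring.
apply: ler_piMr; first exact: ltW.
by rewrite ler_pdivrMr // mul1r; lra.
Qed.

End divergence_free.

(** * The mean value property of complex differentiable functions *)

Section mean_value_property.
Context {R : realType}.

Lemma nbhs_cabs (z : R[i]) (A : set R[i]) :
  nbhs z A <-> exists2 d : R, 0 < d & forall x, cabs (x - z) < d -> A x.
Proof.
split=> [/nbhs_ballP[e /= e0 h]|[d d0 h]].
  move: (e0); rewrite ltcE /= => /andP[/eqP e2 e1].
  exists (Re e) => // x hx; apply: h; rewrite -ball_normE /ball_ /= normcabs cabsB.
  by rewrite ltcE /= -e2 eqxx.
apply/nbhs_ballP; exists d%:C; first by rewrite /= ltcR.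
by move=> x; rewrite -ball_normE /ball_ /= normcabs ltcR cabsB; exact: h.
Qed.

(** Quotient-free, with real tolerances. Nothing is asked of the derivative c as a function of w,
    since the definition of [holomorphic] gives only differentiability at each point. *)
Definition cdiff (f : R[i] -> R[i]) (w : R[i]) : Prop :=
  exists c : R[i], forall e : R, 0 < e -> exists2 d : R, 0 < d &
    forall h, cabs h < d -> cabs (f (w + h) - f w - c * h) <= e * cabs h.

Lemma cdiff_continuous f w : cdiff f w -> {for w, continuous f}.
Proof.
move=> [c H]; apply: (@cvg_cabs R _ (nbhs w) _ _ _).2 => e e0.
have [d d0 hd] := H 1 ltr01.
have K0 : 0 < cabs c + 1 by have := cabs_ge0 c; lra.
have d1 : 0 < Num.min d (e / (cabs c + 1)) by rewrite lt_min d0 divr_gt0.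
have : \forall x \near w, cabs (x - w) < Num.min d (e / (cabs c + 1)).
  by apply: (@cvg_cabs R _ (nbhs w) _ _ _).1 => //; exact: cvg_id.
apply: filterS => x; rewrite lt_min => /andP[xd xe].
have := hd (x - w) xd; rewrite subrKC mul1r => h1.
rewrite (_ : f x - f w = (f x - f w - c * (x - w)) + c * (x - w)); last by ring.
apply: le_lt_trans (cabsD _ _) _; rewrite cabsM.
move: xe; rewrite ltr_pdivlMr //; lra.
Qed.

Lemma derive_expansion (f : R -> R) (l : R) : is_derive (0 : R) (1 : R) f l ->
  forall e, 0 < e -> exists2 d, 0 < d &
    forall x, `|x| <= d -> `|f x - f 0 - l * x| <= e * `|x|.
Proof.
move=> [df fl] e e0.
have : (fun h : R => h^-1 *: (f (h *: (1:R) + 0) - f 0)) @ 0^' --> l.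
  by rewrite -fl; exact: df.
move/cvgrPdist_lt/(_ _ e0); rewrite near_withinE => /nbhs_ballP[d /= d0 hd].
exists (d / 2) => [|x xd]; first by rewrite divr_gt0.
have [->|x0] := eqVneq x 0; first by rewrite mulr0 subr0 subrr normr0 mulr0.
have := hd x; rewrite /ball /= sub0r normrN => /(_ _ x0).
have xd' : `|x| < d by apply: le_lt_trans xd _; rewrite ltr_pdivrMr //; lra.
move=> /(_ xd'); rewrite addr0 /GRing.scale /= mulr1 => h.
have nx : 0 < `|x| by rewrite normr_gt0.
rewrite (_ : f x - f 0 - l * x = - ((l - x^-1 * (f x - f 0)) * x)); last by field.
by rewrite normrN normrM ler_pM2r // ltW.
Qed.

Lemma small_factor (c e : R) : 0 <= c -> 0 < e -> exists x : R, [/\ 0 < x, x <= 1 & c * x <= e].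
Proof.
move=> c0 e0; have c1 : 0 < c + 1 by rewrite ltr_wpDl.
exists (Num.min 1 (e / (c + 1))); split; first by rewrite lt_min ltr01 divr_gt0.
  by rewrite ge_min lexx.
apply: (@le_trans _ _ ((c + 1) * (e / (c + 1)))); last by rewrite mulrC divfK ?lt0r_neq0.
by apply: ler_pM => //; [rewrite le_min ler01 divr_ge0 // ltW|rewrite lerDl|
  rewrite ge_min lexx orbT].
Qed.

(** First-order expansion of exp(x + i y) at 0, assembled from the expansions of exp, cos and
    sin. *)
Lemma cexp_expansion (e : R) : 0 < e -> exists2 d, 0 < d &
  forall x y, `|x| <= d -> `|y| <= d ->
    cabs ((expR x)%:C * cis y - 1 - (x +i* y)) <= e * (`|x| + `|y|).
Proof.
move=> e0; pose e1 := Num.min (e / 8%:R) 1.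
have e10 : 0 < e1 by rewrite lt_min ltr01 andbT divr_gt0.
have e11 : e1 <= 1 by rewrite ge_min lexx orbT.
have e18 : e1 <= e / 8%:R by rewrite ge_min lexx.
have dexp : is_derive (0:R) (1:R) expR 1 by rewrite -[X in is_derive _ _ _ X]expR0; exact: is_derive_expR.
have dcos : is_derive (0:R) (1:R) cos 0.
  by have := is_derive_cos (0:R); rewrite sin0 oppr0.
have dsin : is_derive (0:R) (1:R) sin 1.
  by have := is_derive_sin (0:R); rewrite cos0.
have [d1 d10 h1] := derive_expansion dexp e10.
have [d2 d20 h2] := derive_expansion dcos e10.
have [d3 d30 h3] := derive_expansion dsin e10.
exists (Num.min (Num.min d1 d2) (Num.min d3 (e1 / 2))).
  by rewrite !lt_min d10 d20 d30 divr_gt0.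
move=> x y; rewrite !le_min => /andP[/andP[x1 _] /andP[_ x4]] /andP[/andP[_ y2] /andP[y3 _]].
have := h1 x x1; have := h2 y y2; have := h3 y y3.
rewrite expR0 cos0 sin0 mul0r mul1r !subr0 mul1r => a3 a2 a1.
have x0 := normr_ge0 x; have y0 := normr_ge0 y.
have exm : `|expR x - 1| <= e1.
  have := ler_normD (expR x - 1 - x) x; rewrite subrK => /le_trans; apply.
  have : e1 * `|x| <= `|x| by rewrite ler_piMl.
  lra.
have ex2 : `|expR x| <= 2.
  by have := ler_normD (expR x - 1) 1; rewrite subrK normr1; lra.
apply: le_trans (cabs_le_ReIm _) _.
rewrite !ReD !ImD !ReN !ImN ReZ ImZ /= subr0.
have E1 : expR x * cos y - 1 - x = expR x * (cos y - 1) + (expR x - 1 - x) by ring.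
have E2 : expR x * sin y - y = expR x * (sin y - y) + (expR x - 1) * y by ring.
rewrite E1 E2.
have T1 := ler_normD (expR x * (cos y - 1)) (expR x - 1 - x).
have T2 := ler_normD (expR x * (sin y - y)) ((expR x - 1) * y).
rewrite !normrM in T1 T2.
have m1 : `|expR x| * `|cos y - 1| <= 2 * (e1 * `|y|) by rewrite ler_pM.
have m2 : `|expR x| * `|sin y - y| <= 2 * (e1 * `|y|) by rewrite ler_pM.
have m3 : `|expR x - 1| * `|y| <= e1 * `|y| by rewrite ler_wpM2r.
have m4 : e1 * `|x| <= e / 8%:R * `|x| by rewrite ler_wpM2r.
have m5 : e1 * `|y| <= e / 8%:R * `|y| by rewrite ler_wpM2r.
have m6 : 0 <= e * `|x| by rewrite mulr_ge0 // ltW.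
have m7 : 0 <= e * `|y| by rewrite mulr_ge0 // ltW.
clear -T1 T2 m1 m2 m3 m4 m5 m6 m7 a1; lra.
Qed.

(** In the coordinates w = z + r exp(s + i t) the Cauchy-Riemann equations take the form required by
    [divergence_free]. The circle mean of Re f therefore does not depend on s <= 0, and s -> -oo
    gives the value at the centre. *)
Lemma mean_value f (z : R[i]) (r : R) : 0 < r ->
  (forall w, cabs (w - z) <= r -> cdiff f w) ->
  cmean (fun t => Re (f (z + r%:C * cis t))) = Re (f z).
Proof.
move=> r0 fd.
(* This is min(s, 0): it keeps all points in the closed disc where f is differentiable and makes the
   pullback continuous on the whole plane. *)
pose n (s : R) := (s - `|s|) / 2.
have n0 s : n s <= 0 by rewrite /n; have := ler_norm s; lra.
have nid s : s <= 0 -> n s = s by move=> s0; rewrite /n ler0_norm //; lra.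
have cn : continuous n.
  by move=> s; apply: cvgMl; apply: cvgB; [exact: cvg_id|apply: cvg_norm; exact: cvg_id].
pose w (p : R * R) := (r * expR (n p.1))%:C * cis p.2.
have wr p : cabs (z + w p - z) <= r.
  rewrite (addrC z) addrK cabsM cabs_cis mulr1 cabs_real.
  rewrite ger0_norm ?mulr_ge0 ?expR_ge0 ?(ltW r0) // -[leRHS]mulr1 ler_pM2l //.
  by rewrite -expR0 ler_expR.
have cw : continuous w.
  move=> p; apply: cvgM.
    apply: cvg_real_complex; apply: cvgMr.
    apply: (@continuous_comp _ _ _ (n \o fst) expR); last exact: continuous_expR.
    by apply: (@continuous_comp _ _ _ fst n); [exact: cvg_fst|exact: cn].
  by apply: (@continuous_comp _ _ _ snd cis); [exact: cvg_snd|exact: continuous_cis].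
have cg : continuous (fun p => f (z + w p)).
  move=> p; apply: (@continuous_comp _ _ _ (fun p => z + w p) f).
    by apply: cvgD; [exact: cvg_cst|exact: cw].
  by apply: cdiff_continuous; exact: fd.
have cU : continuous (fun p => Re (f (z + w p))) by move=> p; apply: cvg_Re; exact: cg.
have cV : continuous (fun p => Im (f (z + w p))) by move=> p; apply: cvg_Im; exact: cg.
have key (L : R) : 0 <= L ->
   cmean (fun t => Re (f (z + w (0, t)))) = cmean (fun t => Re (f (z + w (- L, t)))).
  move=> L0.
  have := @divergence_free R _ _ (- L) 0 L (2 * pi) L0 (ltW pi20) cU cV.
  rewrite addNr add0r => H; apply/eqP; rewrite -subr_eq0 -cmeanB; first last.
  - exact: continuous_pair1 cU.
  - exact: continuous_pair1 cU.
  (* The flux through the sides t = 0 and t = 2 pi cancels by periodicity. *)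
  rewrite /cmean H => [|p [/andP[p1 p2] /andP[p3 p4]]].
    under segint_eq => x _ do
      rewrite /w /= -[2 * pi]add0r cis2pi subrr.
    by rewrite segint_cst ?mul0r ?mulr0 // oppr_le0.
  have [c Hc] := fd _ (wr p).
  (* The derivative of f(z + w) in s + i t, by the chain rule; its real and imaginary parts are the
     coefficients of the two expansions. *)
  pose A := c * w p.
  exists (Re A), (- Im A), (Im A) => e e0.
  have K0 := cabs_ge0 (w p); have c0 := cabs_ge0 c.
  set K := cabs (w p) in K0; set cc := cabs c in c0.
  have e20 : 0 < e / 2 by rewrite divr_gt0.
  have [e1 [e10 e11 e1K]] := small_factor (mulr_ge0 c0 K0) e20.
  have [e2 [e20' _ e2K]] := small_factor (mulr_ge0 (ler0n R 2) K0) e20.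
  have [d1 d10 h1] := cexp_expansion e10.
  have [d2 d20 h2] := Hc e2 e20'.
  have d220 : 0 < d2 / 2 by rewrite divr_gt0.
  have [d3 [d30 _ d3K]] := small_factor (mulr_ge0 (ler0n R 4) K0) d220.
  exists (Num.min d1 d3); first by rewrite lt_min d10.
  move=> x y [/= /andP[q1 q2] _]; rewrite !le_min => /andP[x1 x2] /andP[y1 y2].
  have S0 : 0 <= `|x| + `|y| by rewrite addr_ge0.
  have xs : p.1 + x <= 0 by [].
  pose E := (expR x)%:C * cis y - 1.
  have wE : w (p.1 + x, p.2 + y) = w p + w p * E.
    rewrite /w /E /= !nid //.
    by rewrite expRD cisD !rmorphM /=; ring.
  have hE := h1 x y x1 y1; rewrite -/E in hE.
  have xy1 : cabs (x +i* y) <= `|x| + `|y| by exact: (cabs_le_ReIm (x +i* y)).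
  have E2 : cabs E <= 2 * (`|x| + `|y|).
    have := cabsD (E - (x +i* y)) (x +i* y); rewrite subrK => /le_trans; apply.
    rewrite mulr_natl mulr2n; apply: lerD => //; apply: le_trans hE _.
    by rewrite ler_piMl.
  have B1 : cabs (w p * E) <= K * (2 * (`|x| + `|y|)) by rewrite cabsM ler_wpM2l.
  have hh : cabs (w p * E) < d2.
    apply: le_lt_trans B1 _.
    have : K * (`|x| + `|y|) <= K * (d3 + d3) by rewrite ler_wpM2l // lerD.
    by clear -d3K d20; lra.
  have B2 := h2 _ hh.
  have TOT : cabs (f (z + w (p.1 + x, p.2 + y)) - f (z + w p) - A * (x +i* y)) <=
     e * (`|x| + `|y|).
    rewrite wE addrA.
    rewrite (_ : f (z + w p + w p * E) - f (z + w p) - A * (x +i* y) =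
       (f (z + w p + w p * E) - f (z + w p) - c * (w p * E)) +
       A * (E - (x +i* y))); last by rewrite /A; ring.
    apply: le_trans (cabsD _ _) _; rewrite [cabs (A * _)]cabsM.
    have B3 : cabs A * cabs (E - (x +i* y)) <= (cc * K) * (e1 * (`|x| + `|y|)).
      by rewrite /A cabsM ler_wpM2l // mulr_ge0.
    have B6 : (cc * K * e1) * (`|x| + `|y|) <= e / 2 * (`|x| + `|y|) by rewrite ler_wpM2r.
    have B7 : (2 * K * e2) * (`|x| + `|y|) <= e / 2 * (`|x| + `|y|) by rewrite ler_wpM2r.
    have B8 : e2 * cabs (w p * E) <= e2 * (K * (2 * (`|x| + `|y|))) by rewrite ler_pM2l.
    by clear -B2 B3 B6 B7 B8; lra.
  clearbody A; split.
    apply: le_trans TOT; apply: le_trans (Re_le_cabs _).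
    by rewrite !ReD !ReN ReM /= mulNr.
  apply: le_trans TOT; apply: le_trans (Im_le_cabs _).
  by rewrite !ImD !ImN ImM /= (addrC (Re A * y)).
have w0 t : w (0, t) = r%:C * cis t by rewrite /w /= nid // expR0 mulr1.
under eq_fun do rewrite -w0.
apply/eqP; rewrite -subr_eq0 -normr_le0; apply/ler_addgt0Pr => e e0; rewrite add0r.
have fz : {for z, continuous f}.
  by apply: cdiff_continuous; apply: fd; rewrite subrr cabs0 ltW.
have [d d01 hd] := (@nbhs_cabs z _).1 ((@cvg_cabs R _ (nbhs z) _ _ _).1 fz e e0).
(* Since exp L >= 1 + L > r / d, the circle of radius r exp(-L) lies in the disc of radius d, where
   f is e-close to f z. *)
pose L := 2 * r / d.
have L0 : 0 <= L by rewrite divr_ge0 ?mulr_ge0 // ltW.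
rewrite (key L L0).
have -> : Re (f z) = cmean (fun=> Re (f z)) by rewrite cmean_cst.
rewrite -cmeanB; first last.
- by move=> ?; exact: cvg_cst.
- exact: (continuous_pair1 cU).
apply: cmean_abs => [t|t _].
  by apply: cvgB; [exact: (continuous_pair1 cU)|exact: cvg_cst].
rewrite -ReN -ReD; apply: le_trans (Re_le_cabs _) _.
apply/ltW/hd; rewrite (addrC z) addrK.
rewrite cabsM cabs_cis mulr1 cabs_real.
rewrite nid ?oppr_le0 // ger0_norm ?mulr_ge0 ?expR_ge0 ?(ltW r0) //.
rewrite expRN ltr_pdivrMr ?expR_gt0 //.
have := expR_ge1Dx L; have : d * L = 2 * r by rewrite /L; field; rewrite lt0r_neq0.
clear -r0 d01; nra.
Qed.

End mean_value_property.

(** * Lebesgue measure on C^n *)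

Section lebesgue_line.
Context {R : realType}.
Local Notation mu := (@lebesgue_measure R).
Local Open Scope ereal_scope.

(** Lebesgue measure is determined by its values on half-open intervals, and a times its image under
    x -> a x + c has the same values. *)
Lemma lebesgue_affine (a c : R) (f : R -> \bar R) : (0 < a)%R ->
  measurable_fun setT f -> (forall x, 0 <= f x) ->
  \int[mu]_x f (a * x + c)%R = (a^-1)%:E * \int[mu]_x f x.
Proof.
move=> a0 mf f0.
pose phi (x : measurableTypeR R) : measurableTypeR R := (a * x + c)%R.
have mphi : measurable_fun setT phi.
  by apply: measurable_funD => //; exact: measurable_funM.
have -> : \int[mu]_x f (a * x + c)%R = \int[pushforward mu phi]_x f x.
  by rewrite ge0_integral_pushforward.
have ia0 : (0 <= a^-1 :> R)%R by rewrite invr_ge0 ltW.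
have a0' : (0 <= a)%R by rewrite ltW.
pose nu' := mscale (NngNum a0') (pushforward mu phi).
pose nu : {measure set (measurableTypeR R) -> \bar R} := nu' mphi.
have nuE A : measurable A -> mu A = nu A.
  apply: lebesgue_measure_unique => _ [[x y] _ <-] /=.
  rewrite /nu /nu' /mscale /= /pushforward.
  have -> : phi @^-1` `]x, y]%classic = `]((x - c) / a)%R, ((y - c) / a)%R]%classic.
    apply/seteqP; split => z; rewrite /= !in_itv /= /phi ltr_pdivrMr // ler_pdivlMr //.
      by move=> /andP[z1 z2]; apply/andP; split; rewrite mulrC; lra.
    by move=> /andP[z1 z2]; apply/andP; split; move: z1 z2; rewrite mulrC; lra.
  
  rewrite !lebesgue_measure_itv /= !lte_fin ltr_pM2r ?invr_gt0 // ltrD2r.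
  case: ifPn => _; last by rewrite mule0.
  rewrite -!EFinD -EFinM; congr (_%:E).
  by field; rewrite lt0r_neq0.
have -> : \int[mu]_x f x = \int[nu]_x f x.
  by apply: eq_measure_integral => A mA _; exact: nuE.
rewrite ge0_integral_mscale //= muleA -EFinM mulVf ?mul1e //.
by rewrite lt0r_neq0.
Qed.

End lebesgue_line.

(** * Similarities of the plane and Lebesgue measure *)

Section lebesgue_plane.
Context {R : realType}.
Local Notation mu := (@lebesgue_measure R).
Local Notation RR := (measurableTypeR R * measurableTypeR R)%type.
Local Open Scope ereal_scope.

Definition int2 (g : RR -> \bar R) : \bar R := \int[mu]_x \int[mu]_y g (x, y).

Definition affine2 (al c : R[i]) (p : RR) : RR :=
  (Re (al * (p.1 +i* p.2) + c)%R, Im (al * (p.1 +i* p.2) + c)%R).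

Lemma affine2E (al c : R[i]) (p : RR) : affine2 al c p =
  ((Re al * p.1 - Im al * p.2 + Re c)%R, (Re al * p.2 + Im al * p.1 + Im c)%R).
Proof. by rewrite /affine2 ReD ImD ReM ImM. Qed.

(* [k] is the factor by which z |-> al * z + c contracts the integral of a
   nonnegative function over the complex plane. *)
Definition plane_factor (al : R[i]) (k : R) := forall (g : RR -> \bar R) (c : R[i]),
  measurable_fun setT g -> (forall p, 0 <= g p) ->
  int2 (g \o affine2 al c) = k%:E * int2 g.

Lemma measurable_lin2 (a b c : R) :
  measurable_fun setT (fun p : RR => a * p.1 + b * p.2 + c)%R.
Proof.
by apply: measurable_funD => //; apply: measurable_funD; apply: measurable_funM.
Qed.

Lemma int2_swap (g : RR -> \bar R) : measurable_fun setT g -> (forall p, 0 <= g p) ->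
  int2 g = \int[mu]_y \int[mu]_x g (x, y).
Proof. by move=> mg g0; rewrite /int2 fubini_tonelli. Qed.

Lemma measurable_pairing (f1 f2 : RR -> R) (g : RR -> \bar R) :
  measurable_fun setT f1 -> measurable_fun setT f2 -> measurable_fun setT g ->
  measurable_fun setT (fun p => g (f1 p, f2 p)).
Proof.
move=> m1 m2 mg; apply: (@measurableT_comp _ _ _ _ _ _ g) => //.
exact: (measurable_fun_pair (m1 : measurable_fun setT (f1 : RR -> measurableTypeR R))
  (m2 : measurable_fun setT (f2 : RR -> measurableTypeR R))).
Qed.

Lemma measurable_sec1 (g : RR -> \bar R) (x : R) : measurable_fun setT g ->
  measurable_fun setT (fun y => g (x, y)).
Proof. by move=> mg; exact: measurableT_comp. Qed.

Lemma measurable_sec2 (g : RR -> \bar R) (y : R) : measurable_fun setT g ->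
  measurable_fun setT (fun x => g (x, y)).
Proof. by move=> mg; exact: measurableT_comp. Qed.

Lemma int2_shearx (t c : R) (g : RR -> \bar R) :
  measurable_fun setT g -> (forall p, 0 <= g p) ->
  int2 (fun p => g (p.1 + t * p.2 + c, p.2)%R) = int2 g.
Proof.
move=> mg g0; rewrite [RHS](int2_swap mg g0) int2_swap; first last.
- by move=> p; exact: g0.
- apply: measurable_pairing => //.
  by have := measurable_lin2 1 t c; under eq_fun do rewrite mul1r.
apply: eq_integral => y _ /=.
rewrite (_ : (fun x => g (x + t * y + c, y)%R) =
   (fun x => (fun z => g (z, y)) (1 * x + (t * y + c))%R)); last first.
  by apply/funext => x; rewrite mul1r addrA.
rewrite (@lebesgue_affine R 1 (t * y + c) (fun z => g (z, y))) ?invr1 ?mul1e //.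
exact: measurable_sec2.
Qed.

Lemma int2_sheary (t c : R) (g : RR -> \bar R) :
  measurable_fun setT g -> (forall p, 0 <= g p) ->
  int2 (fun p => g (p.1, p.2 + t * p.1 + c)%R) = int2 g.
Proof.
move=> mg g0; apply: eq_integral => x _ /=.
rewrite (_ : (fun y => g (x, y + t * x + c)%R) =
   (fun y => (fun z => g (x, z)) (1 * y + (t * x + c))%R)); last first.
  by apply/funext => y; rewrite mul1r addrA.
rewrite (@lebesgue_affine R 1 (t * x + c) (fun z => g (x, z))) ?invr1 ?mul1e //.
exact: measurable_sec1.
Qed.

Lemma plane_factor_real (s : R) : (0 < s)%R -> plane_factor s%:C (s^-1 * s^-1).
Proof.
move=> s0 g c mg g0; rewrite /int2.
under eq_integral => x _.
  under eq_integral => y _ do rewrite /= affine2E /= !mul0r subr0 addr0.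
  rewrite (@lebesgue_affine R s (Im c) (fun z => g ((s * x + Re c)%R, z))) //; last first.
    exact: measurable_sec1.
  over.
rewrite (@lebesgue_affine R s (Re c) (fun x => (s^-1)%:E * \int[mu]_y g (x, y))) //; first last.
- move=> x; apply: mule_ge0; first by rewrite lee_fin invr_ge0 ltW.
  exact: integral_ge0.
- by apply: measurable_funeM; exact: measurable_fun_fubini_tonelli_F.
rewrite ge0_integralZl ?muleA //.
- exact: measurable_fun_fubini_tonelli_F.
- by move=> x _; exact: integral_ge0.
- by rewrite lee_fin invr_ge0 ltW.
Qed.

Lemma plane_factor_trans (al be : R[i]) (k k' : R) :
  plane_factor al k -> plane_factor be k' -> plane_factor (al * be)%R (k * k')%R.
Proof.
move=> h1 h2 g c mg g0.
have -> : g \o affine2 (al * be)%R c = (g \o affine2 al c) \o affine2 be 0%R.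
  apply/funext => -[x y]; rewrite /comp; congr g.
  by rewrite !affine2E ReM ImM /=; congr pair; ring.
have mal : measurable_fun setT (g \o affine2 al c).
  rewrite (_ : g \o affine2 al c = fun p => g (Re al * p.1 + (- Im al) * p.2 + Re c,
     Im al * p.1 + Re al * p.2 + Im c)%R); last first.
    by apply/funext => p; rewrite /= affine2E mulNr (addrC (Re al * p.2)%R).
  by apply: measurable_pairing => //; exact: measurable_lin2.
rewrite (h2 _ _ mal (fun p => g0 _)) (h1 _ _ mg g0) muleA -EFinM.
by rewrite mulrC.
Qed.

(* A rotation is a product of three shears unless its angle is [pi]. *)
Lemma plane_factor_cis_neq (t : R) : cos t != (-1)%R -> plane_factor (cis t) 1.
Proof.
move=> c1 g c mg g0; rewrite mul1e.
have D0 : (1 + cos t != 0)%R by rewrite addrC addr_eq0.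
(* This is - tan (t / 2): the rotation is the shear by u in x, then by sin t in y, then by u in x
   again. *)
pose u : R := (- (sin t / (1 + cos t)))%R.
have E := cos2Dsin2 t.
have e1 : (1 + u * sin t = cos t)%R.
  apply: (mulfI D0); rewrite /u mulrDr mulNr mulrN.
  rewrite (_ : ((1 + cos t) * (sin t / (1 + cos t) * sin t) = sin t ^+ 2)%R); last by field.
  have -> : (sin t ^+ 2 = 1 - cos t ^+ 2)%R by rewrite -E addrC addKr.
  by ring.
have e2 : (u + u * (1 + u * sin t) = - sin t)%R.
  by rewrite e1 /u; field.
pose v := (Re c - u * Im c)%R.
have m1 : measurable_fun setT (fun p : RR => g (p.1 + u * p.2 + v, p.2)%R).
  apply: measurable_pairing => //.
  by have := measurable_lin2 1 u v; under eq_fun do rewrite mul1r.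
have m2 : measurable_fun setT (fun p : RR =>
    g (p.1 + u * (p.2 + sin t * p.1 + Im c) + v, p.2 + sin t * p.1 + Im c)%R).
  apply: measurable_pairing => //.
    have := measurable_lin2 (1 + u * sin t) u (u * Im c + v).
    by congr measurable_fun; apply/funext => p; ring.
  have := measurable_lin2 (sin t) 1 (Im c).
  by congr measurable_fun; apply/funext => p; ring.
rewrite -(int2_shearx u v mg g0).
rewrite -(int2_sheary (sin t) (Im c) m1 (fun p => g0 _)).
rewrite -(int2_shearx u 0 m2 (fun p => g0 _)).
congr int2; apply/funext => -[x y]; rewrite /comp affine2E /=; congr g; congr pair.
  transitivity ((1 + u * sin t) * x + (u + u * (1 + u * sin t)) * y + Re c)%R.
    by rewrite e2 e1; ring.
  by rewrite /v; ring.
transitivity ((1 + u * sin t) * y + sin t * x + Im c)%R; first by rewrite e1; ring.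
by ring.
Qed.

Lemma plane_factor_cis (t : R) : plane_factor (cis t) 1.
Proof.
have [c1|] := eqVneq (cos t) (-1)%R; last exact: plane_factor_cis_neq.
have s0 : sin t = 0%R.
  by apply/eqP; rewrite -sqrf_eq0 -[X in X == _](addKr (cos t ^+ 2)%R) cos2Dsin2 c1
    sqrrN expr1n addNr.
(* The half turn, for which tan (t / 2) is undefined, is the square of a quarter turn. *)
have -> : cis t = (cis (pi / 2) * cis (pi / 2))%R.
  by rewrite -cisD -splitr /cis c1 s0 cospi sinpi.
rewrite -[X in plane_factor _ X]mulr1; apply: plane_factor_trans;
  apply: plane_factor_cis_neq; rewrite cos_pihalf eq_sym oppr_eq0; exact: oner_neq0.
Qed.

End lebesgue_plane.

Section product_sigma_finite.
Context {R : realType}.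
Local Open Scope ereal_scope.
Context {d1 d2} {T1 : measurableType d1} {T2 : measurableType d2}
  (m1 : {sigma_finite_measure set T1 -> \bar R})
  (m2 : {sigma_finite_measure set T2 -> \bar R}).

Lemma product_sigma_finite : sigma_finite setT (m1 \x m2).
Proof.
have /sigma_finiteP[F [TF ndF Foo]] := sigma_finiteT m1.
have /sigma_finiteP[G [TG ndG Goo]] := sigma_finiteT m2.
exists (fun n => F n `*` G n).
  apply/seteqP; split=> // -[x y] _.
  have [i _ Fi] : (\bigcup_i F i) x by rewrite -TF.
  have [j _ Gj] : (\bigcup_i G i) y by rewrite -TG.
  exists (maxn i j) => //; split => /=.
    by move: Fi; apply/subsetPset/ndF/leq_maxl.
  by move: Gj; apply/subsetPset/ndG/leq_maxr.
move=> k; have [mF Fk] := Foo k; have [mG Gk] := Goo k.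
split; first exact: measurableX.
by rewrite product_measure1E // lte_mul_pinfty // ge0_fin_numE.
Qed.

(** Packed together with its sigma-finiteness so that the product construction can be iterated. *)
Definition product_sf : {sigma_finite_measure set (T1 * T2)%type -> \bar R} :=
  HB.pack (m1 \x m2)
    (@Measure_isSigmaFinite.Build _ _ _ (m1 \x m2) product_sigma_finite).

End product_sigma_finite.

Section lebesgue_Cn_theory.
Context {R : realType}.
Local Notation mu := (@lebesgue_measure R).
Local Notation RR := (measurableTypeR R * measurableTypeR R)%type.
Local Notation Cn n := 'rV[R[i]]_n.
Local Notation L n := (leb_type (lebesgue_Cn R n)).
Local Notation co n := (@leb_coord R n (lebesgue_Cn R n)).
Local Open Scope ereal_scope.

Definition point_mass : {sigma_finite_measure set unit -> \bar R} :=
  [the {sigma_finite_measure set _ -> \bar R} of @dirac _ unit tt R].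

(** The measure of [lebesgue_Cn] rebuilt as a sigma-finite measure, the form in which Tonelli's
    theorem applies at each stage; [leb_sfE] identifies the two. *)
Fixpoint leb_sf (n : nat) : {sigma_finite_measure set (L n) -> \bar R} :=
  match n return {sigma_finite_measure set (L n) -> \bar R} with
  | 0%N => point_mass
  | m.+1 => product_sf (product_sf (leb_sf m) mu) mu
  end.

Lemma leb_sfE n : leb_measure (lebesgue_Cn R n) = leb_sf n :> (set (L n) -> \bar R).
Proof. by elim: n => [//|n IH] /=; rewrite IH. Qed.

Lemma row_mx_split (T : Type) n (x : 'M[T]_1) (w : 'rV[T]_n) :
  (forall k, (row_mx x w : 'rV[T]_(1 + n)) 0%R (lshift n k) = x 0%R 0%R) /\
  (forall k, (row_mx x w : 'rV[T]_(1 + n)) 0%R (rshift 1 k) = w 0%R k).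
Proof. by split=> k; rewrite ?row_mxEl ?row_mxEr // (ord1 k). Qed.

Lemma leb_coord0 n (x : L n.+1) : co n.+1 x 0%R (lshift n (ord0 : 'I_1)) = x.1.2 +i* x.2.
Proof. by rewrite (row_mx_split _ _).1 mxE eqxx. Qed.

Lemma leb_coordS n (x : L n.+1) k : co n.+1 x 0%R (rshift 1 k) = co n x.1.1 0%R k.
Proof. exact: (row_mx_split _ _).2. Qed.

Lemma ord_split n (P : 'I_n.+1 -> Prop) :
  P (lshift n (ord0 : 'I_1)) -> (forall k, P (rshift 1 k)) -> forall j, P j.
Proof.
move=> P0 PS j; case: (splitP (j : 'I_(1 + n))) => k jk.
  by rewrite (_ : j = lshift n (ord0 : 'I_1)) //; apply: val_inj; rewrite /= jk (ord1 k).
by rewrite (_ : j = rshift 1 k) //; exact: val_inj.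
Qed.

Lemma leb_coord_measurable n : measurable_fun setT (co n : L n -> BCn R n).
Proof.
apply: measurable_to_BCn; elim: n => [|n IH] j; try by case: j.
- move: j; apply: ord_split => [|k].
    by under eq_fun do rewrite leb_coord0; apply: measurableT_comp.
  under eq_fun do rewrite leb_coordS.
  apply: (@measurableT_comp _ _ _ _ _ _ (fun y : L n => Re (co n y 0%R k))); first exact: IH.
  by apply: measurableT_comp.
- move: j; apply: ord_split => [|k].
    by under eq_fun do rewrite leb_coord0 /=; exact: measurable_snd.
  under eq_fun do rewrite leb_coordS.
  apply: (@measurableT_comp _ _ _ _ _ _ (fun y : L n => Im (co n y 0%R k))); first exact: IH.
  by apply: measurableT_comp.
Qed.

Lemma measurable_comp_coord n (f : Cn n -> \bar R) :
  measurable_fun setT (f : BCn R n -> \bar R) ->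
  measurable_fun setT (fun p : L n => f (co n p)).
Proof.
move=> mf; exact: (@measurableT_comp _ _ _ (L n) (BCn R n) (\bar R) f setT (co n) mf (@leb_coord_measurable n)).
Qed.

Definition intC n (f : Cn n -> \bar R) : \bar R := \int[leb_sf n]_p f (co n p).

Lemma intCS n (f : Cn n.+1 -> \bar R) :
  measurable_fun setT (f : BCn R n.+1 -> \bar R) -> (forall z, 0 <= f z) ->
  intC f = \int[leb_sf n]_p int2 (fun q : RR =>
     f (row_mx (q.1 +i* q.2)%:M (co n p) : 'rV[R[i]]_(1 + n))).
Proof.
move=> mf f0.
have mF : measurable_fun setT (fun p : L n.+1 => f (co n.+1 p)).
  exact: measurable_comp_coord.
etransitivity.
  exact: (@fubini_tonelli1 _ _ _ _ _ (product_sf (leb_sf n) mu) mu _ mF (fun p => f0 _)).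
apply: (@fubini_tonelli1 _ _ _ _ _ (leb_sf n) mu).
  exact: (@measurable_fun_fubini_tonelli_F _ _ _ _ _ mu _ mF (fun p => f0 _)).
by move=> q; apply: integral_ge0 => y _; exact: f0.
Qed.

Lemma measurable_slice n (f : Cn n.+1 -> \bar R) (w : Cn n) :
  measurable_fun setT (f : BCn R n.+1 -> \bar R) ->
  measurable_fun setT (fun q : RR => f (row_mx (q.1 +i* q.2)%:M w : 'rV[R[i]]_(1 + n))).
Proof.
move=> mf.
pose F (q : RR) : BCn R n.+1 := (row_mx (q.1 +i* q.2)%:M w : 'rV[R[i]]_(1 + n)).
apply: (@measurableT_comp _ _ _ _ _ _ (f : BCn R n.+1 -> \bar R) setT F mf).
have F0 q : F q 0%R (lshift n (ord0 : 'I_1)) = q.1 +i* q.2.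
  by rewrite /F (row_mx_split _ _).1 mxE eqxx mulr1n.
have FS q k : F q 0%R (rshift 1 k) = w 0%R k by rewrite /F (row_mx_split _ _).2.
apply: measurable_to_BCn; apply: ord_split => [|k].
- by under eq_fun do rewrite F0 /=; exact: measurable_fst.
- by under eq_fun do rewrite FS; exact: measurable_cst.
- by under eq_fun do rewrite F0 /=; exact: measurable_snd.
- by under eq_fun do rewrite FS; exact: measurable_cst.
Qed.

Lemma measurable_affineC n (al : R[i]) (c : Cn n) (f : Cn n -> \bar R) :
  measurable_fun setT (f : BCn R n -> \bar R) ->
  measurable_fun setT ((fun z : Cn n => f (al *: z + c)%R) : BCn R n -> \bar R).
Proof.
move=> mf.
apply: (@measurableT_comp _ _ _ _ _ _ (f : BCn R n -> \bar R)
  setT (fun z : BCn R n => (al *: (z : Cn n) + c)%R : BCn R n) mf).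
apply: measurable_to_BCn => j.
  rewrite (_ : (fun x => _) = fun z : BCn R n => (Re al * Re ((z : Cn n) 0%R j) -
     Im al * Im ((z : Cn n) 0%R j) + Re (c 0 j))%R); last first.
    by apply/funext => z; rewrite !mxE ReD ReM.
  apply: measurable_funD => //; apply: measurable_funB; apply: measurable_funM => //.
    exact: measurable_ReBCn.
  exact: measurable_ImBCn.
rewrite (_ : (fun x => _) = fun z : BCn R n => (Re al * Im ((z : Cn n) 0%R j) +
   Im al * Re ((z : Cn n) 0%R j) + Im (c 0 j))%R); last first.
  by apply/funext => z; rewrite !mxE ImD ImM.
apply: measurable_funD => //; apply: measurable_funD; apply: measurable_funM => //.
  exact: measurable_ImBCn.
exact: measurable_ReBCn.
Qed.

(** Induction on the dimension: the first coordinate contributes the planar factor k, and the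
    partial integral G over it is again a Borel function on C^n to which the induction hypothesis
    applies. *)
Lemma intC_affine n (al : R[i]) (k : R) (c : Cn n) (f : Cn n -> \bar R) :
  (0 <= k)%R -> plane_factor al k ->
  measurable_fun setT (f : BCn R n -> \bar R) -> (forall z, 0 <= f z) ->
  intC (fun z => f (al *: z + c)%R) = (k ^+ n)%:E * intC f.
Proof.
move=> k0 hk; elim: n c f => [|n IH] c f mf f0.
  rewrite expr0 mul1e; apply: eq_integral => p _; congr f.
  by apply/rowP => -[].
rewrite intCS //; last exact: measurable_affineC.
pose c0 := c 0%R (lshift n (ord0 : 'I_1)); pose c1 : Cn n := rsubmx (c : 'rV_(1 + n)).
pose G (w : Cn n) := int2 (fun q : RR => f (row_mx (q.1 +i* q.2)%:M w : 'rV[R[i]]_(1 + n))).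
have E p : int2 (fun q : RR => f (al *: (row_mx (q.1 +i* q.2)%:M (co n p) : Cn n.+1) + c)%R) =
    k%:E * G (al *: co n p + c1)%R.
  rewrite -(hk _ c0); first last.
  - by move=> q; exact: f0.
  - exact: measurable_slice.
  congr int2; apply/funext => q /=; congr f.
  apply/rowP; apply: ord_split => [|i]; rewrite [LHS]mxE [X in (X + _)%R = _]mxE.
    rewrite !(row_mx_split _ _).1 /affine2 mxE eqxx mulr1n mxE eqxx mulr1n /c0.
    by case: (al * _ + _)%R.
  by rewrite !(row_mx_split _ _).2 !mxE.
under eq_integral do rewrite E.
(* Measurability of G for the Borel sets of C^n, and not just along [leb_coord], is what the
   induction hypothesis asks for. *)
have mG : measurable_fun setT (G : BCn R n -> \bar R).
  pose H (x : BCn R n * RR) : \bar R :=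
    f (row_mx (x.2.1 +i* x.2.2)%:M (x.1 : Cn n) : 'rV[R[i]]_(1 + n)).
  pose K (x : BCn R n * RR) : BCn R n.+1 :=
    (row_mx (x.2.1 +i* x.2.2)%:M (x.1 : Cn n) : 'rV[R[i]]_(1 + n)).
  have mK : measurable_fun setT K.
    have K0 x : K x 0%R (lshift n (ord0 : 'I_1)) = x.2.1 +i* x.2.2.
      by rewrite /K (row_mx_split _ _).1 mxE eqxx mulr1n.
    have KS x i : K x 0%R (rshift 1 i) = (x.1 : Cn n) 0%R i.
      by rewrite /K (row_mx_split _ _).2.
    apply: measurable_to_BCn; apply: ord_split => [|i].
    - by under eq_fun do rewrite K0 /=; apply: measurableT_comp.
    - under eq_fun do rewrite KS.
      exact: (measurableT_comp (measurable_ReBCn i)).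
    - by under eq_fun do rewrite K0 /=; apply: measurableT_comp.
    - under eq_fun do rewrite KS.
      exact: (measurableT_comp (measurable_ImBCn i)).
  have mH : measurable_fun setT H by exact: (measurableT_comp mf mK).
  rewrite (_ : G = fubini_F (product_sf mu mu) H).
    exact: (@measurable_fun_fubini_tonelli_F _ _ _ _ _ (product_sf mu mu) H mH (fun x => f0 _)).
  apply/funext => w; rewrite /G /fubini_F /int2.
  have mHw : measurable_fun setT (fun q : RR => H (w, q)) by exact: measurable_slice.
  exact/esym/(@fubini_tonelli1 _ _ _ _ _ mu mu _ mHw (fun q => f0 _)).
have G0 w : 0 <= G w by apply: integral_ge0 => x _; exact: integral_ge0.
have mGc : measurable_fun setT (fun p : L n => G (al *: co n p + c1)%R).
  exact: measurable_comp_coord (measurable_affineC al c1 mG).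
rewrite ge0_integralZl; [|exact: measurableT|exact: mGc|by move=> p _; exact: G0|by rewrite lee_fin].
have E2 : \int[leb_sf n]_p G (al *: co n p + c1)%R =
  (k ^+ n)%:E * \int[leb_sf n]_p G (co n p) := IH c1 G mG G0.
by rewrite E2 muleA -EFinM -exprS (intCS mf f0).
Qed.

Lemma intC_rot n (t : R) (f : Cn n -> \bar R) :
  measurable_fun setT (f : BCn R n -> \bar R) -> (forall z, 0 <= f z) ->
  intC (fun z => f (cis t *: z)%R) = intC f.
Proof.
move=> mf f0; have := intC_affine 0%R ler01 (plane_factor_cis t) mf f0.
by under eq_fun do rewrite addr0; rewrite expr1n mul1e.
Qed.

Lemma intC_scale n (s : R) (c : Cn n) (f : Cn n -> \bar R) : (0 < s)%R ->
  measurable_fun setT (f : BCn R n -> \bar R) -> (forall z, 0 <= f z) ->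
  intC (fun z => f (s%:C *: z + c)%R) = ((s^-1 * s^-1) ^+ n)%:E * intC f.
Proof.
move=> s0; apply: intC_affine; last exact: plane_factor_real.
by rewrite mulr_ge0 // invr_ge0 ltW.
Qed.

Lemma intC_shift n (c : Cn n) (f : Cn n -> \bar R) :
  measurable_fun setT (f : BCn R n -> \bar R) -> (forall z, 0 <= f z) ->
  intC (fun z => f (z + c)%R) = intC f.
Proof.
move=> mf f0; have := intC_scale c ltr01 mf f0.
by under eq_fun do rewrite scale1r; rewrite invr1 mulr1 expr1n mul1e.
Qed.

Definition box n (z : Cn n) (s : R) : set (Cn n) :=
  [set w | forall j, (`|Re (w 0 j) - Re (z 0 j)| < s)%R /\ (`|Im (w 0 j) - Im (z 0 j)| < s)%R].

Lemma measurable_coord_open n (U : set (Cn n)) : open U -> measurable (co n @^-1` U).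
Proof.
by move=> Uo; rewrite -[X in measurable X]setTI; apply: leb_coord_measurable => //;
  exact: open_BCn.
Qed.

Lemma leb_box n (z : Cn n) (s : R) : (0 < s)%R ->
  measurable (co n @^-1` box z s) /\
  leb_sf n (co n @^-1` box z s) = (((2 * s) * (2 * s)) ^+ n)%:E.
Proof.
move=> s0; elim: n z => [|n IH] z.
  rewrite expr0 (_ : co 0 @^-1` box z s = setT); last by apply/seteqP; split=> // x _ [].
  by split; [exact: measurableT|rewrite /= diracT].
pose z' : Cn n := \row_k z 0%R (rshift 1 k); pose z0 := z 0%R (lshift n (ord0 : 'I_1)).
have -> : co n.+1 @^-1` box z s = ((co n @^-1` box z' s) `*` ball (Re z0) s) `*` ball (Im z0) s.
  apply/seteqP; split => x; rewrite -!ball_normE /ball_ /box /=.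
    move=> h; split; last by have := (h (lshift n (ord0 : 'I_1))).2; rewrite leb_coord0 /= distrC.
    split; last by have := (h (lshift n (ord0 : 'I_1))).1; rewrite leb_coord0 /= distrC.
    by move=> j; rewrite mxE -(leb_coordS x).
  move=> [[h1 h2] h3]; apply: ord_split => [|k].
    by rewrite leb_coord0 /= distrC h2 distrC h3.
  by rewrite leb_coordS; have := h1 k; rewrite mxE.
have [m1 E1] := IH z'.
have mb (x : R) : measurable (ball x s : set (measurableTypeR R)) by exact: measurable_ball.
have mp := measurableX m1 (mb (Re z0)).
split; first exact: (measurableX mp (mb (Im z0))).
have mball (x : R) : mu (ball x s) = (2 * s)%:E.
  by rewrite lebesgue_measure_ball ?mulr_natl // ltW.
have Q1 : product_sf (leb_sf n) mu ((co n @^-1` box z' s) `*` ball (Re z0) s) =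
    ((2 * s * (2 * s)) ^+ n)%:E * (2 * s)%:E.
  apply: (eq_trans (@product_measure1E _ _ _ _ _ (leb_sf n) mu _ _ m1 (mb (Re z0)))).
  by congr (_ * _); [exact: E1|exact: mball].
apply: (eq_trans (@product_measure1E _ _ _ _ _ (product_sf (leb_sf n) mu) mu _ _ mp (mb (Im z0)))).
transitivity (((2 * s * (2 * s)) ^+ n)%:E * (2 * s)%:E * (2 * s)%:E).
  by congr (_ * _); [exact: Q1|exact: mball].
by rewrite -!EFinM exprSr !mulrA.
Qed.

Lemma pd_sub_box n (z : Cn n) (s : R) : pd z s `<=` box z s.
Proof.
move=> w /pdE h j; rewrite -!ReN -ReD -!ImN -ImD; split.
  exact: le_lt_trans (Re_le_cabs _) (h j).
exact: le_lt_trans (Im_le_cabs _) (h j).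
Qed.

Lemma box_sub_pd n (z : Cn n) (s : R) : box z (s / 2) `<=` pd z s.
Proof.
move=> w h; apply/pdE => j; have [h1 h2] := h j.
apply: le_lt_trans (cabs_le_ReIm _) _; rewrite ReD ImD ReN ImN (splitr s).
exact: ltrD.
Qed.

(** The polydisc lies between the boxes of half-sides s / 2 and s, whose measures are explicit. *)
Lemma leb_pd n (z : Cn n) (s : R) : (0 < s)%R ->
  0 < leb_sf n (co n @^-1` pd z s) /\ leb_sf n (co n @^-1` pd z s) < +oo.
Proof.
move=> s0; have s20 : (0 < s / 2)%R by rewrite divr_gt0.
have mp := measurable_coord_open (@pd_open R n z s).
have [m1 E1] := leb_box z s0; have [m2 E2] := leb_box z s20.
split.
  apply: (@lt_le_trans _ _ (leb_sf n (co n @^-1` box z (s / 2)))).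
    by rewrite E2 lte_fin exprn_gt0 // mulr_gt0 // mulr_gt0.
  by apply: le_measure; rewrite ?inE // => x; exact: box_sub_pd.
apply: (@le_lt_trans _ _ (leb_sf n (co n @^-1` box z s))).
  by apply: le_measure; rewrite ?inE // => x; exact: pd_sub_box.
by rewrite E1 ltry.
Qed.

End lebesgue_Cn_theory.

(** * Smooth functions and the bump kernel *)

Section directional_derivatives.
Context {R : realType} {n : nat}.
Local Notation Cn := 'rV[R[i]]_n.
Implicit Types (f g : Cn -> R[i]) (z v : Cn) (A B : 'I_n -> Cn -> R[i]).

Definition dquot f z v (t : R) : R[i] := t%:C^-1 * (f (z + t%:C *: v) - f z).

Definition rd f z v (l : R[i]) : Prop := dquot f z v t @[t --> (0 : R)^'] --> l.

Lemma rdP f z v l : rd f z v l <-> forall e, 0 < e -> exists2 d, 0 < d &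
  forall t : R, `|t| < d -> cabs (f (z + t%:C *: v) - f z - t%:C * l) <= e * `|t|.
Proof.
have E (t : R) : t != 0 -> cabs (f (z + t%:C *: v) - f z - t%:C * l) =
    `|t| * cabs (dquot f z v t - l).
  move=> t0; rewrite -cabs_real -cabsM /dquot mulrBr mulrA divff ?mul1r //.
  by rewrite -(rmorph0 (real_complex R)) (inj_eq (@complexI R)).
split=> [h e e0|h].
  have : \forall t \near (0:R)^', cabs (dquot f z v t - l) < e.
    exact: (@cvg_cabs R _ (0:R)^' _ _ l).1.
  rewrite near_withinE => /nbhs_ballP[d /= d0 hd].
  exists d => // t td; have [->|t0] := eqVneq t 0.
    by rewrite scale0r addr0 subrr mul0r subrr cabs0 normr0 mulr0.
  rewrite E // mulrC ler_wpM2r //; apply/ltW/hd => //.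
  by rewrite /ball /= sub0r normrN.
apply: (@cvg_cabs R _ (0:R)^' _ _ l).2 => e e0.
have e20 : 0 < e / 2 by rewrite divr_gt0.
have [d d0 hd] := h _ e20.
rewrite near_withinE; apply/nbhs_ballP; exists d => // t.
rewrite /ball /= sub0r normrN => td t0.
have := hd t td; rewrite E // mulrC ler_pM2r ?normr_gt0 // => h1.
by apply: le_lt_trans h1 _; rewrite ltr_pdivrMr //; lra.
Qed.

Lemma rd_unique f z v l l' : rd f z v l -> rd f z v l' -> l = l'.
Proof. by move=> h1 h2; apply: (cvg_unique _ h1 h2). Qed.

Lemma rd_quadratic f z v l (K : R) :
  (forall t : R, `|t| <= 1 -> cabs (f (z + t%:C *: v) - f z - t%:C * l) <= K * `|t| ^+ 2) ->
  rd f z v l.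
Proof.
move=> h; apply/rdP => e e0; pose d := Num.min 1 (e / (`|K| + 1)).
have K1 : 0 < `|K| + 1 by rewrite ltr_wpDl.
exists d; first by rewrite lt_min ltr01 divr_gt0.
move=> t; rewrite lt_min => /andP[t1 t2].
apply: le_trans (h t (ltW t1)) _; rewrite expr2 mulrA ler_wpM2r //.
apply: (@le_trans _ _ ((`|K| + 1) * `|t|)).
  by rewrite ler_wpM2r // (le_trans (ler_norm K)) // lerDl.
by move: t2; rewrite ltr_pdivlMr // mulrC => /ltW.
Qed.

Lemma rd_cont f z v l : rd f z v l -> f (z + t%:C *: v) @[t --> (0 : R)^'] --> f z.
Proof.
move=> /rdP h; apply/cvg_cabs => e e0; have [d d0 hd] := h 1 ltr01.
pose K := 1 + cabs l; have K0 : 0 < K by rewrite ltr_wpDr ?cabs_ge0.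
rewrite near_withinE; apply/nbhs_ballP; exists (Num.min d (e / K)).
  by rewrite /= lt_min d0 divr_gt0.
move=> t; rewrite /ball /= sub0r normrN lt_min => /andP[t1 t2] _.
rewrite -(subrK (t%:C * l) (f _ - f z)); apply: le_lt_trans (cabsD _ _) _.
apply: (@le_lt_trans _ _ (K * `|t|)).
  by rewrite /K mulrDl cabsM cabs_real [cabs l * _]mulrC lerD2r; exact: hd.
by move: t2; rewrite ltr_pdivlMr // mulrC.
Qed.

Lemma rdD f g z v l l' : rd f z v l -> rd g z v l' -> rd (fun x => f x + g x) z v (l + l').
Proof.
move=> h1 h2; rewrite /rd.
rewrite (_ : dquot _ z v = fun t => dquot f z v t + dquot g z v t); first exact: cvgD h1 h2.
by apply/funext => t; rewrite /dquot -mulrDr opprD addrACA.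
Qed.

Lemma rdM f g z v l l' : rd f z v l -> rd g z v l' ->
  rd (fun x => f x * g x) z v (l * g z + f z * l').
Proof.
move=> h1 h2; rewrite /rd.
rewrite (_ : dquot _ z v = fun t => dquot f z v t * g (z + t%:C *: v) + f z * dquot g z v t).
  exact: (cvgD (cvgM h1 (rd_cont h2)) (cvgM (cvg_cst (f z)) h2)).
apply/funext => t; rewrite /dquot.
by move: (f (z + _)) (g (z + _)) => F G; ring.
Qed.

Lemma rd_cst (c : R[i]) z v : rd (fun=> c) z v 0.
Proof.
apply/rdP => e e0; exists 1 => // t _.
by rewrite subrr mulr0 subrr cabs0 mulr_ge0 // ltW.
Qed.

Lemma rd_coord (j : 'I_n) z v : rd (fun x => x 0 j) z v (v 0 j).
Proof.
apply/rdP => e e0; exists 1 => // t _.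
by rewrite !mxE (addrC (z 0 j)) addrK subrr cabs0 mulr_ge0 // ltW.
Qed.

Lemma rd_conj f z v l : rd f z v l -> rd (fun x => cj (f x)) z v (cj l).
Proof.
move=> /rdP h; apply/rdP => e /h[d d0 hd]; exists d => // t /hd.
by rewrite -cjZ -!cjN -!cjD cabs_conj.
Qed.

Lemma rd_exp f z v l p : rd f z v l -> rd (fun x => f x ^+ p) z v (f z ^+ p.-1 * l *+ p).
Proof.
move=> h; elim: p => [|p IH].
  by rewrite mulr0n; under eq_fun do rewrite expr0; exact: rd_cst.
under eq_fun do rewrite exprS.
rewrite (_ : _ *+ p.+1 = l * f z ^+ p + f z * (f z ^+ p.-1 * l *+ p)); first exact: rdM.
case: p {IH} => [|p]; first by rewrite !expr0; ring.
by rewrite /= exprS; ring.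
Qed.

Lemma rd_real (r : Cn -> R) z v (l : R) :
  is_derive (0 : R) (1 : R) (fun t : R => r (z + t%:C *: v)) l ->
  rd (fun x => (r x)%:C) z v l%:C.
Proof.
move=> h; apply/rdP => e e0; have [d d0 hd] := derive_expansion h e0.
exists d => // t /ltW/hd; rewrite scale0r addr0 mulrC => h1.
by rewrite -rmorphB -rmorphM -rmorphB /= cabs_real.
Qed.

(** The real differential in Wirtinger form: A j and B j stand for the derivatives with respect to
    z_j and its conjugate. *)
Definition dd A B z v : R[i] := \sum_j (v 0 j * A j z + cj (v 0 j) * B j z).

Definition has_der f A B := forall z v, rd f z v (dd A B z v).

Lemma dd_real (t : R) A B z v : dd A B z (t%:C *: v) = t%:C * dd A B z v.
Proof.
rewrite mulr_sumr; apply: eq_bigr => j _; rewrite mxE cjZ; ring.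
Qed.

Definition bounded_cont f :=
  continuous f /\ exists M : R, 0 <= M /\ forall z, cabs (f z) <= M.

(** Bounds on all of C^n are built in at every order. They make the constants of the Taylor
    estimates independent of the base point, and they hold for the convolutions used below. *)
Fixpoint sm (k : nat) f : Prop := bounded_cont f /\
  (if k is k'.+1 then exists A B, has_der f A B /\ forall j, sm k' (A j) /\ sm k' (B j)
   else True).

Lemma sm_bounded k f : sm k f -> bounded_cont f. Proof. by case: k => [|k] []. Qed.

Lemma smW k f : sm k.+1 f -> sm k f.
Proof.
elim: k f => [|k IH] f; first by move=> [h _].
move=> [h [A [B [hd hs]]]]; split=> //; exists A, B; split=> // j.
by have [h1 h2] := hs j; split; apply: IH.
Qed.

Lemma bounded_contD f g : bounded_cont f -> bounded_cont g ->
  bounded_cont (fun x => f x + g x).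
Proof.
move=> [cf [M [M0 hM]]] [cg [N [N0 hN]]]; split.
  by move=> x; exact: (cvgD (cf x) (cg x)).
exists (M + N); split; first exact: addr_ge0.
by move=> z; apply: le_trans (cabsD _ _) _; apply: lerD.
Qed.

Lemma bounded_contM f g : bounded_cont f -> bounded_cont g ->
  bounded_cont (fun x => f x * g x).
Proof.
move=> [cf [M [M0 hM]]] [cg [N [N0 hN]]]; split.
  by move=> x; exact: (cvgM (cf x) (cg x)).
exists (M * N); split; first exact: mulr_ge0.
by move=> z; rewrite cabsM; apply: ler_pM; rewrite ?cabs_ge0.
Qed.

Lemma bounded_cont_cst (c : R[i]) : bounded_cont (fun=> c).
Proof.
split; first exact: cst_continuous.
by exists (cabs c); split=> //; exact: cabs_ge0.
Qed.

Lemma sm_cst k (c : R[i]) : sm k (fun=> c).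
Proof.
elim: k c => [|k IH] c; split=> //; try exact: bounded_cont_cst.
exists (fun _ _ => 0), (fun _ _ => 0); split=> // z v.
rewrite (_ : dd _ _ _ _ = 0); first exact: rd_cst.
by rewrite /dd big1 // => j _; rewrite !mulr0 addr0.
Qed.

Lemma smD k f g : sm k f -> sm k g -> sm k (fun x => f x + g x).
Proof.
elim: k f g => [|k IH] f g.
  by move=> [h1 _] [h2 _]; split=> //; exact: bounded_contD.
move=> [h1 [A [B [hd hs]]]] [h2 [A' [B' [hd' hs']]]]; split; first exact: bounded_contD.
exists (fun j x => A j x + A' j x), (fun j x => B j x + B' j x); split.
  move=> z v; rewrite (_ : dd _ _ _ _ = dd A B z v + dd A' B' z v); first exact: rdD.
  by rewrite /dd -big_split; apply: eq_bigr => j _; rewrite /=; ring.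
by move=> j; have [s1 s2] := hs j; have [s3 s4] := hs' j; split; apply: IH.
Qed.

Lemma smM k f g : sm k f -> sm k g -> sm k (fun x => f x * g x).
Proof.
elim: k f g => [|k IH] f g.
  by move=> [h1 _] [h2 _]; split=> //; exact: bounded_contM.
move=> sf sg; have sf1 := smW sf; have sg1 := smW sg; move: sf sg.
move=> [h1 [A [B [hd hs]]]] [h2 [A' [B' [hd' hs']]]]; split; first exact: bounded_contM.
exists (fun j x => A j x * g x + f x * A' j x), (fun j x => B j x * g x + f x * B' j x); split.
  move=> z v; rewrite (_ : dd _ _ _ _ = dd A B z v * g z + f z * dd A' B' z v); first exact: rdM.
  by rewrite /dd mulr_suml mulr_sumr -big_split; apply: eq_bigr => j _; rewrite /=; ring.
by move=> j; have [s1 s2] := hs j; have [s3 s4] := hs' j; split; apply: smD; apply: IH.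
Qed.

Lemma sm_sum k (I : Type) (r : seq I) (F : I -> Cn -> R[i]) :
  (forall i, sm k (F i)) -> sm k (fun x => \sum_(i <- r) F i x).
Proof.
move=> h; elim: r => [|i r IH].
  by under eq_fun do rewrite big_nil; exact: sm_cst.
by under eq_fun do rewrite big_cons; apply: smD.
Qed.

Lemma sm_prod k (I : Type) (r : seq I) (F : I -> Cn -> R[i]) :
  (forall i, sm k (F i)) -> sm k (fun x => \prod_(i <- r) F i x).
Proof.
move=> h; elim: r => [|i r IH].
  by under eq_fun do rewrite big_nil; exact: sm_cst.
by under eq_fun do rewrite big_cons; apply: smM.
Qed.

Lemma continuous_dilate (a : R[i]) : continuous (fun x : Cn => a *: x).
Proof.
move=> x; apply: (@cvg_rV R n _ (nbhs x) _ (fun x : Cn => a *: x)) => j.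
rewrite mxE; under eq_fun do rewrite mxE.
exact: (cvgM (cvg_cst a) (@cvg_coord R n x j)).
Qed.

Lemma bounded_cont_dilate (a : R[i]) f : bounded_cont f -> bounded_cont (fun x => f (a *: x)).
Proof.
move=> [cf [M [M0 hM]]]; split; last by exists M.
move=> x; exact: (continuous_comp (@continuous_dilate a x) (cf (a *: x))).
Qed.

Lemma sm_dilate k f (a : R) : sm k f -> sm k (fun x => f (a%:C *: x)).
Proof.
elim: k f => [|k IH] f.
  by move=> [h _]; split; [exact: bounded_cont_dilate|].
move=> [h1 [A [B [hd hs]]]]; split; first exact: bounded_cont_dilate.
exists (fun j x => a%:C * A j (a%:C *: x)), (fun j x => a%:C * B j (a%:C *: x)); split.
  move=> z v.
  rewrite (_ : dd _ _ _ _ = dd A B (a%:C *: z) (a%:C *: v)); last first.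
    by rewrite dd_real mulr_sumr; apply: eq_bigr => j _; ring.
  have /rdP h := hd (a%:C *: z) (a%:C *: v); apply/rdP => e /h[d d0 hd'].
  exists d => // t /hd'.
  by rewrite scalerDr !scalerA (mulrC a%:C).
move=> j; have [s1 s2] := hs j.
by split; apply: smM; [exact: sm_cst|exact: IH|exact: sm_cst|exact: IH].
Qed.

End directional_derivatives.

(** * Taylor expansions with uniform constants *)

Section taylor.
Context {R : realType}.

Lemma rcD (a b : R) : (a + b)%:C = a%:C + b%:C.
Proof. exact: (rmorphD (real_complex R)). Qed.

Lemma half_real : (2^-1 : R[i]) = (2^-1 : R)%:C.
Proof. by rewrite [RHS](fmorphV (real_complex R)) (rmorph_nat (real_complex R)). Qed.

Lemma cabs_half : cabs (2^-1 : R[i]) = 2^-1.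
Proof. by rewrite half_real cabs_real ger0_norm // invr_ge0. Qed.

Lemma der_expansion (h : R -> R) (t l : R) :
  (forall e, 0 < e -> exists2 d, 0 < d &
    forall s, `|s| < d -> `|h (t + s) - h t - l * s| <= e * `|s|) ->
  is_derive t (1 : R) h l.
Proof.
move=> H.
have C : (fun s : R => s^-1 *: (h (s *: (1:R) + t) - h t)) @ (0:R)^' --> l.
  apply/cvgrPdist_lt => e e0; have e20 : 0 < e / 2 by rewrite divr_gt0.
  have [d d0 hd] := H _ e20.
  rewrite near_withinE; apply/nbhs_ballP; exists d => // s.
  rewrite /ball /= sub0r normrN => sd s0.
  have s1 : 0 < `|s| by rewrite normr_gt0.
  rewrite -(ltr_pM2r s1) -normrM /GRing.scale /= mulr1 (addrC s).
  rewrite (_ : (l - s^-1 * (h (t + s) - h t)) * s = - (h (t + s) - h t - l * s));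
    last by field.
  rewrite normrN; apply: le_lt_trans (hd s sd) _; rewrite ltr_pM2r // ltr_pdivrMr //.
  by lra.
apply: DeriveDef; first by apply/cvg_ex; exists l.
by apply: cvg_lim.
Qed.

Lemma real_mvt_bound (h h' : R -> R) (M : R) :
  (forall t : R, 0 <= t <= 1 -> is_derive t (1 : R) h (h' t)) ->
  (forall t, 0 <= t <= 1 -> `|h' t| <= M) -> `|h 1 - h 0| <= M.
Proof.
move=> dh bh.
have hin (t : R) : t \in `]0, 1[%R -> 0 <= t <= 1.
  by rewrite in_itv /= => /andP[a b]; rewrite !ltW.
have cont : {within `[0, 1], continuous h}.
  apply: derivable_within_continuous => t; rewrite in_itv /= => t01.
  by have := dh t t01 => ?; exact: ex_derive.
have [c c01 ->] := MVT_segment ler01 (fun t tI => dh t (hin t tI)) cont.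
rewrite subr0 mulr1; apply: bh; by move: c01; rewrite in_itv.
Qed.

(** The mean value theorem is applied to the real and to the imaginary part separately, whence the
    factor 2. *)
Lemma complex_mvt_bound (g g' : R -> R[i]) (M : R) :
  (forall t, 0 <= t <= 1 -> forall e, 0 < e -> exists2 d, 0 < d &
    forall s, `|s| < d -> cabs (g (t + s) - g t - s%:C * g' t) <= e * `|s|) ->
  (forall t, 0 <= t <= 1 -> cabs (g' t) <= M) -> cabs (g 1 - g 0) <= 2 * M.
Proof.
move=> H b.
have r : `|Re (g 1) - Re (g 0)| <= M.
  apply: (@real_mvt_bound (fun t => Re (g t)) (fun t => Re (g' t))) => t t01.
    apply: der_expansion => e /(H t t01)[d d0 hd]; exists d => // s /hd.
    by apply: le_trans; rewrite mulrC -ReZ -!ReN -!ReD; exact: Re_le_cabs.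
  by apply: le_trans (Re_le_cabs _) (b t t01).
have i : `|Im (g 1) - Im (g 0)| <= M.
  apply: (@real_mvt_bound (fun t => Im (g t)) (fun t => Im (g' t))) => t t01.
    apply: der_expansion => e /(H t t01)[d d0 hd]; exists d => // s /hd.
    by apply: le_trans; rewrite mulrC -ImZ -!ImN -!ImD; exact: Im_le_cabs.
  by apply: le_trans (Im_le_cabs _) (b t t01).
by apply: le_trans (cabs_le_ReIm _) _; rewrite ReD ImD ReN ImN mulr_natl mulr2n lerD.
Qed.

Variable n : nat.
Local Notation Cn := 'rV[R[i]]_n.
Implicit Types (f : Cn -> R[i]) (z v : Cn) (A B : 'I_n -> Cn -> R[i]).

(** The l^1 norm, which fits the coordinatewise sums in [dd]. *)
Definition nv v : R := \sum_j cabs (v 0 j).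

Lemma nv_ge0 v : 0 <= nv v.
Proof. by apply: sumr_ge0 => j _; exact: cabs_ge0. Qed.

Lemma nvZ (c : R[i]) v : nv (c *: v) = cabs c * nv v.
Proof. by rewrite /nv mulr_sumr; apply: eq_bigr => j _; rewrite mxE cabsM. Qed.

Lemma dd_bound (a b : 'I_n -> R[i]) v (C : R) :
  (forall j, cabs (a j) <= C) -> (forall j, cabs (b j) <= C) ->
  cabs (\sum_j (v 0 j * a j + cj (v 0 j) * b j)) <= 2 * C * nv v.
Proof.
move=> ha hb; apply: le_trans (cabs_sum _ _ _) _.
rewrite mulr_sumr; apply: ler_sum => j _; apply: le_trans (cabsD _ _) _.
rewrite !cabsM cabs_conj.
have := ler_wpM2l (cabs_ge0 (v 0 j)) (ha j).
have := ler_wpM2l (cabs_ge0 (v 0 j)) (hb j).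
lra.
Qed.

Lemma has_der_line f A B z v : has_der f A B -> forall t e, 0 < e -> exists2 d, 0 < d &
  forall s : R, `|s| < d ->
    cabs (f (z + (t + s)%:C *: v) - f (z + t%:C *: v) - s%:C * dd A B (z + t%:C *: v) v) <=
    e * `|s|.
Proof.
move=> h t e e0; have /rdP/(_ e e0)[d d0 hd] := h (z + t%:C *: v) v.
exists d; first exact: d0.
move=> s sd; have := hd s sd.
have -> // : z + t%:C *: v + s%:C *: v = z + (t + s)%:C *: v.
by rewrite rcD scalerDl addrA.
Qed.

Lemma taylor1 f A B (M : R) : has_der f A B ->
  (forall j z, cabs (A j z) <= M) -> (forall j z, cabs (B j z) <= M) ->
  forall z v, cabs (f (z + v) - f z) <= 4 * M * nv v.
Proof.
move=> h bA bB z v.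
have -> : f (z + v) - f z = f (z + (1:R)%:C *: v) - f (z + (0:R)%:C *: v).
  by rewrite scale1r scale0r addr0.
apply: (@le_trans _ _ (2 * (2 * M * nv v))); last by rewrite !mulrA -natrM.
apply: (@complex_mvt_bound (fun t => f (z + t%:C *: v)) (fun t => dd A B (z + t%:C *: v) v)).
  by move=> t _; exact: has_der_line.
by move=> t _; apply: dd_bound => j; [exact: bA|exact: bB].
Qed.

Lemma taylor2 f A B (C : R) : has_der f A B ->
  (forall j z v, cabs (A j (z + v) - A j z) <= C * nv v) ->
  (forall j z v, cabs (B j (z + v) - B j z) <= C * nv v) ->
  forall z v, cabs (f (z + v) - f z - dd A B z v) <= 4 * C * nv v ^+ 2.
Proof.
move=> h LA LB z v.
pose g (t : R) := f (z + t%:C *: v) - t%:C * dd A B z v.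
pose g' (t : R) := dd A B (z + t%:C *: v) v - dd A B z v.
have -> : f (z + v) - f z - dd A B z v = g 1 - g 0.
  by rewrite /g scale1r scale0r addr0 mul1r mul0r subr0; ring.
apply: (@le_trans _ _ (2 * (2 * (C * nv v) * nv v))); last first.
  by rewrite (_ : 2 * _ = 4 * C * nv v ^+ 2) //; ring.
apply: (@complex_mvt_bound g g').
  move=> t _ e e0; have [d d0 hd] := has_der_line z v h t e0.
  exists d; first exact: d0.
  move=> s sd; have := hd s sd; congr (cabs _ <= _).
  by rewrite /g /g' rcD; ring.
move=> t /andP[t0 t1].
have -> : g' t = \sum_j (v 0 j * (A j (z + t%:C *: v) - A j z) +
    cj (v 0 j) * (B j (z + t%:C *: v) - B j z)).
  by rewrite /g' /dd -sumrB; apply: eq_bigr => j _; ring.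
have tn : nv (t%:C *: v) <= nv v.
  by rewrite nvZ cabs_real ger0_norm // ler_piMl // nv_ge0.
have C0 (j : 'I_n) : 0 <= C * nv v by exact: le_trans (cabs_ge0 _) (LA j z v).
(* The sign of C can only be read off a nonzero increment; for n = 0 or nv v = 0 all terms vanish
   anyway. *)
have [n0|n0] := posnP n.
  have nv0 w : nv w = 0 by rewrite /nv big1 // => j; exfalso; move: (j); rewrite n0 => -[].
  rewrite nv0 mulr0 big1 ?cabs0 // => j; exfalso; move: (j); rewrite n0 => -[]//.
have [v0|v0] := eqVneq (nv v) 0.
  apply: dd_bound => j; rewrite v0 mulr0.
    by apply: le_trans (LA j z _) _; rewrite nvZ v0 !mulr0.
  by apply: le_trans (LB j z _) _; rewrite nvZ v0 !mulr0.
have Cp : 0 <= C.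
  have := C0 (Ordinal n0); rewrite pmulr_lge0 // lt0r v0; exact: nv_ge0.
apply: dd_bound => j.
  by apply: le_trans (LA j z _) _; rewrite ler_wpM2l.
by apply: le_trans (LB j z _) _; rewrite ler_wpM2l.
Qed.

Definition dd2 (AA AB BA BB : 'I_n -> 'I_n -> Cn -> R[i]) z v : R[i] :=
  \sum_j (v 0 j * dd (AA j) (AB j) z v + cj (v 0 j) * dd (BA j) (BB j) z v).

Lemma taylor3 f A B AA AB BA BB (C : R) : 0 <= C -> has_der f A B ->
  (forall j z v, cabs (A j (z + v) - A j z - dd (AA j) (AB j) z v) <= C * nv v ^+ 2) ->
  (forall j z v, cabs (B j (z + v) - B j z - dd (BA j) (BB j) z v) <= C * nv v ^+ 2) ->
  forall z v, cabs (f (z + v) - f z - dd A B z v - 2^-1 * dd2 AA AB BA BB z v) <=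
    4 * C * nv v ^+ 3.
Proof.
move=> C0 h LA LB z v.
pose D := dd2 AA AB BA BB z v.
(* Subtracting the linear and quadratic terms makes the derivative of g a combination of the
   first-order Taylor remainders of A and B, which are of size |v|^2. *)
pose g (t : R) := f (z + t%:C *: v) - t%:C * dd A B z v - 2^-1 * (t%:C ^+ 2 * D).
pose g' (t : R) := dd A B (z + t%:C *: v) v - dd A B z v - t%:C * D.
have -> : f (z + v) - f z - dd A B z v - 2^-1 * dd2 AA AB BA BB z v = g 1 - g 0.
  by rewrite /g -/D scale1r scale0r addr0 expr1n mul1r !mul0r expr0n /= mul0r; ring.
apply: (@le_trans _ _ (2 * (2 * (C * nv v ^+ 2) * nv v))); last first.
  by rewrite (_ : 2 * _ = 4 * C * nv v ^+ 3) //; ring.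
apply: (@complex_mvt_bound g g').
  move=> t _ e e0; have e20 : 0 < e / 2 by rewrite divr_gt0.
  have [d d0 hd] := has_der_line z v h t e20.
  have D0 : 0 < cabs D + 1 by rewrite ltr_wpDl ?cabs_ge0.
  exists (Num.min d (e / (cabs D + 1))); first by rewrite lt_min d0 divr_gt0.
  move=> s; rewrite lt_min => /andP[/hd h1 h2].
  have -> : g (t + s) - g t - s%:C * g' t =
    (f (z + (t + s)%:C *: v) - f (z + t%:C *: v) - s%:C * dd A B (z + t%:C *: v) v)
     - 2^-1 * (s%:C ^+ 2 * D).
    by rewrite /g /g' rcD; field.
  apply: le_trans (cabsD _ _) _; rewrite cabsN [cabs (_ * _)]cabsM cabsM expr2 cabsM cabs_real.
  rewrite cabs_half.
  have h3 : `|s| * (cabs D + 1) <= e.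
    by move: h2; rewrite ltr_pdivlMr // => /ltW.
  have h4 : `|s| * cabs D <= e by apply: le_trans h3; rewrite ler_wpM2l // lerDl.
  have := ler_wpM2l (normr_ge0 s) h4; clear -h1; lra.
move=> t /andP[t0 t1].
have -> : g' t = \sum_j (v 0 j * (A j (z + t%:C *: v) - A j z - dd (AA j) (AB j) z (t%:C *: v)) +
    cj (v 0 j) * (B j (z + t%:C *: v) - B j z - dd (BA j) (BB j) z (t%:C *: v))).
  rewrite /g' /D /dd2 mulr_sumr /dd -!sumrB; apply: eq_bigr => j _.
  by rewrite -!/(dd _ _ _ _) !dd_real; ring.
have tn : nv (t%:C *: v) ^+ 2 <= nv v ^+ 2.
  rewrite ler_pXn2r ?nnegrE ?nv_ge0 //.
  by rewrite nvZ cabs_real ger0_norm // ler_piMl // nv_ge0.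
apply: dd_bound => j.
  by apply: le_trans (LA j z _) _; rewrite ler_wpM2l.
by apply: le_trans (LB j z _) _; rewrite ler_wpM2l.
Qed.

Lemma finite_bound (F : 'I_n -> R -> Prop) :
  (forall j M M', M <= M' -> F j M -> F j M') -> (forall j, exists M, F j M) ->
  exists2 M, 0 <= M & forall j, F j M.
Proof.
move=> mono /choice[M hM]; exists (\sum_j `|M j|); first exact: sumr_ge0.
move=> j; apply: mono (hM j); rewrite (bigD1 j) //=.
by apply: le_trans (ler_norm _) _; rewrite lerDl sumr_ge0.
Qed.

Lemma sm_lipschitz f : sm 1 f -> exists2 C, 0 <= C &
  forall z v, cabs (f (z + v) - f z) <= C * nv v.
Proof.
move=> [_ [A [B [h hs]]]].
have [M M0 hM] : exists2 M, 0 <= M & forall j,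
    (forall z, cabs (A j z) <= M) /\ (forall z, cabs (B j z) <= M).
  apply: finite_bound => [j M M' MM' [h1 h2]|j].
    by split=> z; [apply: le_trans (h1 z) MM'|apply: le_trans (h2 z) MM'].
  have [[[_ [M1 [M10 h1]]] _] [[_ [M2 [M20 h2]]] _]] := hs j.
  exists (M1 + M2); split=> z; [apply: le_trans (h1 z) _|apply: le_trans (h2 z) _].
    by rewrite lerDl.
  by rewrite lerDr.
exists (4 * M); first by rewrite mulr_ge0.
by apply: taylor1 h _ _ => j; have [] := hM j.
Qed.

Lemma sm_taylor2 f : sm 2 f -> exists A B, has_der f A B /\
  (forall j, sm 1 (A j) /\ sm 1 (B j)) /\ exists2 C, 0 <= C &
  forall z v, cabs (f (z + v) - f z - dd A B z v) <= C * nv v ^+ 2.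
Proof.
move=> [_ [A [B [h hs]]]]; exists A, B; split=> //; split=> //.
have [C C0 hC] : exists2 C, 0 <= C & forall j,
    (forall z v, cabs (A j (z + v) - A j z) <= C * nv v) /\
    (forall z v, cabs (B j (z + v) - B j z) <= C * nv v).
  apply: finite_bound => [j M M' MM' [h1 h2]|j].
    by split=> z v; [apply: le_trans (h1 z v) _|apply: le_trans (h2 z v) _];
      rewrite ler_wpM2r // nv_ge0.
  have [/sm_lipschitz[C1 C10 h1] /sm_lipschitz[C2 C20 h2]] := hs j.
  exists (C1 + C2); split=> z v; [apply: le_trans (h1 z v) _|apply: le_trans (h2 z v) _];
    by rewrite ler_wpM2r ?nv_ge0 // ?lerDl ?lerDr.
exists (4 * C); first by rewrite mulr_ge0.
by apply: taylor2 h _ _ => j; have [] := hC j.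
Qed.

End taylor.

(** * The bump kernel *)

Section flat_function.
Context {R : realType}.

(* The derivatives of exp(-1/x) are linear combinations of these functions. *)
Definition beta (m : nat) (x : R) : R := if 0 < x then x^-1 ^+ m * expR (- x^-1) else 0.

Lemma beta_ge0 m x : 0 <= beta m x.
Proof.
by rewrite /beta; case: ifP => // x0; rewrite mulr_ge0 ?expR_ge0 // exprn_ge0 // invr_ge0 ltW.
Qed.

Lemma beta0_gt0 x : 0 < x -> 0 < beta 0 x.
Proof. by move=> x0; rewrite /beta x0 expr0 mul1r expR_gt0. Qed.

Lemma beta_le0 m x : x <= 0 -> beta m x = 0.
Proof. by rewrite /beta ltNge => ->. Qed.

(** From exp y >= y^(m+2) / (m+2)! at y = 1 / x. A quadratic bound is what makes the derivative at
    the origin vanish. *)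
Lemma beta_le m : exists2 C : R, 0 <= C & forall x, beta m x <= C * `|x| ^+ 2.
Proof.
exists (m.+2)`!%:R => // x; rewrite /beta; case: ifP => [x0|_]; last first.
  by rewrite mulr_ge0 // exprn_ge0.
rewrite (gtr0_norm x0).
have y0 : 0 <= x^-1 by rewrite invr_ge0 ltW.
have := expR_ge1Dxn m.+1 y0.
have F0 : (0 : R) < (m.+2)`!%:R by rewrite ltr0n fact_gt0.
move=> h; have {}h : x^-1 ^+ m.+2 <= (m.+2)`!%:R * expR x^-1.
  rewrite mulrC -ler_pdivrMr //; apply: le_trans h; by rewrite lerDr.
rewrite expRN -(ler_pM2r (expR_gt0 x^-1)) -mulrA mulVf ?lt0r_neq0 ?expR_gt0 // mulr1.
have x20 : 0 < x^-1 ^+ 2 by rewrite exprn_gt0 // invr_gt0.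
rewrite -(ler_pM2r x20) -exprD addn2.
rewrite (_ : (m.+2)`!%:R * x ^+ 2 * expR x^-1 * x^-1 ^+ 2 = (m.+2)`!%:R * expR x^-1) //.
by field; rewrite lt0r_neq0.
Qed.

Lemma is_derive_beta m (x : R) :
  is_derive x (1 : R) (beta m) (beta m.+2 x - m%:R * beta m.+1 x).
Proof.
have [x0|x0|->] := ltgtP x 0.
- rewrite !beta_le0 ?ltW // mulr0 subr0; apply: der_expansion => e e0.
  exists (- x); first by rewrite oppr_gt0.
  move=> s; rewrite ltr_norml => /andP[_ sx].
  have xs : x + s <= 0 by lra.
  by rewrite !beta_le0 ?(ltW x0) // !subrr mul0r subr0 normr0 mulr_ge0 // ltW.
- have xn : x != 0 by rewrite lt0r_neq0.
  pose g (y : R) := y^-1 ^+ m * expR (- y^-1).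
  have dg : is_derive x (1 : R) g (beta m.+2 x - m%:R * beta m.+1 x).
    have dV := @is_deriveV R id x 1 1 xn (is_derive_id x 1).
    have dE : is_derive x (1:R) (expR \o (fun y => - y^-1)) (expR (- x^-1) * (x^-1 ^+ 2)).
      apply: is_derive1_comp.
      have := is_deriveN dV; congr is_derive.
      by rewrite /GRing.scale /= mulr1 opprK exprVn.
    have gE : g = (fun y : R => y^-1) ^+ m * (expR \o (fun y : R => - y^-1)).
      by rewrite exprfctE.
    rewrite gE; apply: (@is_derive_eq _ _ _ _ _ _ _ _ (is_deriveM (is_deriveX m dV) dE)).
    rewrite /beta x0 /GRing.scale /= mulr1.
    case: m {g gE} => [|m]; first by rewrite !exprfctE !expr0 /=; ring.
    by rewrite !exprfctE !exprS /= -mulr_natr; field.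
  have near0 : \forall y \near x, g y = beta m y.
    near=> y; rewrite /g /beta; case: ifP => //.
    by move/negP; case; near: y; exact: lt_nbhsr.
  exact: near_eq_is_derive near0 dg.
- rewrite !beta_le0 // mulr0 subr0; apply: der_expansion => e e0.
  have [C C0 hC] := beta_le m.
  exists (e / (C + 1)); first by rewrite divr_gt0 // ltr_wpDl.
  move=> s se; rewrite add0r (beta_le0 m (lexx 0)) mul0r !subr0 ger0_norm ?beta_ge0 //.
  apply: le_trans (hC s) _; rewrite expr2 mulrA ler_wpM2r //.
  apply: (@le_trans _ _ ((C + 1) * `|s|)); first by rewrite ler_wpM2r // lerDl.
  by move: se; rewrite ltr_pdivlMr ?ltr_wpDl // mulrC => /ltW.
Unshelve. all: by end_near. Qed.

Lemma beta_continuous m : continuous (beta m).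
Proof.
move=> x; apply: differentiable_continuous; apply/derivable1_diffP.
by have := is_derive_beta m x => ?; exact: ex_derive.
Qed.

End flat_function.

Section bump_kernel.
Context {R : realType} {n : nat}.
Local Notation Cn := 'rV[R[i]]_n.

(** A family stable, up to linear combinations, under both Wirtinger derivatives, so that smoothness
    of every order follows by a single induction. The kernel is the product over j of its members
    with all exponents 0. *)
Definition kap (j : 'I_n) (m p q : nat) (z : Cn) : R[i] :=
  z 0 j ^+ p * cj (z 0 j) ^+ q * (beta m (1 - cabs (z 0 j) ^+ 2))%:C.

Let dkap j m p q (z : Cn) := p%:R * kap j m p.-1 q z -
  (kap j m.+2 p q.+1 z - m%:R * kap j m.+1 p q.+1 z).
Let dbkap j m p q (z : Cn) := q%:R * kap j m p q.-1 z -
  (kap j m.+2 p.+1 q z - m%:R * kap j m.+1 p.+1 q z).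

Let der_norm (j : 'I_n) (z v : Cn) :
  is_derive (0 : R) (1 : R) (fun t : R => 1 - cabs ((z + t%:C *: v) 0 j) ^+ 2)
    (- (2 * Re (cj (z 0 j) * v 0 j))).
Proof.
apply: der_expansion => e e0; have K0 : 0 < cabs (v 0 j) ^+ 2 + 1.
  by rewrite ltr_wpDl // sqr_ge0.
exists (e / (cabs (v 0 j) ^+ 2 + 1)); first by rewrite divr_gt0.
move=> s; rewrite ltr_pdivlMr // => hs.
rewrite add0r rmorph0 scale0r addr0 (mxE _ _ 0 j) (mxE _ _ 0 j).
rewrite (_ : _ - _ = - (s ^+ 2 * cabs (v 0 j) ^+ 2)); last first.
  rewrite !cabs_sqr ReD ImD ReZ ImZ ReM ReJ ImJ; ring.
rewrite normrN normrM normrX (ger0_norm (sqr_ge0 _)) expr2 -mulrA mulrC ler_wpM2r //.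
by apply: le_trans (ltW hs); rewrite ler_wpM2l // lerDl.
Qed.

Let has_der_kap j m p q : has_der (kap j m p q)
  (fun i z => if i == j then dkap j m p q z else 0)
  (fun i z => if i == j then dbkap j m p q z else 0).
Proof.
move=> z v.
have r1 := @rd_exp R n _ z v _ p (@rd_coord R n j z v).
have r2 := @rd_exp R n _ z v _ q (rd_conj (@rd_coord R n j z v)).
have r3 : rd (fun x : Cn => (beta m (1 - cabs (x 0 j) ^+ 2))%:C) z v
    ((beta m.+2 (1 - cabs (z 0 j) ^+ 2) - m%:R * beta m.+1 (1 - cabs (z 0 j) ^+ 2)) *
     - (2 * Re (cj (z 0 j) * v 0 j)))%:C.
  apply: rd_real.
  apply: (@is_derive1_comp R (beta m) (fun t : R => 1 - cabs ((z + t%:C *: v) 0 j) ^+ 2));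
    last exact: der_norm.
  by rewrite scale0r addr0; exact: is_derive_beta.
have := rdM (rdM r1 r2) r3; congr rd.
rewrite /dd (bigD1 j) //= eqxx big1 ?addr0 => [|i /negbTE->]; last by rewrite !mulr0 addr0.
have RE : (2 * Re (cj (z 0 j) * v 0 j))%:C = cj (z 0 j) * v 0 j + z 0 j * cj (v 0 j) :> R[i].
  apply/eqP; rewrite eq_complex /= ReD ImD !ReM !ImM !ReJ !ImJ.
  by apply/andP; split; apply/eqP; ring.
rewrite rmorphM rmorphN /= RE rmorphB /= rmorphM /= rmorph_nat /dkap /dbkap /kap.
move: (beta m _)%:C (beta m.+1 _)%:C (beta m.+2 _)%:C => b0 b1 b2.
rewrite (exprS (cj (z 0 j)) q) (exprS (z 0 j) p).
rewrite -(mulr_natl _ p) -(mulr_natl _ q).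
move: (z 0 j ^+ p.-1) (cj (z 0 j) ^+ q.-1) (z 0 j ^+ p) (cj (z 0 j) ^+ q).
move: (cj (z 0 j)) (cj (v 0 j)) (z 0 j) (v 0 j) (p%:R) (q%:R) (m%:R).
move=> {r1 r2 r3 RE} y1 y2 y3 y4 y5 y6 y7 y8 y9 y10 y11.
by clear; ring.
Qed.

Let kap_bounded j m p q : bounded_cont (kap j m p q).
Proof.
split.
  move=> z; have c1 := @cvg_coord R n z j.
  have X (f : Cn -> R[i]) (l : R[i]) k : f @ z --> l -> (fun x => f x ^+ k) @ z --> l ^+ k.
    move=> h; elim: k => [|k IH].
      by under eq_fun do rewrite expr0; rewrite expr0; exact: cst_continuous.
    by under eq_fun do rewrite exprS; rewrite exprS; exact: (cvgM h IH).
  have c2 := cvg_conjc c1.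
  have c3 := cvg_cabs_norm c1.
  have c4 : (fun x : Cn => beta m (1 - cabs (x 0 j) ^+ 2)) @ z --> beta m (1 - cabs (z 0 j) ^+ 2).
    apply: (@cvg_comp _ _ _ (fun x : Cn => cabs (x 0 j)) (fun y : R => beta m (1 - y ^+ 2)) _ _ _ (c3 _)).
    apply: (@continuous_comp _ _ _ (fun y : R => 1 - y ^+ 2) (beta m)); last exact: beta_continuous.
    by apply: cvgB; [exact: cvg_cst | exact: exprn_continuous].
  have c5 := cvgM (X _ _ p c1) (X (fun x : Cn => cj (x 0 j)) _ q (c2 _)).
  have c6 := cvg_real_complex c4.
  exact: (cvgM (c5 _ _) (c6 _)).
have [C C0 hC] := beta_le (R := R) m.
exists C; split=> // z; rewrite /kap !cabsM cabs_real ger0_norm ?beta_ge0 //.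
have X (w : R[i]) k : cabs (w ^+ k) = cabs w ^+ k.
  by elim: k => [|k IH]; rewrite ?expr0 ?cabs1 // !exprS cabsM IH.
rewrite !X cabs_conj.
set y := cabs (z 0 j); have y0 : 0 <= y by exact: cabs_ge0.
have [y1|y1] := leP 1 y.
  by rewrite beta_le0 ?mulr0 // subr_le0 exprn_ege1.
have yX k : 0 <= y ^+ k <= 1 by rewrite exprn_ge0 // exprn_ile1 // ltW.
have yp : 0 <= y ^+ p * y ^+ q <= 1.
  by have /andP[a1 a2] := yX p; have /andP[a3 a4] := yX q; rewrite mulr_ge0 // mulr_ile1.
have b1 : beta m (1 - y ^+ 2) <= C.
  apply: le_trans (hC _) _; apply: ler_piMr => //.
  have /andP[a1 a2] := yX 2%N.
  by rewrite exprn_ile1 // ler_norml; apply/andP; split; lra.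
have /andP[a1 a2] := yp.
by apply: le_trans (ler_piMl _ a2) b1; exact: beta_ge0.
Qed.

Lemma sm_kap k j m p q : sm k (kap j m p q).
Proof.
elim: k m p q => [|k IH] m p q; split => //; try exact: kap_bounded.
exists (fun i z => if i == j then dkap j m p q z else 0),
  (fun i z => if i == j then dbkap j m p q z else 0); split; first exact: has_der_kap.
have S (c : R[i]) f : sm k f -> sm k (fun x : Cn => c * f x).
  by move=> h; apply: smM => //; exact: sm_cst.
have N f : sm k f -> sm k (fun x : Cn => - f x).
  by move=> /(S (-1)); under eq_fun do rewrite mulN1r.
move=> i; case: (i == j); split; try exact: sm_cst.
  apply: smD; first by apply: S; exact: IH.
  exact: (N _ (smD (IH _ _ _) (N _ (S _ _ (IH _ _ _))))).
apply: smD; first by apply: S; exact: IH.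
exact: (N _ (smD (IH _ _ _) (N _ (S _ _ (IH _ _ _))))).
Qed.

(** The product of the exp(-1 / (1 - |z_j|^2)) on the unit polydisc. It is not normalised, its mass
    being [kmass], and depends on the moduli only. *)
Definition chi (z : Cn) : R := \prod_j beta 0 (1 - cabs (z 0 j) ^+ 2).

Lemma sm_chi k : sm k (fun z => (chi z)%:C).
Proof.
rewrite (_ : (fun z => _) = fun z => \prod_j kap j 0 0 0 z).
  by apply: sm_prod => j; exact: sm_kap.
apply/funext => z; rewrite /chi rmorph_prod; apply: eq_bigr => j _.
by rewrite /kap !expr0 !mul1r.
Qed.

Lemma chi_ge0 z : 0 <= chi z.
Proof. by apply: prodr_ge0 => j _; exact: beta_ge0. Qed.

Lemma chi_eq0 z : ~ pd 0 1 z -> chi z = 0.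
Proof.
move=> h; have [j hj] : exists j, 1 <= cabs (z 0 j).
  apply: contrapT => h1; apply: h; apply/pdE => j; rewrite mxE subr0 ltNge.
  by apply/negP => h2; apply: h1; exists j.
rewrite /chi (bigD1 j) //= beta_le0 ?mul0r // subr_le0 exprn_ege1 //.
Qed.

Lemma chi_rot (t : R) z : chi (cis t *: z) = chi z.
Proof. by apply: eq_bigr => j _; rewrite mxE cabsM cabs_cis mul1r. Qed.

End bump_kernel.

(** * Integrals of bounded complex functions, and convolution *)

Section complex_integral.
Context {R : realType} {d} {T : measurableType d}.
Variable mu : {measure set T -> \bar R}.
Variable D : set T.
Hypothesis mD : measurable D.
Hypothesis fD : (mu D < +oo)%E.

Definition bmeas (g : T -> R[i]) : Prop :=
  [/\ measurable_fun setT (fun x => Re (g x)), measurable_fun setT (fun x => Im (g x))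
    & exists M : R, forall x, cabs (g x) <= M].

Lemma bmeasD f g : bmeas f -> bmeas g -> bmeas (fun x => f x + g x).
Proof.
move=> [rf jf [M hM]] [rg jg [N hN]]; split.
- by under eq_fun do rewrite ReD; exact: measurable_funD.
- by under eq_fun do rewrite ImD; exact: measurable_funD.
- by exists (M + N) => x; apply: le_trans (cabsD _ _) _; apply: lerD.
Qed.

Lemma bmeasM f g : bmeas f -> bmeas g -> bmeas (fun x => f x * g x).
Proof.
move=> [rf jf [M hM]] [rg jg [N hN]]; split.
- under eq_fun do rewrite ReM; apply: measurable_funB; exact: measurable_funM.
- under eq_fun do rewrite ImM; apply: measurable_funD; exact: measurable_funM.
- by exists (M * N) => x; rewrite cabsM; apply: ler_pM; rewrite ?cabs_ge0.
Qed.

Lemma bmeas_cst (c : R[i]) : bmeas (fun=> c).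
Proof. by split; [exact: measurable_cst|exact: measurable_cst|exists (cabs c)]. Qed.

Lemma bmeas_sum (I : Type) (s : seq I) (F : I -> T -> R[i]) :
  (forall i, bmeas (F i)) -> bmeas (fun x => \sum_(i <- s) F i x).
Proof.
move=> h; elim: s => [|a s IH].
  by under eq_fun do rewrite big_nil; exact: bmeas_cst.
by under eq_fun do rewrite big_cons; exact: bmeasD.
Qed.

Lemma cst_integrable (M : R) : mu.-integrable D (EFin \o cst M).
Proof.
apply/integrableP; split; first by apply/measurable_EFinP; exact: measurable_cst.
under eq_integral do rewrite /=.
by rewrite (integral_cst _ mD) lte_mul_pinfty.
Qed.

Lemma bounded_integrable (f : T -> R) (M : R) : measurable_fun setT f ->
  (forall x, `|f x| <= M) -> mu.-integrable D (EFin \o f).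
Proof.
move=> mf hM; apply: (@le_integrable _ _ _ mu D mD _ (EFin \o cst M)).
- by apply/measurable_EFinP; exact: measurable_funS mf.
- by move=> x _ /=; rewrite lee_fin; apply: le_trans (hM x) (ler_norm _).
- exact: cst_integrable.
Qed.

Definition cint (g : T -> R[i]) : R[i] :=
  (Rintegral mu D (fun x => Re (g x))) +i* (Rintegral mu D (fun x => Im (g x))).

Let ire g : bmeas g -> mu.-integrable D (EFin \o (fun x => Re (g x))).
Proof.
move=> [rg _ [M hM]]; apply: (@bounded_integrable _ M rg) => x.
by apply: le_trans (hM x); exact: Re_le_cabs.
Qed.

Let iim g : bmeas g -> mu.-integrable D (EFin \o (fun x => Im (g x))).
Proof.
move=> [_ jg [M hM]]; apply: (@bounded_integrable _ M jg) => x.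
by apply: le_trans (hM x); exact: Im_le_cabs.
Qed.

Lemma cintD f g : bmeas f -> bmeas g -> cint (fun x => f x + g x) = cint f + cint g.
Proof.
move=> bf bg; rewrite /cint.
under eq_Rintegral do rewrite ReD.
under [X in _ +i* X]eq_Rintegral do rewrite ImD.
rewrite (RintegralD mD (ire bf) (ire bg)) (RintegralD mD (iim bf) (iim bg)).
by [].
Qed.

Lemma cintZ (c : R[i]) g : bmeas g -> cint (fun x => c * g x) = c * cint g.
Proof.
move=> bg; rewrite /cint.
have ZR (a : R) f : mu.-integrable D (EFin \o f) -> mu.-integrable D (EFin \o (fun x => a * f x)).
  by move=> h; have := integrableZl mD a h; apply: eq_integrable.
under eq_Rintegral do rewrite ReM.
under [X in _ +i* X]eq_Rintegral do rewrite ImM.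
rewrite (RintegralB mD (ZR _ _ (ire bg)) (ZR _ _ (iim bg))).
rewrite (RintegralD mD (ZR _ _ (iim bg)) (ZR _ _ (ire bg))).
rewrite !RintegralZl ?(ire bg) ?(iim bg) //.
by case: c.
Qed.

Lemma cint_sum (I : Type) (s : seq I) (F : I -> T -> R[i]) :
  (forall i, bmeas (F i)) -> cint (fun x => \sum_(i <- s) F i x) = \sum_(i <- s) cint (F i).
Proof.
move=> h; elim: s => [|a s IH].
  rewrite big_nil /cint; under eq_Rintegral do rewrite big_nil.
  under [X in _ +i* X]eq_Rintegral do rewrite big_nil.
  by rewrite !Rintegral_cst //= !mul0r.
rewrite big_cons -IH -cintD //; last exact: bmeas_sum.
by congr cint; apply/funext => x; rewrite big_cons.
Qed.

Lemma cint_abs g (M : R) : bmeas g -> 0 <= M -> (forall x, cabs (g x) <= M) ->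
  cabs (cint g) <= 2 * M * fine (mu D).
Proof.
move=> bg M0 hM.
have H (f : T -> R) : mu.-integrable D (EFin \o f) -> (forall x, `|f x| <= M) ->
    `|Rintegral mu D f| <= M * fine (mu D).
  move=> jf hf; apply: le_trans (le_normr_Rintegral mD jf) _.
  rewrite -(Rintegral_cst mu mD M); apply: le_Rintegral => //.
  - by apply: integrable_norm jf.
  - exact: cst_integrable.
apply: le_trans (cabs_le_ReIm _) _ => /=.
have -> : 2 * M * fine (mu D) = M * fine (mu D) + M * fine (mu D) by ring.
apply: lerD; [apply: H; first exact: ire|apply: H; first exact: iim] => x.
- by apply: le_trans (hM x); exact: Re_le_cabs.
- by apply: le_trans (hM x); exact: Im_le_cabs.
Qed.

Lemma Re_cint g : bmeas g -> (forall x, 0 <= Re (g x)) ->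
  ((Re (cint g))%:E = \int[mu]_(x in D) (Re (g x))%:E)%E.
Proof.
move=> bg g0 /=; rewrite /Rintegral fineK //.
exact: (integrable_fin_num mD (ire bg)).
Qed.

End complex_integral.

Section convolution.
Context {R : realType} {n : nat}.
Local Notation Cn := 'rV[R[i]]_n.
Local Notation L := (leb_type (lebesgue_Cn R n)).
Local Notation co := (@leb_coord R n (lebesgue_Cn R n)).
Variable Q : set Cn.
Hypothesis mQ : measurable (Q : set (BCn R n)).
Hypothesis fQ : (leb_sf n (co @^-1` Q) < +oo)%E.
Variable f : Cn -> R[i].
Hypothesis bf : bmeas (f : BCn R n -> R[i]).

Let D := co @^-1` Q.

Lemma measurable_preimage_coord : measurable D.
Proof. by rewrite -(setTI D); apply: leb_coord_measurable. Qed.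
Let mD := measurable_preimage_coord.

Lemma bmeas_coord (g : Cn -> R[i]) : bmeas (g : BCn R n -> R[i]) -> bmeas (fun p : L => g (co p)).
Proof.
move=> [rg jg [M hM]]; split; last by exists M.
- exact: (measurableT_comp rg (@leb_coord_measurable R n)).
- exact: (measurableT_comp jg (@leb_coord_measurable R n)).
Qed.

Lemma bmeas_bounded_cont (g : Cn -> R[i]) (z : Cn) : bounded_cont g ->
  bmeas ((fun y : Cn => g (y - z)) : BCn R n -> R[i]).
Proof.
move=> [cg [M [_ hM]]].
have cs : continuous (fun y : Cn => g (y - z)).
  move=> y; apply: (@continuous_comp _ _ _ (fun y : Cn => y - z) g); last exact: cg.
  by apply: (@cvgB _ _ _ (nbhs y)); [exact: cvg_id|exact: cvg_cst].
split; last by exists M.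
- by apply: continuous_BCn => y; exact: (cvg_Re (cs y)).
- by apply: continuous_BCn => y; exact: (cvg_Im (cs y)).
Qed.

(** The parameter z occurs only in the kernel, so that f need only be bounded and measurable; the
    derivatives of the convolution are those of the kernel with a minus sign. *)
Definition conv (phi : Cn -> R[i]) (z : Cn) : R[i] :=
  cint (leb_sf n) D (fun p => f (co p) * phi (co p - z)).


(** Transfers uniform estimates on kernels, such as Taylor remainders, to their convolutions with
    f. *)
Lemma conv_bound : exists2 K : R, 0 <= K & forall (psi : L -> R[i]) (M : R), 0 <= M ->
  bmeas psi -> (forall p, cabs (psi p) <= M) ->
  cabs (cint (leb_sf n) D (fun p => f (co p) * psi p)) <= K * M.
Proof.
have [rf jf [N hN]] := bf; have N0 : 0 <= N by apply: le_trans (hN 0); exact: cabs_ge0.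
exists (2 * N * fine (leb_sf n D)).
  by rewrite !mulr_ge0 // fine_ge0.
move=> psi M M0 bpsi hM.
have -> : 2 * N * fine (leb_sf n D) * M = 2 * (N * M) * fine (leb_sf n D) by ring.
apply: (cint_abs mD fQ); first by apply: bmeasM => //; exact: bmeas_coord.
- exact: mulr_ge0.
- by move=> p; rewrite cabsM; apply: ler_pM; rewrite ?cabs_ge0.
Qed.

Let bphi phi z : bounded_cont phi -> bmeas (fun p : L => phi (co p - z)).
Proof. by move=> h; exact: (bmeas_coord (bmeas_bounded_cont z h)). Qed.

Let fineD psi1 psi2 : bmeas psi1 -> bmeas psi2 ->
  cint (leb_sf n) D (fun p => f (co p) * (psi1 p + psi2 p)) =
  cint (leb_sf n) D (fun p => f (co p) * psi1 p) + cint (leb_sf n) D (fun p => f (co p) * psi2 p).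
Proof.
move=> b1 b2; rewrite -(cintD mD fQ); last 2 first.
- by apply: bmeasM => //; exact: bmeas_coord.
- by apply: bmeasM => //; exact: bmeas_coord.
by congr cint; apply/funext => p; rewrite mulrDr.
Qed.

Let fineZ c psi : bmeas psi -> cint (leb_sf n) D (fun p => f (co p) * (c * psi p)) =
  c * cint (leb_sf n) D (fun p => f (co p) * psi p).
Proof.
move=> b1; rewrite -(cintZ mD fQ); last by apply: bmeasM => //; exact: bmeas_coord.
by congr cint; apply/funext => p; rewrite mulrCA.
Qed.

Let finesum (I : Type) (s : seq I) (F : I -> L -> R[i]) : (forall i, bmeas (F i)) ->
  cint (leb_sf n) D (fun p => f (co p) * \sum_(i <- s) F i p) =
  \sum_(i <- s) cint (leb_sf n) D (fun p => f (co p) * F i p).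
Proof.
move=> h; rewrite -(cint_sum mD fQ); last first.
  by move=> i; apply: bmeasM => //; exact: bmeas_coord.
by congr cint; apply/funext => p; rewrite mulr_sumr.
Qed.

Lemma sm_le j k (phi : Cn -> R[i]) : (j <= k)%N -> sm k phi -> sm j phi.
Proof.
by move=> /subnK <-; elim: (k - j)%N => [|m IH] //= h; apply: IH; exact: smW.
Qed.

Lemma bounded_cont_conv phi : sm 1 phi -> bounded_cont (conv phi).
Proof.
move=> s1; have [K K0 hK] := conv_bound.
have bp := sm_bounded s1.
have [C C0 hC] := sm_lipschitz s1.
split; last first.
  have [_ [M [M0 hM]]] := bp; exists (K * M); split; [exact: mulr_ge0|] => z.
  by apply: hK; [exact: M0|exact: bphi|move=> p; exact: hM].
move=> z; apply/(@cvg_cabs _ _ (nbhs z) _ _ _) => e e0.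
have KC : 0 < K * (C * n%:R) + 1 by rewrite ltr_wpDl // !mulr_ge0.
apply/nbhs_pd; exists (e / (K * (C * n%:R) + 1)); first by rewrite divr_gt0.
move=> w /pdE hw /=.
have E : conv phi w - conv phi z =
    cint (leb_sf n) D (fun p => f (co p) * (phi (co p - w) + -1 * phi (co p - z))).
  rewrite fineD; [|exact: bphi|by apply: bmeasM; [exact: bmeas_cst|exact: bphi]].
  by rewrite fineZ ?mulN1r //; exact: bphi.
have nvw : nv (z - w) <= n%:R * (e / (K * (C * n%:R) + 1)).
  rewrite /nv; apply: (@le_trans _ _ (\sum_(j < n) (e / (K * (C * n%:R) + 1)))); last first.
    by rewrite sumr_const card_ord mulr_natl.
  by apply: ler_sum => j _; rewrite !mxE -cabsN opprB; exact: ltW.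
rewrite E; apply: (@le_lt_trans _ _ (K * (C * nv (z - w)))).
  apply: hK; first by rewrite mulr_ge0 ?nv_ge0.
    by apply: bmeasD; [exact: bphi|apply: bmeasM; [exact: bmeas_cst|exact: bphi]].
  by move=> p; rewrite mulN1r; have := hC (co p - z) (z - w); rewrite addrA subrK.
apply: (@le_lt_trans _ _ (K * (C * (n%:R * (e / (K * (C * n%:R) + 1)))))).
  apply: ler_wpM2l => //; exact: ler_wpM2l.
have -> : K * (C * (n%:R * (e / (K * (C * n%:R) + 1)))) = (K * (C * n%:R)) * e / (K * (C * n%:R) + 1).
  by ring.
by rewrite ltr_pdivrMr // mulrC ltr_pM2l // ltrDl.
Qed.

(** Differentiation under the integral sign: the second-order Taylor remainder of phi is uniform in
    the base point, so it integrates to O(t^2). Two orders of smoothness are spent on this estimate,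
    at no cost for kernels smooth to every order. *)
Lemma sm_conv k phi : sm k.+2 phi -> sm k (conv phi).
Proof.
elim: k phi => [|k IH] phi sphi.
  by split=> //; apply: bounded_cont_conv; exact: sm_le sphi.
have bp := sm_bounded sphi.
split; first by apply: bounded_cont_conv; exact: sm_le sphi.
have [K K0 hK] := conv_bound.
have s2 : sm 2 phi by exact: sm_le sphi.
have [_ [A [B [dphi sAB]]]] := sphi.
have [A' [B' [dphi' [sAB' [C2 C20 hC2]]]]] := sm_taylor2 s2.
exists (fun j z => - conv (A j) z), (fun j z => - conv (B j) z); split; last first.
  by move=> j; have [sA sB] := sAB j; split;
    under eq_fun do rewrite -mulN1r; apply: smM; try exact: sm_cst; exact: IH.
have ddE z v : dd A' B' z v = dd A B z v by apply: rd_unique (dphi' z v) (dphi z v).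
have bA j z : bmeas (fun p : L => A j (co p - z)) by exact: (bphi _ (@sm_bounded R n k.+2 _ (proj1 (sAB j)))).
have bB j z : bmeas (fun p : L => B j (co p - z)) by exact: (bphi _ (@sm_bounded R n k.+2 _ (proj2 (sAB j)))).
move=> z v; apply: (@rd_quadratic _ _ _ _ _ _ (K * (C2 * nv v ^+ 2))) => t t1.
have bdd : bmeas (fun p : L => dd A B (co p - z) v).
  by apply: bmeas_sum => j; apply: bmeasD; apply: bmeasM => //; exact: bmeas_cst.
have E : conv phi (z + t%:C *: v) - conv phi z -
    t%:C * dd (fun j z => - conv (A j) z) (fun j z => - conv (B j) z) z v =
    cint (leb_sf n) D (fun p => f (co p) *
      (phi (co p - (z + t%:C *: v)) + (-1 * phi (co p - z) + t%:C * dd A B (co p - z) v))).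
  have b1 := bphi z bp; have b2 := bphi (z + t%:C *: v) bp.
  have m1 := bmeas_cst (T := L) (-1 : R[i]); have mt := bmeas_cst (T := L) (t%:C : R[i]).
  rewrite (fineD b2 (bmeasD (bmeasM m1 b1) (bmeasM mt bdd))).
  rewrite (fineD (bmeasM m1 b1) (bmeasM mt bdd)) (fineZ _ b1) (fineZ _ bdd) mulN1r addrA.
  congr (_ + _); rewrite -mulrN; congr (_ * _).
  rewrite /dd finesum; last first.
    by move=> j; apply: bmeasD; apply: bmeasM => //; exact: bmeas_cst.
  rewrite -sumrN; apply: eq_bigr => j _.
  rewrite fineD; [|apply: bmeasM => //; exact: bmeas_cst|apply: bmeasM => //; exact: bmeas_cst].
  by rewrite !fineZ // !mulrN -opprD opprK.
rewrite E -mulrA; apply: hK.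
- by rewrite mulr_ge0 ?sqr_ge0 // mulr_ge0 ?sqr_ge0.
- apply: bmeasD; first exact: bphi.
  apply: bmeasD; apply: bmeasM => //; try exact: bmeas_cst; exact: bphi.
move=> p; have := hC2 (co p - z) (- (t%:C *: v)).
have -> : - (t%:C *: v) = (- t)%:C *: v by rewrite rmorphN scaleNr.
rewrite ddE dd_real nvZ cabs_real normrN exprMn mulrA mulrAC.
have En : (- t)%:C = - t%:C :> R[i] by rewrite rmorphN.
by rewrite En scaleNr (mulNr t%:C) opprK mulN1r opprD !addrA.
Qed.

End convolution.

(** * Convolution of Griffiths negative metrics *)

Section hermitian_forms.
Context {R : realType} {r : nat}.
Implicit Types (M : 'M[R[i]]_r) (s t : 'cV[R[i]]_r).

Lemma hdotE M s t : hdot M s t = \sum_i \sum_j cj (t i 0) * M i j * s j 0.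
Proof.
rewrite /hdot mxE exchange_big /=; apply: eq_bigr => j _.
by rewrite mxE mulr_suml; apply: eq_bigr => i _; rewrite !mxE.
Qed.

Definition qf M s : R := Re (hdot M s s).
Definition herm M : Prop := forall i j, M j i = cj (M i j).
Definition psdm M : Prop := herm M /\ forall s, 0 <= qf M s.
Definition ev (i : 'I_r) : 'cV[R[i]]_r := delta_mx i 0.

Lemma hdotDl M s s' t : hdot M (s + s') t = hdot M s t + hdot M s' t.
Proof. by rewrite /hdot mulmxDr mxE. Qed.

Lemma hdotZl M (a : R[i]) s t : hdot M (a *: s) t = a * hdot M s t.
Proof. by rewrite /hdot -scalemxAr mxE. Qed.

Lemma hdotDr M s t t' : hdot M s (t + t') = hdot M s t + hdot M s t'.
Proof. by rewrite /hdot map_mxD raddfD /= !mulmxDl mxE. Qed.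

Lemma hdotZr M (a : R[i]) s t : hdot M s (a *: t) = cj a * hdot M s t.
Proof. by rewrite /hdot map_mxZ linearZ /= -!scalemxAl mxE. Qed.

Lemma hdotDm M N s t : hdot (M + N) s t = hdot M s t + hdot N s t.
Proof. by rewrite /hdot mulmxDr mulmxDl mxE. Qed.

Lemma hdotZm (a : R[i]) M s t : hdot (a *: M) s t = a * hdot M s t.
Proof. by rewrite /hdot -scalemxAr -scalemxAl mxE. Qed.

Lemma hdot_ev M i j : hdot M (ev j) (ev i) = M i j.
Proof.
rewrite hdotE (bigD1 i) //= (bigD1 j) //= !big1 ?addr0 ?add0r; last first.
- by move=> k /negbTE nk; rewrite [ev j]lock mxE -lock /= mxE nk mulr0.
- move=> k /negbTE nk; apply: big1 => l _.
  by rewrite /ev mxE nk rmorph0 !mul0r.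
by rewrite /ev !mxE !eqxx rmorph1 mul1r mulr1.
Qed.

Lemma hdot_swap M s t : herm M -> hdot M t s = cj (hdot M s t).
Proof.
move=> hM; rewrite !hdotE cj_sum exchange_big; apply: eq_bigr => i _.
rewrite cj_sum; apply: eq_bigr => j _.
by rewrite !cjM conjCK (hM i j); ring.
Qed.

Lemma herm_real M s : herm M -> hdot M s s = (qf M s)%:C.
Proof.
move=> hM; have := hdot_swap s s hM; rewrite /qf; case: (hdot M s s) => a b [] /eqP.
rewrite -subr_eq0 opprK -mulr2n mulrn_eq0 /= => /eqP ->; by [].
Qed.

Lemma qf_ev M i : qf M (ev i) = Re (M i i).
Proof. by rewrite /qf hdot_ev. Qed.

Lemma qfD M N s : qf (M + N) s = qf M s + qf N s.
Proof. by rewrite /qf hdotDm ReD. Qed.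

Lemma qf_scalar (a : R) s : qf (a%:C%:M) s = a * \sum_i cabs (s i 0) ^+ 2.
Proof.
rewrite /qf hdotE Re_sum mulr_sumr; apply: eq_bigr => i _.
rewrite (bigD1 i) //= big1 ?addr0 => [|j /negbTE nj]; last first.
  by rewrite mxE eq_sym nj mulr0n mulr0 mul0r.
rewrite mxE eqxx mulr1n cabs_sqr; case: (s i 0) => x y /=; ring.
Qed.

Lemma polarization M i j (c : R[i]) : herm M -> cabs c = 1 ->
  qf M (ev i + c *: ev j) = qf M (ev i) + qf M (ev j) + 2 * Re (c * M i j).
Proof.
move=> hM c1.
rewrite /qf !hdotDl !hdotDr !hdotZl !hdotZr !hdot_ev !ReD.
have -> : M j i = cj (M i j) by exact: hM.
have : Re c ^+ 2 + Im c ^+ 2 = 1 by rewrite -cabs_sqr c1 expr1n.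
have hj : Im (M j j) = 0.
  have := hM j j; case: (M j j) => a b [] /eqP.
  by rewrite -subr_eq0 opprK -mulr2n mulrn_eq0 /= => /eqP.
have -> : Re (c * (cj c * M j j)) = (Re c ^+ 2 + Im c ^+ 2) * Re (M j j).
  by rewrite mulrA; case: c {c1} => a b; move: hj; case: (M j j) => x y /= ->; ring.
move=> ->; rewrite mul1r.
by case: c {c1} => a b; case: (M i j) => x y /=; ring.
Qed.

(** Positivity on ev i + c ev j for c = 1, -1, i and -i bounds twice the real and twice the
    imaginary part of the entry. *)
Lemma psdm_entry_bound M i j : psdm M -> cabs (M i j) <= qf M (ev i) + qf M (ev j).
Proof.
move=> [hM pM].
have H (c : R[i]) : cabs c = 1 -> `|2 * Re (c * M i j)| <= qf M (ev i) + qf M (ev j).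
  move=> c1; have h1 := pM (ev i + c *: ev j); have h2 := pM (ev i + (- c) *: ev j).
  rewrite !polarization ?cabsN // in h1 h2.
  rewrite mulNr ReN in h2; rewrite ler_norml; apply/andP; split; clear -h1 h2; lra.
have h1 := H 1 cabs1; have h2 := H 'i%C.
have ci : cabs ('i%C : R[i]) = 1 by rewrite /cabs /= expr0n expr1n add0r sqrtr1.
have := cabs_le_ReIm (M i j); have {}h2 := h2 ci.
rewrite mul1r in h1; have -> : Im (M i j) = - Re ('i%C * M i j) by case: (M i j) => x y /=; ring.
rewrite normrN; rewrite !normrM ger0_norm // in h1 h2.
move=> h; clear -h h1 h2; lra.
Qed.

Lemma qf_bound M s (C : R) : psdm M -> (forall i, qf M (ev i) <= C) ->
  qf M s <= 2 * C * (\sum_i cabs (s i 0)) ^+ 2.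
Proof.
move=> pM hC; rewrite /qf hdotE; apply: le_trans (ler_norm _) _; apply: le_trans (Re_le_cabs _) _.
apply: (@le_trans _ _ (\sum_i \sum_j cabs (s i 0) * (2 * C) * cabs (s j 0))).
  apply: le_trans (cabs_sum _ _ _) _; apply: ler_sum => i _.
  apply: le_trans (cabs_sum _ _ _) _; apply: ler_sum => j _.
  rewrite !cabsM cabs_conj; apply: ler_wpM2r; first exact: cabs_ge0.
  apply: ler_wpM2l; first exact: cabs_ge0.
  apply: le_trans (psdm_entry_bound i j pM) _.
  have := hC i; have := hC j; clear; lra.
rewrite expr2 mulr_suml mulr_sumr le_eqVlt; apply/orP; left; apply/eqP.
apply: eq_bigr => i _; rewrite !mulr_sumr; apply: eq_bigr => j _; ring.
Qed.

End hermitian_forms.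

(** * Circle averages and kernel averages *)

Section circle_averages.
Context {R : realType}.
Local Notation mu := (@lebesgue_measure R).
Local Open Scope ereal_scope.

(** The mean that occurs in [psh], for integrands that are only semicontinuous or extended real; on
    continuous real functions it agrees with [cmean]. *)
Definition emean (f : R -> \bar R) : \bar R :=
  ((2 * pi)^-1)%R%:E * \int[mu]_(t in `[0%R, (2 * pi)%R]) f t.

Lemma emean_cmean (f : R -> R) : continuous f -> emean (EFin \o f) = (cmean f)%:E.
Proof. by move=> cf; rewrite cmeanE. Qed.

Let mI : measurable (`[0%R, (2 * pi)%R] : set R).
Proof. exact: measurable_itv. Qed.

Let mpi0 : (0 <= (2 * pi)^-1 :> R)%R.
Proof. by rewrite invr_ge0; exact: (ltW pi20). Qed.

Lemma emean_le (f g : R -> \bar R) : measurable_fun setT f -> measurable_fun setT g ->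
  (forall t, 0 <= f t) -> (forall t, f t <= g t) -> emean f <= emean g.
Proof.
move=> mf mg f0 fg; apply: lee_wpmul2l; first by rewrite lee_fin; exact: mpi0.
apply: ge0_le_integral => //.
- exact: measurable_funS mf.
- exact: measurable_funS mg.
Qed.

Lemma emean_ge0 (f : R -> \bar R) : (forall t, 0 <= f t) -> 0 <= emean f.
Proof.
move=> f0; apply: mule_ge0; first by rewrite lee_fin; exact: mpi0.
by apply: integral_ge0 => t _.
Qed.

Lemma emean_cst (c : R) : emean (fun=> c%:E) = c%:E.
Proof. by rewrite (emean_cmean (@cst_continuous _ _ c)) cmean_cst. Qed.

Lemma emeanZ (c : R) (f : R -> \bar R) : (0 <= c)%R -> measurable_fun setT f ->
  (forall t, 0 <= f t) -> emean (fun t => c%:E * f t) = c%:E * emean f.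
Proof.
move=> c0 mf f0; rewrite /emean ge0_integralZl_EFin //; first by rewrite muleCA.
exact: measurable_funS mf.
Qed.


Variable n : nat.
Local Notation Cn := 'rV[R[i]]_n.
Local Notation L := (leb_type (lebesgue_Cn R n)).
Local Notation co := (@leb_coord R n (lebesgue_Cn R n)).

Lemma intC_ge0 (f : Cn -> \bar R) : (forall w, 0 <= f w) -> 0 <= intC f.
Proof. by move=> f0; apply: integral_ge0. Qed.

Lemma intC_le (f g : Cn -> \bar R) :
  measurable_fun setT (fun p => f (co p)) -> measurable_fun setT (fun p => g (co p)) ->
  (forall w, 0 <= f w) -> (forall w, f w <= g w) -> intC f <= intC g.
Proof.
move=> mf mg f0 fg; by apply: ge0_le_integral.
Qed.

Lemma intCZ (c : R) (f : Cn -> \bar R) : (0 <= c)%R ->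
  measurable_fun setT (fun p => f (co p)) -> (forall w, 0 <= f w) ->
  intC (fun w => c%:E * f w) = c%:E * intC f.
Proof. by move=> c0 mf f0; rewrite /intC ge0_integralZl_EFin. Qed.

Lemma emean_measurable (Phi : L * R -> \bar R) : measurable_fun setT Phi ->
  (forall p, 0 <= Phi p) -> measurable_fun setT (fun p => emean (fun t => Phi (p, t))).
Proof.
move=> mP P0; apply: measurable_funeM.
pose Psi := Phi \_ (setT `*` (`[0%R, (2 * pi)%R] : set R)).
have mPsi : measurable_fun setT Psi.
  apply/(measurable_restrictT Phi (measurableX measurableT mI)).
  exact: measurable_funS mP.
rewrite (_ : (fun p => _) = (fun p => \int[mu]_t Psi (p, t))); last first.
  apply/funext => p; rewrite integral_mkcond; apply: eq_integral => t _.
  by rewrite /Psi !patchE in_setX in_setT.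
apply: measurable_fun_fubini_tonelli_F => //.
by move=> p; rewrite /Psi patchE; case: ifP.
Qed.

Lemma intC_emean (Phi : L * R -> \bar R) : measurable_fun setT Phi ->
  (forall p, 0 <= Phi p) ->
  \int[leb_sf n]_p emean (fun t => Phi (p, t)) =
  emean (fun t => \int[leb_sf n]_p Phi (p, t)).
Proof.
move=> mP P0; rewrite /emean.
pose Psi := Phi \_ (setT `*` (`[0%R, (2 * pi)%R] : set R)).
have mPsi : measurable_fun setT Psi.
  apply/(measurable_restrictT Phi (measurableX measurableT mI)).
  exact: measurable_funS mP.
rewrite ge0_integralZl_EFin //.
- by rewrite (tonelli_set (leb_sf n) mu measurableT mI mP P0).
- by move=> p _; apply: integral_ge0.
- rewrite (_ : (fun p => _) = (fun p => \int[mu]_t Psi (p, t))); last first.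
    apply/funext => p; rewrite integral_mkcond; apply: eq_integral => t _.
    by rewrite /Psi !patchE in_setX in_setT.
  apply: measurable_fun_fubini_tonelli_F => //.
  by move=> p; rewrite /Psi patchE; case: ifP.
Qed.

Lemma measurable_rotation (z : Cn) (e : R) :
  measurable_fun setT (fun q : L * R => (z + e%:C *: (cis q.2 *: co q.1))%R : BCn R n).
Proof.
have mc : measurable_fun setT (fun q : L * R => co q.1 : BCn R n).
  exact: (measurableT_comp (@leb_coord_measurable R n) measurable_fst).
have mr j := measurableT_comp (@measurable_ReBCn R n j) mc.
have mi j := measurableT_comp (@measurable_ImBCn R n j) mc.
have mcos : measurable_fun setT (fun q : L * R => cos q.2).
  apply: measurableT_comp measurable_snd; apply: continuous_measurable_fun.
  by move=> t; exact: continuous_cos.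
have msin : measurable_fun setT (fun q : L * R => sin q.2).
  apply: measurableT_comp measurable_snd; apply: continuous_measurable_fun.
  by move=> t; exact: continuous_sin.
apply: measurable_to_BCn => j.
- rewrite (_ : (fun q => _) = (fun q : L * R => Re (z 0 j) + e *
    (cos q.2 * Re (co q.1 0 j) - sin q.2 * Im (co q.1 0 j)))%R); last first.
    by apply/funext => q; rewrite !mxE /cis; case: (z _ _) => a b; case: (co q.1 _ _) => x y /=; ring.
  apply: measurable_funD; first exact: measurable_cst.
  apply: measurable_funM; first exact: measurable_cst.
  by apply: measurable_funB; apply: measurable_funM; [exact: mcos|exact: (mr j)|exact: msin|exact: (mi j)].
- rewrite (_ : (fun q => _) = (fun q : L * R => Im (z 0 j) + e *
    (cos q.2 * Im (co q.1 0 j) + sin q.2 * Re (co q.1 0 j)))%R); last first.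
    by apply/funext => q; rewrite !mxE /cis; case: (z _ _) => a b; case: (co q.1 _ _) => x y /=; ring.
  apply: measurable_funD; first exact: measurable_cst.
  apply: measurable_funM; first exact: measurable_cst.
  by apply: measurable_funD; apply: measurable_funM; [exact: mcos|exact: (mi j)|exact: msin|exact: (mr j)].
Qed.

(** For each t the rotation w -> cis t w preserves Lebesgue measure and X, so the integral does not
    change when G is averaged over t; Tonelli moves the average inside. *)
Lemma intC_rot_mean (z : Cn) (e : R) (G X : Cn -> R) :
  measurable_fun setT (G : BCn R n -> R) -> measurable_fun setT (X : BCn R n -> R) ->
  (forall w, 0 <= G w)%R -> (forall w, 0 <= X w)%R ->
  (forall t w, X (cis t *: w) = X w)%R ->
  intC (fun w => (G (z + e%:C *: w) * X w)%:E) =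
  intC (fun w => (X w)%:E * emean (fun t => (G (z + e%:C *: (cis t *: w)))%:E)).
Proof.
move=> mG mX G0 X0 rX.
have mrot := measurable_rotation z e.
have mGr : measurable_fun setT (fun q : L * R => (G (z + e%:C *: (cis q.2 *: co q.1)))%:E).
  by apply/measurable_EFinP; exact: (measurableT_comp mG mrot).
have mXq : measurable_fun setT (fun q : L * R => (X (co q.1))%:E).
  apply/measurable_EFinP; apply: (measurableT_comp mX).
  exact: (measurableT_comp (@leb_coord_measurable R n) measurable_fst).
pose Phi (q : L * R) := (X (co q.1))%:E * (G (z + e%:C *: (cis q.2 *: co q.1)))%:E.
have mPhi : measurable_fun setT Phi by exact: emeasurable_funM.
have Phi0 q : 0 <= Phi q by rewrite mule_ge0 ?lee_fin.
transitivity (\int[leb_sf n]_p emean (fun t => Phi (p, t))); last first.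
  apply: eq_integral => p _; rewrite /Phi /= emeanZ //; last by move=> t; rewrite lee_fin.
  exact: (measurableT_comp mGr (measurable_pair1 p)).
rewrite (intC_emean mPhi Phi0).
have mF : measurable_fun setT ((fun w => (G (z + e%:C *: w) * X w)%:E) : BCn R n -> \bar R).
  apply/measurable_EFinP; apply: measurable_funM => //.
  have mG' : measurable_fun setT ((EFin \o G) : BCn R n -> \bar R) by apply/measurable_EFinP.
  have := measurable_affineC e%:C z mG' => /measurable_EFinP; congr measurable_fun.
  by apply/funext => w /=; rewrite addrC.
rewrite [RHS](_ : _ = emean (fun=> intC (fun w => (G (z + e%:C *: w) * X w)%:E))); last first.
  congr emean; apply/funext => t; rewrite -[RHS](intC_rot t mF); last first.
    by move=> w; rewrite lee_fin mulr_ge0.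
  by apply: eq_integral => p _; rewrite /Phi /= rX -EFinM mulrC.
set I := intC _.
have I0 : 0 <= I by apply: intC_ge0 => w; rewrite lee_fin mulr_ge0.
rewrite /emean; move: I I0 => [x _|_|//]; first exact: (esym (emean_cst x)).
(* If the integral is +oo, the mean of that constant dominates every real constant. *)
apply/esym/eq_infty => c.
apply: (@le_trans _ _ (`|c|%R)%:E); first by rewrite lee_fin ler_norm.
rewrite -[X in X <= _]emean_cst; apply: emean_le.
- exact: measurable_cst.
- exact: measurable_cst.
- by move=> t; rewrite lee_fin.
- by move=> t; rewrite leey.
Qed.

End circle_averages.

Section forms_with_parameters.
Context {R : realType} {r : nat}.

Lemma continuous_bigsum (T : topologicalType) (I : Type) (s : seq I) (F : I -> T -> R[i]) (x : T) :
  (forall i, F i @ x --> F i x) ->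
  (fun y => \sum_(i <- s) F i y) @ x --> \sum_(i <- s) F i x.
Proof.
move=> h; elim: s => [|a s IH].
  under eq_fun do rewrite big_nil; rewrite big_nil; exact: cst_continuous.
under eq_fun do rewrite big_cons; rewrite big_cons; exact: (cvgD (h a) IH).
Qed.

Lemma continuous_qf (T : topologicalType) (M : T -> 'M[R[i]]_r) (s : T -> 'cV[R[i]]_r) (x : T) :
  (forall i j, (fun y => M y i j) @ x --> M x i j) ->
  (forall i, (fun y => s y i 0) @ x --> s x i 0) ->
  (fun y => qf (M y) (s y)) @ x --> qf (M x) (s x).
Proof.
move=> cM cs; rewrite /qf; under eq_fun do rewrite hdotE; rewrite hdotE.
have FF : Filter (nbhs x) by exact: nbhs_filter.
apply: cvg_Re; apply: (@continuous_bigsum T _ _ (fun i y => \sum_j cj (s y i 0) * M y i j * s y j 0)) => i.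
apply: (@continuous_bigsum T _ _ (fun j y => cj (s y i 0) * M y i j * s y j 0)) => j.
have c1 := cvg_conjc (cs i); have c2 := cM i j; have c3 := cs j.
exact: (cvgM (cvgM (c1 _) c2) c3).
Qed.

Lemma measurable_qf d (T : measurableType d) (M : T -> 'M[R[i]]_r) (s : T -> 'cV[R[i]]_r) :
  (forall i j, measurable_fun setT (fun x => Re (M x i j))) ->
  (forall i j, measurable_fun setT (fun x => Im (M x i j))) ->
  (forall i, measurable_fun setT (fun x => Re (s x i 0))) ->
  (forall i, measurable_fun setT (fun x => Im (s x i 0))) ->
  measurable_fun setT (fun x => qf (M x) (s x)).
Proof.
move=> rM iM rs is_.
rewrite (_ : (fun x => _) = fun x => \sum_i \sum_j
   ((Re (s x i 0) * Re (M x i j) + Im (s x i 0) * Im (M x i j)) * Re (s x j 0)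
    - (Re (s x i 0) * Im (M x i j) - Im (s x i 0) * Re (M x i j)) * Im (s x j 0))); last first.
  apply/funext => x; rewrite /qf hdotE Re_sum; apply: eq_bigr => i _; rewrite Re_sum.
  apply: eq_bigr => j _.
  by case: (s x i 0) => a b; case: (s x j 0) => c e; case: (M x i j) => y z /=; ring.
apply: measurable_sum => i; apply: measurable_sum => j.
apply: measurable_funB; apply: measurable_funM => //.
  by apply: measurable_funD; apply: measurable_funM.
by apply: measurable_funB; apply: measurable_funM.
Qed.

End forms_with_parameters.

Section kernel_average.
Context {R : realType} {n : nat}.
Local Notation Cn := 'rV[R[i]]_n.
Local Notation co := (@leb_coord R n (lebesgue_Cn R n)).

Lemma chi_measurable : measurable_fun setT (chi : BCn R n -> R).
Proof.
have [cc _] := sm_bounded (@sm_chi R n 0).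
by apply: continuous_BCn => z; exact: (cvg_Re (cc z)).
Qed.

Lemma chi_lower : exists2 m : R, 0 < m & forall z : Cn, pd 0 (2^-1) z -> m <= chi z.
Proof.
exists (\prod_(j < n) beta 0 (4^-1 : R)).
  by apply: prodr_gt0 => j _; apply: beta0_gt0; rewrite invr_gt0.
move=> z /pdE hz; apply: ler_prod => j _; rewrite beta_ge0 /=.
have := hz j; rewrite mxE subr0 => h.
have h0 := cabs_ge0 (z 0 j).
have h2 : cabs (z 0 j) ^+ 2 <= 4^-1.
  rewrite (_ : 4^-1 = 2^-1 ^+ 2 :> R); last by field.
  by rewrite ler_sqr ?nnegrE ?invr_ge0 // ltW.
have h3 : 4^-1 <= 1 - cabs (z 0 j) ^+ 2.
  have E4 : 4 * (4^-1 : R) = 1 by field.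
  move: h2 E4; move: (cabs _ ^+ 2) (4^-1) => x y; clear; lra.
have h4 : (0 : R) < 4^-1 by rewrite invr_gt0.
rewrite /beta h4 (lt_le_trans h4 h3) !expr0 !mul1r ler_expR lerN2 lef_pV2 ?posrE //.
exact: lt_le_trans h4 h3.
Qed.

Let c0E := intC (EFin \o (chi : Cn -> R)).
Let mpd (s : R) : measurable (co @^-1` (pd 0 s)).
Proof. by apply: measurable_coord_open; exact: pd_open. Qed.

Let mchi : measurable_fun setT (fun p => (chi (co p))%:E).
Proof.
by apply/measurable_EFinP; exact: (measurableT_comp chi_measurable (@leb_coord_measurable R n)).
Qed.

Definition kmass : R := fine (intC (EFin \o (chi : Cn -> R))).

Lemma kmassP : 0 < kmass /\ intC (EFin \o (chi : Cn -> R)) = kmass%:E.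
Proof.
have [_ [M [M0 hM]]] := sm_bounded (@sm_chi R n 0).
have fin : (c0E < +oo)%E.
  have [_ h2] := @leb_pd R n 0 1 ltr01.
  apply: (@le_lt_trans _ _ (\int[leb_sf n]_(p in co @^-1` (pd 0 1)) M%:E)%E); last first.
    by rewrite integral_cst // lte_mul_pinfty // lee_fin.
  rewrite /c0E /intC [X in (_ <= X)%E]integral_mkcond; apply: ge0_le_integral => //.
  - by move=> p _; rewrite lee_fin chi_ge0.
  - by apply/(measurable_restrictT _ (mpd 1)); exact: measurable_cst.
  - move=> p _ /=; rewrite patchE; case: ifPn => [_|/negP hp].
      rewrite lee_fin; have := hM (co p); rewrite cabs_real ger0_norm ?chi_ge0 //.
    by rewrite chi_eq0 // => hp'; apply: hp; apply: mem_set.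
have pos : (0 < c0E)%E.
  have [m m0 hm] := chi_lower.
  have [h1 _] := @leb_pd R n 0 2^-1 ltac:(by rewrite invr_gt0).
  apply: (@lt_le_trans _ _ (\int[leb_sf n]_(p in co @^-1` (pd 0 2^-1)) m%:E)%E).
    by rewrite integral_cst // mule_gt0.
  rewrite /c0E /intC [X in (X <= _)%E]integral_mkcond; apply: ge0_le_integral => //.
  - by move=> p _; rewrite patchE; case: ifP => // _; rewrite lee_fin ltW.
  - by apply/(measurable_restrictT _ (mpd 2^-1)); exact: measurable_cst.
  - move=> p _ /=; rewrite patchE; case: ifPn => [/set_mem hp|_].
      by rewrite lee_fin; exact: hm.
    by rewrite lee_fin chi_ge0.
have E : c0E = kmass%:E by rewrite /kmass -/c0E fineK // fin_real // (lt_le_trans _ (ltW pos)) //= ?ltNy0.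
by split=> //; rewrite -lte_fin -E.
Qed.

(** The mean against the normalised kernel. Pointwise inequalities on the unit polydisc pass to it,
    which [conv] does not show directly. *)
Definition kavg (Psi : Cn -> \bar R) : \bar R :=
  ((kmass^-1)%:E * intC (fun w => (chi w)%:E * Psi w))%E.

Let ki0 : 0 <= kmass^-1.
Proof. by rewrite invr_ge0 ltW //; have [] := kmassP. Qed.

Lemma kavg_ge0 Psi : (forall w, 0 <= Psi w)%E -> (0 <= kavg Psi)%E.
Proof.
move=> P0; rewrite mule_ge0 ?lee_fin ?ki0 //; apply: intC_ge0 => w.
by rewrite mule_ge0 ?lee_fin ?chi_ge0.
Qed.

Lemma kavg_le (Psi1 Psi2 : Cn -> \bar R) :
  measurable_fun setT (fun p => Psi1 (co p)) -> measurable_fun setT (fun p => Psi2 (co p)) ->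
  (forall w, 0 <= Psi1 w)%E -> (forall w, pd 0 1 w -> Psi1 w <= Psi2 w)%E ->
  (kavg Psi1 <= kavg Psi2)%E.
Proof.
move=> m1 m2 P0 h; apply: lee_wpmul2l; first by rewrite lee_fin ki0.
apply: intC_le.
- exact: (emeasurable_funM mchi m1).
- exact: (emeasurable_funM mchi m2).
- by move=> w; rewrite mule_ge0 ?lee_fin ?chi_ge0.
- move=> w; have [hw|hw] := pselect (pd 0 1 w).
    by apply: lee_wpmul2l; [rewrite lee_fin chi_ge0|exact: h].
  by rewrite chi_eq0 // !mul0e.
Qed.

Lemma kavg_cst (c : R) : 0 <= c -> kavg (fun=> c%:E) = c%:E.
Proof.
move=> c0; have [k0 kE] := kmassP; rewrite /kavg.
rewrite (_ : (fun w => _) = (fun w : Cn => c%:E * (EFin \o (chi : Cn -> R)) w)%E); last first.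
  by apply/funext => w; rewrite muleC.
rewrite intCZ //; last by move=> w; rewrite lee_fin chi_ge0.
by rewrite kE -!EFinM mulrCA mulVf ?mulr1 // lt0r_neq0.
Qed.

Lemma kavg_rot (z : Cn) (e : R) (G : Cn -> R) :
  measurable_fun setT (G : BCn R n -> R) -> (forall w, 0 <= G w) ->
  kavg (fun w => (G (z + e%:C *: w))%:E) =
  kavg (fun w => emean (fun t => (G (z + e%:C *: (cis t *: w)))%:E)).
Proof.
move=> mG G0; rewrite /kavg -(intC_rot_mean z e mG chi_measurable G0 (@chi_ge0 R n)).
  by congr (_ * intC _)%E; apply/funext => w; rewrite -EFinM mulrC.
by move=> t w; exact: chi_rot.
Qed.

Lemma kavg_emean (Phi : Cn -> R -> \bar R) :
  measurable_fun setT (fun q : leb_type (lebesgue_Cn R n) * R => Phi (co q.1) q.2) ->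
  (forall w t, 0 <= Phi w t)%E ->
  kavg (fun w => emean (Phi w)) = emean (fun t => kavg (fun w => Phi w t)).
Proof.
move=> mP P0; rewrite /kavg.
pose Psi (q : leb_type (lebesgue_Cn R n) * R) := ((chi (co q.1))%:E * Phi (co q.1) q.2)%E.
have mPsi : measurable_fun setT Psi.
  by apply: emeasurable_funM => //; exact: (measurableT_comp mchi measurable_fst).
have Psi0 q : (0 <= Psi q)%E by rewrite mule_ge0 ?lee_fin ?chi_ge0.
have mPt w : measurable_fun setT (fun t => Phi (co w) t).
  exact: (measurableT_comp mP (measurable_pair1 w)).
have := intC_emean mPsi Psi0.
rewrite (_ : \int[leb_sf n]_p emean _ = intC (fun w => (chi w)%:E * emean (Phi w)))%E; last first.
  apply: eq_integral => p _; rewrite /Psi /= emeanZ // chi_ge0 //.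
move=> ->; rewrite -emeanZ //; last first.
  by move=> t; apply: integral_ge0 => p _.
apply: measurable_fun_fubini_tonelli_G => //.
Qed.

End kernel_average.

Lemma cjR {R : realType} (a : R) : cj (a%:C : R[i]) = a%:C.
Proof. exact: conjc_real. Qed.

Section conv_conj.
Context {R : realType} {d} {T : measurableType d}.
Variables (mu : {measure set T -> \bar R}) (D : set T).
Hypothesis mD : measurable D.
Hypothesis fD : (mu D < +oo)%E.

Lemma cint_conj (g : T -> R[i]) : bmeas g -> cint mu D (fun x => cj (g x)) = cj (cint mu D g).
Proof.
move=> bg; have h1 : bmeas (fun x => cj (g x)).
  have [rg jg [M hM]] := bg; split; last by exists M => x; rewrite cabs_conj.
  - by under eq_fun do rewrite ReJ.
  - by under eq_fun do rewrite ImJ; exact: measurable_funN.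
have h2 := cintD mD fD bg h1.
have h3 := cintD mD fD bg (bmeasM (bmeas_cst (T := T) (-1 : R[i])) h1).
rewrite (cintZ mD fD _ h1) in h3.
apply/eqP; rewrite eq_complex; apply/andP; split; apply/eqP.
  by rewrite [RHS]ReJ /cint /=; apply: eq_Rintegral => x _; rewrite ReJ.
have : Im (cint mu D (fun x => g x + cj (g x))) = 0.
  rewrite /cint /=; under eq_Rintegral do rewrite ImD ImJ subrr.
  by rewrite Rintegral_cst // mul0r.
by rewrite h2 ImD ImJ => /eqP; rewrite addrC addr_eq0 => /eqP.
Qed.

End conv_conj.

(** * Construction of the smoothed metrics *)

Section griffiths_smoothing.
Context {R : realType} {n r : nat}.
Local Notation Cn := 'rV[R[i]]_n.
Local Notation co := (@leb_coord R n (lebesgue_Cn R n)).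
Variables (D : set Cn) (H : Cn -> 'M[R[i]]_r) (adm : (Cn -> 'cV[R[i]]_r) -> Prop).

(* The fields against which negativity is tested; they are affine, and
   translating the argument of [H] translates the field. *)
Record admissible_fields : Prop := AdmissibleFields {
  adm_cst : forall s, adm (fun=> s);
  adm_shift : forall u v, adm u -> adm (fun y => u (y - v));
  adm_affine : forall u, adm u ->
    exists (P : 'M[R[i]]_(r, n)) c, forall z, u z = P *m z^T + c }.

(** The submean inequality is required only on the discs inside some polydisc around each point.
    This is what a manifold can offer, since a disc has to lie in a single chart for negativity to
    be used. *)
Record locally_negative : Prop := LocallyNegative {
  neg_open : open D;
  neg_psd : forall z, psdm (H z);
  neg_usc : forall u, adm u -> forall z (c : R), D z -> qf (H z) (u z) < c ->
    \forall w \near z, qf (H w) (u w) < c;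
  neg_sub : forall z, D z -> exists d : R, [/\ 0 < d, pd z d `<=` D &
    forall u a b, adm u -> (forall l, cabs l <= 1 -> pd z d (a + l *: b)) ->
      ((qf (H a) (u a))%:E <=
        emean (fun t => (qf (H (a + cis t *: b)) (u (a + cis t *: b)))%:E))%E] }.

Hypothesis Aadm : admissible_fields.
Hypothesis N : locally_negative.

Let posH := neg_psd N.

(** A single radius that controls everything near z. The bounds by 1 / d on positions and diagonal
    entries ensure that the polydisc lies in [QQ nu] as soon as [eps nu] is at most d. *)
Definition good (d : R) (z : Cn) : Prop :=
  [/\ 0 < d, pd z d `<=` D,
      forall u a b, adm u -> (forall l, cabs l <= 1 -> pd z d (a + l *: b)) ->
      ((qf (H a) (u a))%:E <=
        emean (fun t => (qf (H (a + cis t *: b)) (u (a + cis t *: b)))%:E))%E &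
      forall y, pd z d y -> pd 0 d^-1 y /\ forall i, qf (H y) (ev i) < d^-1].

Lemma good_pd d z z' s : 0 <= s < d -> good d z -> pd z s z' -> good (d - s) z'.
Proof.
move=> /andP[s0 sd] [d0 dD sub b] zz'.
have pp : pd z' (d - s) `<=` pd z d.
  by move=> y hy; rewrite -(subrKC s d); exact: pd_triangle zz' hy.
split; first by rewrite subr_gt0.
- by move=> y /pp /dD.
- by move=> u a b' au h; apply: sub => // l /h /pp.
- move=> y /pp /b [h1 h2].
  have h3 : d^-1 <= (d - s)^-1 by rewrite lef_pV2 ?posrE ?subr_gt0 // gerBl.
  split; first exact: pd_sub h3 _ h1.
  by move=> i; apply: lt_le_trans (h2 i) h3.
Qed.

Lemma nbhs_all (I : finType) (z : Cn) (P : I -> Cn -> Prop) :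
  (forall i, \forall w \near z, P i w) -> \forall w \near z, forall i, P i w.
Proof. by move=> h; exact: (filter_forall _ h). Qed.

Lemma good_exists z : D z -> exists d, good d z.
Proof.
move=> Dz; have [d1 [d10 d1D sub]] := neg_sub N Dz.
have uz i : exists C : R, 0 < C /\ \forall w \near z, qf (H w) (ev i) < C.
  exists (qf (H z) (ev i) + 1); split; first by rewrite ltr_wpDl // (proj2 (posH z)).
  by apply: (neg_usc N (adm_cst Aadm (ev i)) Dz); rewrite ltrDl.
have /choice[C hC] := uz.
have [d2 d20 d2h] : exists2 d, 0 < d & pd z d `<=` [set w | forall i, qf (H w) (ev i) < C i].
  by apply/nbhs_pd; apply: nbhs_all => i; have [] := hC i.
(* B dominates the moduli |z_j| and all the local bounds C i, and d <= 1 / (B + 1) turns this into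
   the bounds by 1 / d. *)
pose B := 1 + \sum_i C i + \sum_j cabs (z 0 j).
have C0 i : 0 <= C i by have [/ltW] := hC i.
have S0 : 0 <= \sum_i C i by apply: sumr_ge0 => i _.
have Z0 : 0 <= \sum_j cabs (z 0 j) by apply: sumr_ge0 => j _; exact: cabs_ge0.
have B1 : 1 <= B by rewrite /B -addrA lerDl addr_ge0.
have B0 : 0 < B by exact: lt_le_trans B1.
pose d := Num.min (Num.min d1 d2) (Num.min 1 (B + 1)^-1).
have B10 : 0 < B + 1 by rewrite addr_gt0.
have d0 : 0 < d by rewrite !lt_min d10 d20 ltr01 invr_gt0 B10.
have dd1 : d <= d1 by rewrite !ge_min lexx.
have dd2 : d <= d2 by rewrite !ge_min lexx orbT.
have dl1 : d <= 1 by rewrite !ge_min lexx !orbT.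
have dB : B + 1 <= d^-1.
  by rewrite -[B + 1]invrK lef_pV2 ?posrE ?invr_gt0 // !ge_min lexx !orbT.
exists d; split=> //.
- by move=> y /(pd_sub dd1) /d1D.
- by move=> u a b au h; apply: sub => // l /h /(pd_sub dd1).
- move=> y hy; split.
    apply/pdE => j; rewrite mxE subr0; apply: lt_le_trans dB.
    have hj := (pdE _ _ _).1 hy j.
    have -> : y 0 j = (y 0 j - z 0 j) + z 0 j by rewrite subrK.
    apply: le_lt_trans (cabsD _ _) _; rewrite addrC; apply: ler_ltD; last exact: lt_le_trans dl1.
    rewrite /B (bigD1 j) //=.
    have := sumr_ge0 _ (fun k (_ : k != j) => cabs_ge0 (z 0 k)) : 0 <= \sum_(k | k != j) cabs (z 0 k).
    by move=> v0; rewrite addrCA lerDl addr_ge0 // addr_ge0.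
  move=> i; apply: lt_le_trans (d2h y (pd_sub dd2 hy) i) _; apply: le_trans dB.
  rewrite /B (bigD1 i) //=.
  have := sumr_ge0 _ (fun k (_ : k != i) => C0 k) : 0 <= \sum_(k | k != i) C k.
  by move=> v0; rewrite -!addrA addrCA lerDl !addr_ge0.
Qed.

(** Increasing open sets of finite measure on which the entries of H are bounded. Cutting off to
    them makes the convolution meaningful on all of C^n, and every compact part of D is eventually
    inside. *)
Definition QQ (nu : nat) : set Cn := [set z | [/\ D z, pd 0 nu.+1%:R z &
  forall i, qf (H z) (ev i) < nu.+1%:R]].

Lemma open_usc (u : Cn -> 'cV[R[i]]_r) (A : set Cn) (c : R) : adm u -> open A -> A `<=` D ->
  open [set z | A z /\ qf (H z) (u z) < c].
Proof.
move=> au oA AD; rewrite openE => z [Az hz].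
near=> w; split; near: w; first exact: open_nbhs_nbhs.
by apply: (neg_usc N au) => //; exact: AD.
Unshelve. all: by end_near. Qed.

Lemma QQ_open nu : open (QQ nu).
Proof.
rewrite openE => z [Dz zn hz]; near=> w; split; near: w.
- by apply: open_nbhs_nbhs; split => //; exact: neg_open N.
- by apply: open_nbhs_nbhs; split => //; exact: pd_open.
- by apply: nbhs_all => i; apply: (neg_usc N (adm_cst Aadm (ev i)) Dz); exact: hz.
Unshelve. all: by end_near. Qed.

Definition HQ nu z : 'M[R[i]]_r := if z \in QQ nu then H z else 0.

Lemma HQ_in nu z : QQ nu z -> HQ nu z = H z.
Proof. by move=> h; rewrite /HQ mem_set. Qed.

Lemma HQ_out nu z : ~ QQ nu z -> HQ nu z = 0.
Proof. by move=> h; rewrite /HQ memNset. Qed.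

Lemma qf0 (s : 'cV[R[i]]_r) : qf 0 s = 0.
Proof. by rewrite /qf /hdot mulmx0 mul0mx mxE. Qed.

Lemma psd_HQ nu z : psdm (HQ nu z).
Proof.
rewrite /HQ; case: ifP => // _; split; last by move=> s; rewrite qf0.
by move=> i j; rewrite !mxE rmorph0.
Qed.

Lemma HQ_bound nu z i j : cabs (HQ nu z i j) <= nu.+1%:R + nu.+1%:R.
Proof.
apply: le_trans (psdm_entry_bound i j (psd_HQ nu z)) _; rewrite /HQ.
by case: ifPn => [/set_mem[_ _ h]|_]; [apply: lerD; apply: ltW|rewrite !qf0 addr0 addr_ge0].
Qed.

(** By semicontinuity the sublevel sets are open within [QQ nu]; outside, the form is 0, so the sign
    of the level decides. *)
Lemma measurable_HQ nu s : measurable_fun setT ((fun z => qf (HQ nu z) s) : BCn R n -> R).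
Proof.
apply: (measurability _ (RGenInftyO.measurableE R)) => //.
move=> _ [_ [c ->] <-]; rewrite setTI.
have [c0|c0] := leP c 0.
  rewrite (_ : _ @^-1` _ = set0) //; apply/seteqP; split => // z /=.
  by rewrite in_itv /= => h; have := proj2 (psd_HQ nu z) s; rewrite leNgt (lt_le_trans h c0).
rewrite (_ : _ @^-1` _ = ~` (QQ nu) `|` [set z | QQ nu z /\ qf (H z) s < c]); last first.
  apply/seteqP; split => z /=; rewrite in_itv /=.
    have [hz|hz] := pselect (QQ nu z); last by left.
    by rewrite HQ_in //; right.
  by case=> [hz|[hz h]]; [rewrite HQ_out // qf0|rewrite HQ_in].
apply: measurableU.
  by apply: measurableC; apply: open_BCn; exact: QQ_open.
by apply: open_BCn; apply: (@open_usc (fun=> s) (QQ nu) c (adm_cst Aadm s)); [exact: QQ_open|move=> z []].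
Qed.

(** Polarization recovers the entries from the quadratic form: c = 1 gives the real part and c = -i
    the imaginary part. *)
Lemma measurable_HQ_entries nu i j :
  measurable_fun setT ((fun z => Re (HQ nu z i j)) : BCn R n -> R) /\
  measurable_fun setT ((fun z => Im (HQ nu z i j)) : BCn R n -> R).
Proof.
have ci : cabs (- 'i%C : R[i]) = 1.
  by rewrite cabsN /cabs /= expr0n expr1n add0r sqrtr1.
have E (c : R[i]) : cabs c = 1 -> measurable_fun setT ((fun z => Re (c * HQ nu z i j)) : BCn R n -> R).
  move=> c1; rewrite (_ : (fun z => _) = fun z => 2^-1 * (qf (HQ nu z) (ev i + c *: ev j) -
      qf (HQ nu z) (ev i) - qf (HQ nu z) (ev j))).
    apply: measurable_funM; first exact: measurable_cst.
    by apply: measurable_funB; [apply: measurable_funB|]; exact: measurable_HQ.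
  apply/funext => z; rewrite polarization //; last exact: (proj1 (psd_HQ nu z)).
  by field.
split; first by have := E 1 cabs1; under eq_fun do rewrite mul1r.
have := E _ ci; congr measurable_fun; apply/funext => z.
by case: (HQ nu z i j) => x y /=; ring.
Qed.

Lemma bmeas_HQ nu i j : bmeas ((fun z => HQ nu z i j) : BCn R n -> R[i]).
Proof.
have [h1 h2] := measurable_HQ_entries nu i j; split=> //.
by exists (nu.+1%:R + nu.+1%:R) => z; exact: HQ_bound.
Qed.

Let mQ nu : measurable (QQ nu : set (BCn R n)).
Proof. by apply: open_BCn; exact: QQ_open. Qed.

Let mDQ nu : measurable (co @^-1` (QQ nu)).
Proof. by apply: measurable_coord_open; exact: QQ_open. Qed.

Lemma QQ_finite nu : (leb_sf n (co @^-1` (QQ nu)) < +oo)%E.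
Proof.
have [_ h] := @leb_pd R n 0 nu.+1%:R ltac:(by rewrite ltr0n).
apply: le_lt_trans h; apply: le_measure; rewrite ?inE //.
- by apply: measurable_coord_open; exact: pd_open.
- by move=> p [].
Qed.

Definition eps (nu : nat) : R := nu.+1%:R^-1.
Lemma eps_gt0 nu : 0 < eps nu. Proof. by rewrite invr_gt0 ltr0n. Qed.

Definition chis (nu : nat) (y : Cn) : R[i] := (chi ((eps nu)^-1%:C *: y))%:C.

Lemma sm_chis k nu : sm k (chis nu).
Proof. exact: (@sm_dilate R n k (fun y => (chi y)%:C) (eps nu)^-1 (sm_chi k)). Qed.

(** This is 1 / (kmass eps^(2 n)): the dilated kernel [chis nu] has mass kmass eps^(2 n). *)
Definition knu (nu : nat) : R := (kmass (R := R) (n := n))^-1 * ((eps nu)^-1^-1 * (eps nu)^-1^-1) ^- n.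

Definition Hc nu (z : Cn) : 'M[R[i]]_r :=
  \matrix_(i, j) ((knu nu)%:C * conv (QQ nu) (fun y => HQ nu y i j) (chis nu) z).

Definition Hs nu (z : Cn) : 'M[R[i]]_r := Hc nu z + (eps nu)%:C%:M.

Lemma sm_Hc k nu i j : sm k (fun z => Hc nu z i j).
Proof.
under eq_fun do rewrite mxE; apply: smM; first exact: sm_cst.
exact: (sm_conv (mQ nu) (QQ_finite nu) (bmeas_HQ nu i j) (sm_chis k.+2 nu)).
Qed.

Lemma sm_Hs k nu i j : sm k (fun z => Hs nu z i j).
Proof.
under eq_fun do rewrite mxE; apply: smD; first exact: sm_Hc.
under eq_fun do rewrite mxE; exact: sm_cst.
Qed.

Let bphi nu z : bmeas (fun p => chis nu (co p - z)).
Proof.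
have := bmeas_bounded_cont z (sm_bounded (sm_chis 0 nu)).
exact: bmeas_coord.
Qed.

Lemma herm_Hc nu z : herm (Hc nu z).
Proof.
move=> i j; rewrite !mxE cjM; congr (_ * _); first by rewrite cjR.
rewrite /conv -cint_conj //.
- congr cint; apply/funext => p; rewrite cjM (proj1 (psd_HQ nu (co p)) i j).
  by congr (_ * _); rewrite /chis cjR.
- exact: QQ_finite.
- by apply: bmeasM; [exact: (bmeas_coord (bmeas_HQ nu i j))|exact: bphi].
Qed.

(** The bridge between the two forms of the convolution: [conv] carries the smoothness in z, [kavg]
    the inequalities. *)
Lemma qf_Hc nu z s : (qf (Hc nu z) s)%:E =
  kavg (fun w => (qf (HQ nu (z + (eps nu)%:C *: w)) s)%:E).
Proof.
pose g p := hdot (HQ nu (co p)) s s * chis nu (co p - z).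
have bF i j : bmeas (fun p => HQ nu (co p) i j * chis nu (co p - z)).
  by apply: bmeasM; [exact: (bmeas_coord (bmeas_HQ nu i j))|exact: bphi].
have gE : g = fun p => \sum_i \sum_j (cj (s i 0) * s j 0) * (HQ nu (co p) i j * chis nu (co p - z)).
  apply/funext => p; rewrite /g hdotE mulr_suml; apply: eq_bigr => i _.
  by rewrite mulr_suml; apply: eq_bigr => j _; ring.
have bG : bmeas g.
  rewrite gE; apply: bmeas_sum => i; apply: bmeas_sum => j.
  by apply: bmeasM => //; exact: bmeas_cst.
have E : hdot (Hc nu z) s s = (knu nu)%:C * cint (leb_sf n) (co @^-1` (QQ nu)) g.
  rewrite gE (cint_sum (mDQ nu) (QQ_finite nu)); last first.
    by move=> i; apply: bmeas_sum => j; apply: bmeasM => //; exact: bmeas_cst.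
  rewrite hdotE mulr_sumr; apply: eq_bigr => i _.
  rewrite (cint_sum (mDQ nu) (QQ_finite nu)); last first.
    by move=> j; apply: bmeasM => //; exact: bmeas_cst.
  rewrite mulr_sumr; apply: eq_bigr => j _.
  rewrite (cintZ (mDQ nu) (QQ_finite nu) _ (bF i j)) mxE /conv; ring.
have gR p : Re (g p) = qf (HQ nu (co p)) s * chi ((eps nu)^-1%:C *: (co p - z)).
  by rewrite /g /chis ReM /= mulr0 subr0.
have g0 p : 0 <= Re (g p) by rewrite gR mulr_ge0 ?chi_ge0 // (proj2 (psd_HQ nu _)).
have kE : (qf (Hc nu z) s)%:E = ((knu nu)%:E * (Re (cint (leb_sf n) (co @^-1` (QQ nu)) g))%:E)%E.
  by rewrite /qf E ReM /= mul0r subr0.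
rewrite kE (Re_cint (mDQ nu) (QQ_finite nu) bG g0).
pose G (y : Cn) := (qf (HQ nu y) s * chi ((eps nu)^-1%:C *: (y - z)))%:E.
have mchis : measurable_fun setT ((fun y : Cn => chi ((eps nu)^-1%:C *: (y - z))) : BCn R n -> R).
  have [m _ _] := bmeas_bounded_cont z (sm_bounded (sm_chis 0 nu)); exact: m.
have mG : measurable_fun setT (G : BCn R n -> \bar R).
  by apply/measurable_EFinP; apply: measurable_funM => //; exact: measurable_HQ.
have G0 y : (0 <= G y)%E by rewrite lee_fin mulr_ge0 ?chi_ge0 // (proj2 (psd_HQ nu _)).
have -> : (\int[leb_sf n]_(p in co @^-1` (QQ nu)) (Re (g p))%:E = intC G)%E.
  rewrite integral_mkcond /intC; apply: eq_integral => p _; rewrite patchE /G.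
  case: ifPn => [_|/negP h]; first by rewrite gR.
  by rewrite HQ_out ?qf0 ?mul0r // => h'; apply: h; exact: mem_set.
(* The substitution y = z + eps w, after which the kernel no longer depends on z or nu. *)
have := intC_scale z (eps_gt0 nu) mG G0.
rewrite /kavg (_ : (fun w => G ((eps nu)%:C *: w + z)) =
    (fun w => (chi w)%:E * (qf (HQ nu (z + (eps nu)%:C *: w)) s)%:E)%E); last first.
  apply/funext => w; rewrite /G addrK scalerA -rmorphM mulVf ?lt0r_neq0 ?eps_gt0 //.
  by rewrite rmorph1 scale1r -EFinM mulrC addrC.
move=> ->; rewrite muleA -EFinM /knu; congr (_ * _)%E; congr (_%:E).
by rewrite -exprVn invfM !invrK.
Qed.

Lemma psd_Hc nu z : psdm (Hc nu z).
Proof.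
split; first exact: herm_Hc.
move=> s; rewrite -lee_fin qf_Hc; apply: kavg_ge0 => w.
by rewrite lee_fin (proj2 (psd_HQ nu _)).
Qed.

Lemma qf_Hs nu z s : qf (Hs nu z) s = qf (Hc nu z) s + eps nu * \sum_i cabs (s i 0) ^+ 2.
Proof. by rewrite /Hs qfD qf_scalar. Qed.

Lemma herm_Hs nu z : herm (Hs nu z).
Proof.
have scal : herm ((eps nu)%:C%:M : 'M[R[i]]_r).
  by move=> i j; rewrite !mxE eq_sym; case: (i == j); rewrite ?mulr1n ?mulr0n ?rmorph0 ?cjR.
by move=> i j; have := herm_Hc nu z i j; have := scal i j; rewrite !mxE => -> ->; rewrite cjD.
Qed.

Lemma sum_sqr_gt0 (s : 'cV[R[i]]_r) : s != 0 -> 0 < \sum_i cabs (s i 0) ^+ 2.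
Proof.
move=> s0; have [i hi] : exists i, s i 0 != 0.
  apply: contrapT => h; move/eqP: s0; apply; apply/matrixP => i j; rewrite ord1 mxE.
  by apply/eqP; apply: contrapT => hi; apply: h; exists i; apply/negP.
rewrite (bigD1 i) //= ltr_wpDr // ?sumr_ge0 // => [k _|]; first exact: sqr_ge0.
by rewrite exprn_gt0 // lt_neqAle cabs_ge0 andbT eq_sym cabs_eq0.
Qed.

Lemma posdef_Hs nu z s : s != 0 -> 0 < qf (Hs nu z) s.
Proof.
move=> s0; rewrite qf_Hs ltr_wpDl ?(proj2 (psd_Hc nu z)) //.
by rewrite mulr_gt0 ?eps_gt0 // sum_sqr_gt0.
Qed.

End griffiths_smoothing.

Section line_maps.
Context {R : realType} {n : nat}.
Local Notation Cn := 'rV[R[i]]_n.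
Local Notation co := (@leb_coord R n (lebesgue_Cn R n)).

Lemma scale_swap (a b : R[i]) (w : Cn) : a *: (b *: w) = b *: (a *: w).
Proof. by rewrite !scalerA mulrC. Qed.

Lemma continuous_line_coord (z b : Cn) j : continuous (fun l : R[i] => (z + l *: b) 0 j).
Proof.
rewrite (_ : (fun l : R[i] => _) = (fun l : R[i] => z 0 j + l * b 0 j)); last first.
  by apply/funext => l; rewrite !mxE.
move=> l; apply: (@cdiff_continuous R); exists (b 0 j) => e e0; exists 1 => // h _.
rewrite (_ : _ - _ - _ = 0) ?cabs0 ?mulr_ge0 ?cabs_ge0 // ?(ltW e0) //; ring.
Qed.

Lemma continuous_line (z b : Cn) : continuous (fun l : R[i] => z + l *: b).
Proof.
move=> l; apply: (@cvg_rV R n _ (nbhs l)) => j; exact: continuous_line_coord.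
Qed.

Lemma continuous_circle (z b : Cn) : continuous (fun t : R => z + cis t *: b).
Proof.
move=> t; apply: (@continuous_comp _ _ _ (fun t : R => cis t) (fun l : R[i] => z + l *: b)).
  exact: continuous_cis.
exact: continuous_line.
Qed.

Lemma continuous_circle_coord (z b : Cn) j : continuous (fun t : R => (z + cis t *: b) 0 j).
Proof.
move=> t; apply: (@continuous_comp _ _ _ (fun t : R => cis t) (fun l : R[i] => (z + l *: b) 0 j)).
  exact: continuous_cis.
exact: continuous_line_coord.
Qed.

Lemma kavg_circle_mean (z : Cn) (e : R) (G : Cn -> R) :
  measurable_fun setT (G : BCn R n -> R) -> (forall w, 0 <= G w) ->
  kavg (fun w => (G (z + e%:C *: w))%:E) =
  kavg (fun w => emean (fun t => (G (z + cis t *: (e%:C *: w)))%:E)).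
Proof.
move=> mG G0; rewrite (kavg_rot z e mG G0); apply: congr1; apply/funext => w.
by apply: congr1; apply/funext => t; rewrite scale_swap.
Qed.

Lemma pd_disc (z : Cn) (e : R) (l : R[i]) (w : Cn) : 0 < e -> cabs l <= 1 -> pd 0 1 w ->
  pd z e (z + l *: (e%:C *: w)).
Proof.
move=> e0 l1 /pdE hw; apply/pdE => j; have := hw j; rewrite !mxE subr0 => h.
rewrite addrAC subrr add0r !cabsM cabs_real (gtr0_norm e0).
apply: (@le_lt_trans _ _ (1 * (e * cabs (w 0 j)))).
  by apply: ler_wpM2r => //; rewrite mulr_ge0 ?cabs_ge0 // ltW.
by rewrite mul1r gtr_pMr.
Qed.

Lemma measurable_circle_shift (z b : Cn) (e : R) :
  measurable_fun setT (fun q : leb_type (lebesgue_Cn R n) * R =>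
    (z + cis q.2 *: b) + e%:C *: co q.1 : BCn R n).
Proof.
have mc : measurable_fun setT (fun q : leb_type (lebesgue_Cn R n) * R => co q.1 : BCn R n).
  exact: (measurableT_comp (@leb_coord_measurable R n) measurable_fst).
have mr j := measurableT_comp (@measurable_ReBCn R n j) mc.
have mi j := measurableT_comp (@measurable_ImBCn R n j) mc.
have mz (f : R -> R) : continuous f ->
    measurable_fun setT (fun q : leb_type (lebesgue_Cn R n) * R => f q.2).
  by move=> cf; apply: measurableT_comp measurable_snd; exact: continuous_measurable_fun.
have cz j (t : R) : (fun t : R => (z + cis t *: b) 0 j) @ t --> (z + cis t *: b) 0 j.
  exact: continuous_circle_coord.
apply: measurable_to_BCn => j.
- rewrite (_ : (fun q => _) = (fun q => Re ((z + cis q.2 *: b) 0 j) + e * Re (co q.1 0 j))).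
    apply: measurable_funD; first by apply: (mz (fun t => Re ((z + cis t *: b) 0 j))) => t; exact: (cvg_Re (cz j t)).
    by apply: measurable_funM; [exact: measurable_cst|exact: (mr j)].
  by apply/funext => q; rewrite [in LHS]mxE [X in _ + X]mxE ReD ReM /= mul0r subr0.
- rewrite (_ : (fun q => _) = (fun q => Im ((z + cis q.2 *: b) 0 j) + e * Im (co q.1 0 j))).
    apply: measurable_funD; first by apply: (mz (fun t => Im ((z + cis t *: b) 0 j))) => t; exact: (cvg_Im (cz j t)).
    by apply: measurable_funM; [exact: measurable_cst|exact: (mi j)].
  by apply/funext => q; rewrite [in LHS]mxE [X in _ + X]mxE ImD ImM /= mul0r addr0.
Qed.

End line_maps.

(** * Comparison of the smoothed metrics with the original one *)

Section smoothing_estimates.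
Context {R : realType} {n r : nat}.
Local Notation Cn := 'rV[R[i]]_n.
Local Notation co := (@leb_coord R n (lebesgue_Cn R n)).
Variables (D : set Cn) (H : Cn -> 'M[R[i]]_r) (adm : (Cn -> 'cV[R[i]]_r) -> Prop).
Hypothesis Aadm : admissible_fields adm.
Hypothesis N : locally_negative D H adm.
Local Notation good := (good D H adm).
Local Notation HQ := (HQ D H).
Local Notation Hc := (Hc D H).
Local Notation Hs := (Hs D H).
Local Notation eps := (@eps R).

Lemma adm_continuous u : adm u -> forall i, continuous (fun z => u z i 0).
Proof.
move=> /(adm_affine Aadm)[P [c hu]] i z.
have E y : u y i 0 = \sum_k P i k * y 0 k + c i 0.
  by rewrite hu !mxE; congr (_ + _); apply: eq_bigr => k _; rewrite !mxE.
move: z; rewrite (funext E) => z.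
have h : (fun y : Cn => \sum_k P i k * y 0 k) @ z --> \sum_k P i k * z 0 k.
  apply: (@continuous_bigsum R Cn _ _ (fun k (y : Cn) => P i k * y 0 k)) => k.
  exact: (cvgM (@cst_continuous Cn R[i] (P i k) z) (@cvg_coord R n z k)).
exact: (cvgD h (@cst_continuous Cn R[i] (c i 0) z)).
Qed.

Lemma good_QQ d z nu : good d z -> eps nu <= d -> pd z d `<=` QQ D H nu.
Proof.
move=> [d0 dD _ b] ed y hy; have [h1 h2] := b y hy.
have h3 : d^-1 <= nu.+1%:R by rewrite -[nu.+1%:R]invrK lef_pV2 ?posrE ?invr_gt0 ?ltr0n.
split; [exact: dD|exact: pd_sub h3 _ h1|].
by move=> i; apply: lt_le_trans (h2 i) h3.
Qed.

Let mHQ nu s := measurable_HQ Aadm N nu s.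
Let G0 nu s w : 0 <= qf (HQ nu w) s.
Proof. exact: (proj2 (psd_HQ N nu w)). Qed.

Let mshift nu s z e : measurable_fun setT (fun p => (qf (HQ nu (z + e%:C *: co p)) s)%:E).
Proof.
apply/measurable_EFinP; have h := measurableT_comp (mHQ nu s) (measurable_circle_shift z 0 e).
have := measurableT_comp h (measurable_pair2 (0 : R)); congr measurable_fun.
by apply/funext => p /=; rewrite scaler0 addr0.
Qed.

Lemma Hc_upper nu z s (c : R) : 0 <= c -> pd z (eps nu) `<=` QQ D H nu ->
  (forall y, pd z (eps nu) y -> qf (H y) s <= c) -> qf (Hc nu z) s <= c.
Proof.
move=> c0 hQ hc; rewrite -lee_fin (qf_Hc Aadm N) -[leRHS](kavg_cst (n := n) c0).
apply: kavg_le.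
- exact: mshift.
- exact: measurable_cst.
- by move=> w; rewrite lee_fin G0.
- move=> w hw; have h : pd z (eps nu) (z + (eps nu)%:C *: w).
    by have := @pd_disc R n z _ 1 w (eps_gt0 nu) _ hw; rewrite scale1r; apply; rewrite cabs1.
  by rewrite lee_fin HQ_in; [exact: hc|exact: hQ].
Qed.

Lemma kavg_circle nu z s : (qf (Hc nu z) s)%:E =
  kavg (fun w => emean (fun t => (qf (HQ nu (z + cis t *: ((eps nu)%:C *: w))) s)%:E)).
Proof.
rewrite (qf_Hc Aadm N).
exact: (@kavg_circle_mean R n z (eps nu) (fun y => qf (HQ nu y) s) (mHQ nu s) (G0 nu s)).
Qed.

Lemma measurable_circle_mean nu z s e : measurable_fun setT
  (fun p => emean (fun t => (qf (HQ nu (z + cis t *: (e%:C *: co p))) s)%:E)).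
Proof.
pose Phi (q : leb_type (lebesgue_Cn R n) * R) :=
  (qf (HQ nu (z + cis q.2 *: (e%:C *: co q.1))) s)%:E.
have mP : measurable_fun setT Phi.
  apply/measurable_EFinP.
  rewrite [X in measurable_fun _ X](_ : _ = (fun y => qf (HQ nu y) s) \o
      (fun q : leb_type (lebesgue_Cn R n) * R => z + e%:C *: (cis q.2 *: co q.1))).
    exact: (measurableT_comp (mHQ nu s) (measurable_rotation z e)).
  by apply/funext => q; rewrite /= (scale_swap (cis q.2)).
by apply: (emean_measurable mP) => q; rewrite lee_fin G0.
Qed.

Lemma measurable_circle nu z s (b : Cn) :
  measurable_fun setT (fun t : R => (qf (HQ nu (z + cis t *: b)) s)%:E).
Proof.
apply/measurable_EFinP.
have m : measurable_fun setT (fun t : R => z + cis t *: b : BCn R n).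
  have cz j (t : R) : (fun t : R => (z + cis t *: b) 0 j) @ t --> (z + cis t *: b) 0 j.
    exact: continuous_circle_coord.
  by apply: measurable_to_BCn => j; apply: continuous_measurable_fun => t;
    [exact: (cvg_Re (cz j t))|exact: (cvg_Im (cz j t))].
exact: (measurableT_comp (mHQ nu s) m).
Qed.

(** For each w the circle mean through z + eps w is at least the value at z, by the submean
    inequality for the constant field s, and the kernel average keeps this. *)
Lemma Hc_lower d nu z s : good d z -> eps nu <= d -> qf (H z) s <= qf (Hc nu z) s.
Proof.
move=> gz ed; have hQ := good_QQ gz ed; have [d0 dD sub b] := gz.
rewrite -lee_fin kavg_circle -[leLHS](kavg_cst (n := n) (proj2 (neg_psd N z) s)).
apply: kavg_le.
- exact: measurable_cst.
- exact: measurable_circle_mean.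
- by move=> w; rewrite lee_fin (proj2 (neg_psd N z)).
- move=> w hw; apply: le_trans (sub (fun=> s) z ((eps nu)%:C *: w) (adm_cst Aadm s) _) _.
    by move=> l l1; apply: (pd_sub ed); exact: pd_disc (eps_gt0 nu) l1 hw.
  rewrite le_eqVlt; apply/orP; left; apply/eqP; congr emean; apply/funext => t.
  rewrite HQ_in //; apply: hQ; apply: (pd_sub ed); apply: pd_disc (eps_gt0 nu) _ hw.
  by rewrite cabs_cis.
Qed.

Lemma continuous_Hc nu u : adm u -> continuous (fun z => qf (Hc nu z) (u z)).
Proof.
move=> au z; apply: continuous_qf => [i j|i]; last exact: adm_continuous.
by have [c _] := sm_bounded (sm_Hc Aadm N 0 nu i j); exact: c.
Qed.

Lemma Hc_submean d nu z u b : good d z -> eps nu <= d / 2 -> adm u -> pd 0 (d / 2) b ->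
  (forall l, cabs l <= 1 -> pd 0 (d / 2) (l *: b)) ->
  qf (Hc nu z) (u z) <= cmean (fun t => qf (Hc nu (z + cis t *: b)) (u (z + cis t *: b))).
Proof.
move=> gz ed au _ hb; have [d0 dD sub _] := gz.
have d2 : d / 2 + d / 2 = d by rewrite -splitr.
have ed' : eps nu <= d by apply: le_trans ed _; rewrite ler_pdivrMr // ler_peMr ?ler1n // ltW.
have hQ := good_QQ gz ed'.
(* One half of d pays for the translation by eps w, the other half for the circle. *)
have inD l w : cabs l <= 1 -> pd 0 1 w -> pd z d (z + (eps nu)%:C *: w + l *: b).
  move=> l1 hw; rewrite -d2; apply: (@pd_triangle R n z (z + (eps nu)%:C *: w)).
    apply: (pd_sub ed); have := @pd_disc R n z _ 1 w (eps_gt0 nu) _ hw.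
    by rewrite scale1r; apply; rewrite cabs1.
  apply/pdE => j; have /pdE/(_ j) := hb l l1; rewrite !mxE subr0.
  by rewrite (addrAC (z 0 j + _)) subrr add0r.
have cG : continuous (fun t : R => qf (Hc nu (z + cis t *: b)) (u (z + cis t *: b))).
  move=> t; apply: (@continuous_comp _ _ _ (fun t : R => z + cis t *: b) (fun y => qf (Hc nu y) (u y))).
    exact: continuous_circle.
  exact: continuous_Hc.
rewrite -lee_fin -(emean_cmean cG).
rewrite (qf_Hc Aadm N).
pose Phi (w : Cn) (t : R) := (qf (HQ nu (z + cis t *: b + (eps nu)%:C *: w)) (u (z + cis t *: b)))%:E.
have mPhi : measurable_fun setT (fun q : leb_type (lebesgue_Cn R n) * R => Phi (co q.1) q.2).
  apply/measurable_EFinP.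
  have mz := measurable_circle_shift z b (eps nu).
  have cu i (t : R) : (fun t : R => u (z + cis t *: b) i 0) @ t --> u (z + cis t *: b) i 0.
    apply: (@continuous_comp _ _ _ (fun t : R => z + cis t *: b) (fun y => u y i 0)).
      exact: continuous_circle.
    exact: adm_continuous.
  have ms (f : R -> R) : continuous f ->
      measurable_fun setT (fun q : leb_type (lebesgue_Cn R n) * R => f q.2).
    by move=> cf; apply: measurableT_comp measurable_snd; exact: continuous_measurable_fun.
  apply: measurable_qf => [i j|i j|i|i].
  - by have [h _] := measurable_HQ_entries Aadm N nu i j; exact: (measurableT_comp h mz).
  - by have [_ h] := measurable_HQ_entries Aadm N nu i j; exact: (measurableT_comp h mz).
  - by apply: (ms (fun t => Re (u (z + cis t *: b) i 0))) => t; exact: (cvg_Re (cu i t)).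
  - by apply: (ms (fun t => Im (u (z + cis t *: b) i 0))) => t; exact: (cvg_Im (cu i t)).
have Phi0 w t : (0 <= Phi w t)%E by rewrite lee_fin G0.
rewrite [leRHS](_ : _ = emean (fun t => kavg (fun w => Phi w t))); last first.
  by congr emean; apply/funext => t; rewrite /= (qf_Hc Aadm N).
rewrite -(kavg_emean mPhi Phi0); apply: kavg_le.
- exact: mshift.
- exact: (emean_measurable mPhi).
- by move=> w; rewrite lee_fin G0.
move=> w hw; have h0 := inD 0 w; rewrite scale0r addr0 in h0.
rewrite HQ_in; last by apply: hQ; apply: h0 => //; rewrite cabs0.
have := sub (fun y => u (y - (eps nu)%:C *: w)) (z + (eps nu)%:C *: w) b
  (adm_shift Aadm _ au) (fun l l1 => inD l w l1 hw).
rewrite addrK => h; apply: le_trans h _; rewrite le_eqVlt; apply/orP; left; apply/eqP.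
congr emean; apply/funext => t; rewrite /Phi [z + cis t *: b + _]addrAC HQ_in.
  by rewrite [X in u X](_ : _ = z + cis t *: b) // addrAC addrK.
by apply: hQ; apply: inD => //; rewrite cabs_cis.
Qed.

End smoothing_estimates.

Lemma lime_bound {R : realType} (u : nat -> \bar R) (l x : \bar R) :
  u m @[m --> \oo] --> l -> (forall m, (x <= u m)%E) -> (x <= l)%E.
Proof.
move=> hl hx; have <- := cvg_lim (@ereal_hausdorff R) hl.
apply: lime_ge; first by apply/cvg_ex; exists l.
by exists 0%N => // m _; exact: hx.
Qed.

Section smoothing_limits.
Context {R : realType} {n r : nat}.
Local Notation Cn := 'rV[R[i]]_n.
Local Notation co := (@leb_coord R n (lebesgue_Cn R n)).
Variables (D : set Cn) (H : Cn -> 'M[R[i]]_r) (adm : (Cn -> 'cV[R[i]]_r) -> Prop).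
Hypothesis Aadm : admissible_fields adm.
Hypothesis N : locally_negative D H adm.
Local Notation good := (good D H adm).
Local Notation HQ := (HQ D H).
Local Notation Hc := (Hc D H).
Local Notation Hs := (Hs D H).
Local Notation eps := (@eps R).

Lemma eps_le m k : (m <= k)%N -> eps k <= eps m.
Proof. by move=> mk; rewrite lef_pV2 ?posrE ?ltr0n // ler_nat ltnS. Qed.

Lemma eps_small (e : R) : 0 < e -> exists N0, forall nu, (N0 <= nu)%N -> eps nu < e.
Proof.
move=> e0; have [N0 _ h] := near_infty_natSinv_lt (PosNum e0).
by exists N0 => nu /h.
Qed.

(** The lower bound is [Hc_lower]; the upper one is semicontinuity on a polydisc that contains the
    support of the averaging. *)
Lemma Hc_cvg z s (e : R) : D z -> 0 < e -> exists N0, forall nu, (N0 <= nu)%N ->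
  qf (H z) s <= qf (Hc nu z) s <= qf (H z) s + e.
Proof.
move=> Dz e0; have [d gz] := good_exists Aadm N Dz; have [d0 _ _ _] := gz.
have [d1 d10 h1] : exists2 d, 0 < d & pd z d `<=` [set w | qf (H w) s < qf (H z) s + e].
  by apply/nbhs_pd; apply: (neg_usc N (adm_cst Aadm s) Dz); rewrite ltrDl.
have [N0 hN0] := @eps_small (Num.min d d1) ltac:(by rewrite lt_min d0 d10).
exists N0 => nu /hN0; rewrite lt_min => /andP[/ltW e1 /ltW e2].
apply/andP; split; first exact: (Hc_lower Aadm N s gz e1).
apply: (Hc_upper Aadm N).
- by rewrite addr_ge0 ?(ltW e0) // (proj2 (neg_psd N z)).
- by apply: subset_trans (good_QQ gz e1); exact: pd_sub.
- by move=> y /(pd_sub e2) /h1 /ltW.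
Qed.

Lemma eps_cvg0 : eps nu @[nu --> \oo] --> 0.
Proof. exact: cvg_harmonic. Qed.

Lemma qf_Hs_cvg z s : D z -> qf (Hs nu z) s @[nu --> \oo] --> qf (H z) s.
Proof.
move=> Dz; under eq_fun do rewrite (qf_Hs D H).
have h1 : qf (Hc nu z) s @[nu --> \oo] --> qf (H z) s.
  apply/cvgrPdist_le => e e0; have [N0 h] := Hc_cvg s Dz e0.
  exists N0 => // nu /= /h /andP[h1 h2]; rewrite distrC ger0_norm ?subr_ge0 //.
  by rewrite lerBlDl.
have h2 : eps nu * (\sum_i cabs (s i 0) ^+ 2) @[nu --> \oo] --> 0 * (\sum_i cabs (s i 0) ^+ 2).
  by apply: cvgM; [exact: eps_cvg0|exact: cvg_cst].
by have := cvgD h1 h2; rewrite mul0r addr0; exact.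
Qed.

Lemma Hs_cvg z i j : D z -> Hs nu z i j @[nu --> \oo] --> H z i j.
Proof.
move=> Dz.
have E (c : R[i]) : cabs c = 1 -> Re (c * Hs nu z i j) @[nu --> \oo] --> Re (c * H z i j).
  move=> c1.
  have F M : herm M -> Re (c * M i j) = 2^-1 * (qf M (ev i + c *: ev j) - qf M (ev i) - qf M (ev j)).
    by move=> hM; rewrite polarization //; field.
  rewrite (F _ (proj1 (neg_psd N z))).
  under eq_fun => nu do rewrite (F _ (herm_Hs Aadm N nu z)).
  apply: cvgM; first exact: cvg_cst.
  by apply: cvgB; [apply: cvgB|]; exact: qf_Hs_cvg.
have h1 := E 1 cabs1.
have h2 := E (- 'i%C) _; rewrite cabsN in h2.
have ci : cabs ('i%C : R[i]) = 1 by rewrite /cabs /= expr0n expr1n add0r sqrtr1.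
have {}h2 := h2 ci.
have I (x : R[i]) : Re (- 'i%C * x) = Im x by case: x => a b /=; ring.
rewrite I in h2; rewrite mul1r in h1.
have {}h1 : Re (Hs nu z i j) @[nu --> \oo] --> Re (H z i j).
  by move: h1; under eq_fun do rewrite mul1r.
have {}h2 : Im (Hs nu z i j) @[nu --> \oo] --> Im (H z i j).
  by move: h2; under eq_fun do rewrite I.
by apply: (@cvg_complex R nat \oo _ (fun nu => Hs nu z i j) (H z i j)); [exact: h1|exact: h2].
Qed.

Let cHc m s : continuous (fun y => qf (Hc m y) s).
Proof.
move=> z; have := @continuous_Hc R n r D H adm Aadm N m (fun=> s) (adm_cst Aadm s) z; exact.
Qed.

(** [radial_mean_le] needs a continuous function, and H is only semicontinuous. The comparison of
    two circles is therefore made first for [Hc m] with an auxiliary rank m, small against the fixed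
    radius d. *)
Lemma Hc_radial d nu m z s w (x : R) : good d z -> eps nu <= d / 2 -> eps m <= d / 4 ->
  pd 0 1 w -> 0 <= x <= 1 ->
  cmean (fun t => qf (Hc m (z + cis t *: ((x * eps nu)%:C *: w))) s) <=
  cmean (fun t => qf (Hc m (z + cis t *: ((eps nu)%:C *: w))) s).
Proof.
move=> gz e1 e2 hw hx; have [d0 _ _ _] := gz.
have en0 := @eps_gt0 R nu.
have d2 : 0 < d / 2 by rewrite divr_gt0.
pose f (l : R[i]) := qf (Hc m (z + l *: ((eps nu)%:C *: w))) s.
have cf l : {for l, continuous f}.
  apply: (@continuous_comp _ _ _ (fun l : R[i] => z + l *: ((eps nu)%:C *: w)) (fun y => qf (Hc m y) s)).
    exact: continuous_line.
  exact: cHc.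
have sub e : 0 < e -> exists2 d', 0 < d' & forall (l : R[i]) (y : R), cabs l < 1 -> 0 < y < d' ->
    cabs l + y <= 1 -> f l <= cmean (fun t => f (l + y%:C * cis t)) + e * y ^+ 2.
  move=> e0; exists 2^-1; first by rewrite invr_gt0.
  move=> l y l1 /andP[y0 y1] _.
  apply: (@le_trans _ _ (cmean (fun t => f (l + y%:C * cis t)))); last first.
    by rewrite lerDl mulr_ge0 ?(ltW e0) // sqr_ge0.
  have hy : pd z (eps nu) (z + l *: ((eps nu)%:C *: w)) by apply: pd_disc => //; exact: ltW.
  have gy : good (d - d / 2) (z + l *: ((eps nu)%:C *: w)).
    apply: good_pd gz _; first by rewrite (ltW d2) /= ltr_pdivrMr // mulr_natr mulr2n ltrDl.
    exact: pd_sub e1 _ hy.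
  have dd : d - d / 2 = d / 2 by rewrite {1}(splitr d) addrK.
  rewrite dd in gy.
  have hb l' : cabs l' <= 1 -> pd 0 (d / 2 / 2) (l' *: (y%:C *: ((eps nu)%:C *: w))).
    move=> l1'; apply/pdE => j; have /pdE/(_ j) := hw; rewrite !mxE subr0 => h.
    rewrite subr0 !cabsM !cabs_real (gtr0_norm y0) (gtr0_norm en0).
    apply: (@le_lt_trans _ _ (1 * (y * (eps nu * cabs (w 0 j))))).
      by apply: ler_wpM2r => //; rewrite !mulr_ge0 ?cabs_ge0 // ltW.
    rewrite mul1r; apply: (@lt_le_trans _ _ (2^-1 * (d / 2))); last by rewrite mulrC.
    apply: ltr_pM; rewrite ?mulr_ge0 ?cabs_ge0 ?(ltW y0) ?(ltW en0) //.
    by apply: lt_le_trans e1; rewrite gtr_pMr.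
  have e2' : eps m <= d / 2 / 2 by rewrite -mulrA -invfM -natrM.
  have := Hc_submean Aadm N gy e2' (adm_cst Aadm s) (b := y%:C *: ((eps nu)%:C *: w)) _ hb.
  have h1 := hb 1; rewrite scale1r cabs1 in h1.
  move/(_ (h1 (lexx _))) => h; apply: le_trans h _; rewrite le_eqVlt; apply/orP; left; apply/eqP.
  apply: congr1; apply/funext => t; rewrite /f -addrA scalerDl.
  by rewrite (scalerA (cis t)) [cis t * _]mulrC.
have := radial_mean_le ltr01 (fun l _ => cf l) sub hx; rewrite /f => h.
apply: le_trans (le_trans _ h) _; rewrite le_eqVlt; apply/orP; left; apply/eqP;
  apply: congr1; apply/funext => t.
- by rewrite rmorphM !scalerA mulrA [cis t * _]mulrC -!mulrA.
- by rewrite mul1r.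
Qed.

(** H is below [Hc m] on the inner circle, [Hc_radial] passes to the outer circle, and m -> oo
    returns to H there by dominated convergence. *)
Lemma circle_monotone d nu z s w (x : R) : good d z -> eps nu <= d / 2 ->
  pd 0 1 w -> 0 < x <= 1 ->
  (emean (fun t => (qf (H (z + cis t *: ((x * eps nu)%:C *: w))) s)%:E) <=
   emean (fun t => (qf (H (z + cis t *: ((eps nu)%:C *: w))) s)%:E))%E.
Proof.
move=> gz e1 hw /andP[x0 x1]; have [d0 dD _ _] := gz.
have en0 := @eps_gt0 R nu.
have d2 : 0 < d / 2 by rewrite divr_gt0.
have d4 : 0 < d / 4 by rewrite divr_gt0.
have d2d : d / 2 <= d by rewrite ler_pdivrMr // ler_peMr ?ler1n // ltW.
have d42 : d / 4 <= d / 2 by rewrite ler_pM2l // lef_pV2 ?posrE // ler_nat.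
have [N0 hN0] := eps_small d4.
pose y2 t := z + cis t *: ((eps nu)%:C *: w).
pose y1 t := z + cis t *: ((x * eps nu)%:C *: w).
have dd : d - d / 2 = d / 2 by rewrite {1}(splitr d) addrK.
have gS y : pd z (d / 2) y -> good (d / 2) y.
  move=> hy; rewrite -dd; apply: good_pd gz hy.
  by rewrite (ltW d2) /= ltr_pdivrMr // mulr_natr mulr2n ltrDl.
have xe : x * eps nu <= eps nu by rewrite ger_pMl.
have hy2 t : pd z (d / 2) (y2 t).
  by apply: (pd_sub e1); apply: pd_disc => //; rewrite cabs_cis.
have hy1 t : pd z (d / 2) (y1 t).
  by apply: (pd_sub (le_trans xe e1)); apply: pd_disc => //; rewrite ?cabs_cis // mulr_gt0.
have HQE m t (y : R -> Cn) : (forall t, pd z (d / 2) (y t)) -> eps m <= d / 4 -> H (y t) = HQ m (y t).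
  move=> hy em; rewrite HQ_in //; apply: (good_QQ gz); last exact: (pd_sub d2d (hy t)).
  by apply: le_trans em _; apply: le_trans d42 d2d.
have eN : eps N0 <= d / 4 by apply/ltW/hN0.
have mH (b : Cn) : (forall t, pd z (d / 2) (z + cis t *: b)) ->
    measurable_fun setT (fun t : R => (qf (H (z + cis t *: b)) s)%:E).
  move=> hy; under eq_fun => t do rewrite (HQE N0 t (fun t => z + cis t *: b) hy eN).
  exact: (measurable_circle Aadm N).
have cH m (b : Cn) : continuous (fun t : R => qf (Hc m (z + cis t *: b)) s).
  move=> t; apply: (@continuous_comp _ _ _ (fun t : R => z + cis t *: b) (fun y => qf (Hc m y) s)).
    exact: continuous_circle.
  exact: cHc.
have step m : (N0 <= m)%N -> (emean (fun t => (qf (H (y1 t)) s)%:E) <=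
    emean (fun t => (qf (Hc m (y2 t)) s)%:E))%E.
  move=> /hN0/ltW em.
  apply: (@le_trans _ _ (emean (EFin \o (fun t => qf (Hc m (y1 t)) s)))).
    apply: emean_le.
    - exact: mH.
    - by apply/measurable_EFinP; exact: (continuous_measurable_fun (cH m _)).
    - by move=> t; rewrite lee_fin (proj2 (neg_psd N _)).
    - by move=> t; rewrite lee_fin; apply: (Hc_lower Aadm N s (gS _ (hy1 t))); exact: le_trans em d42.
  have E1 : emean (EFin \o (fun t => qf (Hc m (y1 t)) s)) = (cmean (fun t => qf (Hc m (y1 t)) s))%:E.
    exact: (emean_cmean (cH m _)).
  have E2 : emean (fun t => (qf (Hc m (y2 t)) s)%:E) = (cmean (fun t => qf (Hc m (y2 t)) s))%:E.
    exact: (emean_cmean (cH m _)).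
  rewrite [X in (X <= _)%E]E1 [X in (_ <= X)%E]E2 lee_fin.
  by apply: (Hc_radial s gz e1 em hw); rewrite (ltW x0).
(* The dominating constant: the diagonal entries are below 1 / d, hence below 2 / d, on the polydisc
   of radius d, and [qf_bound] bounds the form by them. *)
pose C := 2 * (d / 2)^-1 * (\sum_i cabs (s i 0)) ^+ 2.
have C0 : 0 <= C by rewrite mulr_ge0 ?sqr_ge0 // divr_ge0 // ltW.
have Cd (y : Cn) : pd z d y -> qf (H y) s <= C.
  have [_ _ _ b] := gz; move=> hy; apply: qf_bound; first exact: (neg_psd N).
  move=> i; have [_ /(_ i)] := b y hy; move=> /ltW h; apply: le_trans h _.
  by rewrite lef_pV2 ?posrE.
have bC m t : (N0 <= m)%N -> qf (Hc m (y2 t)) s <= C.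
  move=> /hN0/ltW em; have em2 := le_trans em d42.
  apply: (Hc_upper Aadm N) => //.
    by apply: subset_trans (good_QQ (gS _ (hy2 t)) em2); exact: pd_sub.
  move=> y /(pd_sub em2) hy; apply: Cd; rewrite (splitr d); exact: pd_triangle (hy2 t) hy.
pose mu := @lebesgue_measure R.
have mI : measurable (`[0%R, (2 * pi)%R] : set R) by exact: measurable_itv.
pose F m t := (qf (Hc (m + N0)%N (y2 t)) s)%:E.
have [] := @dominated_convergence _ _ R mu `[0%R, (2 * pi)%R]%classic mI F
   (fun t => (qf (H (y2 t)) s)%:E) (fun=> C%:E).
- move=> m; apply: measurable_funS (_ : measurable_fun setT _) => //.
  by apply/measurable_EFinP; exact: (continuous_measurable_fun (cH (m + N0)%N _)).
- exact: (measurable_funS measurableT (@subsetT _ _) (mH ((eps nu)%:C *: w) hy2)).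
- apply: aeW => t _; apply: cvg_EFin; first by near=> m.
  apply/cvgrPdist_le => e e0; have [N1 h] := Hc_cvg s (dD _ (pd_sub d2d (hy2 t))) e0.
  exists N1 => // m /= hm; have /h /andP[h1 h2] : (N1 <= m + N0)%N by exact: leq_trans hm (leq_addr _ _).
  by rewrite distrC ger0_norm ?subr_ge0 // lerBlDl.
- by have := @seg_integrable R 0 (2 * pi) (fun=> C) (fun x => @cst_continuous _ _ C x).
- apply: aeW => t m _; rewrite gee0_abs ?lee_fin; last exact: (proj2 (psd_Hc Aadm N _ _)).
  by apply: bC; exact: leq_addl.
move=> _ _ hlim.
have hl : (emean (F m) @[m --> \oo] --> emean (fun t => (qf (H (y2 t)) s)%:E))%E.
  by apply: cvgeZl.
exact: (lime_bound hl (fun m => step _ (leq_addl m N0))).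
Unshelve. all: by end_near. Qed.

(** Both sides are kernel averages of means over circles about z with the same direction w, of radii
    proportional to [eps nu.+1] and [eps nu]; these means are compared by [circle_monotone]. *)
Lemma Hc_mono d nu z s : good d z -> eps nu <= d / 2 ->
  qf (Hc nu.+1 z) s <= qf (Hc nu z) s.
Proof.
move=> gz e1; have [d0 dD _ _] := gz.
have en0 := @eps_gt0 R nu.
have d2d : d / 2 <= d by rewrite ler_pdivrMr // ler_peMr ?ler1n // ltW.
have e2 := eps_le (leqnSn nu).
have K1 := kavg_circle Aadm N nu.+1 z s; have K2 := kavg_circle Aadm N nu z s.
rewrite -lee_fin [X in (X <= _)%E]K1 [X in (_ <= X)%E]K2 {K1 K2}; apply: kavg_le.
- exact: (measurable_circle_mean Aadm N).
- exact: (measurable_circle_mean Aadm N).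
- move=> w; apply: emean_ge0 => t; rewrite lee_fin; exact: (proj2 (psd_HQ N _ _)).
move=> w hw.
have hE m : eps m <= eps nu -> (emean (fun t => (qf (HQ m (z + cis t *: ((eps m)%:C *: w))) s)%:E) =
    emean (fun t => (qf (H (z + cis t *: ((eps m)%:C *: w))) s)%:E))%E.
  move=> em; apply: congr1; apply/funext => t; rewrite HQ_in //.
  have emd : eps m <= d by apply: le_trans em _; apply: le_trans e1 d2d.
  apply: (good_QQ gz emd); apply: (pd_sub emd); apply: pd_disc => //; first exact: eps_gt0.
  by rewrite cabs_cis.
have E1 := hE _ e2; have E2 := hE nu (lexx _).
rewrite [X in (X <= _)%E]E1 [X in (_ <= X)%E]E2 {E1 E2 hE}.
have hx : 0 < eps nu.+1 / eps nu <= 1.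
  by apply/andP; split; [rewrite divr_gt0 // eps_gt0|rewrite ler_pdivrMr // mul1r].
have := circle_monotone s gz e1 hw hx.
by rewrite mulfVK // lt0r_neq0.
Qed.

End smoothing_limits.

(** * Curvature of the smoothed metrics *)

Lemma le_eq {R : realType} (x y : R) : x = y -> x <= y. Proof. by move->. Qed.

(** Such identities are stated over an abstract ring so that [ring] meets variables in place of
    large analytic terms. *)
Lemma second_difference_ring {K : comRingType} (y1 y2 y3 y4 y5 y6 y7 x1 x2 x3 x4 : K) :
  y1 - y2 - (x3 + x4) * (x2 * y7) - (y3 - y4 - x3 * (x2 * y7)) - x4 * (x1 * (y5 - y6) - x2 * y7) =
  y1 - y3 - x4 * (x1 * y5) - (y2 - y4 - x4 * (x1 * y6)).
Proof. ring. Qed.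

Lemma symmetric_difference_ring {K : comRingType} (y1 y2 y3 y4 x p q : K) :
  y1 - y2 - y3 + y4 - x * p - (y1 - y3 - y2 + y4 - x * q) = - (x * (p - q)).
Proof. ring. Qed.

(** * Wirtinger calculus and second-order expansions *)

Section smooth_calculus.
Context {R : realType} {n : nat}.
Local Notation Cn := 'rV[R[i]]_n.
Implicit Types (f g : Cn -> R[i]) (z v : Cn).

Definition csm f : Prop := forall k, sm k f.

Definition dv v f z : R[i] := lim (dquot f z v t @[t --> (0 : R)^']).

Lemma dvE f z v l : rd f z v l -> dv v f z = l.
Proof. by move=> h; apply: cvg_lim. Qed.

Lemma csm_rd f z v : csm f -> rd f z v (dv v f z).
Proof. by move=> /(_ 1%N)[_ [A [B [hd _]]]]; rewrite (dvE (hd z v)). Qed.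

Lemma csm_cst (c : R[i]) : csm (fun=> c). Proof. by move=> k; exact: sm_cst. Qed.
Lemma csmD f g : csm f -> csm g -> csm (fun x => f x + g x).
Proof. by move=> hf hg k; exact: smD. Qed.
Lemma csmM f g : csm f -> csm g -> csm (fun x => f x * g x).
Proof. by move=> hf hg k; exact: smM. Qed.
Lemma csmZ c f : csm f -> csm (fun x => c * f x).
Proof. by move=> hf; apply: csmM => //; exact: csm_cst. Qed.
Lemma csm_sum (I : Type) (s : seq I) (F : I -> Cn -> R[i]) :
  (forall i, csm (F i)) -> csm (fun x => \sum_(i <- s) F i x).
Proof. by move=> h k; apply: sm_sum => i; exact: h. Qed.

Lemma csm_dv v f : csm f -> csm (dv v f).
Proof.
move=> hf k; have [_ [A [B [hd hs]]]] := hf k.+1.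
rewrite (_ : dv v f = fun z => dd A B z v); last by apply/funext => z; exact: dvE.
by apply: sm_sum => j; apply: smD; apply: smM; try exact: sm_cst; have [] := hs j.
Qed.

Definition dz j f z : R[i] := 2^-1 * (dv (delta_mx 0 j) f z - 'i%C * dv ('i%C *: delta_mx 0 j) f z).
Definition dzb j f z : R[i] := 2^-1 * (dv (delta_mx 0 j) f z + 'i%C * dv ('i%C *: delta_mx 0 j) f z).

Lemma csm_dz j f : csm f -> csm (dz j f).
Proof.
move=> hf; apply: csmZ; apply: csmD; first exact: csm_dv.
have h := csm_dv ('i%C *: delta_mx 0 j) hf.
by have := csmZ (- 'i%C) h; under eq_fun do rewrite mulNr.
Qed.

Lemma csm_dzb j f : csm f -> csm (dzb j f).
Proof. by move=> hf; apply: csmZ; apply: csmD; [|apply: csmZ]; exact: csm_dv. Qed.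

Lemma dd_delta A B z j (c : R[i]) : dd A B z (c *: (delta_mx 0 j : Cn)) = c * A j z + cj c * B j z.
Proof.
rewrite /dd (bigD1 j) //= big1 ?addr0 => [|k nk].
  by rewrite !mxE !eqxx mulr1.
by rewrite !mxE (negbTE nk) andbF mulr0 rmorph0 !mul0r addr0.
Qed.

(** The coefficients of a differential are unique, so each differentiation rule below follows by
    exhibiting some differential of the right shape. *)
Lemma has_der_dz f A B : has_der f A B -> forall j z, dz j f z = A j z /\ dzb j f z = B j z.
Proof.
move=> hd j z; rewrite /dz /dzb (dvE (hd z ('i%C *: delta_mx 0 j))).
have := hd z (1 *: delta_mx 0 j); rewrite [X in rd _ _ X _ -> _]scale1r => h.
rewrite (dvE h) !dd_delta rmorph1 !mul1r.
have i2 : 'i%C * 'i%C = -1 :> R[i] by rewrite -expr2 sqr_i.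
have ci : cj 'i%C = - 'i%C :> R[i] by apply/eqP; rewrite eq_complex /= !oppr0 !eqxx.
rewrite ci; move: ('i%C) i2 (A j z) (B j z) => I i2 a b.
rewrite (_ : I * (I * a + - I * b) = (I * I) * (a - b)); last by ring.
by rewrite i2; split; field.
Qed.

Lemma csm_der f : csm f -> has_der f (dz^~ f) (dzb^~ f).
Proof.
move=> hf z v; have [_ [A [B [hd _]]]] := hf 1%N.
have := hd z v; congr rd; apply: eq_bigr => j _.
by have [-> ->] := has_der_dz hd j z.
Qed.

Lemma dzD f g j z : csm f -> csm g ->
  dz j (fun x => f x + g x) z = dz j f z + dz j g z /\
  dzb j (fun x => f x + g x) z = dzb j f z + dzb j g z.
Proof.
move=> hf hg; apply: (@has_der_dz _ (fun j z => dz j f z + dz j g z) (fun j z => dzb j f z + dzb j g z)).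
move=> {}z v; have := rdD (@csm_der f hf z v) (@csm_der g hg z v); congr rd.
by rewrite /dd -big_split; apply: eq_bigr => k _ /=; ring.
Qed.

Lemma dzZ (c : R[i]) f j z : csm f ->
  dz j (fun x => c * f x) z = c * dz j f z /\ dzb j (fun x => c * f x) z = c * dzb j f z.
Proof.
move=> hf; apply: (@has_der_dz _ (fun j z => c * dz j f z) (fun j z => c * dzb j f z)).
move=> {}z v; have := rdM (@rd_cst R n c z v) (@csm_der f hf z v); congr rd.
by rewrite mul0r add0r /dd mulr_sumr; apply: eq_bigr => k _ /=; ring.
Qed.

Lemma dz_sum (I : Type) (s : seq I) (F : I -> Cn -> R[i]) j z : (forall i, csm (F i)) ->
  dz j (fun x => \sum_(i <- s) F i x) z = \sum_(i <- s) dz j (F i) z /\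
  dzb j (fun x => \sum_(i <- s) F i x) z = \sum_(i <- s) dzb j (F i) z.
Proof.
move=> h; elim: s => [|a s [IH1 IH2]].
  under eq_fun do rewrite big_nil; rewrite !big_nil.
  apply: (@has_der_dz (fun=> 0) (fun _ _ => 0) (fun _ _ => 0)) => {}z v.
  have := @rd_cst R n (0 : R[i]) z v; congr rd.
  by rewrite /dd big1 // => k _; rewrite !mulr0 addr0.
under eq_fun do rewrite big_cons; rewrite !big_cons -IH1 -IH2; apply: dzD => //.
exact: csm_sum.
Qed.

Lemma csm_taylor3 f : csm f -> exists2 C : R, 0 <= C & forall z v,
  cabs (f (z + v) - f z - dd (dz^~ f) (dzb^~ f) z v -
    2^-1 * dd2 (fun j k => dz k (dz j f)) (fun j k => dzb k (dz j f))
               (fun j k => dz k (dzb j f)) (fun j k => dzb k (dzb j f)) z v) <= C * nv v ^+ 3.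
Proof.
move=> hf.
have T g : csm g -> exists2 C : R, 0 <= C & forall z v,
    cabs (g (z + v) - g z - dd (fun k => dz k g) (fun k => dzb k g) z v) <= C * nv v ^+ 2.
  move=> hg; have [A [B [hd [_ [C C0 hC]]]]] := sm_taylor2 (hg 2%N).
  exists C => // z v; have := hC z v; congr (cabs (_ - _) <= _).
  exact: (@rd_unique R n _ _ _ _ _ (hd z v) (@csm_der g hg z v)).
pose P j C := (forall z v, cabs (dz j f (z + v) - dz j f z -
     dd (fun k => dz k (dz j f)) (fun k => dzb k (dz j f)) z v) <= C * nv v ^+ 2) /\
   (forall z v, cabs (dzb j f (z + v) - dzb j f z -
     dd (fun k => dz k (dzb j f)) (fun k => dzb k (dzb j f)) z v) <= C * nv v ^+ 2).
have [C C0 hC] : exists2 C, 0 <= C & forall j, P j C.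
  apply: finite_bound.
    by move=> j M M' MM' [h1 h2]; split=> z v; [apply: le_trans (h1 z v) _|apply: le_trans (h2 z v) _];
      apply: ler_wpM2r => //; exact: sqr_ge0.
  move=> j; have [C1 C10 h1] := T _ (csm_dz j hf); have [C2 C20 h2] := T _ (csm_dzb j hf).
  exists (C1 + C2); split=> z v.
    by apply: le_trans (h1 z v) _; apply: ler_wpM2r; [exact: sqr_ge0|rewrite lerDl].
  by apply: le_trans (h2 z v) _; apply: ler_wpM2r; [exact: sqr_ge0|rewrite lerDr].
exists (4 * C); first exact: mulr_ge0.
by move=> z v; apply: (taylor3 C0 (csm_der hf)) => j; have [h1 h2] := hC j.
Qed.

(* Both sides are second differences of [f] divided by the increments, up to an
   error controlled by the mean value inequality. *)
Lemma dv_comm f v w z : csm f -> dv w (dv v f) z = dv v (dv w f) z.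
Proof.
move=> hf.
have K (a b : Cn) : exists2 C : R, 0 <= C & forall t : R, `|t| <= 1 ->
    cabs (f (z + t%:C *: a + t%:C *: b) - f (z + t%:C *: a) - f (z + t%:C *: b) + f z
      - (t ^+ 2)%:C * dv a (dv b f) z) <= C * `|t| ^+ 3.
  have hb := csm_dv b hf.
  have [A [B [hd [_ [C C0 hC]]]]] := sm_taylor2 (hb 2%N).
  have [C1 C10 hC1] := sm_lipschitz (csm_dv a hb 1%N).
  exists (2 * (C * nv a ^+ 2 + C1 * nv b)); first by rewrite !(mulr_ge0, addr_ge0, nv_ge0, sqr_ge0).
  move=> t t1; have t0 := normr_ge0 t.
  pose g (x : R) := f (z + t%:C *: a + x%:C *: (t%:C *: b)) - f (z + x%:C *: (t%:C *: b)) -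
    x%:C * ((t ^+ 2)%:C * dv a (dv b f) z).
  pose g' (x : R) := t%:C * (dv b f (z + t%:C *: a + x%:C *: (t%:C *: b)) -
    dv b f (z + x%:C *: (t%:C *: b))) - (t ^+ 2)%:C * dv a (dv b f) z.
  have Dt y : dd (dz^~ f) (dzb^~ f) y (t%:C *: b) = t%:C * dv b f y.
    by rewrite dd_real; congr (_ * _); exact: (@rd_unique R n _ _ _ _ _ (@csm_der f hf y b) (@csm_rd f y b hf)).
  have := @complex_mvt_bound R g g' (C * nv a ^+ 2 * `|t| ^+ 3 + C1 * nv b * `|t| ^+ 3) _ _.
  have g1 : g 1 = f (z + t%:C *: a + t%:C *: b) - f (z + t%:C *: b) - (t ^+ 2)%:C * dv a (dv b f) z.
    by rewrite /g rmorph1 scale1r mul1r.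
  have g0 : g 0 = f (z + t%:C *: a) - f z.
    by rewrite /g rmorph0 !scale0r !addr0 mul0r subr0.
  rewrite g1 g0 => h.
  rewrite (_ : 2 * (C * nv a ^+ 2 + C1 * nv b) * `|t| ^+ 3 =
    2 * (C * nv a ^+ 2 * `|t| ^+ 3 + C1 * nv b * `|t| ^+ 3)); last by ring.
  rewrite (_ : f (z + t%:C *: a + t%:C *: b) - f (z + t%:C *: a) - f (z + t%:C *: b) + f z
      - (t ^+ 2)%:C * dv a (dv b f) z =
    f (z + t%:C *: a + t%:C *: b) - f (z + t%:C *: b) - (t ^+ 2)%:C * dv a (dv b f) z
      - (f (z + t%:C *: a) - f z)); last by ring.
  apply: h.
  - move=> x _ e e0.
    have e2 : 0 < e / 2 by rewrite divr_gt0.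
    have [d1 d10 h1] := has_der_line (z + t%:C *: a) (t%:C *: b) (csm_der hf) x e2.
    have [d2 d20 h2] := has_der_line z (t%:C *: b) (csm_der hf) x e2.
    exists (Num.min d1 d2); first by rewrite lt_min d10.
    move=> s; rewrite lt_min => /andP[/h1 {}h1 /h2 {}h2].
    rewrite (splitr e) mulrDl; apply: le_trans (lerD h1 h2); rewrite -(cabsN (f (z + _ *: _) - _ - _)).
    apply: le_trans (cabsD _ _); apply: le_eq; congr cabs.
    rewrite !Dt /g /g' (rmorphD _ x s) /=.
    exact: second_difference_ring.
  - move=> x /andP[x0 x1].
    pose y := z + x%:C *: (t%:C *: b).
    have E1 : z + t%:C *: a + x%:C *: (t%:C *: b) = y + t%:C *: a by rewrite addrAC.
    have k1 := hC y (t%:C *: a); rewrite dd_real nvZ cabs_real in k1.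
    have Da : dd A B y a = dv a (dv b f) y by exact: (@rd_unique R n _ _ _ _ _ (hd y a) (@csm_rd _ y a hb)).
    rewrite Da in k1.
    have k2 := hC1 z (x%:C *: (t%:C *: b)); rewrite -/y !nvZ !cabs_real in k2.
    have -> : g' x = t%:C * (dv b f (y + t%:C *: a) - dv b f y - t%:C * dv a (dv b f) y) +
        (t ^+ 2)%:C * (dv a (dv b f) y - dv a (dv b f) z).
      by rewrite /g' E1 -/y rmorphXn /=; ring.
    apply: le_trans (cabsD _ _) _; rewrite !cabsM !cabs_real normrX.
    apply: lerD.
      have := ler_wpM2l t0 k1; move=> hh; apply: le_trans hh _.
      by rewrite le_eqVlt; apply/orP; left; apply/eqP; ring.
    apply: (@le_trans _ _ (`|t| ^+ 2 * (C1 * (`|x| * (`|t| * nv b))))).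
      by apply: ler_wpM2l; [exact: sqr_ge0|].
    have x1' : `|x| <= 1 by rewrite ger0_norm.
    rewrite (_ : `|t| ^+ 2 * _ = `|x| * (C1 * nv b * `|t| ^+ 3)); last by ring.
    by apply: ler_piMl => //; rewrite !mulr_ge0 ?exprn_ge0 ?nv_ge0.
have [C1 C10 h1] := K w v; have [C2 C20 h2] := K v w.
apply/eqP; rewrite -subr_eq0 -cabs_eq0 eq_le cabs_ge0 andbT leNgt; apply/negP => c0.
set c := cabs _ in c0.
have CC : 0 < C1 + C2 + 1 by rewrite ltr_wpDl // addr_ge0.
(* So small that the error (C1 + C2) t^3 of the two second differences stays below t^2 c. *)
pose t := Num.min 1 (c / (C1 + C2 + 1)) / 2.
have m0 : 0 < Num.min 1 (c / (C1 + C2 + 1)) by rewrite lt_min ltr01 divr_gt0.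
have t0 : 0 < t by rewrite divr_gt0.
have t1 : t <= 1.
  by rewrite ler_pdivrMr // mul1r ge_min; apply/orP; left; rewrite ler1n.
have tc : (C1 + C2 + 1) * t < c.
  have : t < Num.min 1 (c / (C1 + C2 + 1)) by rewrite ltr_pdivrMr // mulr_natr mulr2n ltrDl.
  by rewrite lt_min => /andP[_]; rewrite ltr_pdivlMr // mulrC.
have n1 : `|t| <= 1 by rewrite ger0_norm // ltW.
have {}h1 := h1 t n1; have {}h2 := h2 t n1; rewrite gtr0_norm // in h1 h2.
have := le_trans (cabsD _ _) (lerD h1 (eq_ind_r (fun x => x <= _) h2 (cabsN _))).
rewrite [X in cabs X](_ : _ = - ((t ^+ 2)%:C * (dv w (dv v f) z - dv v (dv w f) z))); last first.
  rewrite (addrAC z (t%:C *: v)); exact: symmetric_difference_ring.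
rewrite cabsN cabsM cabs_real ger0_norm ?sqr_ge0 // -/c -mulrDl.
have -> : (C1 + C2) * t ^+ 3 = t ^+ 2 * ((C1 + C2) * t) by ring.
rewrite ler_pM2l ?exprn_gt0 // => hh.
have := lt_le_trans tc hh; rewrite mulrDl mul1r -[X in _ < X]addr0 ltrD2l.
by rewrite ltNge ltW.
Qed.

Lemma dz_comm f j k z : csm f -> dzb k (dz j f) z = dz j (dzb k f) z.
Proof.
move=> hf; set e1 := delta_mx 0 j : Cn; set e2 := delta_mx 0 k : Cn.
have L (w v1 v2 : Cn) (c : R[i]) y : dv w (fun z => 2^-1 * (dv v1 f z + c * dv v2 f z)) y =
    2^-1 * (dv w (dv v1 f) y + c * dv w (dv v2 f) y).
  apply: dvE; have h1 := @csm_rd _ y w (csm_dv v1 hf); have h2 := @csm_rd _ y w (csm_dv v2 hf).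
  have := rdM (@rd_cst R n 2^-1 y w) (rdD h1 (rdM (@rd_cst R n c y w) h2)); congr rd.
  by rewrite !mul0r !add0r.
have Ez i : dz i f = fun z => 2^-1 * (dv (delta_mx 0 i) f z + (- 'i%C) * dv ('i%C *: delta_mx 0 i) f z).
  by apply/funext => x; rewrite /dz mulNr.
have -> : dzb k (dz j f) z = 2^-1 * (2^-1 * (dv e2 (dv e1 f) z + (- 'i%C) * dv e2 (dv ('i%C *: e1) f) z) +
    'i%C * (2^-1 * (dv ('i%C *: e2) (dv e1 f) z + (- 'i%C) * dv ('i%C *: e2) (dv ('i%C *: e1) f) z))).
  by rewrite {1}/dzb (Ez j) !L.
have -> : dz j (dzb k f) z = 2^-1 * (2^-1 * (dv e1 (dv e2 f) z + 'i%C * dv e1 (dv ('i%C *: e2) f) z) -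
    'i%C * (2^-1 * (dv ('i%C *: e1) (dv e2 f) z + 'i%C * dv ('i%C *: e1) (dv ('i%C *: e2) f) z))).
  by rewrite {1}/dz /dzb !L.
have P (a a' b b' : Cn) (I : R[i]) :
    2^-1 * (2^-1 * (dv b (dv a f) z + (- I) * dv b (dv a' f) z) +
      I * (2^-1 * (dv b' (dv a f) z + (- I) * dv b' (dv a' f) z))) =
    2^-1 * (2^-1 * (dv a (dv b f) z + I * dv a (dv b' f) z) -
      I * (2^-1 * (dv a' (dv b f) z + I * dv a' (dv b' f) z))).
  rewrite (dv_comm b a z hf) (dv_comm b' a z hf) (dv_comm b a' z hf) (dv_comm b' a' z hf).
  move: (dv b (dv a f) z) (dv b (dv a' f) z) (dv b' (dv a f) z) (dv b' (dv a' f) z) (2^-1).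
  by move=> x1 x2 x3 x4 h; ring.
exact: P.
Qed.

End smooth_calculus.

Section levi_form.
Context {R : realType} {n : nat}.
Local Notation Cn := 'rV[R[i]]_n.
Implicit Types (f g : Cn -> R[i]) (z xi : Cn).

Definition D1 f z xi : R[i] := \sum_j xi 0 j * dz j f z.
Definition Db f z xi : R[i] := \sum_j cj (xi 0 j) * dzb j f z.
(** The Levi form of f in the direction xi, that is, the coefficient of |l|^2 in the expansion along
    z + l xi. *)
Definition lev f z xi : R[i] := \sum_j \sum_k xi 0 j * cj (xi 0 k) * dzb k (dz j f) z.

Definition D2 f z xi : R[i] := 2^-1 * \sum_j \sum_k xi 0 j * xi 0 k * dz k (dz j f) z.
Definition Db2 f z xi : R[i] := 2^-1 * \sum_j \sum_k cj (xi 0 j) * cj (xi 0 k) * dzb k (dzb j f) z.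

Lemma dd_line f z xi (l : R[i]) :
  dd (dz^~ f) (dzb^~ f) z (l *: xi) = l * D1 f z xi + cj l * Db f z xi.
Proof.
rewrite /dd /D1 /Db !mulr_sumr -big_split; apply: eq_bigr => j _ /=.
by rewrite mxE cjM !mulrA.
Qed.

(** The two mixed second-order terms agree by [dz_comm] and together make up the Levi term without
    the factor 1/2. *)
Lemma csm_line3 f : csm f -> exists2 C : R, 0 <= C & forall z xi l,
  cabs (f (z + l *: xi) - (f z + l * D1 f z xi + cj l * Db f z xi + l ^+ 2 * D2 f z xi +
    cj l ^+ 2 * Db2 f z xi + l * cj l * lev f z xi)) <= C * nv xi ^+ 3 * cabs l ^+ 3.
Proof.
move=> hf; have [C C0 hC] := csm_taylor3 hf; exists C => // z xi l; rewrite /D2 /Db2.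
have := hC z (l *: xi); rewrite nvZ exprMn [cabs l ^+ 3 * _]mulrC mulrA dd_line.
congr (cabs _ <= _); rewrite -!addrA -!opprD !addrA; congr (_ - _).
rewrite -!addrA; congr (_ + (_ + (_ + _))).
have symL : \sum_j \sum_k cj (xi 0 j) * xi 0 k * dz k (dzb j f) z = lev f z xi.
  rewrite exchange_big; apply: eq_bigr => j _; apply: eq_bigr => k _.
  by rewrite -dz_comm // [cj _ * _]mulrC.
have -> : l * cj l * lev f z xi = 2^-1 * (l * cj l * lev f z xi + l * cj l * lev f z xi).
  by move: (l * cj l * lev f z xi) => x; field.
rewrite -{2}symL /lev !(mulrCA _ 2^-1) -!mulrDr; congr (_ * _).
rewrite mulrDr /dd2 !mulr_sumr -!big_split; apply: eq_bigr => j _ /=.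
rewrite /dd !mulr_sumr -!big_split; apply: eq_bigr => k _ /=.
rewrite !mxE !cjM; ring.
Qed.

Lemma csm_line1 f : csm f -> exists2 C : R, 0 <= C & forall z xi l,
  cabs (f (z + l *: xi) - (f z + l * D1 f z xi + cj l * Db f z xi)) <= C * nv xi ^+ 2 * cabs l ^+ 2.
Proof.
move=> hf; have [A [B [hd [_ [C C0 hC]]]]] := sm_taylor2 (hf 2%N).
exists C => // z xi l; have := hC z (l *: xi).
rewrite nvZ exprMn [cabs l ^+ 2 * _]mulrC mulrA; congr (cabs _ <= _).
have -> : dd A B z (l *: xi) = dd (dz^~ f) (dzb^~ f) z (l *: xi).
  exact: (@rd_unique R n _ _ _ _ _ (hd z _) (@csm_der _ _ f hf z _)).
by rewrite dd_line -addrA -!opprD !addrA.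
Qed.

Lemma csm_line0 f : csm f -> exists2 C : R, 0 <= C & forall z xi l,
  cabs (f (z + l *: xi) - f z) <= C * nv xi * cabs l.
Proof.
move=> hf; have [C C0 hC] := sm_lipschitz (hf 1%N).
by exists C => // z xi l; have := hC z (l *: xi); rewrite nvZ [cabs l * _]mulrC mulrA.
Qed.

End levi_form.

Section quadratic_expansions.
Context {R : realType}.

(** Second-order expansion in l and its conjugate on the unit disc. Apart from c, a circle mean sees
    only the coefficient q of |l|^2. *)
Definition qexp (F : R[i] -> R[i]) (c a b p p' q : R[i]) (C : R) : Prop :=
  forall l, cabs l <= 1 -> cabs (F l - (c + l * a + cj l * b + l ^+ 2 * p + cj l ^+ 2 * p' +
    l * cj l * q)) <= C * cabs l ^+ 3.

Lemma quarter_ring (l m c a b p p' q I f0 f1 f2 f3 : R[i]) : I * I = -1 ->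
  2^-1 * 2^-1 * (f0 + f1 + f2 + f3) - c - l * m * q =
  2^-1 * 2^-1 * ((f0 - (c + l * a + m * b + l ^+ 2 * p + m ^+ 2 * p' + l * m * q)) +
    (f1 - (c + l * I * a + m * - I * b + (l * I) ^+ 2 * p + (m * - I) ^+ 2 * p' + l * I * (m * - I) * q)) +
    (f2 - (c + l * -1 * a + m * -1 * b + (l * -1) ^+ 2 * p + (m * -1) ^+ 2 * p' + l * -1 * (m * -1) * q)) +
    (f3 - (c + l * - I * a + m * I * b + (l * - I) ^+ 2 * p + (m * I) ^+ 2 * p' + l * - I * (m * I) * q))).
Proof.
move=> II.
have X1 (x : R[i]) : (x * I) ^+ 2 = - x ^+ 2 by rewrite expr2 mulrACA II mulrN1.
have X2 (x : R[i]) : (x * - I) ^+ 2 = - x ^+ 2 by rewrite expr2 mulrACA mulrNN II mulrN1.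
have X3 : l * I * (m * - I) = l * m by rewrite mulrACA mulrN II opprK mulr1.
have X4 : l * - I * (m * I) = l * m by rewrite mulrACA mulNr II opprK mulr1.
by rewrite !X1 !X2 X3 X4; field.
Qed.

(** Averaging over l, i l, -l and -i l already cancels every term except c and q |l|^2. Since the
    circle mean is invariant under these rotations, it equals the mean of the four-point average,
    which satisfies a pointwise bound. *)
Lemma qexp_mean F c a b p p' q (C r : R) : qexp F c a b p p' q C -> 0 < r <= 1 ->
  continuous (fun t => Re (F (r%:C * cis t))) ->
  `|cmean (fun t => Re (F (r%:C * cis t))) - Re c - r ^+ 2 * Re q| <= C * r ^+ 3.
Proof.
move=> hF /andP[r0 r1] cF.
pose g (w : R[i]) := Re (F (r%:C * w)).
pose G (al : R) t := g (cis t * cis al).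
have cG al : continuous (G al).
  rewrite /G; under eq_fun do rewrite -cisD.
  move=> t; apply: (@continuous_comp _ _ _ (fun t : R => t + al) (fun t => g (cis t))).
    by apply: cvgD; [exact: cvg_id|exact: cvg_cst].
  exact: cF.
have mG al : 0 <= al -> cmean (G al) = cmean (fun t => g (cis t)) by exact: cmean_rot.
have h4 : (0 : R) < 2^-1 * 2^-1 by rewrite mulr_gt0 // invr_gt0.
have p2 : (0 : R) <= pi / 2 by rewrite divr_ge0 // pi_ge0.
pose G4 t := 2^-1 * 2^-1 * (G 0 t + G (pi / 2) t + G pi t + G (pi + pi / 2) t).
have cG4a : continuous (fun t => G 0 t + G (pi / 2) t) by move=> t; exact: (cvgD (cG 0 t) (cG (pi / 2) t)).
have cG4b : continuous (fun t => G 0 t + G (pi / 2) t + G pi t) by move=> t; exact: (cvgD (cG4a t) (cG pi t)).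
have cG4c : continuous (fun t => G 0 t + G (pi / 2) t + G pi t + G (pi + pi / 2) t).
  by move=> t; exact: (cvgD (cG4b t) (cG (pi + pi / 2) t)).
have cG4 : continuous G4 by move=> t; exact: (cvgM (@cst_continuous _ _ (2^-1 * 2^-1 : R) t) (cG4c t)).
have E4 : cmean G4 = cmean (fun t => g (cis t)).
  rewrite /G4 (cmeanZ _ cG4c) (cmeanD cG4b (cG (pi + pi / 2))) (cmeanD cG4a (cG pi)).
  rewrite (cmeanD (cG 0) (cG (pi / 2))) (mG _ (lexx 0)) (mG _ p2) (mG _ (pi_ge0 R)).
  rewrite (mG _ (addr_ge0 (pi_ge0 R) p2)).
  by field.
rewrite -/(g) in cF *.
have -> : cmean (fun t => Re (F (r%:C * cis t))) = cmean G4 by rewrite E4.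
have -> : cmean G4 - Re c - r ^+ 2 * Re q = cmean (fun t => G4 t - (Re c + r ^+ 2 * Re q)).
  rewrite cmeanB ?cmean_cst //; first by rewrite opprD addrA.
  by move=> t; exact: cst_continuous.
apply: cmean_abs.
  move=> t; exact: (cvgB (cG4 t) (@cst_continuous _ _ (Re c + r ^+ 2 * Re q) t)).
move=> t _; rewrite /G4 /G /g cis0 mulr1.
have ch : cis (pi / 2) = 'i%C :> R[i] by rewrite /cis cos_pihalf sin_pihalf.
have cp : cis pi = -1 :> R[i].
  by rewrite /cis cospi sinpi; apply/eqP; rewrite eq_complex /= oppr0 !eqxx.
rewrite cisD cp ch mulN1r.
set l := r%:C * cis t.
have cl : cabs l = r by rewrite /l cabsM cabs_real cabs_cis mulr1 gtr0_norm.
have lm : l * cj l = (r ^+ 2)%:C by rewrite mulcJ cl.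
rewrite !(mulrA r%:C) -/l.
have II : 'i%C * 'i%C = -1 :> R[i] by rewrite -expr2 sqr_i.
have ci : cabs ('i%C : R[i]) = 1 by rewrite /cabs /= expr0n expr1n add0r sqrtr1.
have cji : cj 'i%C = - 'i%C :> R[i] by apply/eqP; rewrite eq_complex /= !oppr0 !eqxx.
pose f0 := F l; pose f1 := F (l * 'i%C); pose f2 := F (l * -1); pose f3 := F (l * - 'i%C).
have -> : 2^-1 * 2^-1 * (Re (F l) + Re (F (l * 'i%C)) + Re (F (l * -1)) + Re (F (l * - 'i%C))) -
    (Re c + r ^+ 2 * Re q) = Re (2^-1 * 2^-1 * (f0 + f1 + f2 + f3) - c - l * cj l * q).
  rewrite lm half_real -rmorphM /= !ReD !ReN !ReZ !ReD opprD addrA; ring.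
rewrite (@quarter_ring l (cj l) c a b p p' q 'i%C f0 f1 f2 f3 II).
apply: le_trans (Re_le_cabs _) _; rewrite !cabsM !cabs_half.
have Q (w w' : R[i]) : cabs w = 1 -> cj w = w' ->
    cabs (F (l * w) - (c + l * w * a + cj l * w' * b + (l * w) ^+ 2 * p + (cj l * w') ^+ 2 * p' +
      l * w * (cj l * w') * q)) <= C * r ^+ 3.
  move=> cw <-; have := hF (l * w); rewrite (cabsM l w) cl cw mulr1 cjM => /(_ r1); exact.
have q0 := Q 1 1 cabs1 (rmorph1 _); rewrite !mulr1 in q0.
have q1 := Q 'i%C (- 'i%C) ci cji.
have c1 : cabs (-1 : R[i]) = 1 by rewrite cabsN cabs1.
have q2 := Q (-1) (-1) c1 ltac:(by rewrite cjN rmorph1).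
have q3 := Q (- 'i%C) 'i%C ltac:(by rewrite cabsN) ltac:(by rewrite cjN cji opprK).
have -> : C * r ^+ 3 = 2^-1 * 2^-1 * (C * r ^+ 3 + C * r ^+ 3 + C * r ^+ 3 + C * r ^+ 3).
  by move: (C * r ^+ 3) => x; field.
rewrite ler_pM2l //.
apply: le_trans (cabsD _ _) _; apply: lerD; last exact: q3.
apply: le_trans (cabsD _ _) _; apply: lerD; last exact: q2.
apply: le_trans (cabsD _ _) _; apply: lerD; last exact: q1.
exact: q0.
Qed.

Lemma cubic_vanish (x C : R) : (forall r, 0 < r <= 1 -> r ^+ 2 * x <= C * r ^+ 3) -> x <= 0.
Proof.
move=> h; rewrite leNgt; apply/negP => x0.
have C1 : 0 < `|C| + 1 by rewrite ltr_wpDl.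
pose r := Num.min 1 (x / (`|C| + 1) / 2).
have r0 : 0 < r by rewrite lt_min ltr01 !divr_gt0.
have r1 : r <= 1 by rewrite ge_min lexx.
have := h r; rewrite r0 r1 => /(_ isT); rewrite (exprS r 2) mulrA [_ * x]mulrC.
rewrite ler_pM2r ?exprn_gt0 // => h1.
have h2 : r <= x / (`|C| + 1) / 2 by rewrite ge_min lexx orbT.
have h3 : C * r <= (`|C| + 1) * r by apply: ler_wpM2r; [exact: ltW|rewrite (le_trans (ler_norm C)) // lerDl].
have h4 : (`|C| + 1) * r <= x / 2.
  by rewrite -(ler_pM2l C1) in h2; apply: le_trans h2 _; rewrite mulrA mulrCA divff ?mulr1 // lt0r_neq0.
have := le_trans h1 (le_trans h3 h4); rewrite ler_pdivlMr // mulr_natr mulr2n gerDl.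
by rewrite leNgt x0.
Qed.

End quadratic_expansions.

Lemma inverse_quotient_ring {K : fieldType} (x a b a' b' : K) : a * a' = 1 -> b * b' = 1 ->
  - (x * (a - b)) * (a' * b') = x * (a' - b').
Proof.
move=> ha hb; rewrite mulNr -mulrA -mulrN; congr (_ * _).
rewrite mulrBl (mulrA a) ha mul1r [a' * b']mulrC (mulrA b) hb mul1r; ring.
Qed.

Section matrix_fields.
Context {R : realType} {n : nat}.
Local Notation Cn := 'rV[R[i]]_n.
Implicit Types (f g : Cn -> R[i]) (z v : Cn).

Lemma cvg_mx T (F : set_system T) {FF : Filter F} p q (f : T -> 'M[R[i]]_(p, q)) (l : 'M[R[i]]_(p, q)) :
  (forall i j, f x i j @[x --> F] --> l i j) -> f x @[x --> F] --> l.
Proof.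
move=> h A [P hP hA].
have : \forall x \near F, forall i j, P i j (f x i j).
  by apply: filter_forall => i; apply: filter_forall => j; apply: h; exact: hP.
by apply: filterS => x hx; exact: hA.
Qed.

Definition mrd p q (F : Cn -> 'M[R[i]]_(p, q)) z v (L : 'M[R[i]]_(p, q)) : Prop :=
  forall i j, rd (fun x => F x i j) z v (L i j).

Lemma rderive_mrd p q (F : Cn -> 'M[R[i]]_(p, q)) z v L : mrd F z v L ->
  rderivable v F z /\ rderive v F z = L.
Proof.
move=> h; have c : rquotient v F z t @[t --> (0 : R)^'] --> L.
  apply: cvg_mx => i j.
  have E : (fun t => rquotient v F z t i j) = dquot (fun x => F x i j) z v.
    by apply/funext => t; rewrite /dquot /rquotient !mxE.
  by rewrite E; exact: h.
split; first by apply/cvg_ex; exists L.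
exact: cvg_lim c.
Qed.

Lemma rd_sum (I : Type) (s : seq I) (F : I -> Cn -> R[i]) z v (l : I -> R[i]) :
  (forall i, rd (F i) z v (l i)) -> rd (fun x => \sum_(i <- s) F i x) z v (\sum_(i <- s) l i).
Proof.
move=> h; elim: s => [|a s IH].
  by under eq_fun do rewrite big_nil; rewrite big_nil; exact: rd_cst.
by under eq_fun do rewrite big_cons; rewrite big_cons; exact: (rdD (h a) IH).
Qed.

Lemma mrdM p q m (F : Cn -> 'M[R[i]]_(p, q)) (G : Cn -> 'M[R[i]]_(q, m)) z v L L' :
  mrd F z v L -> mrd G z v L' -> mrd (fun x => F x *m G x) z v (L *m G z + F z *m L').
Proof.
move=> hF hG i j; under eq_fun do rewrite mxE.
rewrite !mxE -big_split; apply: rd_sum => k /=; exact: (rdM (hF i k) (hG k j)).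
Qed.

Lemma rdV f z v l : rd f z v l -> f z != 0 -> exists l', rd (fun x => (f x)^-1) z v l'.
Proof.
move=> h f0; have c := rd_cont h.
exists (- l * ((f z)^-1 * (f z)^-1)).
have ci : (f (z + t%:C *: v))^-1 @[t --> (0 : R)^'] --> (f z)^-1 by exact: (cvgV f0 c).
have n0 : \forall t \near (0 : R)^', f (z + t%:C *: v) != 0.
  have f1 : 0 < cabs (f z) by rewrite lt_neqAle cabs_ge0 andbT eq_sym cabs_eq0.
  have hc : \forall t \near (0 : R)^', cabs (f (z + t%:C *: v) - f z) < cabs (f z).
    exact: (@cvg_cabs R _ (0 : R)^' _ _ _).1 c _ f1.
  apply: filterS hc => t.
  by apply: contraTneq => ->; rewrite sub0r cabsN ltxx.
have hl : - dquot f z v t * ((f (z + t%:C *: v))^-1 * (f z)^-1) @[t --> (0 : R)^'] -->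
    - l * ((f z)^-1 * (f z)^-1).
  have hN : - dquot f z v t @[t --> (0 : R)^'] --> - l by exact: (cvgN h).
  exact: (cvgM hN (cvgM ci (cvg_cst (f z)^-1))).
apply: cvg_trans hl; apply: near_eq_cvg; near=> t.
have ft : f (z + t%:C *: v) != 0 by near: t.
have f2 : f (z + t%:C *: v) * (f (z + t%:C *: v))^-1 = 1 by rewrite divff.
have f3 : f z * (f z)^-1 = 1 by rewrite divff.
rewrite /dquot; exact: (inverse_quotient_ring _ f2 f3).
Unshelve. all: by end_near. Qed.

Definition rdx f z v : Prop := exists l, rd f z v l.

Lemma rdx_sum (I : Type) (s : seq I) (F : I -> Cn -> R[i]) z v :
  (forall i, rdx (F i) z v) -> rdx (fun x => \sum_(i <- s) F i x) z v.
Proof. by move=> /choice[l hl]; exists (\sum_(i <- s) l i); exact: rd_sum. Qed.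

Lemma rdxM f g z v : rdx f z v -> rdx g z v -> rdx (fun x => f x * g x) z v.
Proof. by move=> [l hl] [m hm]; exists (l * g z + f z * m); exact: rdM. Qed.

Lemma rdx_cst (c : R[i]) z v : rdx (fun=> c) z v.
Proof. by exists 0; exact: rd_cst. Qed.

Lemma rdx_prod (I : Type) (s : seq I) (F : I -> Cn -> R[i]) z v :
  (forall i, rdx (F i) z v) -> rdx (fun x => \prod_(i <- s) F i x) z v.
Proof.
move=> h; elim: s => [|a s IH].
  by under eq_fun do rewrite big_nil; exact: rdx_cst.
by under eq_fun do rewrite big_cons; exact: rdxM.
Qed.

Lemma rdx_det m (F : Cn -> 'M[R[i]]_m) z v : (forall i j, rdx (fun x => F x i j) z v) ->
  rdx (fun x => \det (F x)) z v.
Proof.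
move=> h; apply: rdx_sum => s; apply: rdxM; first exact: rdx_cst.
exact: rdx_prod.
Qed.

(** Cramer's rule gives the existence of the derivative; differentiating H H^-1 = 1 then determines
    it. *)
Lemma mrd_inv r (H : Cn -> 'M[R[i]]_r) z v L : (forall w, H w \in unitmx) -> mrd H z v L ->
  mrd (fun x => invmx (H x)) z v (- (invmx (H z) *m L *m invmx (H z))).
Proof.
move=> uH hL; pose L' := \matrix_(i, j) dv v (fun x => invmx (H x) i j) z.
have hV : mrd (fun x => invmx (H x)) z v L'.
  move=> i j; rewrite mxE.
  have [l hl] : rdx (fun x => invmx (H x) i j) z v.
    rewrite (_ : (fun x => _) = fun x => (\det (H x))^-1 * cofactor (H x) j i); last first.
      by apply/funext => x; rewrite /invmx uH !mxE.
    have ent i' j' : rdx (fun x => H x i' j') z v by exists (L i' j'); exact: hL.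
    have [d hd] := rdx_det ent.
    apply: rdxM; first by apply: (rdV hd); have := uH z; rewrite unitmxE unitfE.
    apply: rdxM; first exact: rdx_cst.
    by apply: rdx_det => i' j'; under eq_fun do rewrite !mxE; exact: ent.
  by rewrite (dvE hl).
have h1 := mrdM hL hV.
have h0 : L *m invmx (H z) + H z *m L' = 0.
  apply/matrixP => i j; rewrite [RHS]mxE; apply: (rd_unique (h1 i j)).
  have E : (fun x => (H x *m invmx (H x)) i j) = fun=> (1%:M : 'M[R[i]]_r) i j.
    by apply/funext => x; rewrite mulmxV.
  by rewrite E; exact: rd_cst.
have -> : - (invmx (H z) *m L *m invmx (H z)) = L'; last exact: hV.
have := congr1 (mulmx (invmx (H z))) h0; rewrite mulmxDr mulmx0 !mulmxA mulVmx // mul1mx.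
by move/eqP; rewrite addrC addr_eq0 => /eqP <-.
Qed.

End matrix_fields.

Lemma hermitian_square_ring {K : comRingType} (A B C D l m : K) :
  A + - m * B + (- l * C + - l * (- m * D)) = A - l * C - m * B + l * m * D.
Proof. ring. Qed.

Lemma expansion_ring {K : comRingType}
  (F1 F2 F3 F4 a1 a2 a3 a4 b1 b2 b3 c1 c2 c3 l m p p' q : K) :
  F1 - l * F2 - m * F3 + l * m * F4 -
    (a1 + l * (b1 - a2) + m * (c1 - a3) + l ^+ 2 * (p - b2) + m ^+ 2 * (p' - c3) +
     l * m * (q - c2 - b3 + a4)) =
  F1 - (a1 + l * b1 + m * c1 + l ^+ 2 * p + m ^+ 2 * p' + l * m * q) -
    l * (F2 - (a2 + l * b2 + m * c2)) - m * (F3 - (a3 + l * b3 + m * c3)) + l * m * (F4 - a4).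
Proof. ring. Qed.

Lemma curvature_ring {K : comRingType} (p l x w : K) :
  (p + -1 * l) * x * w = w * (x * p) - x * w * l.
Proof. ring. Qed.

Lemma scale_expansion_ring {K : comRingType} (I f c a b p p' q l m : K) :
  I * f - (I * c + l * (I * a) + m * (I * b) + l ^+ 2 * (I * p) + m ^+ 2 * (I * p') + l * m * (I * q)) =
  I * (f - (c + l * a + m * b + l ^+ 2 * p + m ^+ 2 * p' + l * m * q)).
Proof. ring. Qed.

Lemma curvature_mx {K : comRingType} r (H V X Y X' Y' M : 'M[K]_r) (I h : K) : H *m V = 1%:M ->
  H *m - (h *: (- (V *m X *m V) *m M + V *m Y' + I *: (- (V *m Y *m V) *m M + V *m X'))) =
  h *: (X + I *: Y) *m V *m M - h *: (Y' + I *: X').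
Proof.
move=> HV.
have E Z W : - (V *m Z *m V) *m M + V *m W = V *m (- (Z *m V *m M) + W).
  by rewrite mulmxDr mulmxN !mulmxA mulNmx.
rewrite !E scalemxAr -mulmxDr scalemxAr -mulmxN mulmxA HV mul1mx.
rewrite -!scalemxAl !mulmxDl -!scalemxAl.
move: (X *m V *m M) (Y *m V *m M) => x y; apply/matrixP => i j; rewrite !mxE; ring.
Qed.

(** * Sign of the Chern curvature *)

Section chern_curvature_sign.
Context {R : realType} {n r : nat}.
Local Notation Cn := 'rV[R[i]]_n.
Local Notation mat := (Cn -> 'M[R[i]]_r).

Definition mcsm (F : mat) : Prop := forall i j, csm (fun x => F x i j).
Definition mdz (k : 'I_n) (F : mat) : mat := fun z => \matrix_(i, j) dz k (fun x => F x i j) z.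
Definition mdzb (k : 'I_n) (F : mat) : mat := fun z => \matrix_(i, j) dzb k (fun x => F x i j) z.
Definition mdv (v : Cn) (F : mat) : mat := fun z => \matrix_(i, j) dv v (fun x => F x i j) z.

Lemma mcsm_dz k F : mcsm F -> mcsm (mdz k F).
Proof. by move=> h i j; under eq_fun do rewrite mxE; exact: csm_dz. Qed.

Lemma mcsm_dv v F : mcsm F -> mcsm (mdv v F).
Proof. by move=> h i j; under eq_fun do rewrite mxE; exact: csm_dv. Qed.

Lemma mrd_mcsm F z v : mcsm F -> mrd F z v (mdv v F z).
Proof. by move=> h i j; rewrite mxE; exact: csm_rd. Qed.

Lemma mcsm_Ck k D F : mcsm F -> Ck k D F.
Proof.
elim: k F => [|k IH] F hF; split=> //.
- move=> z _; apply: (@cvg_mx R _ (nbhs z)) => i j.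
  by have [c _] := sm_bounded (hF i j 0%N); exact: c.
- move=> z _; apply: (@cvg_mx R _ (nbhs z)) => i j.
  by have [c _] := sm_bounded (hF i j 0%N); exact: c.
move=> v; split; first by move=> z _; have [] := rderive_mrd (@mrd_mcsm F z v hF).
have -> : rderive v F = mdv v F.
  by apply/funext => z; have [] := rderive_mrd (@mrd_mcsm F z v hF).
by apply: IH; exact: mcsm_dv.
Qed.

Lemma ddz_mdz k F : mcsm F -> ddz k F = mdz k F.
Proof.
move=> hF; apply/funext => z; rewrite /ddz.
have [_ ->] := rderive_mrd (@mrd_mcsm F z (delta_mx 0 k) hF).
have [_ ->] := rderive_mrd (@mrd_mcsm F z ('i%C *: delta_mx 0 k) hF).
by apply/matrixP => i j; rewrite !mxE.
Qed.

Lemma dz_hdot (F : mat) s t k z : mcsm F ->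
  dz k (fun x => hdot (F x) s t) z = hdot (mdz k F z) s t /\
  dzb k (fun x => hdot (F x) s t) z = hdot (mdzb k F z) s t.
Proof.
move=> hF; under eq_fun do rewrite hdotE; rewrite !hdotE.
pose f i j x := (cj (t i 0) * s j 0) * F x i j.
have cf i j : csm (f i j) by apply: csmZ; exact: hF.
have cf1 i : csm (fun x => \sum_j f i j x) by apply: csm_sum => j; exact: cf.
rewrite (_ : (fun x => _) = (fun x => \sum_i \sum_j f i j x)); last first.
  by apply/funext => x; apply: eq_bigr => i _; apply: eq_bigr => j _; rewrite /f mulrAC.
have [-> ->] := @dz_sum R n _ (index_enum _) _ k z cf1.
split; apply: eq_bigr => i _; have [E1 E2] := @dz_sum R n _ (index_enum _) _ k z (cf i);
  rewrite ?E1 ?E2; apply: eq_bigr => j _;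
  have [F1 F2] := dzZ (cj (t i 0) * s j 0) k z (hF i j); rewrite mxE mulrAC; [exact: F1|exact: F2].
Qed.

Lemma csm_hdot (F : mat) s t : mcsm F -> csm (fun x => hdot (F x) s t).
Proof.
move=> hF; under eq_fun do rewrite hdotE; apply: csm_sum => i; apply: csm_sum => j.
by apply: csmM; [apply: csmZ; exact: hF|exact: csm_cst].
Qed.

Lemma hdot_msum (I : Type) (e : seq I) (M : I -> 'M[R[i]]_r) s t :
  hdot (\sum_(i <- e) M i) s t = \sum_(i <- e) hdot (M i) s t.
Proof.
elim: e => [|a e IH]; first by rewrite !big_nil /hdot mulmx0 mul0mx mxE.
by rewrite !big_cons hdotDm IH.
Qed.

Variable H : mat.
Hypothesis cH : mcsm H.

Definition AX z (xi : Cn) := \sum_j xi 0 j *: mdz j H z.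
Definition BX z (xi : Cn) := \sum_k cj (xi 0 k) *: mdzb k H z.
Definition LX z (xi : Cn) := \sum_j \sum_k (xi 0 j * cj (xi 0 k)) *: mdzb k (mdz j H) z.

Lemma D1_hdot s t z xi : D1 (fun x => hdot (H x) s t) z xi = hdot (AX z xi) s t.
Proof.
rewrite /D1 /AX hdot_msum; apply: eq_bigr => j _; rewrite hdotZm.
by have [-> _] := dz_hdot s t j z cH.
Qed.

Lemma Db_hdot s t z xi : Db (fun x => hdot (H x) s t) z xi = hdot (BX z xi) s t.
Proof.
rewrite /Db /BX hdot_msum; apply: eq_bigr => j _; rewrite hdotZm.
by have [_ ->] := dz_hdot s t j z cH.
Qed.

Lemma lev_hdot s t z xi : lev (fun x => hdot (H x) s t) z xi = hdot (LX z xi) s t.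
Proof.
rewrite /lev /LX hdot_msum; apply: eq_bigr => j _; rewrite hdot_msum.
apply: eq_bigr => k _; rewrite hdotZm.
have -> : dz j (fun x => hdot (H x) s t) = fun x => hdot (mdz j H x) s t.
  by apply/funext => x; have [] := dz_hdot s t j x cH.
by have [_ ->] := dz_hdot s t k z (mcsm_dz j cH).
Qed.

(** Each of the four products is expanded only as far as its factor 1, l, conj(l) or |l|^2 requires
    for a cubic total error. *)
Lemma qexp_hdot s a z xi : exists p p' c1 c2 C, [/\ 0 <= C &
  qexp (fun l => hdot (H (z + l *: xi)) (s - l *: a) (s - l *: a)) (hdot (H z) s s)
    c1 c2 p p' (hdot (LX z xi) s s - hdot (BX z xi) a s - hdot (AX z xi) s a + hdot (H z) a a) C].
Proof.
have [C1 C10 /(_ z xi) h1] := csm_line3 (csm_hdot s s cH).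
move: h1; set p := D2 _ z xi; set p' := Db2 _ z xi => h1.
have [C2 C20 /(_ z xi) h2] := csm_line1 (csm_hdot a s cH).
have [C3 C30 /(_ z xi) h3] := csm_line1 (csm_hdot s a cH).
have [C4 C40 /(_ z xi) h4] := csm_line0 (csm_hdot a a cH).
pose K1 := C1 * nv xi ^+ 3; pose K2 := C2 * nv xi ^+ 2.
pose K3 := C3 * nv xi ^+ 2; pose K4 := C4 * nv xi.
have n0 := nv_ge0 xi.
have K10 : 0 <= K1 by rewrite mulr_ge0 ?exprn_ge0.
have K20 : 0 <= K2 by rewrite mulr_ge0 ?exprn_ge0.
have K30 : 0 <= K3 by rewrite mulr_ge0 ?exprn_ge0.
have K40 : 0 <= K4 by rewrite mulr_ge0.
exists (p - hdot (AX z xi) a s), (p' - hdot (BX z xi) s a),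
  (hdot (AX z xi) s s - hdot (H z) a s), (hdot (BX z xi) s s - hdot (H z) s a), (K1 + K2 + K3 + K4).
split; first by rewrite !addr_ge0.
move=> l l1; have {}h1 := h1 l; have {}h2 := h2 l; have {}h3 := h3 l; have {}h4 := h4 l.
rewrite D1_hdot Db_hdot lev_hdot in h1; rewrite !D1_hdot !Db_hdot in h2 h3.
rewrite -/K1 in h1; rewrite -/K2 in h2; rewrite -/K3 in h3; rewrite -/K4 in h4.
have EF M : hdot M (s - l *: a) (s - l *: a) =
    hdot M s s - l * hdot M a s - cj l * hdot M s a + l * cj l * hdot M a a.
  rewrite -scaleNr hdotDl !hdotDr !hdotZl !hdotZr cjN.
  exact: hermitian_square_ring.
rewrite EF.
have c0 := cabs_ge0 l.
have := le_trans (cabsD _ _) (lerD (le_trans (cabsD _ _) (lerD (le_trans (cabsD _ _) (lerD h1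
  (_ : cabs (- (l * (hdot (H (z + l *: xi)) a s - (hdot (H z) a s + l * hdot (AX z xi) a s + cj l * hdot (BX z xi) a s)))) <= K2 * cabs l ^+ 3)))
  (_ : cabs (- (cj l * (hdot (H (z + l *: xi)) s a - (hdot (H z) s a + l * hdot (AX z xi) s a + cj l * hdot (BX z xi) s a)))) <= K3 * cabs l ^+ 3)))
  (_ : cabs (l * cj l * (hdot (H (z + l *: xi)) a a - hdot (H z) a a)) <= K4 * cabs l ^+ 3)).
rewrite -!mulrDl => h; apply: le_trans (h _ _ _).
- by apply: le_eq; congr cabs; exact: expansion_ring.
- rewrite cabsN cabsM (exprS _ 2) mulrCA; exact: ler_wpM2l.
- rewrite cabsN cabsM cabs_conj (exprS _ 2) mulrCA; exact: ler_wpM2l.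
- rewrite !cabsM cabs_conj -expr2 (exprSr _ 2) mulrCA; apply: ler_wpM2l; rewrite ?sqr_ge0 //.
Qed.

Hypothesis hH : forall z, herm (H z).
Hypothesis pH : forall z s, s != 0 -> 0 < qf (H z) s.

Lemma posdef_unitmx M : (forall s : 'cV[R[i]]_r, s != 0 -> 0 < qf M s) -> M \in unitmx.
Proof.
move=> pM; rewrite unitmxE unitfE; apply/negP => /det0P[v v0 hv].
pose s : 'cV[R[i]]_r := (map_mx cj v)^T.
have s0 : s != 0.
  apply: contra v0 => /eqP hs; apply/eqP/matrixP => i j; rewrite ord1 mxE.
  have := congr1 (fun x : 'cV[R[i]]_r => x j 0) hs; rewrite !mxE => h.
  by apply/eqP; rewrite -cabs_eq0 -cabs_conj h cabs0.
have := pM s s0; rewrite /qf /hdot.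
have -> : (map_mx Num.conj s)^T = v.
  by apply/matrixP => i j; rewrite !mxE conjCK.
by rewrite hv mul0mx mxE /= ltxx.
Qed.

Let uH w : H w \in unitmx.
Proof. by apply: posdef_unitmx => s; exact: pH. Qed.

Lemma hdot_mul (M N : 'M[R[i]]_r) (s t : 'cV[R[i]]_r) : hdot M (N *m s) t = hdot (M *m N) s t.
Proof. by rewrite /hdot !mulmxA. Qed.

Lemma hdot_curvature j k z s :
  hdot (H z) (chern_curvature H j k z *m s) s =
  hdot (mdzb k H z *m invmx (H z) *m mdz j H z - mdzb k (mdz j H) z) s s.
Proof.
rewrite hdot_mul; congr hdot; rewrite /chern_curvature ddz_mdz //.
set W := fun w => invmx (H w) *m mdz j H w.
have hW v : mrd W z v (- (invmx (H z) *m mdv v H z *m invmx (H z)) *m mdz j H z +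
    invmx (H z) *m mdv v (mdz j H) z).
  by apply: mrdM; [apply: mrd_inv => //|]; apply: mrd_mcsm => //; exact: mcsm_dz.
rewrite /ddzbar; have [_ ->] := rderive_mrd (hW (delta_mx 0 k)).
have [_ ->] := rderive_mrd (hW ('i%C *: delta_mx 0 k)).
have E F : mdzb k F z = 2^-1 *: (mdv (delta_mx 0 k) F z + 'i%C *: mdv ('i%C *: delta_mx 0 k) F z).
  by apply/matrixP => i l; rewrite !mxE.
rewrite !E; move: (mdv _ H z) (mdv ('i%C *: _) H z) (mdv _ (mdz j H) z) (mdv _ (mdz j H) z).
move=> X Y X' Y'; have HV : H z *m invmx (H z) = 1%:M by rewrite mulmxV.
exact: curvature_mx.
Qed.

Lemma negative_curvature (D : set Cn) :
  (forall z, D z -> exists2 d : R, 0 < d &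
     forall (P : 'M[R[i]]_(r, n)) (c : 'cV[R[i]]_r) (b : Cn),
     (forall l, cabs l <= 1 -> pd 0 d (l *: b)) ->
     qf (H z) (P *m z^T + c) <= cmean (fun t => qf (H (z + cis t *: b)) (P *m (z + cis t *: b)^T + c))) ->
  smooth_hermitian_metric D H /\ negative_griffiths_curvature D H.
Proof.
move=> sub; split.
  split; first by move=> k; exact: mcsm_Ck.
  move=> z Dz; split.
    apply/is_hermitianmxP; rewrite /= expr0 scale1r; apply/matrixP => i j; rewrite !mxE.
    exact: hH.
  by move=> s s0; rewrite (herm_real s (hH z)) ltcR pH.
move=> z Dz s xi.
have -> : \sum_j \sum_k hdot (H z) (chern_curvature H j k z *m s) s * xi 0 j * cj (xi 0 k) =
    hdot (BX z xi *m invmx (H z) *m AX z xi) s s - hdot (LX z xi) s s.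
  rewrite /BX /AX mulmx_suml mulmx_suml.
  under [in RHS]eq_bigr do rewrite mulmx_sumr.
  rewrite [X in _ = hdot X s s - _]exchange_big hdot_msum /LX hdot_msum -sumrB; apply: eq_bigr => j _.
  rewrite !hdot_msum -sumrB; apply: eq_bigr => k _.
  rewrite hdot_curvature -!scalemxAl -scalemxAr !hdotZm hdotDm -scaleN1r hdotZm.
  exact: curvature_ring.
(* For xi = 0 the sum vanishes; otherwise a nonzero coordinate of xi will serve as the parameter of
   the line. *)
have [xi0|/eqP xi0] := pselect (xi = 0).
  rewrite /AX /LX !big1 ?mulmx0.
  - by rewrite /hdot mulmx0 mul0mx mxE subrr.
  - by move=> j _; rewrite big1 // => k _; rewrite xi0 mxE mul0r scale0r.
  - by move=> j _; rewrite xi0 mxE scale0r.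
have [j hj] : exists j, xi 0 j != 0.
  apply: contrapT => h; move/eqP: xi0; apply; apply/matrixP => i k; rewrite ord1 mxE.
  by apply/eqP; apply: contrapT => hi; apply: h; exists k; apply/negP.
(* The minimiser of the |l|^2 coefficient over a, found by completing the square; the minimum is
   minus the curvature form. *)
pose a := invmx (H z) *m (AX z xi *m s).
have [p [p' [c1 [c2 [C [C0 hq]]]]]] := qexp_hdot s a z xi.
have qE : hdot (LX z xi) s s - hdot (BX z xi) a s - hdot (AX z xi) s a + hdot (H z) a a =
    hdot (LX z xi) s s - hdot (BX z xi *m invmx (H z) *m AX z xi) s s.
  have -> : hdot (BX z xi) a s = hdot (BX z xi *m invmx (H z) *m AX z xi) s s by rewrite /a !hdot_mul.
  have -> : hdot (H z) a a = hdot (AX z xi) s a.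
    by rewrite {1}/a !hdot_mul mulmxV // mul1mx.
  by rewrite subrK.
rewrite qE in hq; move: hq; set q := hdot (LX z xi) s s - _ => hq.
rewrite -[X in X <= 0]opprK opprB -/q oppr_le0.
pose F l := hdot (H (z + l *: xi)) (s - l *: a) (s - l *: a).
have FR l : F l = (qf (H (z + l *: xi)) (s - l *: a))%:C by exact: herm_real.
have cF (x : R) : continuous (fun t => Re (F (x%:C * cis t))).
  move=> t; apply: (@continuous_qf R r R (fun t => H (z + (x%:C * cis t) *: xi))
     (fun t => s - (x%:C * cis t) *: a)) => [i k|i].
    have E y : z + (x%:C * cis y) *: xi = z + cis y *: (x%:C *: xi) by rewrite scalerA mulrC.
    under eq_fun do rewrite E; rewrite E.
    apply: (@continuous_comp _ _ _ (fun t => z + cis t *: (x%:C *: xi)) (fun y => H y i k)).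
      exact: continuous_circle.
    by have [c _] := sm_bounded (cH i k 0%N); exact: c.
  have E y : (s - (x%:C * cis y) *: a) i 0 = s i 0 + cis y * (- x%:C * a i 0).
    by rewrite !mxE; ring.
  under eq_fun do rewrite E; rewrite E.
  exact: (cvgD (@cst_continuous _ _ (s i 0) t)
     (cvgM (@continuous_cis R t) (@cst_continuous _ _ (- x%:C * a i 0) t))).
have [d d0 hd] := sub z Dz.
have S0 : 0 < nv xi + 1 by rewrite ltr_wpDl ?nv_ge0.
pose r0 := Num.min 1 (d / (nv xi + 1) / 2).
have r00 : 0 < r0 by rewrite lt_min ltr01 !divr_gt0.
have r01 : r0 <= 1 by rewrite ge_min lexx.
have r0d : r0 * nv xi < d.
  have : r0 <= d / (nv xi + 1) / 2 by rewrite ge_min lexx orbT.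
  rewrite ler_pdivlMr // ler_pdivlMr // => h; apply: lt_le_trans h.
  rewrite -mulrA ltr_pM2l // mulrDr mulr1 mulr_natl mulr2n -addrA ltrDl.
  by rewrite ltr_wpDl ?nv_ge0.
have Rq : 0 <= Re q.
  rewrite -oppr_le0; apply: (@cubic_vanish R _ (C * r0)) => x /andP[x0 x1].
  have y0 : 0 < x * r0 by rewrite mulr_gt0.
  have y1 : x * r0 <= 1 by rewrite mulr_ile1 // ltW.
  have := qexp_mean hq _ (cF (x * r0)); rewrite y0 y1 => /(_ isT).
  rewrite ler_norml => /andP[_ hm].
  (* An affine field on C^n that takes the value s - l a at z + l xi: the parameter l is read off
     the coordinate j as (w_j - z_j) / xi_j. *)
  pose P : 'M[R[i]]_(r, n) := - ((xi 0 j)^-1 *: (a *m (delta_mx 0 j : 'rV_n))).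
  pose c := s + ((xi 0 j)^-1 * z 0 j) *: a.
  have Pu l : P *m (z + l *: xi)^T + c = s - l *: a.
    rewrite /P /c mulNmx -scalemxAl -mulmxA.
    have -> : (delta_mx 0 j : 'rV_n) *m (z + l *: xi)^T = (z 0 j + l * xi 0 j)%:M.
      apply/matrixP => i k; rewrite !ord1 !mxE (bigD1 j) //= big1 ?addr0 => [|m /negbTE nm].
        by rewrite !mxE !eqxx mul1r mulr1n.
          by rewrite [X in X * _]mxE nm andbF mul0r.
    rewrite mul_mx_scalar scalerA mulrDr mulrCA mulVf // mulr1 scalerDl opprD.
    by rewrite addrC -addrA addNKr.
  have := hd P c ((x * r0)%:C *: xi) _.
  have E t : z + cis t *: ((x * r0)%:C *: xi) = z + ((x * r0)%:C * cis t) *: xi by rewrite scalerA mulrC.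
  under [X in cmean X]eq_fun do rewrite E Pu.
  have Ez : P *m z^T + c = s by have := Pu 0; rewrite !scale0r addr0 subr0.
  rewrite Ez => hs.
  have {}hs : qf (H z) s <= cmean (fun t => Re (F ((x * r0)%:C * cis t))).
    apply: hs => l l1; apply/pdE => k; rewrite !mxE subr0 !cabsM cabs_real (gtr0_norm y0).
    apply: le_lt_trans r0d.
    have k0 := cabs_ge0 (xi 0 k).
    have hk : cabs (xi 0 k) <= nv xi.
      by rewrite /nv (bigD1 k) //= lerDl; apply: sumr_ge0 => m _; exact: cabs_ge0.
    apply: (@le_trans _ _ (1 * (1 * r0 * nv xi))); last by rewrite !mul1r.
    apply: ler_pM => //; rewrite ?cabs_ge0 ?mulr_ge0 // ?(ltW x0) ?(ltW r00) //.
    by apply: ler_pM => //; rewrite ?mulr_ge0 ?(ltW x0) ?(ltW r00) //; apply: ler_wpM2r => //; exact: ltW.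
  have {hs}hm : (x * r0) ^+ 2 * - Re q <= C * (x * r0) ^+ 3.
    apply: le_trans hm; rewrite mulrN lerBrDr addrC subrr subr_ge0; exact: hs.
  rewrite -(ler_pM2r (exprn_gt0 2 r00)); apply: le_trans (le_trans _ hm) _.
    by apply: le_eq; ring.
  by apply: le_eq; ring.
(* The order of R[i] also asks for a real value. Since F is real, i F has zero real part, and its
   expansion forces Im q = 0. *)
have Iq : Im q = 0.
  have hI : qexp (fun l => 'i%C * F l) ('i%C * hdot (H z) s s) ('i%C * c1) ('i%C * c2)
      ('i%C * p) ('i%C * p') ('i%C * q) C.
    have ci : cabs ('i%C : R[i]) = 1 by rewrite /cabs /= expr0n expr1n add0r sqrtr1.
    by move=> l /hq h; rewrite (scale_expansion_ring 'i%C) cabsM ci mul1r.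
  have Ri (w : R[i]) : Re ('i%C * w) = - Im w by case: w => x y /=; ring.
  have ImF l : Im (F l) = 0 by rewrite FR.
  have Z x : 0 < x <= 1 -> `|x ^+ 2 * Im q| <= C * x ^+ 3.
    move=> hx; have E0 : (fun t => Re ('i%C * F (x%:C * cis t))) = fun=> 0.
      by apply/funext => t; rewrite Ri ImF oppr0.
    have := qexp_mean hI hx _; rewrite E0 cmean_cst Ri (herm_real s (hH z)) oppr0 subr0 Ri.
    by rewrite sub0r mulrN opprK; apply=> t; exact: cst_continuous.
  apply/eqP; rewrite eq_le; apply/andP; split.
    by apply: (@cubic_vanish R _ C) => x /Z; apply: le_trans; exact: ler_norm.
  rewrite -oppr_le0; apply: (@cubic_vanish R _ C) => x /Z; apply: le_trans.
  by rewrite mulrN -normrN; exact: ler_norm.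
have -> : q = (Re q)%:C by case: q Iq {hq Rq} => x y /= ->.
by rewrite lecR.
Qed.

End chern_curvature_sign.

(** * Plurisubharmonicity along holomorphic discs *)

Section complex_differentiability.
Context {R : realType}.
Implicit Types (f g : R[i] -> R[i]) (w : R[i]).

Lemma cdiff_cst (c : R[i]) w : cdiff (fun=> c) w.
Proof.
exists 0 => e e0; exists 1 => // h _; rewrite subrr mul0r subrr cabs0.
by rewrite mulr_ge0 ?cabs_ge0 // ltW.
Qed.

Lemma cdiff_id w : cdiff id w.
Proof.
exists 1 => e e0; exists 1 => // h _; rewrite /= mul1r (addrC w) addrK subrr cabs0.
by rewrite mulr_ge0 ?cabs_ge0 // ltW.
Qed.

Lemma cdiffD f g w : cdiff f w -> cdiff g w -> cdiff (fun x => f x + g x) w.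
Proof.
move=> [c hc] [d hd]; exists (c + d) => e e0.
have e2 : 0 < e / 2 by rewrite divr_gt0.
have [d1 d10 h1] := hc _ e2; have [d2 d20 h2] := hd _ e2.
exists (Num.min d1 d2); first by rewrite lt_min d10.
move=> h; rewrite lt_min => /andP[/h1 k1 /h2 k2].
have -> : e * cabs h = e / 2 * cabs h + e / 2 * cabs h by rewrite -mulrDl -splitr.
apply: (le_trans _ (lerD k1 k2)); apply: (le_trans _ (cabsD _ _)).
by apply: le_eq; congr cabs; ring.
Qed.

Lemma cdiffM f g w : cdiff f w -> cdiff g w -> cdiff (fun x => f x * g x) w.
Proof.
move=> cf cg; have [c hc] := cf; have [d hd] := cg.
exists (c * g w + f w * d) => e e0.
pose K := cabs (g w) + 1 + cabs (f w) + cabs c + 1.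
have K0 : 0 < K by rewrite ltr_wpDl // !addr_ge0 ?cabs_ge0.
have eK : 0 < e / K / 2 by rewrite !divr_gt0.
have [d1 d10 h1] := hc _ eK; have [d2 d20 h2] := hd _ eK.
have cgw := cdiff_continuous cg.
have m0 : 0 < Num.min 1 (e / K / 2) by rewrite lt_min ltr01.
have [d3 d30 h3] : exists2 d : R, 0 < d & forall x, cabs (x - w) < d ->
    cabs (g x - g w) < Num.min 1 (e / K / 2).
  by apply/nbhs_cabs; exact: (@cvg_cabs R _ (nbhs w) _ _ _).1 cgw _ m0.
exists (Num.min d1 (Num.min d2 d3)); first by rewrite !lt_min d10 d20.
move=> h; rewrite !lt_min => /and3P[/h1 k1 /h2 k2 hd3].
have := h3 (w + h); rewrite addrAC subrr add0r => /(_ hd3); rewrite lt_min => /andP[k3 k4].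
have -> : f (w + h) * g (w + h) - f w * g w - (c * g w + f w * d) * h =
   (f (w + h) - f w - c * h) * g (w + h) + f w * (g (w + h) - g w - d * h) +
     c * h * (g (w + h) - g w) by ring.
have kg : cabs (g (w + h)) <= cabs (g w) + 1.
  rewrite -(subrK (g w) (g (w + h))); apply: le_trans (cabsD _ _) _; rewrite addrC lerD2l.
  exact: ltW.
have h0 := cabs_ge0 h.
apply: (@le_trans _ _ (e / K / 2 * cabs h * (cabs (g w) + 1) + cabs (f w) * (e / K / 2 * cabs h) +
    cabs c * cabs h * (e / K / 2))).
  apply: le_trans (cabsD _ _) _; apply: lerD; last first.
    by rewrite !cabsM; apply: ler_wpM2l; [rewrite mulr_ge0 ?cabs_ge0|exact: ltW].
  apply: le_trans (cabsD _ _) _; apply: lerD; last first.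
    by rewrite cabsM; apply: ler_wpM2l; rewrite ?cabs_ge0.
  by rewrite cabsM; apply: ler_pM; rewrite ?cabs_ge0.
rewrite (_ : _ + _ = (e / K / 2 * cabs h) * (cabs (g w) + 1 + cabs (f w) + cabs c)); last by ring.
apply: (@le_trans _ _ (e / K / 2 * cabs h * K)).
  apply: ler_wpM2l; first by rewrite mulr_ge0 // ltW.
  by rewrite lerDl.
rewrite (_ : e / K / 2 * cabs h * K = (e * cabs h) / 2 * (K / K)); last by ring.
by rewrite divff ?lt0r_neq0 // mulr1 ler_pdivrMr // ler_peMr ?ler1n // mulr_ge0 // ltW.
Qed.

Lemma cdiff_sum (I : Type) (s : seq I) (F : I -> R[i] -> R[i]) w :
  (forall i, cdiff (F i) w) -> cdiff (fun x => \sum_(i <- s) F i x) w.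
Proof.
move=> h; elim: s => [|a s IH].
  by under eq_fun do rewrite big_nil; exact: cdiff_cst.
by under eq_fun do rewrite big_cons; exact: cdiffD.
Qed.

End complex_differentiability.

Section covering.
Context {R : realType}.

(** Used to find one rank nu that is fine enough for all points of a disc or of a closed
    polydisc. *)
Lemma compact_eventually (T : topologicalType) (K : set T) (P : nat -> T -> Prop) : compact K ->
  (forall x, K x -> exists2 U, nbhs x U & exists M, forall m y, (M <= m)%N -> U y -> P m y) ->
  exists M, forall m, (M <= m)%N -> forall y, K y -> P m y.
Proof.
move=> /compact_near_coveringP cK h.
have [] := cK nat \oo P _.
  move=> x Kx; have [U nU [M hM]] := h x Kx.
  exists (U, [set m | (M <= m)%N]); first by split => //; exists M.
  by move=> [y m] /= [Uy Mm]; exact: hM.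
by move=> M _ hM; exists M => m Mm y; exact: hM.
Qed.

(** Polar coordinates exhibit the disc as a continuous image of a rectangle. *)
Lemma disc_compact : compact [set l : R[i] | cabs l <= 1].
Proof.
have -> : [set l : R[i] | cabs l <= 1] =
    (fun p : R * R => p.1%:C * cis p.2) @` (`[0, 1] `*` `[0, 2 * pi]).
  apply/seteqP; split => [l /= hl|_ [[x t]] /= [hx ht] <-].
    have [t [ht lt]] := polar l; exists (cabs l, t); last by rewrite -lt.
    by split; rewrite /= in_itv /= ?cabs_ge0.
  move: hx; rewrite in_itv /= => /andP[x0 x1].
  by rewrite cabsM cabs_real cabs_cis mulr1 ger0_norm.
apply: continuous_compact; last by apply: compact_setX; exact: segment_compact.
apply: continuous_subspaceT => -[x t].
have c1 : (fun p : R * R => p.1%:C) @ (x, t) --> x%:C.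
  by apply: (@cvg_comp _ _ _ fst (fun y : R => y%:C) (nbhs (x, t)) (nbhs x) (nbhs (x%:C))); [exact: cvg_fst|exact: continuous_real_complex].
have c2 : (fun p : R * R => cis p.2) @ (x, t) --> cis t.
  by apply: (@cvg_comp _ _ _ snd (fun y : R => cis y) (nbhs (x, t)) (nbhs t) (nbhs (cis t))); [exact: cvg_snd|exact: continuous_cis].
exact: (cvgM c1 c2).
Qed.

Lemma usc_measurable (f : R -> R) : (forall t c, f t < c -> \forall x \near t, f x < c) ->
  measurable_fun setT f.
Proof.
move=> h; apply: (measurability _ (RGenInftyO.measurableE R)) => //.
move=> _ [_ [c ->] <-]; rewrite setTI; apply: open_measurable.
rewrite openE => t /=; rewrite in_itv /= => ht.
by apply: filterS (h t c ht) => x /=; rewrite in_itv.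
Qed.

Lemma emean_limit (f : nat -> R -> R) (g : R -> R) (x M : R) (N0 : nat) :
  (forall m, continuous (f m)) -> measurable_fun setT g ->
  (forall m t, (N0 <= m)%N -> 0 <= f m t <= M) ->
  (forall t, f m t @[m --> \oo] --> g t) ->
  (forall m, (N0 <= m)%N -> x <= cmean (f m)) -> (x%:E <= emean (EFin \o g))%E.
Proof.
move=> cf mg fM fg hx.
pose mu := @lebesgue_measure R.
have mI : measurable (`[0%R, (2 * pi)%R] : set R) by exact: measurable_itv.
pose F m t := (f (m + N0)%N t)%:E.
have [] := @dominated_convergence _ _ R mu `[0%R, (2 * pi)%R]%classic mI F
   (EFin \o g) (fun=> M%:E).
- move=> m; apply: measurable_funS (_ : measurable_fun setT _) => //.
  by apply/measurable_EFinP; exact: (continuous_measurable_fun (cf (m + N0)%N)).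
- by apply: measurable_funS (_ : measurable_fun setT _) => //; exact/measurable_EFinP.
- apply: aeW => t _; apply: cvg_EFin; first by near=> m.
  by have := fg t; rewrite -(cvg_shiftn N0).
- by have := @seg_integrable R 0 (2 * pi) (fun=> M) (fun x => @cst_continuous _ _ M x).
- apply: aeW => t m _; have /andP[h1 h2] := fM (m + N0)%N t (leq_addl _ _).
  by rewrite gee0_abs ?lee_fin.
move=> _ _ hlim.
have hl : (emean (F m) @[m --> \oo] --> emean (EFin \o g))%E by apply: cvgeZl.
apply: (lime_bound hl) => m.
have -> : emean (F m) = (cmean (f (m + N0)%N))%:E by exact: (emean_cmean (cf (m + N0)%N)).
by rewrite lee_fin; apply: hx; exact: leq_addl.
Unshelve. all: by end_near. Qed.

End covering.

Lemma absorb_lra {R : realType} (e x1 x2 x3 x4 x5 x6 x7 : R) :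
  x3 + x1 - x2 <= x4 -> x2 <= e * x7 ->
  x3 + e * x5 + (x1 + 2 * e * x6) <= x4 + e * (x5 + 2 * x6 + x7).
Proof. by move=> h1 h2; lra. Qed.

Lemma epsilon_le {R : realType} (a c b d : R) :
  (forall e, 0 < e -> a + e * b <= c + e * d) -> a <= c.
Proof.
move=> h; rewrite leNgt; apply/negP => ca.
have K0 : 0 < `|d - b| + 1 by rewrite ltr_wpDl.
pose e := (a - c) / (`|d - b| + 1) / 2.
have ac : 0 < a - c by rewrite subr_gt0.
have e0 : 0 < e by rewrite !divr_gt0.
have h1 := h e e0.
have h2 : e * (d - b) <= e * `|d - b| by rewrite ler_pM2l // ler_norm.
have h3 : e * (`|d - b| + 1) = (a - c) / 2 by rewrite /e mulrAC divfK // lt0r_neq0.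
move: h1 h2 h3 e0 ac; move: (`|d - b|) => k; clear; nra.
Qed.

Lemma mul_le_half_sqr {R : realType} (x y : R) : x * y <= 2^-1 * (x ^+ 2 + y ^+ 2).
Proof. by have := sqr_ge0 (x - y); rewrite sqrrB => h; lra. Qed.

Section levi_positivity.
Context {R : realType} {n : nat}.
Local Notation Cn := 'rV[R[i]]_n.

(** By [qexp_mean] the circle mean exceeds the central value by r^2 times the Levi form up to
    O(r^3), so the submean inequality on small circles decides its sign. *)
Lemma levi_ge0 (f : Cn -> R[i]) (z xi : Cn) (d : R) : csm f -> 0 < d ->
  (forall b, (forall l, cabs l <= 1 -> pd 0 d (l *: b)) ->
     Re (f z) <= cmean (fun t => Re (f (z + cis t *: b)))) ->
  0 <= Re (lev f z xi).
Proof.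
move=> hf d0 hd; have [C C0 /(_ z xi) hC] := csm_line3 hf.
have hq : qexp (fun l => f (z + l *: xi)) (f z) (D1 f z xi) (Db f z xi) (D2 f z xi) (Db2 f z xi)
    (lev f z xi) (C * nv xi ^+ 3) by move=> l _; exact: hC.
have [cf _] := sm_bounded (hf 0%N).
have n0 := nv_ge0 xi.
have S0 : 0 < nv xi + 1 by rewrite ltr_wpDl.
pose r0 := Num.min 1 (d / (nv xi + 1) / 2).
have r00 : 0 < r0 by rewrite lt_min ltr01 !divr_gt0.
have r01 : r0 <= 1 by rewrite ge_min lexx.
have r0d : r0 * nv xi < d.
  have : r0 <= d / (nv xi + 1) / 2 by rewrite ge_min lexx orbT.
  rewrite ler_pdivlMr // ler_pdivlMr // => h; apply: lt_le_trans h.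
  rewrite -mulrA ltr_pM2l // mulrDr mulr1 mulr_natl mulr2n -addrA ltrDl.
  by rewrite ltr_wpDl.
rewrite -oppr_le0; apply: (@cubic_vanish R _ (C * nv xi ^+ 3 * r0)) => x /andP[x0 x1].
have y0 : 0 < x * r0 by rewrite mulr_gt0.
have y1 : x * r0 <= 1 by rewrite mulr_ile1 // ltW.
have E t : z + cis t *: ((x * r0)%:C *: xi) = z + ((x * r0)%:C * cis t) *: xi by rewrite scalerA mulrC.
have cF : continuous (fun t => Re (f (z + ((x * r0)%:C * cis t) *: xi))).
  under eq_fun do rewrite -E.
  move=> t; apply: cvg_Re; apply: (@continuous_comp _ _ _ (fun t => z + cis t *: ((x * r0)%:C *: xi)) f).
    exact: continuous_circle.
  exact: cf.
have := qexp_mean hq _ cF; rewrite y0 y1 => /(_ isT).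
rewrite ler_norml => /andP[_ hm].
have := hd ((x * r0)%:C *: xi) _; under [X in cmean X]eq_fun do rewrite E.
move=> hs; have {}hs : Re (f z) <= cmean (fun t => Re (f (z + ((x * r0)%:C * cis t) *: xi))).
  apply: hs => l l1; apply/pdE => k; rewrite !mxE subr0 !cabsM cabs_real (gtr0_norm y0).
  apply: le_lt_trans r0d.
  have k0 := cabs_ge0 (xi 0 k).
  have hk : cabs (xi 0 k) <= nv xi.
    by rewrite /nv (bigD1 k) //= lerDl; apply: sumr_ge0 => m _; exact: cabs_ge0.
  apply: (@le_trans _ _ (1 * (1 * r0 * nv xi))); last by rewrite !mul1r.
  apply: ler_pM => //; rewrite ?cabs_ge0 ?mulr_ge0 // ?(ltW x0) ?(ltW r00) //.
  by apply: ler_pM => //; rewrite ?mulr_ge0 ?(ltW x0) ?(ltW r00) //; apply: ler_wpM2r => //; exact: ltW.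
have {hs}hm : (x * r0) ^+ 2 * - Re (lev f z xi) <= C * nv xi ^+ 3 * (x * r0) ^+ 3.
  by apply: le_trans hm; rewrite mulrN lerBrDr addrC subrr subr_ge0.
rewrite -(ler_pM2r (exprn_gt0 2 r00)); apply: le_trans (le_trans _ hm) _.
  by apply: le_eq; ring.
by apply: le_eq; ring.
Qed.

(** A holomorphic quadratic polynomial in d. Its real part collects the first- and second-order
    terms of Re f other than the Levi form. *)
Definition hpoly (f : Cn -> R[i]) (p d : Cn) : R[i] :=
  \sum_j d 0 j * (dz j f p + cj (dzb j f p)) +
  2^-1 * \sum_j \sum_k d 0 j * d 0 k * (dz k (dz j f) p + cj (dzb k (dzb j f) p)).

(* The non-holomorphic terms of the second order expansion are conjugates of
   holomorphic ones, up to the Levi form. *)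
Lemma psh_lower (f : Cn -> R[i]) : csm f -> exists2 C : R, 0 <= C & forall p d,
  0 <= Re (lev f p d) -> Re (f p) + Re (hpoly f p d) - C * nv d ^+ 3 <= Re (f (p + d)).
Proof.
move=> hf; have [C C0 hC] := csm_line3 hf; exists C => // p d hl.
have := hC p d 1; rewrite scale1r rmorph1 !expr1n !mul1r cabs1 expr1n mulr1 => h.
have := le_trans (Re_le_cabs _) h; rewrite ler_norml => /andP[h1 _].
have RJ (w : R[i]) : Re (cj w) = Re w by exact: ReJ.
have E : Re (D1 f p d + Db f p d + D2 f p d + Db2 f p d) = Re (hpoly f p d).
  rewrite /D1 /Db /D2 /Db2 /hpoly half_real !ReD !ReZ !Re_sum.
  have -> : \sum_j Re (cj (d 0 j) * dzb j f p) = \sum_j Re (d 0 j * cj (dzb j f p)).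
    by apply: eq_bigr => j _; rewrite -[LHS]RJ cjM conjCK.
  have -> : \sum_j Re (d 0 j * (dz j f p + cj (dzb j f p))) =
      \sum_j Re (d 0 j * dz j f p) + \sum_j Re (d 0 j * cj (dzb j f p)).
    by rewrite -big_split; apply: eq_bigr => j _; rewrite mulrDr ReD.
  have -> : \sum_j Re (\sum_k cj (d 0 j) * cj (d 0 k) * dzb k (dzb j f) p) =
      \sum_j Re (\sum_k d 0 j * d 0 k * cj (dzb k (dzb j f) p)).
    apply: eq_bigr => j _; rewrite !Re_sum; apply: eq_bigr => k _.
    by rewrite -[LHS]RJ !cjM !conjCK.
  have -> : \sum_j Re (\sum_k d 0 j * d 0 k * (dz k (dz j f) p + cj (dzb k (dzb j f) p))) =
      \sum_j Re (\sum_k d 0 j * d 0 k * dz k (dz j f) p) +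
      \sum_j Re (\sum_k d 0 j * d 0 k * cj (dzb k (dzb j f) p)).
    rewrite -big_split; apply: eq_bigr => j _ /=; rewrite -ReD -big_split; congr Re.
    by apply: eq_bigr => k _; rewrite mulrDr.
  by rewrite mulrDr; ring.
have {}h1 : - (C * nv d ^+ 3) <= Re (f (p + d)) - (Re (f p) + Re (D1 f p d + Db f p d + D2 f p d + Db2 f p d) + Re (lev f p d)).
  by apply: le_trans h1 _; apply: le_eq; rewrite !ReD ReN !ReD; ring.
rewrite E in h1; move: h1 hl; clear.
move: (Re (f p)) (Re (hpoly f p d)) (Re (lev f p d)) (Re (f (p + d))) (C * nv d ^+ 3) => a b c e g.
lra.
Qed.

End levi_positivity.

(** * Smooth functions along holomorphic discs *)

Section holomorphic_discs.
Context {R : realType} {n : nat}.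
Local Notation Cn := 'rV[R[i]]_n.
Variable Phi : R[i] -> Cn.
Hypothesis dPhi : forall l j, cabs l <= 1 -> cdiff (fun x => Phi x 0 j) l.

Lemma disc_continuous l : cabs l <= 1 -> {for l, continuous Phi}.
Proof.
move=> l1; apply: (@cvg_rV R n _ (nbhs l)) => j.
exact: (cdiff_continuous (dPhi j l1)).
Qed.

Lemma disc_uniform (e : R) : 0 < e -> exists2 d : R, 0 < d & forall l h,
  cabs l <= 1 -> cabs h < d -> nv (Phi (l + h) - Phi l) < e.
Proof.
move=> e0; have e2 : 0 < e / 2 by rewrite divr_gt0.
have nvD (v w : Cn) : nv (v + w) <= nv v + nv w.
  by rewrite /nv -big_split; apply: ler_sum => j _; rewrite mxE cabsD.
have nvN (v : Cn) : nv (- v) = nv v by apply: eq_bigr => j _; rewrite mxE cabsN.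
pose P m l := forall h, cabs h < @eps R m -> nv (Phi (l + h) - Phi l) < e.
have hP : forall x : R[i], [set l : R[i] | cabs l <= 1] x -> exists2 U, nbhs x U &
    exists M, forall m y, (M <= m)%N -> U y -> P m y.
  move=> x /= x1.
  have [d d0 hd] : exists2 d : R, 0 < d & forall y, cabs (y - x) < d -> nv (Phi y - Phi x) < e / 2.
    apply/nbhs_cabs; have n0 : 0 < e / 2 / (n%:R + 1) by rewrite divr_gt0 // ltr_wpDl.
    have := disc_continuous x1; move=> /(_ [set w | pd (Phi x) (e / 2 / (n%:R + 1)) w]) h.
    have /h : nbhs (Phi x) [set w | pd (Phi x) (e / 2 / (n%:R + 1)) w] by apply/nbhs_pd; exists (e / 2 / (n%:R + 1)).
    move=> {}h; have {}h : nbhs x [set y | pd (Phi x) (e / 2 / (n%:R + 1)) (Phi y)] by exact: h.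
    apply: filterS h => y /pdE hy; rewrite /nv.
    apply: (@le_lt_trans _ _ (\sum_(j < n) (e / 2 / (n%:R + 1)))).
      by apply: ler_sum => j _; rewrite !mxE; exact: ltW.
    rewrite sumr_const card_ord -[_ *+ n]mulr_natr mulrAC ltr_pdivrMr ?ltr_wpDl //.
    by rewrite ltr_pM2l // ltrDl.
  have d2 : 0 < d / 2 by rewrite divr_gt0.
  exists [set l | cabs (l - x) < d / 2]; first by apply/nbhs_cabs; exists (d / 2).
  have [M hM] := eps_small d2; exists M => m l /hM hm /= lx h hh.
  have k1 : nv (Phi l - Phi x) < e / 2 by apply: hd; apply: lt_trans lx _; rewrite ltr_pdivrMr // mulr_natr mulr2n ltrDl.
  have k2 : nv (Phi (l + h) - Phi x) < e / 2.
    apply: hd; rewrite addrAC; apply: le_lt_trans (cabsD _ _) _; rewrite (splitr d).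
    by apply: ltrD => //; exact: lt_trans hh hm.
  have -> : Phi (l + h) - Phi l = (Phi (l + h) - Phi x) + - (Phi l - Phi x) by rewrite opprB addrA subrK.
  by rewrite (splitr e); apply: le_lt_trans (nvD _ _) _; rewrite nvN; apply: ltrD.
have [M hM] := compact_eventually (disc_compact (R := R)) hP.
exists (@eps R M); first exact: eps_gt0.
by move=> l h l1 hh; apply: (hM M (leqnn M) l l1).
Qed.

Variable f : Cn -> R[i].
Hypothesis cf : csm f.
Hypothesis lf : forall l, cabs l <= 1 -> forall xi, 0 <= Re (lev f (Phi l) xi).

Let sq (l : R[i]) : R := \sum_j cabs (Phi l 0 j) ^+ 2.

Let sq_continuous l : cabs l <= 1 -> {for l, continuous sq}.
Proof.
move=> l1; have h j : (fun x => ((cabs (Phi x 0 j) ^+ 2)%:C : R[i])) @ l --> (cabs (Phi l 0 j) ^+ 2)%:C.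
  have c := cvg_cabs_norm (cdiff_continuous (dPhi j l1)).
  have c2 : cabs (Phi x 0 j) ^+ 2 @[x --> l] --> cabs (Phi l 0 j) ^+ 2 by exact: (cvgM (c _) (c _)).
  exact: (cvg_real_complex c2).
have := @continuous_bigsum R _ _ (index_enum 'I_n) (fun j x => (cabs (Phi x 0 j) ^+ 2)%:C) l h.
move=> /cvg_Re; rewrite /sq; under eq_fun do rewrite Re_sum /=; rewrite Re_sum /=; exact.
Qed.

Let nv_sqr (v : Cn) : nv v ^+ 2 <= n%:R * \sum_j cabs (v 0 j) ^+ 2.
Proof.
rewrite /nv expr2 mulr_suml; under eq_bigr do rewrite mulr_sumr.
have -> : n%:R * \sum_j cabs (v 0 j) ^+ 2 =
    \sum_(i < n) \sum_(j < n) 2^-1 * (cabs (v 0 i) ^+ 2 + cabs (v 0 j) ^+ 2).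
  have row (i : 'I_n) : \sum_(j < n) 2^-1 * (cabs (v 0 i) ^+ 2 + cabs (v 0 j) ^+ 2) =
      2^-1 * (n%:R * cabs (v 0 i) ^+ 2 + \sum_j cabs (v 0 j) ^+ 2).
    by rewrite -mulr_sumr big_split /= sumr_const card_ord mulr_natl.
  rewrite (eq_bigr _ (fun i _ => row i)) -mulr_sumr big_split /= -mulr_sumr sumr_const card_ord -[(\sum_(j < n) _) *+ n]mulr_natl.
  by move: (\sum_j _) (n%:R) => x y; field.
apply: ler_sum => i _; apply: ler_sum => j _.
exact: mul_le_half_sqr.
Qed.

(* Adding a multiple of |Phi|^2 absorbs the cubic error term. *)
Lemma psh_disc_center : Re (f (Phi 0)) <= cmean (fun t => Re (f (Phi (cis t)))).
Proof.
have [C C0 hC] := psh_lower cf.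
have [cfc _] := sm_bounded (cf 0%N).
have cfP l : cabs l <= 1 -> {for l, continuous (fun x => Re (f (Phi x)))}.
  move=> l1; have c : {for l, continuous (f \o Phi)}.
    by apply: continuous_comp; [exact: disc_continuous|exact: cfc].
  exact: (cvg_Re c).
have cis1 t : cabs (cis t : R[i]) <= 1 by rewrite cabs_cis.
have key e : 0 < e -> Re (f (Phi 0)) + e * sq 0 <=
    cmean (fun t => Re (f (Phi (cis t))) + e * sq (cis t)).
  move=> e0; pose g l := Re (f (Phi l)) + e * sq l.
  have cg l : cabs l <= 1 -> {for l, continuous g}.
    move=> l1; exact: (cvgD (cfP l l1) (cvgM (@cst_continuous _ _ e l) (sq_continuous l1))).
  (* An increment de with nv de < e / (C n + 1) makes C (nv de)^3 at most e |de|^2, because (nv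
     de)^2 <= n |de|^2. *)
  have Kn : 0 < C * n%:R + 1 by rewrite ltr_wpDl // mulr_ge0.
  have [d d0 hd] := disc_uniform (divr_gt0 e0 Kn).
  have sub e' : 0 < e' -> exists2 d, 0 < d & forall z s, cabs z < 1 -> 0 < s < d -> cabs z + s <= 1 ->
      g z <= cmean (fun t => g (z + s%:C * cis t)) + e' * s ^+ 2.
    move=> e'0; exists d => // z s z1 /andP[s0 sd] zs.
    apply: (@le_trans _ _ (cmean (fun t => g (z + s%:C * cis t)))); last first.
      by rewrite lerDl mulr_ge0 ?sqr_ge0 // ltW.
    (* A function holomorphic in l that vanishes at z: the mean of Re q over the circle is 0, so it
       suffices to show the pointwise bound g z + Re q <= g. The second summand of q is the
       holomorphic part of the expansion of e |Phi|^2. *)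
    pose q l := hpoly f (Phi z) (Phi l - Phi z) +
      (2 * e)%:C * \sum_j cj (Phi z 0 j) * (Phi l 0 j - Phi z 0 j).
    have in1 w : cabs (w - z) <= s -> cabs w <= 1.
      move=> ws; rewrite -(subrK z w); apply: le_trans (cabsD _ _) _.
      by apply: le_trans zs; rewrite addrC lerD2l.
    have dq w : cabs (w - z) <= s -> cdiff q w.
      move=> /in1 w1.
      have dj j : cdiff (fun l => (Phi l - Phi z) 0 j) w.
        under eq_fun do rewrite mxE [X in _ + X]mxE.
        by apply: cdiffD; [exact: dPhi|exact: cdiff_cst].
      have dj' j : cdiff (fun l => Phi l 0 j - Phi z 0 j) w.
        by apply: cdiffD; [exact: dPhi|exact: cdiff_cst].
      apply: cdiffD; last first.
        apply: cdiffM; first exact: cdiff_cst.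
        by apply: cdiff_sum => j; apply: cdiffM => //; exact: cdiff_cst.
      apply: cdiffD; first by apply: cdiff_sum => j; apply: cdiffM => //; exact: cdiff_cst.
      apply: cdiffM; first exact: cdiff_cst.
      apply: cdiff_sum => j; apply: cdiff_sum => k.
      by apply: cdiffM; [exact: cdiffM|exact: cdiff_cst].
    have q0 : q z = 0.
      rewrite /q /hpoly subrr !big1 ?mulr0 ?addr0 // => j _.
      - by rewrite subrr mulr0.
      - by rewrite big1 // => k _; rewrite mxE !mul0r.
      - by rewrite mxE mul0r.
    have cq : continuous (fun t => Re (q (z + s%:C * cis t))).
      move=> t; have := cdiff_continuous (dq (z + s%:C * cis t) _).
      rewrite [X in cabs X](_ : _ = s%:C * cis t); last by rewrite addrC addKr.
      rewrite cabsM cabs_real cabs_cis mulr1 gtr0_norm // => /(_ (lexx _)) hc.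
      have c : {for t, continuous (q \o (fun t : R => z + s%:C * cis t))}.
        apply: (@continuous_comp _ _ _ (fun t : R => z + s%:C * cis t) q); last exact: hc.
        exact: (cvgD (@cst_continuous _ _ z t) (cvgM (@cst_continuous _ _ s%:C t) (@continuous_cis R t))).
      exact: (cvg_Re c).
    have cgt : continuous (fun t => g (z + s%:C * cis t)).
      move=> t; apply: (@continuous_comp _ _ _ (fun t => z + s%:C * cis t) g).
        exact: (cvgD (@cst_continuous _ _ z t) (cvgM (@cst_continuous _ _ s%:C t) (@continuous_cis R t))).
      apply: cg; apply: in1; rewrite addrC addKr cabsM cabs_real cabs_cis mulr1 gtr0_norm //.
    have -> : g z = cmean (fun t => g z + Re (q (z + s%:C * cis t))).
      rewrite cmeanD ?cmean_cst //; last by move=> t; exact: cst_continuous.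
      by rewrite (mean_value s0 dq) q0 /= addr0.
    apply: cmean_le => //.
      by move=> t; exact: (cvgD (@cst_continuous _ _ (g z) t) (cq t)).
    move=> t _; set l := z + s%:C * cis t; pose de := Phi l - Phi z.
    have small : nv de < e / (C * n%:R + 1).
      by apply: hd; [exact: ltW|rewrite cabsM cabs_real cabs_cis mulr1 gtr0_norm].
    have h1 := hC (Phi z) de (lf (ltW z1) de).
    have ePhi : Phi z + de = Phi l by rewrite /de addrC subrK.
    rewrite ePhi in h1.
    (* Exact expansion of |Phi|^2; its last term |de|^2 is what absorbs the cubic error. *)
    have h2 : sq l = sq z + 2 * Re (\sum_j cj (Phi z 0 j) * (Phi l 0 j - Phi z 0 j)) +
        \sum_j cabs (de 0 j) ^+ 2.
      rewrite /sq Re_sum mulr_sumr -!big_split; apply: eq_bigr => j _ /=.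
      rewrite /de !mxE !cabs_sqr; case: (Phi l 0 j) => x y; case: (Phi z 0 j) => x' y' /=; ring.
    have h3 : C * nv de ^+ 3 <= e * \sum_j cabs (de 0 j) ^+ 2.
      have S0 : 0 <= \sum_j cabs (de 0 j) ^+ 2 by apply: sumr_ge0 => j _; exact: sqr_ge0.
      apply: (@le_trans _ _ (C * (e / (C * n%:R + 1) * (n%:R * \sum_j cabs (de 0 j) ^+ 2)))).
        apply: ler_wpM2l => //; rewrite exprS; apply: ler_pM; rewrite ?nv_ge0 ?exprn_ge0 ?nv_ge0 //.
        exact: ltW.
      rewrite [leLHS](_ : _ = (C * n%:R) / (C * n%:R + 1) * (e * \sum_j cabs (de 0 j) ^+ 2)); last by ring.
      apply: ler_piMl; first by rewrite mulr_ge0 // ltW.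
      by rewrite ler_pdivrMr // mul1r lerDl.
    rewrite /g h2 /q -/de ReD ReM /= mul0r subr0.
    move: h1 h3; move: (Re (hpoly _ _ _)) (C * nv de ^+ 3) (Re (f (Phi z))) (Re (f (Phi l))) (sq z)
      (Re (\sum_j cj _ * _)) (\sum_j cabs (de 0 j) ^+ 2) => x1 x2 x3 x4 x5 x6 x7.
    exact: absorb_lra.
  have := radial_mean_le ltr01 cg sub (s := 0) _; rewrite lexx ler01 => /(_ isT).
  rewrite rmorph0 rmorph1; under eq_fun do rewrite mul0r; rewrite cmean_cst.
  by under [X in _ <= cmean X]eq_fun do rewrite mul1r.
have cf1 : continuous (fun t => Re (f (Phi (cis t)))).
  move=> t; apply: (@continuous_comp _ _ _ (fun t : R => cis t) (fun x => Re (f (Phi x)))).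
    exact: continuous_cis.
  exact: cfP.
have cs1 : continuous (fun t => sq (cis t)).
  move=> t; apply: (@continuous_comp _ _ _ (fun t : R => cis t) sq); first exact: continuous_cis.
  exact: sq_continuous.
apply: (@epsilon_le R _ _ (sq 0) (cmean (fun t => sq (cis t)))) => e e0.
have := key e e0; rewrite cmeanD // ?cmeanZ //.
by move=> t; exact: (cvgM (@cst_continuous _ _ e t) (cs1 t)).
Qed.

End holomorphic_discs.

Section psh_composition.
Context {R : realType} {n : nat}.
Local Notation Cn := 'rV[R[i]]_n.
Variables (D : set Cn) (w : Cn -> R).
Hypothesis oD : open D.
Hypothesis w0 : forall z, 0 <= w z.
Hypothesis uscw : forall z c, D z -> w z < c -> \forall y \near z, w y < c.
Hypothesis subw : forall a b, (forall l : R[i], cabs l <= 1 -> D (a + l *: b)) ->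
  ((w a)%:E <= emean (fun t => (w (a + cis t *: b))%:E))%E.

(** The function w is read as a metric on the trivial line bundle, tested against constant fields
    only, so that the smoothing applies to it unchanged. *)
Let H (z : Cn) : 'M[R[i]]_1 := (w z)%:C%:M.
Let adm (u : Cn -> 'cV[R[i]]_1) : Prop := exists s, u = fun=> s.
Let k (s : 'cV[R[i]]_1) : R := \sum_i cabs (s i 0) ^+ 2.

Let qfH z s : qf (H z) s = w z * k s.
Proof. exact: qf_scalar. Qed.

Let k0 s : 0 <= k s.
Proof. by apply: sumr_ge0 => i _; exact: sqr_ge0. Qed.

Let Aadm : admissible_fields adm.
Proof.
split; first by move=> s; exists s.
- by move=> u v [s ->]; exists s.
- by move=> u [s ->]; exists 0, s => z; rewrite mul0mx add0r.
Qed.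

Let N : locally_negative D H adm.
Proof.
split=> //.
- move=> z; split; last by move=> s; rewrite qfH mulr_ge0.
  by move=> i j; rewrite !mxE eq_sym; case: (i == j); rewrite ?mulr1n ?mulr0n ?rmorph0 ?cjR.
- move=> u [s ->] z c Dz; rewrite qfH; have := k0 s; rewrite le_eqVlt => /orP[/eqP ks|ks].
    rewrite -ks mulr0 => c0; near=> y; by rewrite qfH -ks mulr0.
  rewrite -ltr_pdivlMr // => /(uscw Dz); apply: filterS => y.
  by rewrite qfH ltr_pdivlMr.
- move=> z Dz; have [d d0 dD] := (open_pd D).1 oD z Dz; exists d; split=> //.
  move=> u a b [s ->] hb.
  have hD l : cabs l <= 1 -> D (a + l *: b) by move=> /hb /dD.
  have mw : measurable_fun setT (fun t => w (a + cis t *: b)).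
    apply: usc_measurable => t c ht.
    have Dt : D (a + cis t *: b) by apply: hD; rewrite cabs_cis.
    have := uscw Dt ht; exact: continuous_circle.
  have E : emean (fun t => (qf (H (a + cis t *: b)) s)%:E) =
      ((k s)%:E * emean (fun t => (w (a + cis t *: b))%:E))%E.
    rewrite -emeanZ //; first by apply: congr1; apply/funext => t; rewrite qfH -EFinM mulrC.
      exact/measurable_EFinP.
    by move=> t; rewrite lee_fin.
  rewrite E qfH mulrC EFinM; apply: lee_wpmul2l; first by rewrite lee_fin.
  exact: subw.
Unshelve. all: by end_near. Qed.

Let one : 'cV[R[i]]_1 := ev 0.
Let k1 : k one = 1.
Proof. by rewrite /k big_ord_recl big_ord0 addr0 /one /ev mxE !eqxx cabs1 expr1n. Qed.

Let f m (z : Cn) : R[i] := Hc D H m z 0 0.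
Let fE m z : Re (f m z) = qf (Hc D H m z) one.
Proof. by rewrite qf_ev. Qed.
Let csmf m : csm (f m).
Proof. by move=> j; exact: (sm_Hc Aadm N). Qed.

Variable Phi : R[i] -> Cn.
Hypothesis dPhi : forall l j, cabs l <= 1 -> cdiff (fun x => Phi x 0 j) l.
Hypothesis PhiD : forall l, cabs l <= 1 -> D (Phi l).

(** For the smooth approximants the Levi form is nonnegative along the disc and [psh_disc_center]
    applies; they decrease to w, so the inequality survives the limit. *)
Lemma psh_comp : ((w (Phi 0))%:E <= emean (fun t => (w (Phi (cis t)))%:E))%E.
Proof.
(* The rank m is fine enough at Phi l. By compactness of the disc one rank serves all l. *)
pose P m l := exists d, good D H adm d (Phi l) /\ @eps R m <= d / 4.
have hP : forall x : R[i], [set l : R[i] | cabs l <= 1] x -> exists2 U, nbhs x U &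
    exists M, forall m y, (M <= m)%N -> U y -> P m y.
  move=> x /= x1; have [d gd] := good_exists Aadm N (PhiD x1); have [d0 _ _ _] := gd.
  have d2 : 0 < d / 2 by rewrite divr_gt0.
  exists [set l | pd (Phi x) (d / 2) (Phi l)].
    have := disc_continuous dPhi x1; move=> /(_ (pd (Phi x) (d / 2))); apply.
    by apply/nbhs_pd; exists (d / 2).
  have [M hM] := @eps_small R (d / 2 / 4) ltac:(by rewrite divr_gt0).
  exists M => m y /hM/ltW hm /= hy; exists (d / 2); split=> //.
  rewrite [X in good _ _ _ X](_ : _ = d - d / 2); last by rewrite {2}(splitr d) addrK.
  by apply: good_pd gd hy; rewrite (ltW d2) /= ltr_pdivrMr // mulr_natr mulr2n ltrDl.
have [M hM] := compact_eventually (disc_compact (R := R)) hP.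
have cis1 t : cabs (cis t : R[i]) <= 1 by rewrite cabs_cis.
have dd (d : R) : 0 < d -> d / 4 <= d / 2 /\ d / 2 <= d.
  move=> d0; split; first by rewrite ler_pM2l // lef_pV2 ?posrE // ler_nat.
  by rewrite ler_pdivrMr // ler_peMr ?ler1n // ltW.
have step m l : (M <= m)%N -> cabs l <= 1 ->
    w (Phi l) <= Re (f m (Phi l)) /\ Re (f m.+1 (Phi l)) <= Re (f m (Phi l)).
  move=> hm l1; have [d [gd ed]] := hM m hm l l1; have [d0 _ _ _] := gd.
  have [h1 h2] := dd d d0.
  have E1 := fE m (Phi l); have E2 := fE m.+1 (Phi l).
  have L1 := Hc_lower Aadm N one gd (le_trans ed (le_trans h1 h2)).
  have L2 := Hc_mono Aadm N one gd (le_trans ed h1).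
  rewrite qfH k1 mulr1 in L1.
  split; first by rewrite [X in _ <= X]E1; exact: L1.
  by rewrite [X in X <= _]E2 [X in _ <= X]E1; exact: L2.
have [_ [K [K0 hK]]] := sm_bounded (csmf M 0%N).
have cf1 m : continuous (fun t => Re (f m (Phi (cis t)))).
  move=> t; have [c _] := sm_bounded (csmf m 0%N).
  have c1 : {for cis t, continuous (f m \o Phi)}.
    by apply: continuous_comp; [exact: disc_continuous|exact: c].
  have c2 : {for t, continuous ((f m \o Phi) \o (fun t : R => cis t))}.
    by apply: (@continuous_comp _ _ _ (fun t : R => cis t) (f m \o Phi)); [exact: continuous_cis|].
  exact: (cvg_Re c2).
apply: (@emean_limit R (fun m t => Re (f m (Phi (cis t)))) (fun t => w (Phi (cis t))) _ K M).
- exact: cf1.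
- apply: usc_measurable => t c ht.
  have Dt := PhiD (cis1 t); have hu := uscw Dt ht.
  have c1 : {for t, continuous (Phi \o (fun t : R => cis t))}.
    apply: (@continuous_comp _ _ _ (fun t : R => cis t) Phi); first exact: continuous_cis.
    exact: disc_continuous.
  exact: (c1 _ hu).
(* Along the disc the approximants decrease from rank M on, so the global bound of the one of rank M
   dominates all later ones. *)
- move=> m t hm; apply/andP; split.
    by rewrite fE (proj2 (psd_Hc Aadm N m _)).
  apply: (@le_trans _ _ (Re (f M (Phi (cis t))))); last first.
    by apply: le_trans (hK (Phi (cis t))); apply: le_trans (ler_norm _) _; exact: Re_le_cabs.
  move: hm => /subnK <-; elim: (m - M)%N => [|j IH]; first by rewrite add0n.
  by rewrite addSn; apply: le_trans IH; have [] := step (j + M)%N (cis t) (leq_addl _ _) (cis1 t).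
- move=> t; apply/cvgrPdist_le => e e0.
  have [N0 h] := Hc_cvg Aadm N one (PhiD (cis1 t)) e0.
  exists N0 => // m /= /h; rewrite qfH k1 mulr1 fE => /andP[h1 h2].
  by rewrite distrC ger0_norm ?subr_ge0 // lerBlDl.
move=> m hm; have c0 : cabs (0 : R[i]) <= 1 by rewrite cabs0.
apply: le_trans (step m 0 hm c0).1 _.
apply: psh_disc_center => // l l1 xi.
have [d [gd ed]] := hM m hm l l1; have [d0 _ _ _] := gd; have [h1 h2] := dd d d0.
have d2 : 0 < d / 2 by rewrite divr_gt0.
apply: (levi_ge0 _ (csmf m) d2) => b hb.
have -> : (fun t => Re (f m (Phi l + cis t *: b))) = (fun t => qf (Hc D H m (Phi l + cis t *: b)) one).
  by apply/funext => t; exact: fE.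
have E1 := fE m (Phi l); rewrite [X in X <= _]E1.
have b1 : pd 0 (d / 2) b by rewrite -[b]scale1r; apply: hb; rewrite cabs1.
exact: (Hc_submean Aadm N gd (le_trans ed h1) (adm_cst Aadm one) b1 hb).
Qed.

End psh_composition.

Section complex_differentiability.
Context {R : realType} {n : nat}.
Local Notation Cn := 'rV[R[i]]_n.

Lemma cdiff_differentiable (g : R[i] -> R[i]) l : differentiable g l -> cdiff g l.
Proof.
move=> /diff_locallyP[_ /eqaddoP H]; exists ('d g l 1) => e e0.
have e0' : (0 : R[i]) < e%:C by rewrite ltcR.
have /nbhs_cabs[d d0 hd] := H _ e0'; exists d => // x hx.
have := hd x; rewrite subr0 => /(_ hx).
have E : 'd g l x = 'd g l 1 * x.
  have E : 'd g l (x *: (1 : R[i])) = x *: 'd g l 1 by rewrite linearZ.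
  by rewrite mulrC -[X in 'd g l X]mulr1; exact: E.
have -> : (g \o shift l - (cst (g l) + 'd g l)) x = g (l + x) - g l - 'd g l 1 * x.
  by rewrite -E /= !fctE /= opprD addrA [x + l]addrC.
by rewrite !normcabs -rmorphM lecR.
Qed.

Lemma differentiable_mx p q (f : Cn -> 'M[R[i]]_(p, q)) z :
  (forall i j, differentiable (fun w => f w i j) z) -> differentiable f z.
Proof.
move=> h.
have -> : f = \sum_(i < p) \sum_(j < q) (fun w => f w i j *: delta_mx i j).
  apply/funext => w; rewrite fct_sumE [LHS]matrix_sum_delta.
  by apply: eq_bigr => i _; rewrite fct_sumE.
apply: differentiable_sum => i; apply: differentiable_sum => j.
exact: differentiableZl.
Qed.

Lemma differentiable_sumM m (f g : 'I_m -> Cn -> R[i]) z :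
  (forall i, differentiable (f i) z) -> (forall i, differentiable (g i) z) ->
  differentiable (fun w => \sum_i f i w * g i w) z.
Proof.
move=> hf hg; rewrite (_ : (fun w => _) = \sum_i (f i * g i)); last first.
  by apply/funext => w; rewrite fct_sumE.
by apply: differentiable_sum => i; exact: differentiableM.
Qed.

Lemma coord_differentiable p q (f : Cn -> 'M[R[i]]_(p, q)) z i j :
  differentiable f z -> differentiable (fun w => f w i j) z.
Proof.
move=> hf; apply: (@differentiable_comp _ _ _ _ f (fun M : 'M[R[i]]_(p, q) => M i j)) => //.
exact: differentiable_coord.
Qed.

Lemma cdiff_line m (f : Cn -> 'rV[R[i]]_m) a b l j : differentiable f (a + l *: b) ->
  cdiff (fun x => f (a + x *: b) 0 j) l.
Proof.
move=> hf; apply: cdiff_differentiable.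
apply: (@differentiable_comp _ _ _ _ (fun x : R[i] => a + x *: b) (fun z => f z 0 j)).
  apply: differentiableD; first exact: differentiable_cst.
  by apply: differentiableZl; exact: ex_diff.
exact: coord_differentiable.
Qed.

Lemma psh_real (D : set Cn) (w : Cn -> R) : psh D (fun z => (w z)%:E) ->
  (forall z c, D z -> w z < c -> \forall y \near z, w y < c) /\
  (forall a b, (forall l, cabs l <= 1 -> D (a + l *: b)) ->
    ((w a)%:E <= emean (fun t => (w (a + cis t *: b))%:E))%E).
Proof.
move=> [_ h1 h2]; split.
  by move=> z c Dz wc; have := h1 z c Dz; rewrite lte_fin => /(_ wc); apply: filterS => y; rewrite lte_fin.
move=> a b hab; apply: (h2 a b) => l hl; apply: hab.
by move: hl; rewrite normcabs -(rmorph1 (real_complex R)) lecR.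
Qed.

(** Affine fields realise every value and first derivative along a line, which is all that the
    curvature and the determinant computations use of them. *)
Definition affine_field r (u : Cn -> 'cV[R[i]]_r) : Prop :=
  exists P c, u = fun z => P *m z^T + c.

Lemma affine_fields_admissible r : admissible_fields (@affine_field r).
Proof.
split.
- by move=> s; exists 0, s; apply/funext => z; rewrite mul0mx add0r.
- move=> u v [P [c ->]]; exists P, (c - P *m v^T); apply/funext => z.
  by rewrite linearB /= mulmxBr addrA addrAC.
- by move=> u [P [c ->]]; exists P, c.
Qed.

End complex_differentiability.

(** * Metrics read in charts and on polydiscs *)

Section manifolds.
Context {R : realType} {n : nat} {X : complex_manifold R n}.
Local Notation Cn := 'rV[R[i]]_n.

Lemma chart_image_open (k : mfd_index X) (U : set X) : open U ->
  open (mfd_chart k @` (U `&` mfd_dom k)).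
Proof.
move=> oU; have -> : mfd_chart k @` (U `&` mfd_dom k) =
    (mfd_chart k @` mfd_dom k) `&` mfd_inv k @^-1` U.
  apply/seteqP; split=> [_ [x [Ux dx] <-]|_ [[x dx <-]]] /=.
    by split; [exists x|rewrite mfd_chartK].
  by rewrite mfd_chartK // => Ux; exists x.
rewrite openE => z [dz Uz]; apply: filterI.
  by apply: open_nbhs_nbhs; split => //; exact: mfd_img_open.
apply: (mfd_inv_continuous dz); exact: (open_nbhs_nbhs (conj oU Uz)).
Qed.

Lemma chart_holomorphic (k : mfd_index X) (V : set X) : V `<=` mfd_dom k ->
  mfd_holomorphic V (mfd_chart k).
Proof.
move=> Vk i _ [x [Vx dx] <-]; apply: mfd_transition; exists x => //; split=> //.
exact: Vk.
Qed.

End manifolds.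

Section frames.
Context {R : realType} {n r : nat} {X : complex_manifold R n}.
Variable E : vector_bundle X r.
Local Notation Cn := 'rV[R[i]]_n.

Lemma frame_section (U V : set X) (e : 'I_r -> forall x, E x) (c : X -> 'cV[R[i]]_r) :
  holomorphic_frame U e -> V `<=` U -> mfd_holomorphic V c ->
  holomorphic_section V (fun x => \sum_j c x j 0 *: e j x).
Proof.
move=> [_ he _] VU hc i k _ [x [[Vx ix] kx] <-]; set z := mfd_chart k x.
have hz j : differentiable ((fun x => vb_triv i x (e j x)) \o mfd_inv k) z.
  by apply: he; exists x => //; split=> //; split=> //; exact: VU.
have cz : differentiable (c \o mfd_inv k) z by apply: hc; exists x.
apply: differentiable_mx => p q.
rewrite (_ : (fun w => _) = fun w => \sum_j c (mfd_inv k w) j 0 *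
    vb_triv i (mfd_inv k w) (e j (mfd_inv k w)) p q); last first.
  apply/funext => w /=; rewrite linear_sum summxE; apply: eq_bigr => j _.
  by rewrite linearZ mxE.
apply: differentiable_sumM => j.
- exact: (coord_differentiable _ _ cz).
- exact: (coord_differentiable _ _ (hz j)).
Qed.

Lemma affine_holomorphic (V : set X) (g : X -> Cn) (P : 'M[R[i]]_(r, n)) (c : 'cV[R[i]]_r) :
  mfd_holomorphic V g -> mfd_holomorphic V (fun x => P *m (g x)^T + c).
Proof.
move=> hg k z hz; have gz := hg k z hz.
rewrite /comp /=; apply: differentiableD; last exact: differentiable_cst.
apply: differentiable_mx => i j.
rewrite (_ : (fun w => _) = fun w => \sum_m P i m * g (mfd_inv k w) 0 m); last first.
  by apply/funext => w; rewrite mxE; apply: eq_bigr => m _; rewrite mxE ord1.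
apply: differentiable_sumM => m; first exact: differentiable_cst.
exact: (coord_differentiable _ _ gz).
Qed.

Variable h : forall x : X, E x -> E x -> R[i].
Hypothesis hh : forall x, nonneg_hermitian_form (@h x).

Lemma form_sum x (e : 'I_r -> forall x, E x) (c : 'cV[R[i]]_r) :
  h (\sum_j c j 0 *: e j x) (\sum_j c j 0 *: e j x) = hdot (frame_matrix h e x) c c.
Proof.
have [lin sym _] := hh x.
have h0 (w : E x) : h 0 w = 0.
  by have := lin (-1) 0 0 w; rewrite scaler0 addr0 mulN1r addNr.
have lsum (w : E x) : h (\sum_j c j 0 *: e j x) w = \sum_j c j 0 * h (e j x) w.
  elim/big_ind2: _ => //.
    by move=> a b a' b' <- <-; have := lin 1 b b' w; rewrite scale1r mul1r.
  by move=> j _; have := lin (c j 0) (e j x) 0 w; rewrite addr0 h0 addr0.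
rewrite lsum hdotE exchange_big; apply: eq_bigr => j _ /=.
rewrite sym lsum rmorph_sum mulr_sumr; apply: eq_bigr => i _.
by rewrite [X in _ * X](cjM (c i 0) _) -sym mxE mulrC.
Qed.

Lemma norm_sq_frame (e : 'I_r -> forall x, E x) (c : X -> 'cV[R[i]]_r) x :
  norm_sq h (fun x => \sum_j c x j 0 *: e j x) x = qf (frame_matrix h e x) (c x).
Proof. by rewrite /norm_sq form_sum. Qed.

Lemma psdm_frame (e : 'I_r -> forall x, E x) x : psdm (frame_matrix h e x).
Proof.
have [_ sym pos] := hh x; split; first by move=> i j; rewrite !mxE; exact: sym.
move=> s; rewrite /qf -form_sum.
by have := pos (\sum_j s j 0 *: e j x); rewrite lecE => /andP[].
Qed.

Hypothesis hneg : griffiths_negative h.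

Lemma affine_psh U V (e : 'I_r -> forall x, E x) (g : X -> Cn) (P : 'M[R[i]]_(r, n)) c :
  holomorphic_frame U e -> open V -> V `<=` U -> mfd_holomorphic V g ->
  mfd_psh V (fun x => (qf (frame_matrix h e x) (P *m (g x)^T + c))%:E).
Proof.
move=> fe oV VU hg.
have hs := frame_section fe VU (affine_holomorphic P c hg).
have := hneg oV hs; rewrite (_ : (fun x => _) = fun x => (qf (frame_matrix h e x) (P *m (g x)^T + c))%:E) //.
by apply/funext => x; rewrite norm_sq_frame.
Qed.

(** Here [mfd_psh] already speaks of straight discs in the chart, so negativity for affine fields is
    read off directly. *)
Lemma chart_negative U (e : 'I_r -> forall x, E x) k : holomorphic_frame U e ->
  locally_negative (mfd_chart k @` (U `&` mfd_dom k)) (fun z => frame_matrix h e (mfd_inv k z))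
    (@affine_field R n r).
Proof.
move=> fe; have [oU _ _] := fe; pose V := U `&` mfd_dom k.
have oV : open V by apply: openI => //; exact: mfd_dom_open.
have oD := chart_image_open (k := k) oU.
have Vdom : V `&` mfd_dom k = U `&` mfd_dom k by rewrite /V -setIA setIid.
have VU : V `<=` U by move=> x [].
have hV : mfd_holomorphic V (mfd_chart k) by apply: chart_holomorphic => x [].
have inv z : (mfd_chart k @` (U `&` mfd_dom k)) z -> mfd_chart k (mfd_inv k z) = z.
  by move=> [x [_ kx] <-]; rewrite mfd_chartK.
have key P c := psh_real (affine_psh P c fe oV VU hV k).
rewrite Vdom in key; split=> //.
- by move=> z; exact: psdm_frame.
- move=> _ [P [c ->]] z b Dz hz; have [h1 _] := key P c.
  have := h1 z b Dz; rewrite inv // => /(_ hz) H.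
  have nD := open_nbhs_nbhs (conj oD Dz).
  by near=> y; rewrite -{2}(inv y); [near: y|near: y].
- move=> z Dz; have [d d0 dD] := (open_pd _).1 oD z Dz; exists d; split=> //.
  move=> _ a b [P [c ->]] hab; have [_ h2] := key P c.
  have hD l : cabs l <= 1 -> (mfd_chart k @` (U `&` mfd_dom k)) (a + l *: b) by move=> /hab/dD.
  have := h2 a b hD; rewrite inv; last first.
    by have := hD 0; rewrite scale0r addr0; apply; rewrite cabs0.
  move=> H; apply: le_trans H _; rewrite le_eqVlt; apply/orP; left; apply/eqP.
  apply: congr1; apply/funext => t; rewrite inv //.
  by apply: hD; rewrite cabs_cis.
Unshelve. all: by end_near. Qed.

(** A straight disc of the polydisc is sent by psi and a chart to a holomorphic disc that is not
    straight, and [psh_comp] supplies the submean inequality. The radius d is small enough for the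
    disc to stay in one chart. *)
Lemma polydisc_negative (D : set Cn) phi psi (e : 'I_r -> forall x, E x) : open D ->
  biholomorphism_onto D phi psi -> holomorphic_frame [set: X] e ->
  locally_negative D (fun z => frame_matrix h e (psi z)) (@affine_field R n r).
Proof.
move=> oD [[phiD hphi] phiK psiK psic hpsi] fe.
have key P c k := psh_real (affine_psh P c fe openT (@subsetT _ _) hphi k).
split=> //.
- by move=> z; exact: psdm_frame.
- move=> _ [P [c ->]] z b Dz hz; have [k kz] := mfd_cover (psi z).
  have [h1 _] := key P c k; have Iz : (mfd_chart k @` ([set: X] `&` mfd_dom k)) (mfd_chart k (psi z)) by exists (psi z).
  have := h1 _ b Iz; rewrite /= mfd_chartK // psiK // => /(_ hz) H.
  have n1 : \forall y \near z, mfd_dom k (psi y).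
    by apply: (psic z Dz); exact: (open_nbhs_nbhs (conj (mfd_dom_open k) kz)).
  have n2 := mfd_chart_continuous kz H; have n3 := psic z Dz _ n2.
  have nD := open_nbhs_nbhs (conj oD Dz).
  apply: filterS (filterI nD (filterI n1 n3)) => y [Dy [ky]]; rewrite /preimage /=.
  by rewrite (mfd_chartK ky) (psiK y Dy).
- move=> z Dz; have [k kz] := mfd_cover (psi z).
  have n1 : \forall y \near z, mfd_dom k (psi y).
    by apply: (psic z Dz); exact: (open_nbhs_nbhs (conj (mfd_dom_open k) kz)).
  have /nbhs_pd[d d0 hd] : nbhs z (D `&` psi @^-1` mfd_dom k).
    by apply: filterI => //; exact: (open_nbhs_nbhs (conj oD Dz)).
  exists d; split=> //; first by move=> y /hd [].
  move=> _ a b [P [c ->]] hab; have [h1 h2] := key P c k.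
  have hD l : cabs l <= 1 -> D (a + l *: b) /\ mfd_dom k (psi (a + l *: b)) by move=> /hab/hd.
  pose Dk := mfd_chart k @` ([set: X] `&` mfd_dom k).
  have oDk : open Dk by apply: chart_image_open; exact: openT.
  (* The squared norm of the affine field in the coordinates phi, seen as a function in the chart
     k. *)
  pose w z := qf (frame_matrix h e (mfd_inv k z)) (P *m (phi (mfd_inv k z))^T + c).
  have w0 y : 0 <= w y by exact: (psdm_frame e _).2.
  have dPhi l j : cabs l <= 1 -> cdiff (fun x => mfd_chart k (psi (a + x *: b)) 0 j) l.
    move=> l1; apply: (@cdiff_line R n n (mfd_chart k \o psi) a b l j); apply: hpsi.
    by have [] := hD l l1.
  have PhiD l : cabs l <= 1 -> Dk (mfd_chart k (psi (a + l *: b))).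
    by move=> l1; have [_ ?] := hD l l1; exists (psi (a + l *: b)).
  have H := @psh_comp R n Dk w oDk w0 h1 h2 (fun l => mfd_chart k (psi (a + l *: b))) dPhi PhiD.
  have wE l : cabs l <= 1 -> w (mfd_chart k (psi (a + l *: b))) =
      qf (frame_matrix h e (psi (a + l *: b))) (P *m (a + l *: b)^T + c).
    by move=> l1; have [Dl kl] := hD l l1; rewrite /w (mfd_chartK kl) (psiK _ Dl).
  have E0 : w (mfd_chart k (psi (a + 0 *: b))) = qf (frame_matrix h e (psi a)) (P *m a^T + c).
    by rewrite wE ?cabs0 // scale0r addr0.
  rewrite E0 in H; apply: le_trans H _; rewrite le_eqVlt; apply/orP; left; apply/eqP.
  by apply: congr1; apply/funext => t; rewrite wE // cabs_cis.
Qed.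

End frames.

(** * Approximation on smaller polydiscs *)

Lemma continuous_rsum {R : realType} (T : topologicalType) (I : Type) (s : seq I) (F : I -> T -> R) :
  (forall i, continuous (F i)) -> continuous (fun t => \sum_(i <- s) F i t).
Proof.
move=> cF; elim: s => [|a s IH] t.
  by under eq_fun do rewrite big_nil; exact: cst_continuous.
rewrite (_ : (fun t => _) = fun t => F a t + \sum_(i <- s) F i t); first exact: (cvgD (cF a t) (IH t)).
by apply/funext => x; rewrite big_cons.
Qed.

Section polydisc_compactness.
Context {R : realType} {n : nat}.
Local Notation Cn := 'rV[R[i]]_n.

Lemma polydisc_open (a : Cn) rho : open (polydisc a rho).
Proof.
rewrite openE => z hz.
have : \forall w \near z, forall j : 'I_n, cabs ((w : Cn) 0 j - a 0 j) < rho j.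
  apply: nbhs_all => j; have := hz j; rewrite normcabs ltcR => h.
  have /(cvg_cabs _ _).1 := @cvg_coord R n z j.
  move=> /(_ (rho j - cabs (z 0 j - a 0 j))); rewrite subr_gt0 => /(_ h); apply: filterS => w hw.
  rewrite (_ : w 0 j - a 0 j = (w 0 j - z 0 j) + (z 0 j - a 0 j)); last by rewrite addrA subrK.
  by apply: le_lt_trans (cabsD _ _) _; rewrite -ltrBrDr.
by apply: filterS => w hw j; rewrite normcabs ltcR.
Qed.

Lemma closed_polydisc_compact (b : Cn) (sigma : 'I_n -> R) : (forall j, 0 <= sigma j) ->
  compact [set z : Cn | forall j, cabs (z 0 j - b 0 j) <= sigma j].
Proof.
move=> s0.
pose A j := (fun l : R[i] => b 0 j + (sigma j)%:C * l) @` [set l : R[i] | cabs l <= 1].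
have cA j : compact (A j).
  apply: continuous_compact; last exact: disc_compact.
  apply: continuous_subspaceT => l.
  exact: (cvgD (@cst_continuous _ _ (b 0 j) l) (cvgM (@cst_continuous _ _ (sigma j)%:C l) (@cvg_id _ (nbhs l)))).
have := rV_compact cA; congr compact; apply/seteqP; split=> z /= hz j.
  have [l /= l1 <-] := hz j; rewrite addrC addKr cabsM cabs_real ger0_norm //.
  by rewrite ler_piMr.
have := hz j; have := s0 j; rewrite le_eqVlt => /orP[/eqP <-|sj] h.
  exists 0; rewrite /= ?cabs0 ?ler01 // mulr0 addr0.
  have /eqP : cabs (z 0 j - b 0 j) == 0 by rewrite eq_le h cabs_ge0.
  by move/eqP; rewrite cabs_eq0 subr_eq0 => /eqP.
exists ((sigma j)^-1%:C * (z 0 j - b 0 j)) => /=.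
  by rewrite cabsM cabs_real gtr0_norm ?invr_gt0 // mulrC ler_pdivrMr // mul1r.
by rewrite mulrA -rmorphM mulfV ?lt0r_neq0 // rmorph1 mul1r addrC subrK.
Qed.

Lemma closure_polydisc_sub (b : Cn) (sigma : 'I_n -> R) :
  closure (polydisc b sigma) `<=` [set z : Cn | forall j, cabs (z 0 j - b 0 j) <= sigma j].
Proof.
move=> z hz j; rewrite leNgt; apply/negP => h.
have d0 : 0 < cabs (z 0 j - b 0 j) - sigma j by rewrite subr_gt0.
have nz : nbhs z (pd z (cabs (z 0 j - b 0 j) - sigma j)) by apply/nbhs_pd; exists (cabs (z 0 j - b 0 j) - sigma j).
have [w [/(_ j)]] := hz _ nz; rewrite normcabs ltcR => h1 /pdE/(_ j) h2.
have := cabsD (z 0 j - w 0 j) (w 0 j - b 0 j); rewrite addrA subrK cabsB => h3.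
by have := le_lt_trans h3 (ltrD h2 h1); rewrite subrK ltxx.
Qed.

Lemma closure_polydisc_compact (b : Cn) (sigma : 'I_n -> R) : (forall j, 0 <= sigma j) ->
  compact (closure (polydisc b sigma)).
Proof.
move=> s0; have K := closed_polydisc_compact (b := b) s0; have sub := @closure_polydisc_sub b sigma.
refine (subclosed_compact _ K sub); exact: closed_closure.
Qed.

(** Serves the summand [eps nu] times the identity of [Hs]: the flat metric satisfies the submean
    inequality on affine fields. *)
Lemma cabs_sqr_submean (al be : R[i]) : cabs al ^+ 2 <= cmean (fun t => cabs (al + cis t * be) ^+ 2).
Proof.
pose g := cj al * be.
have E t : cabs (al + cis t * be) ^+ 2 = (cabs al ^+ 2 + cabs be ^+ 2) + 2 * (Re g * cos t - Im g * sin t).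
  have h : cos t ^+ 2 + sin t ^+ 2 = 1 :> R by exact: cos2Dsin2.
  rewrite !cabs_sqr /g /cis; move: h; clear g; case: al => a b; case: be => c d /= h.
  have -> : (a + (cos t * c - sin t * d)) ^+ 2 + (b + (cos t * d + sin t * c)) ^+ 2 =
    a ^+ 2 + b ^+ 2 + (cos t ^+ 2 + sin t ^+ 2) * (c ^+ 2 + d ^+ 2) +
    2 * ((a * c - - b * d) * cos t - (a * d + - b * c) * sin t) by ring.
  by rewrite h mul1r.
rewrite (_ : (fun t => _) = fun t => (cabs al ^+ 2 + cabs be ^+ 2) + 2 * (Re g * cos t - Im g * sin t)); last by apply/funext.
have cc : continuous (cos : R -> R) by move=> t; exact: continuous_cos.
have cs : continuous (sin : R -> R) by move=> t; exact: continuous_sin.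
have c1 : continuous (fun t : R => Re g * cos t) by move=> t; exact: (cvgM (@cst_continuous _ _ (Re g) t) (cc t)).
have c2 : continuous (fun t : R => Im g * sin t) by move=> t; exact: (cvgM (@cst_continuous _ _ (Im g) t) (cs t)).
have c3 : continuous (fun t : R => Re g * cos t - Im g * sin t) by move=> t; exact: (cvgB (c1 t) (c2 t)).
have c4 : continuous (fun t : R => 2 * (Re g * cos t - Im g * sin t)) by move=> t; exact: (cvgM (@cst_continuous _ _ (2 : R) t) (c3 t)).
rewrite cmeanD // ?cmean_cst; last by move=> t; exact: cst_continuous.
rewrite cmeanZ // cmeanB // !cmeanZ // cmean_cos cmean_sin !mulr0 subr0 mulr0 addr0.
by rewrite lerDl sqr_ge0.
Qed.

End polydisc_compactness.

Section smoothing_on_compact.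
Context {R : realType} {n r : nat}.
Local Notation Cn := 'rV[R[i]]_n.
Variables (D : set Cn) (H : Cn -> 'M[R[i]]_r).
Local Notation adm := (@affine_field R n r).
Hypothesis N : locally_negative D H adm.
Let Aadm := @affine_fields_admissible R n r.
Local Notation Hs := (Hs D H).
Local Notation Hc := (Hc D H).

(** The factor 4 leaves room for [Hc_mono] and [Hc_submean], which ask for [eps nu <= d / 2], and
    for [Hc_radial], which asks for d / 4. *)
Lemma good_uniform (K : set Cn) : compact K -> K `<=` D ->
  exists M, forall nu, (M <= nu)%N -> forall z, K z ->
    exists d, good D H adm d z /\ @eps R nu <= d / 4.
Proof.
move=> cK KD; apply: (compact_eventually cK) => x Kx.
have [d gd] := good_exists Aadm N (KD x Kx); have [d0 _ _ _] := gd.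
have d2 : 0 < d / 2 by rewrite divr_gt0.
exists (pd x (d / 2)); first by apply/nbhs_pd; exists (d / 2).
have [M hM] := @eps_small R (d / 2 / 4) ltac:(by rewrite divr_gt0).
exists M => m y /hM/ltW hm /= hy; exists (d / 2); split=> //.
rewrite [X in good _ _ _ X](_ : _ = d - d / 2); last by rewrite {2}(splitr d) addrK.
by apply: good_pd gd hy; rewrite (ltW d2) /= ltr_pdivrMr // mulr_natr mulr2n ltrDl.
Qed.

Lemma Hs_submean d nu z b P (c : 'cV[R[i]]_r) : good D H adm d z -> eps nu <= d / 2 ->
  (forall l, cabs l <= 1 -> pd 0 (d / 2) (l *: b)) ->
  qf (Hs nu z) (P *m z^T + c) <=
    cmean (fun t => qf (Hs nu (z + cis t *: b)) (P *m (z + cis t *: b)^T + c)).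
Proof.
move=> gd ed hb; pose u (y : Cn) := P *m y^T + c.
have au : adm u by exists P, c.
have b1 : pd 0 (d / 2) b by rewrite -[b]scale1r; apply: hb; rewrite cabs1.
have h1 := Hc_submean Aadm N gd ed au b1 hb.
have cq : continuous (fun t => qf (Hc nu (z + cis t *: b)) (u (z + cis t *: b))).
  move=> t; apply: (@continuous_comp _ _ _ (fun t : R => z + cis t *: b) (fun y => qf (Hc nu y) (u y))).
    exact: continuous_circle.
  exact: (continuous_Hc Aadm N au).
have cu i : continuous (fun t => cabs (u (z + cis t *: b) i 0) ^+ 2).
  move=> t; have c1 : {for t, continuous (fun t : R => u (z + cis t *: b) i 0)}.
    apply: (@continuous_comp _ _ _ (fun t : R => z + cis t *: b) (fun y => u y i 0)).
      exact: continuous_circle.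
    exact: (adm_continuous Aadm au).
  have c2 := cvg_cabs_norm c1; exact: (cvgM (c2 _) (c2 _)).
have cS : continuous (fun t => \sum_i cabs (u (z + cis t *: b) i 0) ^+ 2).
  exact: continuous_rsum.
have cE : continuous (fun t => eps nu * \sum_i cabs (u (z + cis t *: b) i 0) ^+ 2).
  move=> t; exact: (cvgM (@cst_continuous _ _ (@eps R nu) t) (cS t)).
rewrite (_ : (fun t => qf (Hs _ _) _) = (fun t => qf (Hc nu (z + cis t *: b)) (u (z + cis t *: b)) +
   eps nu * \sum_i cabs (u (z + cis t *: b) i 0) ^+ 2)); last by apply/funext => t; rewrite qf_Hs.
rewrite qf_Hs cmeanD // cmeanZ // cmean_sum //; apply: lerD => //.
apply: ler_wpM2l; first exact: (ltW (eps_gt0 nu)).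
apply: ler_sum => i _.
rewrite (_ : (fun t => _) = fun t => cabs (u z i 0 + cis t * (P *m b^T) i 0) ^+ 2); first exact: cabs_sqr_submean.
apply/funext => t; congr (cabs _ ^+ 2).
by rewrite /u linearD /= linearZ /= mulmxDr -scalemxAr addrAC !mxE.
Qed.

Lemma smooth_approximation (O : set Cn) : compact (closure O) -> closure O `<=` D ->
  exists M : nat,
    [/\ forall nu, (M <= nu)%N -> smooth_hermitian_metric O (Hs nu),
        forall nu, (M <= nu)%N -> negative_griffiths_curvature O (Hs nu),
        forall nu, (M <= nu)%N -> forall z, O z -> forall s : 'cV[R[i]]_r,
          hdot (Hs nu.+1 z) s s <= hdot (Hs nu z) s s
      & forall z, O z -> (Hs nu z @[nu --> \oo]) --> H z].
Proof.
move=> cO OD; have [M hM] := good_uniform cO OD; exists M.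
have dd (d : R) : 0 < d -> d / 4 <= d / 2 by move=> d0; rewrite ler_pM2l // lef_pV2 ?posrE // ler_nat.
have curv nu : (M <= nu)%N -> smooth_hermitian_metric O (Hs nu) /\ negative_griffiths_curvature O (Hs nu).
  move=> hnu; apply: negative_curvature.
  - by move=> i j k; exact: (sm_Hs Aadm N).
  - exact: (herm_Hs Aadm N).
  - by move=> z s; exact: (posdef_Hs Aadm N).
  move=> z Oz; have [d [gd ed]] := hM nu hnu z (subset_closure Oz); have [d0 _ _ _] := gd.
  exists (d / 2); first by rewrite divr_gt0.
  by move=> P c b hb; apply: (Hs_submean P c gd (le_trans ed (dd d d0)) hb).
split.
- by move=> nu /curv[].
- by move=> nu /curv[].
- move=> nu hnu z Oz s; have [d [gd ed]] := hM nu hnu z (subset_closure Oz); have [d0 _ _ _] := gd.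
  rewrite [leLHS](herm_real s (herm_Hs Aadm N nu.+1 z)) [leRHS](herm_real s (herm_Hs Aadm N nu z)) lecR.
  have E1 := qf_Hs D H nu z s; have E2 := qf_Hs D H nu.+1 z s.
  rewrite [leLHS]E2 [leRHS]E1; apply: lerD.
    exact: (Hc_mono Aadm N s gd (le_trans ed (dd d d0))).
  apply: ler_wpM2r; last exact: eps_le.
  by apply: sumr_ge0 => i _; exact: sqr_ge0.
- move=> z Oz; apply: cvg_mx => i j.
  exact: (Hs_cvg Aadm N (OD z (subset_closure Oz))).
Qed.

End smoothing_on_compact.

(** * The logarithm of the determinant *)

(** The difference between ln and its quadratic Taylor polynomial at 1 has derivative (y - 1)^2 / y,
    which is nonnegative, and at most 2 x^2 between 1 + x and 1 when -1/2 <= x < 0. *)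
Lemma ln_lower {R : realType} (x : R) : `|x| <= 2^-1 ->
  x - 2^-1 * x ^+ 2 - 2 * `|x| ^+ 3 <= ln (1 + x).
Proof.
move=> hx; have /andP[x1 x2] : - 2^-1 <= x <= 2^-1 by rewrite -ler_norml.
pose f (y : R) := ln y - (y - 1) + 2^-1 * (y - 1) ^+ 2.
pose df (y : R) := y^-1 - 1 + (y - 1).
have der (y : R) : 0 < y -> is_derive y 1 f (df y).
  move=> y0; have h1 := is_derive1_ln y0; rewrite /f /df.
  apply: is_derive_eq; rewrite ?scaler0 ?addr0 ?subr0 /GRing.scale /=; field; exact: lt0r_neq0.
have cont (y : R) : 0 < y -> {for y, continuous f}.
  by move=> /der[h _]; apply/differentiable_continuous/derivable1_diffP.
have f1 : f 1 = 0 by rewrite /f subrr ln1 expr0n mulr0 subrr addr0.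
have dfE (y : R) : 0 < y -> df y = (y - 1) ^+ 2 / y by move=> y0; rewrite /df; field; exact: lt0r_neq0.
suff : - (2 * `|x| ^+ 3) <= f (1 + x).
  by rewrite /f (_ : 1 + x - 1 = x) ?[1 + x]addrC ?addrK //; move: (ln _) (`|x| ^+ 3) (x ^+ 2) => a b c; lra.
have [x0|x0|->] := ltgtP x 0; last first.
- by rewrite addr0 f1 normr0 expr0n mulr0 oppr0.
- have [] := @MVT _ f df 1 (1 + x) _ _ _; first by rewrite ltrDl.
  + by move=> y; rewrite in_itv /= => /andP[y1 _]; apply: der; exact: lt_trans y1.
  + apply: continuous_in_subspaceT => y; rewrite inE /= in_itv /= => /andP[y1 _].
    by apply: cont; exact: lt_le_trans y1.
  move=> c; rewrite in_itv /= => /andP[c1 _]; rewrite f1 subr0 => ->.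
  have c0 : 0 < c by exact: lt_trans c1.
  rewrite dfE //; apply: (@le_trans _ _ 0); first by rewrite oppr_le0 mulr_ge0 ?exprn_ge0.
  rewrite (_ : 1 + x - 1 = x); last by rewrite [1 + x]addrC addrK.
  by rewrite mulr_ge0 ?(ltW x0) // mulr_ge0 ?sqr_ge0 // invr_ge0 ltW.
- have [] := @MVT _ f df (1 + x) 1 _ _ _; first by rewrite gtrDl.
  + move=> y; rewrite in_itv /= => /andP[y1 _]; apply: der; apply: lt_trans y1; lra.
  + apply: continuous_in_subspaceT => y; rewrite inE /= in_itv /= => /andP[y1 _].
    apply: cont; apply: lt_le_trans y1; lra.
  move=> c; rewrite in_itv /= => /andP[c1 c2]; rewrite f1 sub0r => h.
  have c0 : 0 < c by apply: lt_trans c1; lra.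
  rewrite -[f _]opprK h lerN2 dfE // (ltr0_norm x0) opprD addrA subrr add0r.
  have h1 : (c - 1) ^+ 2 <= x ^+ 2.
    by rewrite -(sqrrN (c - 1)) -(sqrrN x) ler_sqr ?nnegrE; lra.
  have h2 : c^-1 <= 2.
    by rewrite -[leRHS]invrK lef_pV2 ?posrE ?invr_gt0 //; lra.
  rewrite (_ : 2 * (- x) ^+ 3 = (x ^+ 2 * 2) * - x); last by ring.
  apply: ler_wpM2r; first by rewrite oppr_ge0 ltW.
  by apply: ler_pM => //; rewrite ?sqr_ge0 ?invr_ge0 ?(ltW c0).
Qed.

(** * Hermitian matrices and their determinants *)

Section psd_matrices.
Context {R : realType} {r : nat}.
Implicit Types (M V S P Q : 'M[R[i]]_r) (s t : 'cV[R[i]]_r).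

Definition ctr p q (S : 'M[R[i]]_(p, q)) : 'M[R[i]]_(q, p) := (map_mx Num.conj S)^T.

Lemma ctrK p q (S : 'M[R[i]]_(p, q)) : ctr (ctr S) = S.
Proof. by apply/matrixP => i j; rewrite !mxE conjCK. Qed.

Lemma ctrM p q k (A : 'M[R[i]]_(p, q)) (B : 'M[R[i]]_(q, k)) : ctr (A *m B) = ctr B *m ctr A.
Proof. by rewrite /ctr map_mxM trmx_mul. Qed.

Lemma hdot_ctr M S s t : hdot M (S *m s) (S *m t) = hdot (ctr S *m M *m S) s t.
Proof. by rewrite /hdot -/(ctr (S *m t)) ctrM !mulmxA. Qed.

Lemma qf_ctr M S s : qf M (S *m s) = qf (ctr S *m M *m S) s.
Proof. by rewrite /qf hdot_ctr. Qed.

Lemma herm_ctr M : herm M <-> ctr M = M.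
Proof.
split=> [h|h i j]; first by apply/matrixP => i j; rewrite !mxE (h i j) conjCK.
by rewrite -{1}h !mxE.
Qed.

Lemma herm_congr M S : herm M -> herm (ctr S *m M *m S).
Proof. by move=> /herm_ctr h; apply/herm_ctr; rewrite !ctrM ctrK h mulmxA. Qed.

Lemma spectral_decomposition M : herm M -> exists P (d : 'I_r -> R),
  [/\ P *m ctr P = 1%:M, ctr P *m P = 1%:M & M = ctr P *m diag_mx (\row_j (d j)%:C) *m P].
Proof.
move=> hM; have hh : M \is hermsymmx.
  apply/is_hermitianmxP; rewrite /= expr0 scale1r; apply/matrixP => i j; rewrite !mxE.
  by rewrite (hM i j) conjCK.
have /orthomx_spectralP E := hermitian_normalmx hh.
have U := spectral_unitarymx M; have re := hermitian_spectral_diag_real hh.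
have cE : map_mx Num.conj (spectralmx M)^T = ctr (spectralmx M) by rewrite /ctr map_trmx.
have UP : spectralmx M *m ctr (spectralmx M) = 1%:M by rewrite -cE; exact/unitarymxP.
exists (spectralmx M), (fun j => Re (spectral_diag M 0 j)); split=> //; first exact: mulmx1C.
rewrite {1}E (invmx_unitary U) cE; congr (_ *m diag_mx _ *m _).
apply/rowP => j; rewrite !mxE; have /mxOverP/(_ 0 j)/CrealP := re.
case: (spectral_diag M 0 j) => a b [] /eqP.
by rewrite eqNr => /eqP ->.
Qed.

Lemma qf_spectral M P (d : 'I_r -> R) j : P *m ctr P = 1%:M -> 
  M = ctr P *m diag_mx (\row_j (d j)%:C) *m P -> qf M (ctr P *m ev j) = d j.
Proof.
move=> hP hM; rewrite qf_ctr ctrK hM !mulmxA hP mul1mx -mulmxA hP mulmx1 qf_ev !mxE eqxx mulr1n.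
by [].
Qed.

Lemma det_spectral M P (d : 'I_r -> R) : P *m ctr P = 1%:M -> 
  M = ctr P *m diag_mx (\row_j (d j)%:C) *m P -> \det M = (\prod_j d j)%:C.
Proof.
move=> hP ->; rewrite !det_mulmx mulrAC -det_mulmx (mulmx1C hP) det1 mul1r det_diag rmorph_prod.
by apply: eq_bigr => j _; rewrite mxE.
Qed.

(** The columns of S are unit eigenvectors of V divided by the square roots of the eigenvalues. *)
Lemma orthonormal_basis V : herm V -> (forall s, s != 0 -> 0 < qf V s) ->
  exists S, ctr S *m V *m S = 1%:M.
Proof.
move=> hV pV; have [P [d [PP PP' VE]]] := spectral_decomposition hV.
have d0 j : 0 < d j.
  rewrite -(qf_spectral j PP VE); apply: pV; apply/eqP => h.
  have : P *m (ctr P *m ev j) = 0 by rewrite h mulmx0.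
  by rewrite mulmxA PP mul1mx => /matrixP/(_ j 0) /eqP; rewrite !mxE !eqxx oner_eq0.
pose D : 'M[R[i]]_r := diag_mx (\row_j ((Num.sqrt (d j))^-1)%:C).
have cD : ctr D = D.
  apply/herm_ctr => i j; rewrite !mxE eq_sym; case: (eqVneq j i) => [->|_].
    by rewrite !mulr1n cjR.
  by rewrite !mulr0n rmorph0.
exists (ctr P *m D); rewrite ctrM ctrK cD VE.
rewrite -!mulmxA [P *m (ctr P *m D)]mulmxA PP mul1mx [P *m (ctr P *m _)]mulmxA PP mul1mx.
rewrite /D !mulmx_diag; apply/matrixP => i j; rewrite !mxE; case: (eqVneq i j) => [_|_]; rewrite ?mulr0n ?mulr1n //.
rewrite -!rmorphM (_ : _ * _ = 1) // mulrCA -invfM -expr2 sqr_sqrtr ?ltW // mulfV //.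
by rewrite lt0r_neq0.
Qed.

Lemma qf_id s : qf 1%:M s = \sum_i cabs (s i 0) ^+ 2.
Proof. by have := qf_scalar 1 s; rewrite rmorph1 mul1r. Qed.

Lemma det_congr M S : \det (ctr S *m M *m S) = (cabs (\det S) ^+ 2)%:C * \det M.
Proof.
by rewrite !det_mulmx /ctr det_tr det_map_mx mulrAC [_ * \det S]mulrC mulcJ.
Qed.

Lemma det_psd M : psdm M -> \det M = (Re (\det M))%:C /\ 0 <= Re (\det M).
Proof.
move=> [hM pM]; have [P [d [PP _ ME]]] := spectral_decomposition hM.
rewrite (det_spectral PP ME); split=> //=; apply: prodr_ge0 => j _.
by rewrite -(qf_spectral j PP ME).
Qed.

Lemma det_posdef M : herm M -> (forall s, s != 0 -> 0 < qf M s) -> 0 < Re (\det M).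
Proof.
move=> hM pM; have pM' : psdm M.
  split=> // s; have [->|s0] := eqVneq s 0; first by rewrite /qf /hdot mulmx0 mxE.
  exact: ltW (pM s s0).
have [E] := det_psd pM'; rewrite le_eqVlt => /orP[/eqP h|//].
by have := posdef_unitmx pM; rewrite unitmxE unitfE E -h rmorph0 eqxx.
Qed.

(** In a basis orthonormal for V the eigenvalues of M lie in [0, 1], and the change of basis
    multiplies both determinants by the same factor. *)
Lemma det_le M V : psdm M -> herm V -> (forall s, s != 0 -> 0 < qf V s) ->
  (forall s, qf M s <= qf V s) -> Re (\det M) <= Re (\det V).
Proof.
move=> pM hV pV hMV; have [S hS] := orthonormal_basis hV pV.
have hN : herm (ctr S *m M *m S) by apply: herm_congr; exact: pM.1.
have [P [d [PP _ NE]]] := spectral_decomposition hN.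
have d1 j : 0 <= d j <= 1.
  have Ed := qf_spectral j PP NE; rewrite -qf_ctr in Ed; rewrite -Ed pM.2 /=.
  apply: le_trans (hMV _) _; rewrite qf_ctr hS qf_ctr ctrK mulmx1 PP qf_ev mxE eqxx.
  by [].
have := det_spectral PP NE; have := congr1 (fun X => \det X) hS; rewrite !det_congr det1.
move=> /(congr1 (@complex.Re R)) + /(congr1 (@complex.Re R)); rewrite !ReM /= !mul0r !subr0 => h1 h2.
have k0 : 0 < cabs (\det S) ^+ 2.
  rewrite lt_neqAle sqr_ge0 andbT eq_sym; apply/eqP => h; move: h1; rewrite h mul0r => /eqP.
  by rewrite eq_sym oner_eq0.
rewrite -(ler_pM2l k0) h1 h2.
suff /andP[] : 0 <= \prod_j d j <= 1 by [].
elim/big_ind: _ => [|x y /andP[x0 x1] /andP[y0 y1]|j _]; last exact: d1.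
  by rewrite ler01 lexx.
by rewrite mulr_ge0 // mulr_ile1.
Qed.

(** Because qf M s = 0, the form at t + c s is affine in c. A nonzero product with t would make it
    negative for a suitable c. *)
Lemma qf_eq0 M s : psdm M -> qf M s = 0 -> M *m s = 0.
Proof.
move=> [hM pM] h0.
have key t (c : R[i]) : 0 <= qf M t + 2 * Re (c * hdot M s t).
  have := pM (t + c *: s); rewrite /qf !hdotDl !hdotDr !hdotZl !hdotZr !ReD.
  have -> : Re (c * (cj c * hdot M s s)) = 0.
    by rewrite mulrA mulcJ (herm_real s hM) h0 mulr0.
  rewrite (hdot_swap s t hM) -(ReJ (cj c * _)) cjM !conjCK addr0.
  by rewrite -addrA -mulr2n mulr_natl.
have hz t : hdot M s t = 0.
  apply/eqP; apply: contraT => n0; pose w := hdot M s t.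
  have w0 : 0 < cabs w ^+ 2 by rewrite exprn_gt0 // lt_neqAle cabs_ge0 andbT eq_sym cabs_eq0.
  (* Chosen so that the form at t + c s, with c = - k cj w, takes the value -1. *)
  pose k := (qf M t + 1) / (2 * cabs w ^+ 2).
  have := key t ((- k)%:C * cj w); rewrite -mulrA [cj w * _]mulrC mulcJ -rmorphM /=.
  have -> : 2 * (- k * cabs w ^+ 2) = - (qf M t + 1).
    by rewrite /k; move: (cabs w ^+ 2) w0 (qf M t + 1) => x x0 y; field; exact: lt0r_neq0.
  by rewrite opprD addNKr oppr_ge0 ler10.
apply/matrixP => i j; rewrite ord1 mxE [RHS]mxE -[RHS](hz (ev i)) hdotE.
rewrite [RHS](bigD1 i) //= [X in _ + X]big1 ?addr0 => [|k /negbTE nk].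
  by apply: eq_bigr => l _; rewrite /ev mxE !eqxx rmorph1 mul1r.
by apply: big1 => l _; rewrite /ev mxE nk rmorph0 !mul0r.
Qed.

Lemma ln_prod (I : Type) (l : seq I) (x : I -> R) : (forall i, 0 < x i) ->
  ln (\prod_(i <- l) x i) = \sum_(i <- l) ln (x i).
Proof.
move=> x0; elim: l => [|i l IH]; first by rewrite !big_nil ln1.
by rewrite !big_cons lnM ?posrE ?IH // prodr_gt0.
Qed.

(** The trace and the sum of the squared entries are the sums of the eigenvalues and of their
    squares; [ln_lower] applies to each eigenvalue, which is at most q in modulus. *)
Lemma logdet_lower Q (q : R) : herm Q -> 0 <= q -> q <= 2^-1 ->
  \sum_i \sum_j cabs (Q i j) ^+ 2 <= q ^+ 2 ->
  \sum_i Re (Q i i) - 2^-1 * (\sum_i \sum_j cabs (Q i j) ^+ 2) - r%:R * (2 * q ^+ 3)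
    <= ln (Re (\det (1%:M + Q))).
Proof.
move=> hQ q0 q1 hq; have [P [d [PP PP' QE]]] := spectral_decomposition hQ.
have E1 : 1%:M + Q = ctr P *m diag_mx (\row_j (1 + d j)%:C) *m P.
  rewrite (_ : diag_mx _ = 1%:M + diag_mx (\row_j (d j)%:C)); last first.
    by apply/matrixP => i j; rewrite !mxE rmorphD rmorph1 mulrnDl.
  by rewrite mulmxDr mulmxDl mulmx1 PP' -QE.
have E2 : \sum_i Re (Q i i) = \sum_j d j.
  have : \tr Q = \sum_j (d j)%:C.
    rewrite QE -mulmxA mxtrace_mulC -mulmxA PP mulmx1 mxtrace_diag.
    by apply: eq_bigr => j _; rewrite mxE.
  by move=> /(congr1 (@complex.Re R)); rewrite /mxtrace !Re_sum.
have E3 : \sum_i \sum_j cabs (Q i j) ^+ 2 = \sum_j d j ^+ 2.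
  have : \tr (Q *m Q) = \sum_j (d j ^+ 2)%:C.
    have -> : Q *m Q = ctr P *m diag_mx (\row_j (d j ^+ 2)%:C) *m P.
      rewrite {1 2}QE -!mulmxA [P *m (ctr P *m _)]mulmxA PP mul1mx.
      congr (_ *m _); rewrite mulmxA; congr (_ *m _); rewrite mulmx_diag; congr diag_mx.
      by apply/rowP => j; rewrite !mxE -rmorphM.
    rewrite -mulmxA mxtrace_mulC -mulmxA PP mulmx1 mxtrace_diag.
    by apply: eq_bigr => j _; rewrite mxE.
  move=> /(congr1 (@complex.Re R)); rewrite /mxtrace !Re_sum => <-; apply: eq_bigr => i _.
  by rewrite mxE Re_sum; apply: eq_bigr => j _; rewrite (hQ i j) mulcJ.
have dq j : `|d j| <= q.
  rewrite -(ler_pXn2r (ltn0Sn 1)) ?nnegrE // real_normK ?num_real //; apply: le_trans hq.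
  by rewrite E3 (bigD1 j) //= lerDl sumr_ge0 // => k _; exact: sqr_ge0.
have d1 j : 0 < 1 + d j.
  by have := dq j; rewrite ler_norml => /andP[h _]; move: h q1; clear; move: (d j) => x; lra.
rewrite (det_spectral PP E1) /= ln_prod // E2 E3 mulr_sumr.
rewrite (_ : r%:R * _ = \sum_(j < r) 2 * q ^+ 3); last by rewrite sumr_const card_ord mulr_natl.
rewrite -!sumrB; apply: ler_sum => j _.
apply: le_trans (ln_lower (le_trans (dq j) q1)); rewrite lerD2l lerN2.
by rewrite ler_pM2l // lerXn2r ?nnegrE.
Qed.

End psd_matrices.

Lemma quadratic_pair_identity {R : realType} (l a a' e : R[i]) :
  - (2^-1 * cabs (l * a + cj l * cj a' + e) ^+ 2) + 2 * Re (l * a' * (l * a + cj l * cj a' + e)) -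
    cabs l ^+ 2 * cabs a' ^+ 2 - Re (l ^+ 2 * (a * a')) =
  2^-1 * (cabs l ^+ 2 * (cabs a' ^+ 2 - cabs a ^+ 2)) +
  (2 * Re (l * a' * e) - Re (cj (l * a + cj l * cj a') * e) - 2^-1 * cabs e ^+ 2).
Proof.
rewrite !cabs_sqr; case: l => l1 l2; case: a => a1 a2; case: a' => b1 b2; case: e => e1 e2 /=.
by field.
Qed.

Lemma quadratic_pair_lra {R : realType} (x y a1 a2 a3 : R) :
  - x <= a1 -> a2 <= x -> a3 <= y -> - (2 * x + y) <= a1 - a2 - a3.
Proof. by move=> h1 h2 h3; lra. Qed.

(** For Y = l a + conj(l a') + e, the second-order terms reduce to an antisymmetric remainder |a'|^2
    - |a|^2, once Re (l^2 a a') is split off. The remainder disappears when the entries (i, k) and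
    (k, i) are summed. *)
Lemma quadratic_pair {R : realType} (l a a' e : R[i]) (m K : R) : 0 <= m -> 0 <= K ->
  cabs l <= 1 -> cabs a <= m -> cabs a' <= m -> cabs e <= K * cabs l ^+ 2 ->
  2^-1 * (cabs l ^+ 2 * (cabs a' ^+ 2 - cabs a ^+ 2)) - (4 * m * K + K ^+ 2) * cabs l ^+ 3 <=
  - (2^-1 * cabs (l * a + cj l * cj a' + e) ^+ 2) + 2 * Re (l * a' * (l * a + cj l * cj a' + e)) -
    cabs l ^+ 2 * cabs a' ^+ 2 - Re (l ^+ 2 * (a * a')).
Proof.
move=> m0 K0 l1 am bm eK; rewrite quadratic_pair_identity lerD2l.
set s := cabs l; have s0 : 0 <= s by exact: cabs_ge0.
have hL : cabs (l * a + cj l * cj a') <= 2 * m * s.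
  apply: le_trans (cabsD _ _) _; rewrite !cabsM !cabs_conj -/s.
  rewrite (_ : 2 * m * s = s * m + s * m); last by ring.
  by apply: lerD; apply: ler_wpM2l.
have Rl (w : R[i]) : - cabs w <= Re w by have := le_trans (ler_norm (- Re w)) (le_trans (le_eq (normrN (Re w))) (Re_le_cabs w)); rewrite lerNl.
have h1 : - (2 * m * K * s ^+ 3) <= 2 * Re (l * a' * e).
  apply: (@le_trans _ _ (2 * - cabs (l * a' * e))); last by rewrite ler_pM2l.
  rewrite mulrN lerN2 (_ : 2 * m * K * s ^+ 3 = 2 * (s * m * (K * s ^+ 2))); last by ring.
  rewrite ler_pM2l // !cabsM; apply: ler_pM; rewrite ?mulr_ge0 ?cabs_ge0 //.
  exact: ler_wpM2l.
have h2 : Re (cj (l * a + cj l * cj a') * e) <= 2 * m * K * s ^+ 3.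
  apply: le_trans (ler_norm _) _; apply: le_trans (Re_le_cabs _) _; rewrite cabsM cabs_conj.
  rewrite (_ : 2 * m * K * s ^+ 3 = (2 * m * s) * (K * s ^+ 2)); last by ring.
  by apply: ler_pM; rewrite ?cabs_ge0.
have h3 : 2^-1 * cabs e ^+ 2 <= K ^+ 2 * s ^+ 3.
  have s4 : (K * s ^+ 2) ^+ 2 <= K ^+ 2 * s ^+ 3.
    by rewrite exprMn -exprM; apply: ler_wpM2l; [exact: sqr_ge0|apply: ler_wiXn2l].
  apply: le_trans s4; apply: (@le_trans _ _ (cabs e ^+ 2)).
    by rewrite ler_piMl ?sqr_ge0 // invf_le1 // ler1n.
  by rewrite lerXn2r ?nnegrE ?cabs_ge0 // mulr_ge0 // sqr_ge0.
apply: le_trans (quadratic_pair_lra h1 h2 h3); apply: le_eq; ring.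
Qed.

Lemma logdet_lra {R : realType} (p1 p2 p3 N A B C T1 T2 Z : R) :
  - p1 <= - (2^-1 * N) + A - B - C -> Z <= p2 ->
  T1 - T2 + (- A + B) + Z + (T2 + C) - (p1 + p2 + p3) <= T1 - 2^-1 * N - p3.
Proof. by move=> h1 h2; lra. Qed.

Lemma double_sum_cst {R : realType} r (x : R) :
  \sum_(i < r) \sum_(j < r) x = r%:R * (r%:R * x).
Proof. by rewrite !sumr_const !card_ord !mulr_natl. Qed.

Lemma first_order_ring {K : comRingType} (x d l a m b : K) :
  x - d - (l * a + m * b) = x - (d + l * a + m * b).
Proof. ring. Qed.

Lemma square_scale_ring {K : comRingType} (a y s : K) : a * (a * (y * s) ^+ 2) = (a * y * s) ^+ 2.
Proof. ring. Qed.

Lemma cube_scale_ring {K : comRingType} (a x s : K) : a * (s ^+ 2 * (x * s)) = a * x * s ^+ 3.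
Proof. ring. Qed.

Lemma cancel_one_ring {K : comRingType} (a b c d e : K) :
  1 + a - b - c + d + e - 1 = a - b + (- c + d) + e.
Proof. ring. Qed.

Section determinant_limits.
Context {R : realType}.

Lemma cvg_bigsum T (F : set_system T) {FF : Filter F} (I : Type) (s : seq I) (f : I -> T -> R[i]) (l : I -> R[i]) :
  (forall i, f i x @[x --> F] --> l i) -> \sum_(i <- s) f i x @[x --> F] --> \sum_(i <- s) l i.
Proof.
move=> h; elim: s => [|a s IH].
  by rewrite (_ : (fun x => _) = fun=> 0); [rewrite big_nil; exact: cvg_cst|apply/funext => x; rewrite big_nil].
rewrite (_ : (fun x => _) = fun x => f a x + \sum_(i <- s) f i x); last by apply/funext => x; rewrite big_cons.
by rewrite big_cons; exact: (cvgD (h a) IH).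
Qed.

Lemma cvg_bigprod T (F : set_system T) {FF : Filter F} (I : Type) (s : seq I) (f : I -> T -> R[i]) (l : I -> R[i]) :
  (forall i, f i x @[x --> F] --> l i) -> \prod_(i <- s) f i x @[x --> F] --> \prod_(i <- s) l i.
Proof.
move=> h; elim: s => [|a s IH].
  by rewrite (_ : (fun x => _) = fun=> 1); [rewrite big_nil; exact: cvg_cst|apply/funext => x; rewrite big_nil].
rewrite (_ : (fun x => _) = fun x => f a x * \prod_(i <- s) f i x); last by apply/funext => x; rewrite big_cons.
by rewrite big_cons; exact: (cvgM (h a) IH).
Qed.

Lemma cvg_det T (F : set_system T) {FF : Filter F} r (M : T -> 'M[R[i]]_r) (L : 'M[R[i]]_r) :
  (forall i j, M x i j @[x --> F] --> L i j) -> \det (M x) @[x --> F] --> \det L.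
Proof.
move=> h; apply: cvg_bigsum => s.
exact: (cvgM (cvg_cst _) (cvg_bigprod (fun i => h i _))).
Qed.

End determinant_limits.

(** * Submean inequality for the logarithm of a smooth determinant *)

Section logdet_submean.
Context {R : realType} {n r : nat}.
Local Notation Cn := 'rV[R[i]]_n.
Variable V : Cn -> 'M[R[i]]_r.
Hypothesis cV : mcsm V.
Hypothesis hV : forall z, herm (V z).
Variable e0 : R.
Hypothesis e00 : 0 < e0.
Hypothesis lowV : forall z (s : 'cV[R[i]]_r), e0 * \sum_i cabs (s i 0) ^+ 2 <= qf (V z) s.
Variable b : Cn.
Hypothesis b0 : b != 0.

Let posV z s : s != 0 -> 0 < qf (V z) s.
Proof. by move=> /sum_sqr_gt0 s0; apply: lt_le_trans (lowV z s); rewrite mulr_gt0. Qed.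

Lemma dzb_cj (f g : Cn -> R[i]) k z : csm f -> csm g -> (forall z, g z = cj (f z)) ->
  dzb k g z = cj (dz k f z).
Proof.
move=> hf hg E.
have dvE' v : dv v g z = cj (dv v f z).
  apply: dvE; have h := @csm_rd R n f z v hf.
  rewrite /rd (_ : dquot g z v = fun t => cj (dquot f z v t)); first exact: (cvg_conjc h).
  apply/funext => t; rewrite /dquot !E cjM cjD cjN; congr (_ * _).
  by rewrite -fmorphV cjR.
rewrite /dzb /dz !dvE' cjM cjD cjN cjM; congr (_ * _).
  by rewrite -[2 : R[i]](rmorph_nat (real_complex R)) -fmorphV cjR.
by congr (_ + _); rewrite -mulNr; congr (_ * _); apply/eqP; rewrite eq_complex /= oppr0 opprK !eqxx.
Qed.

(** S is a basis orthonormal for V at z and c the first-order coefficient of V along b in this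
    basis. The bounds K and m do not depend on z because V >= e0 bounds the entries of S. *)
Lemma adapted_expansion : exists K m : R, [/\ 0 <= K, 0 <= m & forall z, exists S c : 'M[R[i]]_r,
  [/\ ctr S *m V z *m S = 1%:M, forall i j, cabs (c i j) <= m &
    forall l i j, cabs ((ctr S *m V (z + l *: b) *m S - 1%:M) i j -
      (l * c i j + cj l * cj (c j i))) <= K * cabs l ^+ 2]].
Proof.
have hV1 (pq : 'I_r * 'I_r) : exists C : R, 0 <= C /\ forall z l,
    cabs (V (z + l *: b) pq.1 pq.2 - (V z pq.1 pq.2 + l * D1 (fun x => V x pq.1 pq.2) z b +
      cj l * Db (fun x => V x pq.1 pq.2) z b)) <= C * cabs l ^+ 2.
  have [C C0 hC] := csm_line1 (cV pq.1 pq.2); exists (C * nv b ^+ 2); split; last by move=> z l; exact: hC.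
  by rewrite mulr_ge0 // exprn_ge0 // nv_ge0.
have /choice[C1 hC1] := hV1.
have hM1 (pq : 'I_r * 'I_r) : exists M : R, 0 <= M /\ forall z, cabs (D1 (fun x => V x pq.1 pq.2) z b) <= M.
  have c1 : csm (fun z => D1 (fun x => V x pq.1 pq.2) z b).
    by apply: csm_sum => j; apply: csmZ; exact: csm_dz.
  by have [_ [M [M0 hM]]] := sm_bounded (c1 0%N); exists M.
have /choice[M1 hM1'] := hM1.
(* Orthonormality gives e0 |S_pi|^2 <= 1, and x <= 1 + x^2. *)
pose sg : R := 1 + e0^-1.
have sg0 : 0 <= sg by rewrite addr_ge0 // invr_ge0 ltW.
pose K := \sum_p \sum_q sg * C1 (p, q) * sg; pose m := \sum_p \sum_q sg * M1 (p, q) * sg.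
have K0 : 0 <= K by apply: sumr_ge0 => p _; apply: sumr_ge0 => q _; rewrite !mulr_ge0 // (hC1 (p, q)).1.
have m0 : 0 <= m by apply: sumr_ge0 => p _; apply: sumr_ge0 => q _; rewrite !mulr_ge0 // (hM1' (p, q)).1.
exists K, m; split=> // z.
have [S hS] := orthonormal_basis (hV z) (@posV z).
pose A : 'M[R[i]]_r := \matrix_(p, q) D1 (fun x => V x p q) z b.
have BA p q : Db (fun x => V x p q) z b = cj (A q p).
  rewrite mxE /Db /D1 cj_sum; apply: eq_bigr => k _; rewrite cjM; congr (_ * _).
  by apply: dzb_cj => //; move=> y; exact: hV.
have Sb p i : cabs (S p i) <= sg.
  have h1 : e0 * cabs (S p i) ^+ 2 <= 1.
    have := lowV z (S *m ev i); rewrite qf_ctr hS qf_ev mxE eqxx /=.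
    apply: le_trans; rewrite ler_pM2l // (bigD1 p) //= -colE mxE lerDl.
    by apply: sumr_ge0 => k _; exact: sqr_ge0.
  have h2 : cabs (S p i) ^+ 2 <= e0^-1 by rewrite -[e0^-1]mul1r ler_pdivlMr // mulrC.
  apply: le_trans (_ : 1 + cabs (S p i) ^+ 2 <= _); last by rewrite lerD2l.
  have := sqr_ge0 (cabs (S p i) - 2^-1); move: (cabs (S p i)) => x; rewrite sqrrB expr2; lra.
have entry (N : 'M[R[i]]_r) (C : 'I_r -> 'I_r -> R) i j : (forall p q, cabs (N p q) <= C p q) ->
    cabs ((ctr S *m N *m S) i j) <= \sum_p \sum_q sg * C p q * sg.
  move=> hN; rewrite -mulmxA mxE; apply: le_trans (cabs_sum _ _ _) _; apply: ler_sum => p _.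
  rewrite !mxE cabsM cabs_conj; apply: (@le_trans _ _ (sg * \sum_q C p q * sg)); last first.
    by rewrite mulr_sumr; apply: ler_sum => q _; rewrite mulrA.
  apply: ler_pM; rewrite ?cabs_ge0 //; apply: le_trans (cabs_sum _ _ _) _; apply: ler_sum => q _.
  by rewrite cabsM; apply: ler_pM; rewrite ?cabs_ge0.
exists S, (ctr S *m A *m S); split=> //.
  by move=> i j; apply: (entry _ (fun p q => M1 (p, q))) => p q; rewrite mxE; exact: (hM1' (p, q)).2.
move=> l i j.
have -> : cj ((ctr S *m A *m S) j i) = (ctr S *m ctr A *m S) i j.
  transitivity (ctr (ctr S *m A *m S) i j); first by rewrite [RHS]mxE [RHS]mxE.
  by rewrite !ctrM ctrK mulmxA.
pose N := V (z + l *: b) - (V z + l *: A + cj l *: ctr A).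
have -> : (ctr S *m V (z + l *: b) *m S - 1%:M) i j -
    (l * (ctr S *m A *m S) i j + cj l * (ctr S *m ctr A *m S) i j) = (ctr S *m N *m S) i j.
  rewrite /N !mulmxBr !mulmxDr !mulmxBl !mulmxDl hS -!scalemxAr -!scalemxAl.
  move: (ctr S *m V _ *m S) (ctr S *m A *m S) (ctr S *m ctr A *m S) => X1 X2 X3.
  by rewrite !mxE; exact: first_order_ring.
rewrite (_ : K * _ = \sum_p \sum_q sg * (C1 (p, q) * cabs l ^+ 2) * sg); last first.
  by rewrite /K mulr_suml; apply: eq_bigr => p _; rewrite mulr_suml; apply: eq_bigr => q _; ring.
apply: (entry _ (fun p q => C1 (p, q) * cabs l ^+ 2)) => p q; rewrite /N !mxE; have := (hC1 (p, q)).2 z l; rewrite BA.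
by rewrite !mxE.
Qed.

Definition logdet z : R := ln (Re (\det (V z))).

Let det0 z : 0 < Re (\det (V z)).
Proof. exact: (det_posdef (hV z) (@posV z)). Qed.

(** The constant change of basis S multiplies both determinants by |det S|^2, so the difference of
    the logarithms can be computed in a basis where V z is the identity. *)
Let f_ratio (S : 'M[R[i]]_r) z z' : ctr S *m V z *m S = 1%:M ->
  logdet z' - logdet z = ln (Re (\det (ctr S *m V z' *m S))).
Proof.
move=> hS; have := congr1 (fun X => Re (\det X)) hS; rewrite !det_congr det1 !ReM /= !mul0r !subr0.
set k := cabs _ ^+ 2 => h.
have k0 : 0 < k.
  rewrite lt_neqAle sqr_ge0 andbT eq_sym; apply/eqP => hk; move: h; rewrite hk mul0r => /eqP.
  by rewrite eq_sym oner_eq0.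
rewrite lnM ?posrE // addrC /logdet; congr (_ + _); apply/eqP; rewrite eqr_oppLR -addr_eq0.
by rewrite addrC -lnM ?posrE // h ln1.
Qed.

Let qf_adapted (G c : 'M[R[i]]_r) l i : herm G ->
  qf G (ev i - l *: (c *m ev i)) =
  Re (G i i) - 2 * Re (l * hdot G (c *m ev i) (ev i)) + cabs l ^+ 2 * qf G (c *m ev i).
Proof.
move=> hG; set d := c *m ev i.
rewrite -scaleNr /qf !hdotDl !hdotDr !hdotZl !hdotZr (hdot_swap d (ev i) hG) hdot_ev (herm_real d hG).
rewrite -/(qf G d); move: (hdot G d (ev i)) (qf G d) (G i i) => x y g.
rewrite cabs_sqr; case: l => l1 l2; case: x => x1 x2; case: g => g1 g2 /=; ring.
Qed.

Let hdot_col (G c : 'M[R[i]]_r) i : hdot G (c *m ev i) (ev i) = \sum_k G i k * c k i.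
Proof.
rewrite hdotE (bigD1 i) //= [X in _ + X]big1 ?addr0 => [|k /negbTE nk].
  by apply: eq_bigr => k _; rewrite -colE mxE /ev mxE !eqxx rmorph1 mul1r.
by apply: big1 => k' _; rewrite /ev mxE nk rmorph0 !mul0r.
Qed.

Lemma logdet_expansion : exists K d : R, [/\ 0 <= K, 0 < d & forall z, exists s w (al be : R[i]),
  (forall i : 'I_r, qf (V z) (s i) = 1) /\
  forall l, cabs l < d ->
    \sum_i (qf (V (z + l *: b)) (s i + l *: w i) - 1) + Re (al * l + be * l ^+ 2) - K * cabs l ^+ 3
      <= logdet (z + l *: b) - logdet z].
Proof.
have [K [m [K0 m0 hKm]]] := adapted_expansion.
pose y := 2 * m + K; have y0 : 0 <= y by rewrite addr_ge0 // mulr_ge0.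
pose q := r%:R * y; have q0 : 0 <= q by rewrite mulr_ge0.
pose k1 := 4 * m * K + K ^+ 2.
pose K' := r%:R * (r%:R * k1) + r%:R * (r%:R * (r%:R * (m * y * m))) + r%:R * (2 * q ^+ 3).
have K'0 : 0 <= K'.
  by rewrite /K' /k1; repeat (apply: addr_ge0 || apply: mulr_ge0 || apply: exprn_ge0 || apply: ler0n || assumption).
have q2 : 0 < 2 * (q + 1) by rewrite mulr_gt0 // ltr_wpDl.
(* For |l| below this radius q |l| <= 1/2, the range of [logdet_lower]. *)
exists K', (2 * (q + 1))^-1; split=> //; first by rewrite invr_gt0.
move=> z; have [S [c [hS hc hY]]] := hKm z.
(* The correction - l S c kills the first-order part of |u_i|^2, so the first-order part of log det
   is carried entirely by 2 tr c; the quadratic coefficient is tr(c^2). *)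
exists (fun i => S *m ev i), (fun i => - (S *m (c *m ev i))), (2 * \sum_i c i i), (\sum_i \sum_k c i k * c k i).
split; first by move=> i; rewrite qf_ctr hS qf_ev mxE eqxx.
move=> l ld; set s := cabs l; have s0 : 0 <= s by exact: cabs_ge0.
have s1 : s <= 1.
  apply: le_trans (ltW ld) _; rewrite invf_le1 // mulrDr mulr1 -{1}[1]add0r.
  by apply: lerD; rewrite ?mulr_ge0 // ler1n.
have qs : q * s <= 2^-1.
  move: ld; rewrite -/s -[X in _ < X]mul1r ltr_pdivlMr // => ld.
  apply: (@le_trans _ _ ((q + 1) * s)); first by rewrite ler_wpM2r // lerDl.
  by rewrite -(ler_pM2l (@ltr0n _ 2)) mulfV ?pnatr_eq0 // mulrA mulrC ltW.
set z' := z + l *: b; pose Y : 'M[R[i]]_r := ctr S *m V z' *m S - 1%:M.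
have GE : ctr S *m V z' *m S = 1%:M + Y by rewrite /Y addrC subrK.
have hG : herm (1%:M + Y) by rewrite -GE; apply: herm_congr.
have hY' : herm Y.
  move=> i j; have := hG i j; rewrite !mxE cjD.
  have -> : cj ((i == j)%:R : R[i]) = (j == i)%:R by rewrite rmorph_nat eq_sym.
  by move=> /addrI.
have hYl : forall i j, cabs (Y i j - (l * c i j + cj l * cj (c j i))) <= K * s ^+ 2 := hY l.
clearbody Y.
have Yb i j : cabs (Y i j) <= y * s.
  have h := hYl i j; rewrite -(subrK (l * c i j + cj l * cj (c j i)) (Y i j)).
  apply: le_trans (cabsD _ _) _; rewrite /y mulrDl addrC; apply: lerD.
    apply: le_trans (cabsD _ _) _; rewrite !cabsM !cabs_conj -/s.
    rewrite (_ : 2 * m * s = s * m + s * m); last by ring.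
    by apply: lerD; apply: ler_wpM2l.
  apply: le_trans h _; apply: ler_wpM2l => //; rewrite -/s expr2 -[leRHS]mul1r.
  exact: ler_wpM2r.
have N2 : \sum_i \sum_j cabs (Y i j) ^+ 2 <= (q * s) ^+ 2.
  apply: (@le_trans _ _ (\sum_(i < r) \sum_(j < r) (y * s) ^+ 2)).
    by apply: ler_sum => i _; apply: ler_sum => j _; rewrite lerXn2r ?nnegrE ?cabs_ge0 ?mulr_ge0.
  by rewrite double_sum_cst; apply: le_eq; exact: square_scale_ring.
have L := logdet_lower hY' (mulr_ge0 q0 s0) qs N2.
rewrite (f_ratio z' hS) GE; apply: le_trans L.
have uE i : qf (V z') (S *m ev i + l *: - (S *m (c *m ev i))) = 1 + Re (Y i i) - 2 * Re (l * c i i)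
    - \sum_k 2 * Re (l * c k i * Y i k) + s ^+ 2 * (\sum_k cabs (c k i) ^+ 2) + s ^+ 2 * qf Y (c *m ev i).
  have -> : S *m ev i + l *: - (S *m (c *m ev i)) = S *m (ev i - l *: (c *m ev i)).
    by rewrite scalerN mulmxBr -scalemxAr.
  rewrite [LHS]qf_ctr GE (qf_adapted _ _ _ hG) hdot_col.
  rewrite -/s qfD qf_id.
  have -> : \sum_k (1%:M + Y) i k * c k i = c i i + \sum_k Y i k * c k i.
    rewrite (eq_bigr (fun k => (i == k)%:R * c k i + Y i k * c k i)); last by move=> k _; rewrite !mxE mulrDl.
    rewrite big_split /=; congr (_ + _); rewrite (bigD1 i) //= eqxx mul1r big1 ?addr0 // => k nk.
    by rewrite eq_sym (negbTE nk) mul0r.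
  have -> : \sum_k cabs ((c *m ev i) k 0) ^+ 2 = \sum_k cabs (c k i) ^+ 2.
    by apply: eq_bigr => k _; rewrite -colE mxE.
  have -> : \sum_k 2 * Re (l * c k i * Y i k) = 2 * Re (l * \sum_k Y i k * c k i).
    rewrite -mulr_sumr -Re_sum mulr_sumr; congr (2 * Re _); apply: eq_bigr => k _; ring.
  rewrite [(1%:M + Y) i i]mxE [1%:M i i]mxE eqxx mulrDr !ReD /=; ring.
(* Y is O(|l|), so this contribution, multiplied by |l|^2, is part of the cubic error. *)
have Q i : qf Y (c *m ev i) <= r%:R * (r%:R * (m * y * m)) * s.
  rewrite /qf hdotE Re_sum.
  apply: (@le_trans _ _ (\sum_(k < r) \sum_(j < r) (m * y * m * s))).
    apply: ler_sum => k _; rewrite Re_sum; apply: ler_sum => j _.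
    apply: le_trans (ler_norm _) _; apply: le_trans (Re_le_cabs _) _; rewrite !cabsM cabs_conj -!colE !mxE.
    rewrite (_ : m * y * m * s = m * (y * s) * m); last by ring.
    by apply: ler_pM; rewrite ?mulr_ge0 ?cabs_ge0 //; apply: ler_pM; rewrite ?cabs_ge0.
  by rewrite double_sum_cst; apply: le_eq; rewrite !mulrA.
(* The sum of [quadratic_pair] over all index pairs, in which the antisymmetric parts cancel. *)
have P : - (r%:R * (r%:R * k1) * s ^+ 3) <=
    \sum_i \sum_k (- (2^-1 * cabs (Y i k) ^+ 2) + 2 * Re (l * c k i * Y i k) -
      s ^+ 2 * cabs (c k i) ^+ 2 - Re (l ^+ 2 * (c i k * c k i))).
  apply: (@le_trans _ _ (\sum_i \sum_k (2^-1 * (s ^+ 2 * (cabs (c k i) ^+ 2 - cabs (c i k) ^+ 2)) - k1 * s ^+ 3))).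
    rewrite (eq_bigr (fun i : 'I_r => \sum_k 2^-1 * (s ^+ 2 * (cabs (c k i) ^+ 2 - cabs (c i k) ^+ 2)) - r%:R * k1 * s ^+ 3)); last first.
      by move=> i _; rewrite sumrB sumr_const card_ord -[X in _ - X = _]mulr_natl mulrA.
    rewrite sumrB sumr_const card_ord -[(_ * s ^+ 3) *+ r]mulr_natl.
    rewrite (_ : \sum_i \sum_k _ = 0) ?sub0r; last first.
      rewrite (eq_bigr (fun i : 'I_r => 2^-1 * s ^+ 2 * (\sum_k cabs (c k i) ^+ 2) - 2^-1 * s ^+ 2 * (\sum_k cabs (c i k) ^+ 2))).
        by rewrite sumrB -!mulr_sumr exchange_big /= subrr.
      by move=> i _; rewrite -mulrBr -sumrB mulr_sumr; apply: eq_bigr => k _; rewrite mulrA.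
    by apply: le_eq; rewrite !mulrA.
  apply: ler_sum => i _; apply: ler_sum => k _.
  have := @quadratic_pair R l (c i k) (c k i) (Y i k - (l * c i k + cj l * cj (c k i))) m K m0 K0 s1 (hc i k) (hc k i) (hYl i k).
  by rewrite [l * c i k + _ + _]addrC subrK.
rewrite (eq_bigr (fun i => Re (Y i i) - 2 * Re (l * c i i) + (- (\sum_k 2 * Re (l * c k i * Y i k)) + s ^+ 2 * (\sum_k cabs (c k i) ^+ 2)) + s ^+ 2 * qf Y (c *m ev i))); last first.
  by move=> i _; rewrite uE; exact: cancel_one_ring.
have Q2 : \sum_i s ^+ 2 * qf Y (c *m ev i) <= r%:R * (r%:R * (r%:R * (m * y * m))) * s ^+ 3.
  apply: (@le_trans _ _ (\sum_(i < r) s ^+ 2 * (r%:R * (r%:R * (m * y * m)) * s))).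
    by apply: ler_sum => i _; apply: ler_wpM2l; rewrite ?sqr_ge0.
  by rewrite sumr_const card_ord -[_ *+ r]mulr_natl; apply: le_eq; exact: cube_scale_ring.
have E1 : Re (2 * (\sum_i c i i) * l + (\sum_i \sum_k c i k * c k i) * l ^+ 2) =
    \sum_i 2 * Re (l * c i i) + \sum_i \sum_k Re (l ^+ 2 * (c i k * c k i)).
  rewrite ReD; congr (_ + _).
    rewrite -mulr_sumr -Re_sum -mulr_sumr -[2 * _ * l]mulrA [_ * l]mulrC.
    by move: (l * _) => x; case: x => x1 x2 /=; ring.
  rewrite mulrC mulr_sumr Re_sum; apply: eq_bigr => i _.
  by rewrite mulr_sumr Re_sum.
rewrite E1 !big_split /= sumrN.
have E2 : \sum_i \sum_k (- (2^-1 * cabs (Y i k) ^+ 2) + 2 * Re (l * c k i * Y i k) -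
      s ^+ 2 * cabs (c k i) ^+ 2 - Re (l ^+ 2 * (c i k * c k i))) =
    - (2^-1 * (\sum_i \sum_j cabs (Y i j) ^+ 2)) + \sum_i \sum_k 2 * Re (l * c k i * Y i k) -
    \sum_i s ^+ 2 * (\sum_k cabs (c k i) ^+ 2) - \sum_i \sum_k Re (l ^+ 2 * (c i k * c k i)).
  rewrite mulr_sumr -sumrN -big_split -!sumrB /=; apply: eq_bigr => i _.
  by rewrite !mulr_sumr -sumrN -big_split -!sumrB.
rewrite E2 in P; rewrite sumrN.
have E3 : r%:R * (2 * (q * s) ^+ 3) = r%:R * (2 * q ^+ 3) * s ^+ 3 by rewrite exprMn !mulrA.
have E4 : K' * s ^+ 3 = r%:R * (r%:R * k1) * s ^+ 3 + r%:R * (r%:R * (r%:R * (m * y * m))) * s ^+ 3 + r%:R * (2 * q ^+ 3) * s ^+ 3 by rewrite /K' 2!mulrDl.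
rewrite E3 E4.
have F := @logdet_lra R _ _ (r%:R * (2 * q ^+ 3) * s ^+ 3) _ _ _ _ (\sum_i Re (Y i i)) (\sum_i 2 * Re (l * c i i)) _ P Q2.
apply: le_trans (le_trans _ F) _; first by apply: le_eq; congr (_ - _ + _ + _ + _ - _).
exact: le_eq.
Qed.

Lemma logdet_continuous : continuous logdet.
Proof.
move=> z; have c : \det (V x) @[x --> z] --> \det (V z).
  by apply: (@cvg_det R _ (nbhs z) _ r V (V z)) => i j; have [k _] := sm_bounded (cV i j 0%N); exact: k.
apply: (@continuous_comp _ _ _ (fun x => Re (\det (V x))) (@ln R)); first exact: (cvg_Re c).
exact: continuous_ln.
Qed.

(** The expansion is averaged over the circle: each |u_i|^2 has mean at least 1, its value at z, and
    the real part of the holomorphic polynomial has mean 0. *)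
Lemma logdet_submean : exists K d : R, [/\ 0 <= K, 0 < d & forall z s, 0 < s < d ->
  (forall P c, qf (V z) (P *m z^T + c) <= cmean (fun t =>
     qf (V (z + (s%:C * cis t) *: b)) (P *m (z + (s%:C * cis t) *: b)^T + c))) ->
  logdet z <= cmean (fun t => logdet (z + (s%:C * cis t) *: b)) + K * s ^+ 3].
Proof.
have [K [d [K0 d0 h]]] := logdet_expansion; exists K, d; split=> // z s /andP[s0 sd] hs.
have [u [w [al [be [u1 hl]]]]] := h z.
have [j0 bj] : exists j, b 0 j != 0.
  apply: contrapT => hb; move/eqP: b0; apply; apply/rowP => j; rewrite mxE.
  by apply/eqP; apply: contrapT => hj; apply: hb; exists j; apply/negP.
pose ga (t : R) := z + (s%:C * cis t) *: b.
have cl : continuous (fun t : R => s%:C * cis t : R[i]).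
  by move=> t; exact: (cvgM (@cst_continuous _ _ s%:C t) (@continuous_cis R t)).
have cga : continuous ga.
  move=> t; apply: (@continuous_comp _ _ _ (fun t : R => s%:C * cis t) (fun l => z + l *: b)); first exact: cl.
  exact: continuous_line.
have cfg : continuous (fun t => logdet (ga t)).
  move=> t; apply: (@continuous_comp _ _ _ ga logdet); first exact: cga.
  exact: logdet_continuous.
pose Ph i t := qf (V (ga t)) (u i + (s%:C * cis t) *: w i).
have cPh i : continuous (Ph i).
  move=> t; apply: (@continuous_qf _ _ _ (fun t => V (ga t)) (fun t : R => u i + (s%:C * cis t) *: w i)) => [p q|p].
    apply: (@continuous_comp _ _ _ ga (fun x => V x p q)); first exact: cga.
    by have [k _] := sm_bounded (cV p q 0%N); exact: k.
  rewrite (_ : (fun y => _) = fun y : R => u i p 0 + (s%:C * cis y) * w i p 0); last first.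
    by apply/funext => y; rewrite mxE [in X in _ + X = _]mxE.
  rewrite mxE [in X in _ + X]mxE.
  exact: (cvgD (@cst_continuous _ _ (u i p 0) t) (cvgM (cl t) (@cst_continuous _ _ (w i p 0) t))).
have mPh i : 1 <= cmean (Ph i).
  (* The field u_i + l w_i on the line is extended to an affine field on C^n, reading l off a
     coordinate in which b does not vanish. *)
  have := hs (w i *m ((b 0 j0)^-1 *: delta_mx 0 j0)) (u i - (z 0 j0 / b 0 j0) *: w i).
  have E y : w i *m ((b 0 j0)^-1 *: delta_mx 0 j0) *m y^T + (u i - (z 0 j0 / b 0 j0) *: w i) =
      u i + ((y 0 j0 - z 0 j0) / b 0 j0) *: w i.
    have -> : w i *m ((b 0 j0)^-1 *: delta_mx 0 j0) *m y^T = (y 0 j0 / b 0 j0) *: w i.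
      rewrite -mulmxA -scalemxAl -rowE; apply/matrixP => p q; rewrite ord1 !mxE big_ord1 !mxE.
      by rewrite mulrC [y 0 j0 / _]mulrC.
    by rewrite addrCA -scalerBl mulrBl.
  rewrite E subrr mul0r scale0r addr0 u1 => hm; apply: le_trans hm _; apply: le_eq; apply: congr1.
  apply/funext => t; have E2 := E (ga t).
  have gaj : (ga t 0 j0 - z 0 j0) / b 0 j0 = s%:C * cis t.
    by rewrite /ga mxE [X in _ + X - _]mxE addrC addKr mulfK.
  by rewrite gaj in E2; rewrite /Ph -E2.
pose q l : R[i] := al * l + be * l ^+ 2.
have dq x : cdiff q x.
  apply: cdiffD; first by apply: cdiffM; [exact: cdiff_cst|exact: cdiff_id].
  apply: cdiffM; first exact: cdiff_cst.
  by apply: cdiffM; exact: cdiff_id.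
have mq : cmean (fun t => Re (q (s%:C * cis t))) = 0.
  have := mean_value s0 (fun x (_ : cabs (x - 0) <= s) => dq x).
  rewrite {2}/q expr2 !mulr0 addr0 /= => E; rewrite -[RHS]E.
  by apply: congr1; apply/funext => t; rewrite add0r.
have cq : continuous (fun t => Re (q (s%:C * cis t))).
  move=> t; have c1 : {for t, continuous (q \o (fun t : R => s%:C * cis t))}.
    apply: (@continuous_comp _ _ _ (fun t : R => s%:C * cis t) q); first exact: cl.
    exact: (cdiff_continuous (dq _)).
  exact: (cvg_Re c1).
have cP1 i : continuous (fun t => Ph i t - 1).
  by move=> t; exact: (cvgB (cPh i t) (@cst_continuous _ _ (1 : R) t)).
have cS : continuous (fun t => \sum_i (Ph i t - 1)) by exact: continuous_rsum.
have cA : continuous (fun t => \sum_i (Ph i t - 1) + Re (q (s%:C * cis t))).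
  by move=> t; exact: (cvgD (cS t) (cq t)).
have ls t : cabs (s%:C * cis t : R[i]) = s by rewrite cabsM cabs_real cabs_cis mulr1 gtr0_norm.
have pt t : \sum_i (Ph i t - 1) + Re (q (s%:C * cis t)) <= logdet (ga t) + (K * s ^+ 3 - logdet z).
  have := hl (s%:C * cis t); rewrite ls => /(_ sd); rewrite -/(ga t) -/(q _) lerBlDr => H.
  by apply: le_trans H _; apply: le_eq; rewrite -addrA [- _ + _]addrC.
have cR : continuous (fun t => logdet (ga t) + (K * s ^+ 3 - logdet z)).
  by move=> t; exact: (cvgD (cfg t) (@cst_continuous _ _ (K * s ^+ 3 - logdet z) t)).
have := cmean_le cA cR (fun t _ => pt t).
rewrite cmeanD // mq addr0 cmean_sum // cmeanD // ?cmean_cst; last by move=> t; exact: cst_continuous.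
move=> H; rewrite -subr_ge0 -/ga; apply: (@le_trans _ _ (\sum_i cmean (fun t => Ph i t - 1))).
  apply: sumr_ge0 => i _; rewrite cmeanB // ?cmean_cst ?subr_ge0 //.
  by move=> t; exact: cst_continuous.
by apply: le_trans H _; rewrite addrA.
Qed.

End logdet_submean.

(** * The logarithm of the determinant of a singular metric *)

Section psh_logdet.
Context {R : realType} {n r : nat}.
Local Notation Cn := 'rV[R[i]]_n.
Variables (D : set Cn) (H : Cn -> 'M[R[i]]_r).
Local Notation adm := (@affine_field R n r).
Hypothesis N : locally_negative D H adm.
Let Aadm := @affine_fields_admissible R n r.
Local Notation Hs := (Hs D H).
Local Notation Hc := (Hc D H).
Local Notation mu := (@lebesgue_measure R).
Local Notation I := (`[0%R, (2 * pi)%R]%classic : set R).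

Let f nu (z : Cn) : R := logdet (Hs nu) z.
Let u (z : Cn) : \bar R := lne (Re (\det (H z)))%:E.

Let lowV nu z (s : 'cV[R[i]]_r) : @eps R nu * \sum_i cabs (s i 0) ^+ 2 <= qf (Hs nu z) s.
Proof. by rewrite qf_Hs lerDr; exact: (proj2 (psd_Hc Aadm N nu z)). Qed.

Let cVs nu : mcsm (Hs nu).
Proof. by move=> i j k; exact: (sm_Hs Aadm N). Qed.

Let hVs nu z : herm (Hs nu z) := herm_Hs Aadm N nu z.

Let cf nu : continuous (f nu).
Proof. exact: (logdet_continuous (cVs nu) (hVs nu) (eps_gt0 nu) (lowV nu)). Qed.

Let det_Hs nu z : 0 < Re (\det (Hs nu z)).
Proof. by apply: det_posdef => // s; exact: (posdef_Hs Aadm N). Qed.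

Let det_H z : 0 <= Re (\det (H z)).
Proof. by have [] := det_psd (neg_psd N z). Qed.

Let dd (d : R) : 0 < d -> d / 4 <= d / 2 /\ d / 2 <= d.
Proof.
move=> d0; split; first by rewrite ler_pM2l // lef_pV2 ?posrE // ler_nat.
by rewrite ler_pdivrMr // ler_peMr ?ler1n // ltW.
Qed.

Let f_mono d nu z : good D H adm d z -> @eps R nu <= d / 4 -> f nu.+1 z <= f nu z.
Proof.
move=> gd ed; have [d0 _ _ _] := gd; have [h1 h2] := dd d0.
rewrite ler_ln ?posrE //; apply: det_le => //.
- split; first exact: hVs.
  move=> s; apply: le_trans (lowV nu.+1 z s); rewrite mulr_ge0 ?(ltW (eps_gt0 _)) //.
  by apply: sumr_ge0 => i _; exact: sqr_ge0.
- by move=> s; exact: (posdef_Hs Aadm N).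
- move=> s; have E1 := qf_Hs D H nu z s; have E2 := qf_Hs D H nu.+1 z s.
  rewrite [leLHS]E2 [leRHS]E1; apply: lerD; first exact: (Hc_mono Aadm N s gd (le_trans ed h1)).
  by apply: ler_wpM2r; [apply: sumr_ge0 => i _; exact: sqr_ge0|exact: eps_le].
Qed.

Let u_le d nu z : good D H adm d z -> @eps R nu <= d / 4 -> (u z <= (f nu z)%:E)%E.
Proof.
move=> gd ed; have [d0 _ _ _] := gd; have [h1 h2] := dd d0.
have le1 : Re (\det (H z)) <= Re (\det (Hs nu z)).
  apply: det_le => //; first exact: neg_psd N z.
    by move=> s; exact: (posdef_Hs Aadm N).
  move=> s; have E1 := qf_Hs D H nu z s; rewrite [leRHS]E1.
  apply: le_trans (Hc_lower Aadm N s gd (le_trans ed (le_trans h1 h2))) _; rewrite lerDl.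
  by rewrite mulr_ge0 ?(ltW (eps_gt0 _)) //; apply: sumr_ge0 => i _; exact: sqr_ge0.
rewrite /u; have := det_H z; rewrite le_eqVlt => /orP[/eqP <-|h]; first by rewrite le0_lneNy // leNye.
by rewrite lne_EFin // lee_fin ler_ln ?posrE.
Qed.

Let det_cvg z : D z -> Re (\det (Hs nu z)) @[nu --> \oo] --> Re (\det (H z)).
Proof.
move=> Dz; apply: cvg_Re; apply: cvg_det => i j; exact: (Hs_cvg Aadm N Dz).
Qed.

(** Stated with an upper bound c so as to treat u z = -oo and finite values at once. *)
Let f_lt z c : D z -> (u z < c%:E)%E -> \forall nu \near \oo, f nu z < c.
Proof.
move=> Dz uc; have lt1 : Re (\det (H z)) < expR c.
  have := det_H z; rewrite le_eqVlt => /orP[/eqP <-|h]; first exact: expR_gt0.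
  by move: uc; rewrite /u lne_EFin // lte_fin -ltr_expR lnK.
have h0 : \forall nu \near \oo, Re (\det (Hs nu z)) < expR c.
  exact: (@cvgr_lt _ _ _ _ _ _ (det_cvg Dz) _ lt1).
near=> nu; rewrite -ltr_expR /f /logdet lnK ?posrE //; near: nu; exact: h0.
Unshelve. all: by end_near. Qed.

Let B_cvg (B : R) z : D z -> (B - f nu z)%:E @[nu --> \oo] --> (B%:E - u z)%E.
Proof.
move=> Dz; have := det_H z; rewrite le_eqVlt => /orP[/eqP h|h].
  have -> : (B%:E - u z = +oo)%E by rewrite /u -h le0_lneNy.
  apply/cvgeryP/cvgryPge => A.
  have : (u z < (B - A)%:E)%E by rewrite /u -h le0_lneNy // ltNyr.
  move=> /(f_lt Dz); apply: filterS => nu; rewrite ltrBrDr => /ltW.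
  by rewrite lerBrDl.
rewrite /u lne_EFin // -EFinB; apply: cvg_EFin; first exact: nearW.
apply: cvgB; first exact: cvg_cst.
apply: (@cvg_comp _ _ _ (fun nu => Re (\det (Hs nu z))) (@ln R) _ _ _ (det_cvg Dz)).
exact: continuous_ln.
Qed.

(** The submean inequality up to K s^3 on small circles is made exact on the unit circle by
    [radial_mean_le], for one rank that serves the whole compact disc. *)
Let f_disc a b : (forall l, cabs l <= 1 -> D (a + l *: b)) -> exists M, 
  (forall nu, (M <= nu)%N -> f nu a <= cmean (fun t => f nu (a + cis t *: b))) /\
  forall nu l, (M <= nu)%N -> cabs l <= 1 ->
    f nu.+1 (a + l *: b) <= f nu (a + l *: b) /\ (u (a + l *: b) <= (f nu (a + l *: b))%:E)%E.
Proof.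
move=> hD; pose K := (fun l => a + l *: b) @` [set l : R[i] | cabs l <= 1].
have cK : compact K.
  apply: continuous_compact; last exact: disc_compact.
  by apply: continuous_subspaceT; exact: continuous_line.
have KD : K `<=` D by move=> _ [l l1 <-]; exact: hD.
have [M hM] := good_uniform N cK KD; exists M; split; last first.
  move=> nu l hnu l1; have [d [gd ed]] := hM nu hnu _ (ex_intro2 _ _ l l1 erefl).
  by split; [exact: f_mono gd ed|exact: u_le gd ed].
(* The constant disc is trivial and is excluded from [logdet_submean]. *)
move=> nu hnu; have [->|b0] := eqVneq b 0.
  by under eq_fun do rewrite scaler0 addr0; rewrite cmean_cst.
have [K1 [d1 [K10 d10 sub]]] := logdet_submean (cVs nu) (hVs nu) (eps_gt0 nu) (lowV nu) b0.
have nb : 0 <= nv b by exact: nv_ge0.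
pose g (l : R[i]) := f nu (a + l *: b).
have cg (l : R[i]) : {for l, continuous g}.
  apply: (@continuous_comp _ _ _ (fun l : R[i] => a + l *: b) (f nu)); first exact: continuous_line.
  exact: cf.
have gsub e : 0 < e -> exists2 d : R, 0 < d & forall z s, cabs z < 1 -> 0 < s < d -> cabs z + s <= 1 ->
    g z <= cmean (fun t => g (z + s%:C * cis t)) + e * s ^+ 2.
  (* Below d2 the circle fits into the good polydisc; below d3 the cubic error K1 s^3 is at most e
     s^2. *)
  move=> e0; pose d2 := @eps R nu / (nv b + 1); pose d3 := e / (K1 + 1).
  have d20 : 0 < d2 by rewrite divr_gt0 ?eps_gt0 // ltr_wpDl.
  have d30 : 0 < d3 by rewrite divr_gt0 // ltr_wpDl.
  exists (Num.min d1 (Num.min d2 d3)); first by rewrite !lt_min d10 d20.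
  move=> l s l1 /andP[s0]; rewrite !lt_min => /and3P[s1 s2 s3] _.
  have [d [gd ed]] := hM nu hnu (a + l *: b) (ex_intro2 _ _ l (ltW l1) erefl).
  have [d0 _ _ _] := gd; have [h1 h2] := dd d0.
  have ss : 0 < s < d1 by rewrite s0.
  have hb l' : cabs l' <= 1 -> pd 0 (d / 2) (l' *: (s%:C *: b)).
    move=> l'1; apply/pdE => k; rewrite !mxE subr0 !cabsM cabs_real (gtr0_norm s0).
    apply: (@le_lt_trans _ _ (s * nv b)).
      have hk : cabs (b 0 k) <= nv b.
        by rewrite /nv (bigD1 k) //= lerDl; apply: sumr_ge0 => m _; exact: cabs_ge0.
      rewrite -[leRHS]mul1r; apply: ler_pM; rewrite ?mulr_ge0 ?cabs_ge0 ?(ltW s0) //.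
      by rewrite ler_pM2l.
    apply: (@lt_le_trans _ _ (@eps R nu)); last exact: le_trans ed h1.
    apply: (@lt_le_trans _ _ (s * (nv b + 1))); first by rewrite ltr_pM2l // ltrDl.
    by rewrite -ler_pdivlMr ?ltr_wpDl // ltW.
  have := sub (a + l *: b) s ss _; rewrite -/(g l) => hsub.
  have path t : a + l *: b + (s%:C * cis t) *: b = a + (l + s%:C * cis t) *: b.
    by rewrite scalerDl addrA.
  have {hsub} : logdet (Hs nu) (a + l *: b) <=
      cmean (fun t => logdet (Hs nu) (a + l *: b + (s%:C * cis t) *: b)) + K1 * s ^+ 3.
    apply: hsub => P c; have := Hs_submean N P c gd (le_trans ed h1) hb.
    by under [X in _ <= cmean X -> _]eq_fun do rewrite scalerA [cis _ * _]mulrC.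
  under [X in _ <= cmean X + _ -> _]eq_fun do rewrite path.
  move=> h; apply: le_trans h _; rewrite lerD2l exprSr mulrA mulrC mulrA.
  apply: ler_wpM2r; first exact: sqr_ge0.
  apply: (@le_trans _ _ (s * (K1 + 1))); first by rewrite ler_pM2l // lerDl.
  by rewrite -ler_pdivlMr ?ltr_wpDl // ltW.
have r01 : 0 <= (0 : R) <= 1 by rewrite lexx ler01.
have E0 : cmean (fun t => g (0%:C * cis t)) = f nu a.
  rewrite (_ : (fun t => _) = fun=> f nu a); first exact: cmean_cst.
  by apply/funext => t; rewrite rmorph0 mul0r /g scale0r addr0.
have c1 : (1 : R)%:C = 1 :> R[i] by exact: rmorph1.
have E1 : (fun t => g (1%:C * cis t)) = fun t => f nu (a + cis t *: b).
  apply/funext => t; have e : (1%:C * cis t : R[i]) = cis t := etrans (congr1 (fun x => x * cis t) c1) (mul1r _).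
  exact: (congr1 (fun x => f nu (a + x *: b)) e).
have RM : cmean (fun t => g (0%:C * cis t)) <= cmean (fun t => g (1%:C * cis t)).
  exact: (@radial_mean_le R g 1 ltr01 (fun l _ => cg l) gsub 0 r01).
rewrite -[X in X <= _]E0; exact: le_trans RM (le_eq (congr1 (@cmean R) E1)).
Qed.

(** Monotone convergence bounds the integral of B - u by 2 pi (B - x). Finiteness of u at the centre
    thus yields integrability on the circle as well, which the local integrability needs. *)
Lemma lne_det_submean a b (x : R) : (forall l, cabs l <= 1 -> D (a + l *: b)) -> u a = x%:E ->
  mu.-integrable I (fun t => u (a + cis t *: b)) /\
  (x%:E <= emean (fun t => u (a + cis t *: b)))%E.
Proof.
move=> hD ux; have [M [hM1 hM2]] := f_disc hD.
have c1 t : cabs (cis t : R[i]) <= 1 by rewrite cabs_cis.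
(* An upper bound on the circle at rank M, hence at all later ranks: the functions B - f are
   nonnegative and increase to B - u, with value +oo where the determinant vanishes. *)
have [B hB] : exists B : R, forall t, f M (a + cis t *: b) <= B.
  pose P m l := f M (a + l *: b) <= m%:R.
  have hP : forall y : R[i], [set l : R[i] | cabs l <= 1] y -> exists2 U, nbhs y U &
      exists M, forall m z, (M <= m)%N -> U z -> P m z.
    move=> y _; exists [set l | f M (a + l *: b) < f M (a + y *: b) + 1].
      have cl : {for y, continuous (fun l : R[i] => f M (a + l *: b))}.
        apply: (@continuous_comp _ _ _ (fun l : R[i] => a + l *: b) (f M)); first exact: continuous_line.
        exact: cf.
      by apply: (@cvgr_lt _ _ _ _ _ _ cl); rewrite ltrDl.
    exists (Num.bound (`|f M (a + y *: b) + 1|)) => m z hm /= hz.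
    apply: le_trans (ltW hz) _; apply: le_trans (ler_norm _) _.
    by apply: le_trans (ltW (archi_boundP (normr_ge0 _))) _; rewrite ler_nat.
  have [M' hM'] := compact_eventually (disc_compact (R := R)) hP.
  by exists M'%:R => t; exact: (hM' M' (leqnn _) (cis t) (c1 t)).
pose F m t := B - f (m + M)%N (a + cis t *: b).
pose g t := u (a + cis t *: b).
have cF m : continuous (F m).
  move=> t; apply: cvgB; first exact: cvg_cst.
  apply: (@continuous_comp _ _ _ (fun t : R => a + cis t *: b) (f (m + M)%N)); first exact: continuous_circle.
  exact: cf.
have F0 m t : 0 <= F m t.
  rewrite subr_ge0; apply: le_trans (hB t); elim: m => [|m IH]; first by rewrite add0n.
  by apply: le_trans IH; rewrite addSn; have [] := hM2 (m + M)%N (cis t) (leq_addl _ _) (c1 t).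
have Fn m t : F m t <= F m.+1 t.
  by rewrite /F lerD2l lerN2 addSn; have [] := hM2 (m + M)%N (cis t) (leq_addl _ _) (c1 t).
have Fm m : cmean (F m) <= B - x.
  have cft : continuous (fun t => f (m + M)%N (a + cis t *: b)).
    move=> t; apply: (@continuous_comp _ _ _ (fun t : R => a + cis t *: b) (f (m + M)%N)); first exact: continuous_circle.
    exact: cf.
  rewrite /F cmeanB //; last by move=> t; exact: cst_continuous.
  rewrite cmean_cst lerD2l lerN2; apply: le_trans (hM1 _ (leq_addl _ _)).
  have c0 : cabs (0 : R[i]) <= 1 by rewrite cabs0.
  by have [_] := hM2 (m + M)%N 0 (leq_addl _ _) c0; rewrite scale0r addr0 ux lee_fin.
have gF t : (F m t)%:E @[m --> \oo] --> (B%:E - g t)%E.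
  have h := @B_cvg B _ (hD (cis t) (c1 t)).
  by rewrite -(cvg_shiftn M) in h.
have mI : measurable I by exact: measurable_itv.
have mF m : measurable_fun I (EFin \o F m).
  apply: (@measurable_funS _ _ _ _ setT) => //; apply/measurable_EFinP.
  exact: (continuous_measurable_fun (cF m)).
pose v t := (B%:E - g t)%E.
have mv : measurable_fun I v.
  by apply: (@emeasurable_fun_cvg _ _ _ _ (fun m t => (F m t)%:E) v mF) => t _; exact: gF.
have v0 t : (0 <= v t)%E.
  apply: (@lime_bound R (fun m => (F m t)%:E) (v t) 0%E (gF t)) => m.
  by rewrite lee_fin.
have int_emean (k : R -> \bar R) : (\int[mu]_(t in I) k t = (2 * pi)%:E * emean k)%E.
  by rewrite /emean muleA -EFinM mulfV ?mul1e // gt_eqF // mulr_gt0 ?pi_gt0.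
have intF m : (\int[mu]_(t in I) (F m t)%:E <= (2 * pi * (B - x))%:E)%E.
  rewrite int_emean -[emean _]/(emean (EFin \o F m)) emean_cmean // -EFinM lee_fin.
  by apply: ler_wpM2l => //; rewrite mulr_ge0 ?pi_ge0.
have intv : (\int[mu]_(t in I) v t <= (2 * pi * (B - x))%:E)%E.
  have := @monotone_convergence _ _ R mu I mI (fun m t => (F m t)%:E) mF.
  have nd t : I t -> nondecreasing_seq (fun m => (F m t)%:E).
    by move=> _; apply/nondecreasing_seqP => m; rewrite lee_fin.
  move=> /(_ (fun m t _ => _)) MC.
  have -> : (\int[mu]_(t in I) v t = \int[mu]_(t in I) limn (fun m => (F m t)%:E))%E.
    by apply: eq_integral => t _; apply/esym/cvg_lim => //; exact: gF.
  have F0e m t : (0 <= (F m t)%:E)%E by rewrite lee_fin.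
  rewrite (MC F0e nd).
  apply: lime_le; last by near=> m; exact: intF.
  apply: ereal_nondecreasing_is_cvgn; apply/nondecreasing_seqP => m.
  by apply: ge0_le_integral => //; first [exact: mF | by move=> t _; rewrite lee_fin].
have iv : mu.-integrable I v.
  apply/integrableP; split=> //; apply: le_lt_trans (ltry (2 * pi * (B - x))).
  by apply: le_trans intv; under eq_integral do rewrite gee0_abs //.
have gE t : g t = (B%:E - v t)%E.
  by rewrite /v; case: (g t) => [y| |] //=; rewrite -!EFinB opprB addrC subrK.
have iB : mu.-integrable I (fun=> B%:E).
  have fI : (mu I < +oo)%E by rewrite lebesgue_measure_itv /=; case: ifP; rewrite ?ltry.
  apply/integrableP; split; first exact: measurable_cst.
  by rewrite integral_cst // lte_mul_pinfty // ?abse_ge0 // abse_fin_num.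
have igE : (fun t => u (a + cis t *: b)) = ((fun=> B%:E) \- v)%E by apply/funext => t; exact: gE.
rewrite igE; split; first exact: integrableB.
have vfin : (\int[mu]_(t in I) v t)%E \is a fin_num by exact: integrable_fin_num.
have [y yE] : exists y, (\int[mu]_(t in I) v t = y%:E)%E.
  by exists (fine (\int[mu]_(t in I) v t)%E); rewrite fineK.
have iBE : (\int[mu]_(t in I) B%:E = (2 * pi * B)%:E)%E by rewrite int_emean emean_cst.
rewrite /emean integralB // iBE yE -EFinB -EFinM lee_fin ler_pdivlMl ?mulr_gt0 ?pi_gt0 //.
by move: intv; rewrite yE lee_fin mulrBr => h; rewrite lerBrDl -lerBrDr.
Unshelve. all: by end_near. Qed.

Lemma psh_logdet : psh D u.
Proof.
split.
- move=> z _; rewrite /u; have := det_H z; rewrite le_eqVlt => /orP[/eqP <-|h].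
    by rewrite le0_lneNy // ltNyr.
  by rewrite lne_EFin // ltry.
- move=> z c Dz uc; have [d gd] := good_exists Aadm N Dz; have [d0 _ _ _] := gd.
  have d2 : 0 < d / 2 by rewrite divr_gt0.
  have [M hM] := @eps_small R (d / 2 / 4) ltac:(by rewrite divr_gt0).
  (* Semicontinuity of u is inherited from one continuous f nu above it whose value at z is below
     c. *)
  have [M2 _ hM2] := f_lt Dz uc; pose nu := maxn M M2.
  have fc : f nu z < c by apply: hM2; rewrite /= leq_maxr.
  have fn : \forall w \near z, f nu w < c.
    exact: (@cvgr_lt _ _ _ _ _ _ (@cf nu z) _ fc).
  have pn : nbhs z (pd z (d / 2)) by apply/nbhs_pd; exists (d / 2).
  apply: filterS (filterI fn pn) => w [fw pw].
  have gw : good D H adm (d / 2) w.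
    rewrite [X in good _ _ _ X](_ : _ = d - d / 2); last by rewrite {2}(splitr d) addrK.
    by apply: good_pd gd pw; rewrite (ltW d2) /= ltr_pdivrMr // mulr_natr mulr2n ltrDl.
  have en : @eps R nu <= d / 2 / 4 by apply: ltW; apply: hM; rewrite leq_maxl.
  by apply: le_lt_trans (u_le gw en) _; rewrite lte_fin.
- move=> a b hD.
  have hD' l : cabs l <= 1 -> D (a + l *: b).
    by move=> l1; apply: hD; rewrite normcabs -(rmorph1 (real_complex R)) lecR.
  rewrite -/(emean _); case E: (u a) => [x| |]; last by rewrite leNye.
    by have [_] := lne_det_submean hD' E.
  move: E; rewrite /u; have := det_H a; rewrite le_eqVlt => /orP[/eqP <-|h].
    by rewrite le0_lneNy.
  by rewrite lne_EFin.
Qed.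

End psh_logdet.

(** * Local integrability *)

Section psh_integrability.
Context {R : realType} {n : nat}.
Local Notation Cn := 'rV[R[i]]_n.
Local Notation L := (leb_type (lebesgue_Cn R n)).
Local Notation co := (@leb_coord R n (lebesgue_Cn R n)).
Local Notation mu := (@lebesgue_measure R).
Local Notation I := (`[0%R, (2 * pi)%R]%classic : set R).
Local Open Scope ereal_scope.
Variables (D : set Cn) (u : Cn -> \bar R).
Hypothesis oD : open D.
Hypothesis ult : forall z, D z -> u z < +oo.
Hypothesis uscu : forall z (c : R), D z -> u z < c%:E -> \forall w \near z, u w < c%:E.
Hypothesis circ : forall a b (x : R), (forall l, (cabs l <= 1)%R -> D (a + l *: b)%R) -> u a = x%:E ->
  mu.-integrable I (fun t => u (a + cis t *: b)%R) /\
  x%:E <= emean (fun t => u (a + cis t *: b)%R).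

Let mI : measurable I. Proof. exact: measurable_itv. Qed.

Let int_emean (k : R -> \bar R) : \int[mu]_(t in I) k t = (2 * pi)%:E * emean k.
Proof. by rewrite /emean muleA -EFinM mulfV ?mul1e // gt_eqF // mulr_gt0 ?pi_gt0. Qed.

Lemma circle_mean_le (B x : R) a b : (forall l, (cabs l <= 1)%R -> D (a + l *: b)%R) -> u a = x%:E ->
  emean (fun t => B%:E - u (a + cis t *: b)%R) <= (B - x)%:E.
Proof.
move=> hD ux; have [ig ge] := circ hD ux; pose g t := u (a + cis t *: b)%R.
have gfin : (\int[mu]_(t in I) g t) \is a fin_num by exact: integrable_fin_num.
have [y yE] : exists y, (\int[mu]_(t in I) g t = y%:E).
  by exists (fine (\int[mu]_(t in I) g t)); rewrite fineK.
have iB : mu.-integrable I (fun=> B%:E).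
  have fI : (mu I < +oo)%E by rewrite lebesgue_measure_itv /=; case: ifP; rewrite ?ltry.
  apply/integrableP; split; first exact: measurable_cst.
  by rewrite integral_cst // lte_mul_pinfty // ?abse_ge0 // abse_fin_num.
have iBE : (\int[mu]_(t in I) B%:E = (2 * pi * B)%:E) by rewrite int_emean emean_cst.
rewrite -[emean _]/(emean ((fun=> B%:E) \- g)) /emean integralB // iBE yE -EFinB -EFinM lee_fin.
move: ge; rewrite /emean yE -EFinM lee_fin.
have p0 : (0 < 2 * pi :> R)%R by rewrite mulr_gt0 ?pi_gt0.
rewrite ler_pdivlMl // ler_pdivrMl // => h.
by rewrite mulrBr lerD2l lerN2.
Qed.

Lemma psh_integrable w (s B x : R) : (0 < s)%R -> pd w s `<=` D ->
  (forall y, pd w s y -> u y <= B%:E) -> u w = x%:E ->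
  (leb_sf n).-integrable (co @^-1` pd w s) (fun p => u (co p)).
Proof.
move=> s0 wD uB ux.
pose G y : \bar R := if y \in pd w s then B%:E - u y else 0.
have G0 y : 0 <= G y.
  rewrite /G; case: ifPn => // /set_mem /uB; case: (u y) => [z| |]; [|by []|by move=> _; rewrite /= leey].
  by rewrite -EFinB !lee_fin subr_ge0.
have EB (c : R) (v : \bar R) : (c%:E < B%:E - v) = (v < (B - c)%:E).
  case: v => [z| |] /=; [|by rewrite !ltNge leNye leey|by rewrite ltry ltNyr].
  by rewrite -EFinB !lte_fin ltrBrDl ltrBrDr.
have mG : measurable_fun setT (G : BCn R n -> \bar R).
  apply: (measurability _ (ErealGenOInfty.measurableE R)) => //.
  move=> _ [_ [c ->] <-]; rewrite setTI.
  have [c0|c0] := ltP c 0%R.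
    rewrite (_ : _ @^-1` _ = setT) //; apply/seteqP; split => // y _ /=.
    by rewrite in_itv /= andbT; apply: lt_le_trans (G0 y); rewrite lte_fin.
  apply: open_BCn; rewrite (_ : _ @^-1` _ = [set y | pd w s y /\ u y < (B - c)%:E]); last first.
    apply/seteqP; split=> y /=; rewrite in_itv /= andbT /G.
      by case: ifPn => [/set_mem yw h|_]; [split=> //; rewrite -EB|rewrite lte_fin ltNge c0].
    by move=> [yw h]; rewrite mem_set // EB.
  rewrite openE => y [yw h]; apply: filterI.
    exact: (open_nbhs_nbhs (conj (@pd_open R n w s) yw)).
  exact: (uscu (wD y yw) h).
pose F y := G (y + w)%R.
have mF : measurable_fun setT (F : BCn R n -> \bar R).
  have := measurable_affineC 1%R w mG; rewrite (_ : (fun z : Cn => G (1 *: z + w)%R) = F) //.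
  by apply/funext => z; rewrite scale1r.
have F0 y : 0 <= F y by exact: G0.
have mFr : measurable_fun setT (fun q : L * R => F (cis q.2 *: co q.1)).
  have := measurableT_comp mF (@measurable_rotation R n 0%R 1%R).
  congr measurable_fun; apply/funext => q /=.
  by rewrite (rmorph1 (real_complex R)) scale1r add0r.
have step : \int[leb_sf n]_p emean (fun t => F (cis t *: co p)) = emean (fun=> intC F).
  rewrite (intC_emean mFr (fun q => F0 _)); apply: congr1; apply/funext => t.
  exact: (intC_rot t mF F0).
have [m0 mfin] := @leb_pd R n 0%R s s0.
have mpd : measurable (co @^-1` pd 0%R s) by apply: measurable_coord_open; exact: pd_open.
have bx : (0 <= B - x)%R by have := uB w (pd_center w s0); rewrite ux lee_fin subr_ge0.
have up : \int[leb_sf n]_p emean (fun t => F (cis t *: co p)) <= (B - x)%:E * leb_sf n (co @^-1` pd 0%R s).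
  have -> : (B - x)%:E * leb_sf n (co @^-1` pd 0%R s) =
      \int[leb_sf n]_p (if co p \in pd 0%R s then (B - x)%:E else 0).
    rewrite -(integral_cst (leb_sf n) mpd) [LHS]integral_mkcond; apply: eq_integral => p _.
    by rewrite patchE.
  apply: ge0_le_integral => //.
  - by move=> p _; apply: emean_ge0.
  - exact: (@emean_measurable R n (fun q => F (cis q.2 *: co q.1)) mFr (fun q => F0 _)).
  - rewrite (_ : (fun p => _) = (fun p => (B - x)%:E * (\1_(co @^-1` pd 0%R s) p)%:E)).
      by apply: measurable_funeM; apply/measurable_EFinP; exact: measurable_indic.
    apply/funext => p; rewrite indicE; case: (boolP (co p \in _)) => h.
      by rewrite (_ : p \in _) ?mule1 //; apply/mem_set; exact: set_mem h.
    by rewrite (_ : p \in _ = false) ?mule0 //; apply/negbTE; apply: contra h => /set_mem h; apply/mem_set.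
  move=> p _; case: ifPn => [/set_mem hp|/negP hp].
    have hD l : (cabs l <= 1)%R -> pd w s (w + l *: co p)%R.
      move=> l1; apply/pdE => j; move/pdE/(_ j): hp; rewrite !mxE subr0 [(w 0%R j + _)%R]addrC addrK cabsM; apply: le_lt_trans.
      by rewrite ler_piMl ?cabs_ge0.
    rewrite [X in emean X](_ : _ = fun t => B%:E - u (w + cis t *: co p)%R); last first.
      apply/funext => t; rewrite /F /G addrC mem_set //; apply: hD; by rewrite cabs_cis.
    by apply: circle_mean_le ux => l /hD /wD.
  rewrite [X in emean X](_ : _ = fun=> 0%:E); first by rewrite emean_cst.
  apply/funext => t; rewrite /F /G; case: ifPn => // /set_mem /pdE h; exfalso; apply: hp.
  apply/mem_set/pdE => j; have := h j.
  by rewrite !mxE addrK subr0 cabsM cabs_cis mul1r.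
have IG : intC G <= (B - x)%:E * leb_sf n (co @^-1` pd 0%R s).
  rewrite -(intC_shift w mG G0) -/F.
  have : emean (fun=> intC F) <= (B - x)%:E * leb_sf n (co @^-1` pd 0%R s) by rewrite -step.
  have : 0 <= intC F by apply: integral_ge0.
  case: (intC F) => [y _|_|//]; first by rewrite emean_cst.
  have fin : (B - x)%:E * leb_sf n (co @^-1` pd 0%R s) \is a fin_num.
    by rewrite fin_numM // ge0_fin_numE // measure_ge0.
  (* An infinite integral is excluded here: the mean of the constant +oo would exceed |c| + 1. *)
  rewrite -(fineK fin); set c := fine _ => h.
  have c1 : 0 <= (`|c| + 1)%:E by rewrite lee_fin addr_ge0.
  have mc (v : \bar R) : measurable_fun (setT : set R) (fun=> v) by exact: measurable_cst.
  have := @emean_le R (fun=> (`|c| + 1)%:E) (fun=> +oo) (mc _) (mc _) (fun=> c1) (fun=> leey _).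
  rewrite emean_cst => h2; have := le_trans h2 h; rewrite lee_fin => h3.
  by have := le_lt_trans (ler_norm c) (lt_le_trans (_ : `|c| < `|c| + 1)%R h3); rewrite ltrDl ltr01 ltxx => /(_ isT).
have mS : measurable (co @^-1` pd w s) by apply: measurable_coord_open; exact: pd_open.
have [_ wfin] := @leb_pd R n w s s0.
have iG : (leb_sf n).-integrable (co @^-1` pd w s) (fun p => G (co p)).
  have mGc : measurable_fun setT (fun p : L => G (co p)) by exact: measurable_comp_coord.
  apply/integrableP; split; first exact: measurable_funS mGc.
  apply: (@le_lt_trans _ _ (intC G)).
    rewrite (_ : \int[_]_(p in _) _ = \int[leb_sf n]_(p in co @^-1` pd w s) G (co p)).
      by apply: ge0_subset_integral => //.
    by apply: eq_integral => p _; rewrite gee0_abs.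
  apply: le_lt_trans IG _; rewrite lte_mul_pinfty // ?lee_fin //.
have iB : (leb_sf n).-integrable (co @^-1` pd w s) (fun=> B%:E).
  apply/integrableP; split; first exact: measurable_cst.
  by rewrite integral_cst // lte_mul_pinfty // ?abse_ge0 // abse_fin_num.
apply: eq_integrable (integrableB mS iB iG) => // p /set_mem hp.
rewrite /= /G mem_set //; have := ult (wD _ hp).
by case: (u (co p)) => [y _| |_] //=; rewrite -!EFinB opprB addrC subrK.
Qed.

(** A nonempty open set on which u is -oo has positive measure, against the integrability provided
    by a finite value at the centre w. *)
Lemma psh_not_neg_inf w (s B x : R) y : (0 < s)%R -> pd w s `<=` D ->
  (forall y, pd w s y -> u y <= B%:E) -> u w = x%:E -> pd w s y ->
  (\forall z \near y, u z = -oo) -> False.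
Proof.
move=> s0 wD uB ux yw /nbhs_pd[e e0 he].
have /nbhs_pd[e' e'0 he'] : nbhs y (pd w s) by exact: (open_nbhs_nbhs (conj (@pd_open R n w s) yw)).
pose d := Num.min e e'; have d0 : (0 < d)%R by rewrite lt_min e0.
have sub1 : co @^-1` pd y d `<=` co @^-1` pd w s.
  by move=> p hp; apply: he'; apply: pd_sub hp; rewrite ge_min lexx orbT.
have mpd z k : measurable (co @^-1` pd z k) by apply: measurable_coord_open; exact: pd_open.
have := integrableS (mpd w s) (mpd y d) sub1 (psh_integrable s0 wD uB ux).
move=> /integrableP[_]; rewrite (_ : \int[_]_(p in _) _ = \int[leb_sf n]_(p in co @^-1` pd y d) +oo).
  have [m0 _] := @leb_pd R n y d d0.
  by rewrite integral_cst // gt0_mulye // ltxx.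
apply: eq_integral => p /set_mem hp; rewrite he //.
by apply: pd_sub hp; rewrite ge_min lexx.
Qed.

Lemma psh_bounded_pd z : D z -> exists s B : R, [/\ (0 < s)%R, pd z s `<=` D & forall y, pd z s y -> u y <= B%:E].
Proof.
move=> Dz; have [B hB] : exists B : R, u z < B%:E.
  have := ult Dz; case: (u z) => [x _| |_] //; first by exists (x + 1)%R; rewrite lte_fin ltrDl.
  by exists 0%R; rewrite ltNyr.
have nz : nbhs z (D `&` [set w | u w < B%:E]).
  apply: filterI; first exact: (open_nbhs_nbhs (conj oD Dz)).
  exact: uscu.
have [s s0 hs] := (nbhs_pd z _).1 nz; exists s, B; split=> //.
  by move=> y /hs [].
by move=> y /hs [_ /ltW].
Qed.

Let ereal_cases z : D z -> u z <> -oo -> exists x : R, u z = x%:E.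
Proof. by move=> /ult; case: (u z) => // x _ _; exists x. Qed.

(** If u were finite at some w close to z, the polydisc about w of radius s / 2 would still lie in
    that of radius s about z and would contain a point near which u is -oo. *)
Lemma neg_inf_interior_closed z : D z ->
  (forall e : R, (0 < e)%R -> exists2 y, pd z e y & \forall w \near y, u w = -oo) ->
  \forall w \near z, u w = -oo.
Proof.
move=> Dz hz; have [s [B [s0 sD sB]]] := psh_bounded_pd Dz.
have q0 : (0 < s / 4)%R by rewrite divr_gt0.
have [y zy hy] := hz _ q0; apply/nbhs_pd; exists (s / 4)%R => // w zw.
apply: contrapT => uw.
have sub3 : pd w (s / 4 + s / 4)%R `<=` pd z s.
  move=> v /(pd_triangle zw); apply: pd_sub; lra.
have [x ux] := ereal_cases (sD _ (sub3 _ (pd_center w (addr_gt0 q0 q0)))) uw.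
have wy : pd w (s / 4 + s / 4)%R y by exact: pd_triangle (pd_sym zw) zy.
by apply: (psh_not_neg_inf (addr_gt0 q0 q0) _ _ ux wy hy) => v /sub3; [exact: sD|exact: sB].
Qed.

(** Around each point of K a polydisc is chosen whose centre is a nearby point where u is finite and
    which still contains the given point. Finitely many of them cover K. *)
Lemma psh_locally_L1 : (forall z, D z -> forall e : R, (0 < e)%R -> exists2 w, pd z e w & u w <> -oo) ->
  locally_L1 D u.
Proof.
move=> fin K cK KD.
have mo U : open U -> measurable (co @^-1` U) by exact: measurable_coord_open.
have loc z : exists U : set Cn, [/\ open U, (leb_sf n).-integrable (co @^-1` U) (fun p => u (co p)) & K z -> U z].
  have [Kz|nKz] := pselect (K z); last first.
    by exists set0; split=> //; rewrite preimage_set0; exact: integrable_set0.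
  have [s [B [s0 sD sB]]] := psh_bounded_pd (KD _ Kz).
  have q0 : (0 < s / 4)%R by rewrite divr_gt0.
  have [w zw uw] := fin z (KD _ Kz) _ q0.
  have sub3 : pd w (s / 4 + s / 4)%R `<=` pd z s.
    move=> v /(pd_triangle zw); apply: pd_sub; lra.
  have [x ux] := ereal_cases (sD _ (sub3 _ (pd_center w (addr_gt0 q0 q0)))) uw.
  exists (pd w (s / 4 + s / 4)%R); split; first exact: pd_open.
    by apply: (psh_integrable (addr_gt0 q0 q0) _ _ ux) => v /sub3; [exact: sD|exact: sB].
  by move=> _; apply: pd_triangle (pd_sym zw) (pd_center z q0).
have /choice[U hU] := loc.
have := cK; rewrite compact_cover => /(_ Cn setT U); case; first by move=> z _; have [] := hU z.
  by move=> z Kz; exists z => //; have [_ _] := hU z; exact.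
move=> X _ hX.
have [V [oV iV KV]] : exists V : set Cn, [/\ open V, (leb_sf n).-integrable (co @^-1` V) (fun p => u (co p)) & K `<=` V].
  rewrite /cover bigcup_fset in hX; exists (\big[setU/set0]_(i <- finmap.enum_fset X) U i).
  suff [h1 h2] : open (\big[setU/set0]_(i <- finmap.enum_fset X) U i) /\
      (leb_sf n).-integrable (co @^-1` (\big[setU/set0]_(i <- finmap.enum_fset X) U i)) (fun p => u (co p)) by split.
  elim/big_ind: _ => [|A B [oA iA] [oB iB]|i _]; last by have [] := hU i.
    by split; [exact: open0|rewrite preimage_set0; exact: integrable_set0].
  split; first exact: openU.
  rewrite preimage_setU; have mA := mo _ oA; have mB := mo _ oB.
  have /integrableP[fA gA] := iA; have /integrableP[fB gB] := iB.
  have fAB := (measurable_funU (fun p => u (co p)) mA mB).2 (conj fA fB).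
  apply/integrableP; split=> //.
  have mBA : measurable (co @^-1` B `\` co @^-1` A) by exact: measurableD.
  have -> : co @^-1` A `|` co @^-1` B = co @^-1` A `|` (co @^-1` B `\` co @^-1` A).
    apply/seteqP; split=> p /=; last by case=> [a|[b _]]; [left|right].
    by case=> [a|b]; [left|case: (pselect (A (co p))) => a; [left|right]].
  have mf : measurable_fun (co @^-1` A `|` (co @^-1` B `\` co @^-1` A)) (fun p => `|u (co p)|).
    apply: measurableT_comp => //; apply: measurable_funS fAB; first exact: measurableU.
    by move=> p [a|[b _]]; [left|right].
  rewrite ge0_integral_setU //; last by apply/disj_setPS => p [a [_ na]]; exact: na.
  rewrite lte_add_pinfty //; apply: le_lt_trans gB; apply: ge0_subset_integral => //.
    exact: measurableT_comp.
have mK : measurable (co @^-1` K).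
  have cl : closed K by apply: compact_closed => //; exact: norm_hausdorff.
  have mC : measurable (co @^-1` (~` K)) by exact: (measurable_coord_open (closed_openC cl)).
  by rewrite -[X in measurable X]setCK; apply: measurableC; exact: mC.
have := integrableS (mo _ oV) mK (fun p (h : (co @^-1` K) p) => KV _ h) iV.
move=> /integrableP[m1 m2]; apply/integrableP; split=> //.
by rewrite (eq_measure_integral (leb_sf n)) // => A _ _; rewrite leb_sfE.
Qed.

End psh_integrability.

(** Lets a section known only on an open set be replaced by an explicit expression with the same
    germ, as for the frames below. *)
Lemma near_differentiable {K : numFieldType} {V W : normedModType K} (f g : V -> W) x :
  (\forall y \near x, f y = g y) -> differentiable f x -> differentiable g x.
Proof.
move=> fg /diff_locallyP[cd /eqaddoP H].
have fgx : f x = g x by exact: (nbhs_singleton fg).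
have dg : g \o shift x = cst (g x) + 'd f x +o_ 0 id.
  apply/eqaddoP => e e0; have h1 := H e e0.
  have h2 : \forall h \near (0 : V), f (h + x) = g (h + x).
    by move: fg; rewrite (near_shift 0) subr0.
  apply: filterS (filterI h1 h2) => h [k1 k2].
  by move: k1; rewrite !fctE /= k2 fgx.
by apply/diff_locallyP; rewrite (diff_unique cd dg).
Qed.

(** * The degeneracy locus *)

Section degeneracy.
Context {R : realType} {n r : nat} {X : complex_manifold R n}.
Variable E : vector_bundle X r.
Local Notation Cn := 'rV[R[i]]_n.

(** The fibrewise preimages of the standard basis under one trivialization. In another
    trivialization their components are the columns of the transition matrix, hence holomorphic. *)
Lemma local_frame (i : vb_index E) : exists e : 'I_r -> forall x, E x, holomorphic_frame (vb_dom i) e.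
Proof.
(* Off the domain of the trivialization a preimage may fail to exist and the default 0 is taken;
   only the germ inside the domain is used. *)
pose e (j : 'I_r) (x : X) : E x := xget 0 [set v : E x | vb_triv i x v = delta_mx j 0].
have eE j x : vb_dom i x -> vb_triv i x (e j x) = delta_mx j 0.
  move=> ix; have [k kK Kk] := vb_triv_bij ix; rewrite /e; case: xgetP => [v _ //|h].
  by case: (h (k (delta_mx j 0))); rewrite /= Kk.
exists e; split; first exact: vb_dom_open.
- move=> j i' k _ [x [[ix i'x] kx] <-].
  have [g [hg gE]] := vb_transition i i'.
  have ik : (mfd_chart k @` ((vb_dom i `&` vb_dom i') `&` mfd_dom k)) (mfd_chart k x) by exists x.
  have dg := hg k _ ik.
  apply: (@near_differentiable _ _ _ (fun w => g (mfd_inv k w) *m (delta_mx j 0 : 'cV[R[i]]_r))).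
    have oV : open (vb_dom i `&` vb_dom i') by apply: openI; exact: vb_dom_open.
    have := open_nbhs_nbhs (conj (chart_image_open (k := k) oV) ik).
    by apply: filterS => _ [y [[iy i'y] ky] <-] /=; rewrite mfd_chartK // -(eE j y iy) -gE.
  apply: differentiable_mx => p q.
  rewrite (_ : (fun w => _) = fun w => \sum_m g (mfd_inv k w) p m * (delta_mx j 0 : 'cV[R[i]]_r) m q).
    apply: differentiable_sumM => m; last exact: differentiable_cst.
    exact: (coord_differentiable _ _ dg).
  by apply/funext => w; rewrite mxE.
- move=> x ix v; exists (vb_triv i x v).
  have sumE (c : 'cV[R[i]]_r) : vb_triv i x (\sum_j c j 0 *: e j x) = c.
    rewrite linear_sum; apply/matrixP => p q; rewrite ord1 summxE (bigD1 p) //=.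
    rewrite big1 ?addr0 => [|j nj].
      by rewrite linearZ /= eE // !mxE !eqxx mulr1.
    by rewrite linearZ /= eE // !mxE eq_sym (negbTE nj) mulr0.
  split; last by move=> c ->; rewrite sumE.
  by apply: (bij_inj (vb_triv_bij ix)); rewrite sumE.
Qed.

Variable h : forall x : X, E x -> E x -> R[i].
Hypothesis hh : forall x, nonneg_hermitian_form (@h x).

(** A frame-free form of the vanishing of the determinant: the connectedness argument runs over all
    of X, which one frame or one chart need not cover. *)
Definition degenerate (x : X) : Prop := exists v : E x, v != 0 /\ h v v = 0.

Lemma degenerate_det U e x : holomorphic_frame U e -> U x ->
  degenerate x <-> \det (frame_matrix h e x) = 0.
Proof.
move=> [_ _ fe] Ux; have uni := fe x Ux; set M := frame_matrix h e x.
have pM : psdm M := psdm_frame hh e x.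
split=> [[v [v0 hv]]|d0].
  have [c [vE _]] := uni v.
  have c0 : c != 0.
    apply: contra_neq v0 => c0; rewrite vE c0; apply: big1 => j _.
    by rewrite mxE scale0r.
  have q0 : qf M c = 0 by rewrite /qf -form_sum // -vE hv.
  have Mc := qf_eq0 pM q0.
  apply/eqP; rewrite -det_tr; apply/det0P; exists c^T; first by rewrite trmx_eq0.
  by rewrite -trmx_mul Mc trmx0.
have /det0P[w w0 wM] : \det M^T == 0 by rewrite det_tr d0.
have Mw : M *m w^T = 0 by apply: trmx_inj; rewrite trmx_mul trmxK wM trmx0.
exists (\sum_j w^T j 0 *: e j x); split; last first.
  by rewrite form_sum // /hdot -mulmxA Mw mulmx0 mxE.
apply: contra_neq w0 => v0; have [c [_ cu]] := uni 0.
have z1 : c = 0 by apply: cu; rewrite big1 // => j _; rewrite mxE scale0r.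
have z2 : c = w^T by apply: cu; rewrite v0.
by rewrite -[w]trmxK -z2 z1 trmx0.
Qed.

Hypothesis hneg : griffiths_negative h.

Section chart.
Variables (U : set X) (e : 'I_r -> forall x, E x) (k : mfd_index X).
Hypothesis fe : holomorphic_frame U e.
Local Notation D := (mfd_chart k @` (U `&` mfd_dom k)).
Local Notation u := (fun z => lne (Re (\det (frame_matrix h e (mfd_inv k z))))%:E).

Let N := chart_negative hh hneg k fe.
Let oD : open D := neg_open N.

Lemma chart_psh : psh D u.
Proof. exact: (psh_logdet N). Qed.

Let ult z : D z -> (u z < +oo)%E.
Proof. by have [h1 _ _] := chart_psh; exact: h1. Qed.

Let uscu z (c : R) : D z -> (u z < c%:E)%E -> \forall w \near z, (u w < c%:E)%E.
Proof. by have [_ h1 _] := chart_psh; exact: h1. Qed.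

Let circ a b (x : R) (hab : forall l, cabs l <= 1 -> D (a + l *: b)) (ua : u a = x%:E) :=
  lne_det_submean N hab ua.

Lemma u_neg_inf x : U x -> mfd_dom k x -> u (mfd_chart k x) = -oo%E <-> degenerate x.
Proof.
move=> Ux kx; rewrite (degenerate_det fe Ux) /= mfd_chartK //.
have [dE d0] := det_psd (psdm_frame hh e x); rewrite dE /=; move: d0.
rewrite le_eqVlt => /orP[/eqP <-|d0]; first by rewrite lexx rmorph0.
rewrite leNgt d0 /=; split=> // /eqP; rewrite -(rmorph0 (real_complex R)) => /eqP [h0].
by move: d0; rewrite h0 ltxx.
Qed.

Lemma degenerate_near x : U x -> mfd_dom k x ->
  (\forall z \near mfd_chart k x, u z = -oo%E) <-> (\forall y \near x, degenerate y).
Proof.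
move=> Ux kx; have [oU _ _] := fe.
have nU : nbhs x (U `&` mfd_dom k).
  by apply: open_nbhs_nbhs; split=> //; apply: openI => //; exact: mfd_dom_open.
have Dx : D (mfd_chart k x) by exists x.
split=> hx.
  have hc := mfd_chart_continuous kx hx.
  apply: filterS (filterI nU hc) => y [[Uy ky] hy].
  exact/(u_neg_inf Uy ky).
have Ix : (mfd_chart k @` mfd_dom k) (mfd_chart k x) by exists x.
have ci : {for mfd_chart k x, continuous (mfd_inv k)} := mfd_inv_continuous Ix.
have hx' : nbhs (mfd_inv k (mfd_chart k x)) [set y | degenerate y] by rewrite mfd_chartK.
have hc := ci _ hx'.
have nD := open_nbhs_nbhs (conj oD Dx).
apply: filterS (filterI nD hc) => _ [[y [Uy ky] <-]]; rewrite /preimage /= mfd_chartK // => hy.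
by have := (u_neg_inf Uy ky).2 hy; rewrite /= mfd_chartK.
Qed.

Lemma degenerate_closed_at x : U x -> mfd_dom k x ->
  (forall A, nbhs x A -> exists2 y, A y & \forall y' \near y, degenerate y') ->
  \forall y \near x, degenerate y.
Proof.
move=> Ux kx hx; have [oU _ _] := fe; apply/(degenerate_near Ux kx).
have Dx : D (mfd_chart k x) by exists x.
apply: (neg_inf_interior_closed oD ult uscu circ Dx) => d d0.
have nU : nbhs x (U `&` mfd_dom k).
  by apply: open_nbhs_nbhs; split=> //; apply: openI => //; exact: mfd_dom_open.
have nd : nbhs (mfd_chart k x) (pd (mfd_chart k x) d) by apply/nbhs_pd; exists d.
have [y [[Uy ky] yd] hy] := hx _ (filterI nU (mfd_chart_continuous kx nd)).
by exists (mfd_chart k y) => //; exact/(degenerate_near Uy ky).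
Qed.

Lemma chart_L1 : (forall x : X, ~ \forall y \near x, degenerate y) -> locally_L1 D u.
Proof.
move=> nd; apply: (psh_locally_L1 oD ult uscu circ) => _ [x [Ux kx] <-] d d0.
apply: contrapT => hn; apply: (nd x); apply/(degenerate_near Ux kx)/nbhs_pd.
exists d => // w wd; apply: contrapT => uw; apply: hn; by exists w.
Qed.

End chart.

(** Closedness is a local matter, settled at each point in a chart with a local frame. The given
    frame only exhibits a point where the determinant is nonzero. *)
Lemma degenerate_interior0 : connected [set: X] -> det_not_identically_zero h ->
  forall x : X, ~ \forall y \near x, degenerate y.
Proof.
move=> cX [U [e [x0 [fe Ux0 d0]]]] x hx.
pose A := interior degenerate.
have clA : closed A.
  move=> y hy; have [i iy] := vb_cover E y; have [k ky] := mfd_cover y.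
  have [e' fe'] := local_frame i; apply: (degenerate_closed_at fe' iy ky) => B nB.
  have [y' [Ay' By']] := hy B nB; by exists y'.
have AT : A = setT.
  apply: cX; first by exists x.
    by exists A; [exact: open_interior|rewrite setTI].
  by exists A => //; rewrite setTI.
have : A x0 by rewrite AT.
move=> /nbhs_singleton /(degenerate_det fe Ux0) d.
by rewrite d eqxx in d0.
Qed.

End degeneracy.

Local Close Scope complex_scope.

(** The sequence is chosen before the smaller polydisc, and only the starting rank depends on the
    latter: the closure of the smaller polydisc is compact, so all its points have good radii that
    one rank serves. *)
Theorem proposition1p1 (R : realType) (n r : nat) (X : complex_manifold R n)
    (E : vector_bundle X r) (h : forall x : X, E x -> E x -> R[i])
    (hmetric : singular_hermitian_metric h) (hneg : griffiths_negative h) :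
  (forall (a : 'rV[R[i]]_n) (rho : 'I_n -> R)
      (phi : X -> 'rV[R[i]]_n) (psi : 'rV[R[i]]_n -> X)
      (e : 'I_r -> forall x : X, E x),
    (forall j, 0 < rho j) ->
    biholomorphism_onto (polydisc a rho) phi psi ->
    holomorphic_frame [set: X] e ->
    exists hs : nat -> 'rV[R[i]]_n -> 'M[R[i]]_r,
      forall (b : 'rV[R[i]]_n) (sigma : 'I_n -> R),
        (forall j, 0 < sigma j) ->
        closure (polydisc b sigma) `<=` polydisc a rho ->
        exists N : nat,
          [/\ forall nu, (N <= nu)%N ->
                smooth_hermitian_metric (polydisc b sigma) (hs nu),
              forall nu, (N <= nu)%N ->
                negative_griffiths_curvature (polydisc b sigma) (hs nu),
              forall nu, (N <= nu)%N ->
                forall z, polydisc b sigma z -> forall s : 'cV[R[i]]_r,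
                  hdot (hs nu.+1 z) s s <= hdot (hs nu z) s s
            & forall z, polydisc b sigma z ->
                (hs nu z @[nu --> \oo]) --> frame_matrix h e (psi z)])
  /\
  (forall U (e : 'I_r -> forall x : X, E x),
    holomorphic_frame U e -> mfd_psh U (log_det h e))
  /\
  (connected [set: X] -> det_not_identically_zero h ->
    forall U (e : 'I_r -> forall x : X, E x),
      holomorphic_frame U e -> mfd_locally_L1 U (log_det h e)).
Proof.
have [hh _] := hmetric; split; last split.
- move=> a rho phi psi e rho0 bi fe.
  have N := polydisc_negative hh hneg (@polydisc_open R n a rho) bi fe.
  exists (Hs (polydisc a rho) (fun z => frame_matrix h e (psi z))) => b sigma s0 sub.
  apply: (smooth_approximation N _ sub).
  by apply: closure_polydisc_compact => j; exact: ltW.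
- by move=> U e fe k; exact: (chart_psh hh hneg k fe).
- move=> cX nz U e fe k; have nd := degenerate_interior0 hh hneg cX nz.
  have F := chart_L1 hh hneg fe nd; exact: F.
Qed.
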